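(* Let $n\ge 1$, let $u \in L_c^1(\mathbb R^n)$ and $d \in \,]n-1,n[$. The following statements are equivalent: (1) $u \in \bigcap_{d < \delta < n}\mathrm{BV}^{\delta - (n - 1)}_c(\mathbb R^n)$. (2) There is a sequence $(u_k)_{k \geq 0}$ in $\mathrm{BV}_c(\mathbb R^n)$ such that $\sum_{k\geq 0} u_k = u$ in $L^1$, $\bigcup_{k\geq 0}\operatorname{spt}(u_k)$ is bounded, and for all $\delta \in \,]d,n[$ there exists $C \geq 0$ such that for all $k\ge 0$ \[\|u_k\|_{L^1} \leq C\, 2^{k(\delta-n)} \quad\text{and}\quad \mathbf V(u_k) \leq C\, 2^{k(\delta - (n-1))}.\] (3) The map $[\![u]\!] : (f,g_1,\dots,g_n) \mapsto \int_{\mathbb R^n}u(x)f(x)\det D(g_1, \dots, g_n)_x\,dx$ defined on $\mathrm{Lip}(\mathbb R^n)^{n+1}$ has a continuous extension to a multilinear functional \[\mathrm{Lip}^{\alpha}(\mathbb R^n) \times \mathrm{Lip}^{\beta_1}(\mathbb R^n) \times \dots \times \mathrm{Lip}^{\beta_{n}}(\mathbb R^n) \to \mathbb R\] whenever $\alpha,\beta_1,\dots,\beta_n\in\,]0,1]$ satisfy $\alpha + \beta_1 + \dots + \beta_{n} > n$ and $\beta_1 + \dots + \beta_{n} > d$.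
   Context: $L^1_c(\mathbb R^n)$ denotes integrable functions with (essentially) compact support. For $\alpha\in[0,1]$, $\mathrm{Lip}^\alpha(g)=\sup_{x\ne y}|g(x)-g(y)|/|x-y|^\alpha$; $\mathrm{Lip}^\alpha(\mathbb R^n)$ is the set of real functions for which this is finite, and $\mathrm{Lip}=\mathrm{Lip}^1$. For $u\in L^1_c(\mathbb R^n)$ and $\alpha\in[0,1]$, $\mathbf V^\alpha(u)$ is the smallest $C\in[0,\infty]$ such that $\bigl|\int_{\mathbb R^n} u(x)\det D(f,g_1,\dots,g_{n-1})_x\,dx\bigr|\le C\,\mathrm{Lip}^\alpha(f)\,\mathrm{Lip}(g_1)\cdots\mathrm{Lip}(g_{n-1})$ for all $f,g_1,\dots,g_{n-1}\in\mathrm{Lip}(\mathbb R^n)$, and $\mathrm{BV}^\alpha_c(\mathbb R^n)=\{u\in L^1_c(\mathbb R^n):\mathbf V^\alpha(u)<\infty\}$. $\mathbf V(u)=\sup\{\int u\operatorname{div}\varphi\,dx:\varphi\in C^1(\mathbb R^n,\mathbb R^n),\|\varphi\|_\infty\le1\}$ is the classical total variation, and $\mathrm{BV}_c(\mathbb R^n)=\{u\in L^1_c(\mathbb R^n):\mathbf V(u)<\infty\}$. In (3), a multilinear functional $\bar T$ is continuous if $\bar T(f_k,g_{1,k},\dots,g_{n,k})\to\bar T(f,g_1,\dots,g_n)$ whenever $f_k\to f$ and $g_{i,k}\to g_i$ uniformly with $\sup_k \mathrm{Lip}^\alpha(f_k)<\infty$ and $\sup_{k}\mathrm{Lip}^{\beta_i}(g_{i,k})<\infty$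 for all $i$ (because of the strict inequalities one may equivalently use continuity with respect to the Hölder norms). The functionals depend only on the restrictions of the functions to a fixed compact set $K\supset\operatorname{spt}(u)$, on which $\mathrm{Lip}(K)\subset\mathrm{Lip}^\alpha(K)$, and ''extension'' is understood after restriction to such a compact set. *)

(* Defs.v *)
From HB Require Import structures.
From mathcomp Require Import all_boot all_order all_algebra.
From mathcomp Require Import all_classical all_reals all_analysis.
Import Order.TTheory GRing.Theory Num.Theory.
Import numFieldNormedType.Exports.

Set Implicit Arguments.
Unset Strict Implicit.
Unset Printing Implicit Defensive.

Local Open Scope classical_set_scope.
Local Open Scope ring_scope.

(* R^n carries the product of the Borel sigma-algebras of the coordinates, which
   is its Borel sigma-algebra. *)
Section measurable_rV.
Context (R : realType) (n : nat).

Let coord : 'I_n -> 'rV[R]_n -> measurableTypeR R := fun i x => x ord0 i.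

Let rV_set0 : g_sigma_preimage coord set0.
Proof. exact: sigma_algebra0. Qed.

Let rV_setC A : g_sigma_preimage coord A -> g_sigma_preimage coord (~` A).
Proof. exact: sigma_algebraC. Qed.

Let rV_bigcup (F : (set _)^nat) : (forall i, g_sigma_preimage coord (F i)) ->
  g_sigma_preimage coord (\bigcup_i (F i)).
Proof. exact: sigma_algebra_bigcup. Qed.

HB.instance Definition _ := @isMeasurable.Build
  (measure_tuple_display default_measure_display)
  'rV[R]_n (g_sigma_preimage coord) rV_set0 rV_setC rV_bigcup.

Lemma measurable_coord (i : 'I_n) :
  measurable_fun setT (fun x : 'rV[R]_n => x ord0 i : measurableTypeR R).
Proof.
move=> _ Y mY; rewrite setTI; apply: sub_sigma_algebra => /=.
rewrite -bigcup_seq/=; exists i => /=; first by rewrite mem_index_enum.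
by exists Y => //; rewrite setTI.
Qed.

Lemma measurable_fun_rVP d (T : measurableType d) (f : T -> 'rV[R]_n) :
  (forall i, measurable_fun setT (fun x => f x ord0 i : measurableTypeR R)) ->
  measurable_fun setT f.
Proof.
move=> mf _ A mA.
suff : g_sigma_preimage (fun i x => coord i (f x)) `<=` measurable.
  have := g_sigma_preimage_comp coord f; rewrite /comp => -> h.
  by apply: h; exists A.
apply: smallest_sub; first exact: sigma_algebra_measurable.
rewrite -bigcup_seq => B [i _ [C mC <-]].
exact: mf.
Qed.

End measurable_rV.

(* (a, v_0, ..., v_(n-1)) *)
Definition fcons T n (a : T) (v : 'I_n -> T) : 'I_n.+1 -> T :=
  fun i => oapp v a (unlift ord0 i).

(* Used to recover the bundled sigma-finite structure of a measure for which
   sigma-finiteness has been proved. *)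
Section sigma_finite_copy.
Context d (T : measurableType d) (R : realType) (m : {measure set T -> \bar R}).
Hypothesis sf : sigma_finite setT m.

Let mc of sigma_finite setT m : set T -> \bar R := m.

HB.instance Definition _ := Measure.on (mc sf).
HB.instance Definition _ := Measure_isSigmaFinite.Build _ _ _ (mc sf) sf.

Lemma sigma_finite_measure_copy :
  exists m' : {sigma_finite_measure set T -> \bar R},
    m' = m :> (set T -> \bar R).
Proof. by exists (mc sf). Qed.

End sigma_finite_copy.

Section lebesgue_rV.
Context (R : realType).
Local Open Scope ereal_scope.

Definition rV_cons n (p : measurableTypeR R * 'rV[R]_n) : 'rV[R]_n.+1 :=
  \row_i fcons p.1 (p.2 ord0) i.

Lemma measurable_rV_cons n : measurable_fun setT (@rV_cons n).
Proof.
apply: measurable_fun_rVP => i.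
under eq_fun do rewrite mxE /fcons.
case: (unliftP ord0 i) => [j _|_] /=; last exact: measurable_fst.
exact: (measurableT_comp (@measurable_coord R n j) measurable_snd).
Qed.

(* Lebesgue measure on R^n as the iterated product of the one-dimensional one;
   lebesgue_rV_box below characterizes it. *)
Fixpoint lebesgue_rV n : set 'rV[R]_n -> \bar R :=
  match n with
  | 0 => \d_(0%R : 'rV[R]_0)
  | k.+1 => pushforward (lebesgue_measure \x @lebesgue_rV k) (@rV_cons k)
  end.

Lemma rV_cons_inj n : injective (@rV_cons n).
Proof.
move=> [a v] [b w] /rowP vw; congr pair.
  by have := vw ord0; rewrite !mxE /fcons unlift_none.
by apply/rowP => j; have := vw (lift ord0 j); rewrite !mxE /fcons liftK.
Qed.

Lemma rV_consE n (x : 'rV[R]_n.+1) :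
  x = rV_cons (x ord0 ord0, \row_j x ord0 (lift ord0 j)).
Proof.
apply/rowP => i; rewrite mxE /fcons.
by case: (unliftP ord0 i) => [j ->|->] //=; rewrite mxE.
Qed.

Lemma measurable_image_rV_cons n (A : set (measurableTypeR R * 'rV[R]_n)) :
  measurable A -> measurable (@rV_cons n @` A).
Proof.
move=> mA.
pose g (x : 'rV[R]_n.+1) : measurableTypeR R * 'rV[R]_n :=
  (x ord0 ord0, \row_j x ord0 (lift ord0 j)).
have mg : measurable_fun setT g.
  apply/measurable_fun_pair => /=; first exact: measurable_coord.
  apply: measurable_fun_rVP => i; under eq_fun do rewrite mxE.
  exact: measurable_coord.
rewrite (_ : _ @` _ = setT `&` g @^-1` A); first exact: mg.
rewrite setTI; apply/seteqP; split => [_ [p Ap <-]|x Ax].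
  by rewrite /preimage/= (_ : g _ = p)//; apply: rV_cons_inj; rewrite -rV_consE.
by exists (g x) => //; rewrite -rV_consE.
Qed.

Let lebesgue_rV_subproof n :
  exists mu : {sigma_finite_measure set 'rV[R]_n -> \bar R},
    mu = @lebesgue_rV n :> (set _ -> \bar R).
Proof.
elim: n => [|n [mu muE]] /=; first by exists (\d_(0%R : 'rV[R]_0)).
rewrite -muE; pose nu := pushforward (@lebesgue_measure R \x mu) (@rV_cons n).
have sf : sigma_finite setT nu.
  have /sigma_finiteP[F [FT ndF mF]] := sigma_finiteT (@lebesgue_measure R).
  have /sigma_finiteP[G [GT ndG mG]] := sigma_finiteT mu.
  exists (fun i => @rV_cons n @` (F i `*` G i)).
    apply/esym/seteqP; split => // x _.
    have [i _ Fi] : (\bigcup_i F i) (x ord0 ord0) by rewrite -FT.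
    have [j _ Gj] : (\bigcup_i G i) (\row_j x ord0 (lift ord0 j)) by rewrite -GT.
    exists (maxn i j) => //; exists (x ord0 ord0, \row_j x ord0 (lift ord0 j)).
      split => /=.
        by move: Fi; exact/subsetPset/ndF/leq_maxl.
      by move: Gj; exact/subsetPset/ndG/leq_maxr.
    by rewrite -rV_consE.
  move=> i; have [mFi Fioo] := mF i; have [mGi Gioo] := mG i.
  split; first by apply: measurable_image_rV_cons; exact: measurableX.
  rewrite /nu /pushforward (_ : _ @^-1` _ = F i `*` G i).
    by rewrite product_measure1E// lte_mul_pinfty// ge0_fin_numE.
  by apply/seteqP; split => [p [q Fq /rV_cons_inj <-]//|p Fp]; exists p.
exact: (sigma_finite_measure_copy
  (m := measure_function_pushforward__canonical__measure_function_Measure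
    (@lebesgue_measure R \x mu) (@measurable_rV_cons n)) sf).
Qed.

Let lebesgue_rV0 n : @lebesgue_rV n set0 = 0.
Proof. by have [mu <-] := lebesgue_rV_subproof n; exact: measure0. Qed.

Let lebesgue_rV_ge0 n A : 0 <= @lebesgue_rV n A.
Proof. by have [mu <-] := lebesgue_rV_subproof n; exact: measure_ge0. Qed.

Let lebesgue_rV_sigma_additive n : semi_sigma_additive (@lebesgue_rV n).
Proof.
have [mu <-] := lebesgue_rV_subproof n.
exact: measure_semi_sigma_additive.
Qed.

HB.instance Definition _ n := isMeasure.Build _ _ _ (@lebesgue_rV n)
  (@lebesgue_rV0 n) (@lebesgue_rV_ge0 n) (@lebesgue_rV_sigma_additive n).

Let lebesgue_rV_sigma_finite n : sigma_finite setT (@lebesgue_rV n).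
Proof. by have [mu <-] := lebesgue_rV_subproof n; exact: sigma_finiteT. Qed.

HB.instance Definition _ n := Measure_isSigmaFinite.Build _ _ _ (@lebesgue_rV n)
  (@lebesgue_rV_sigma_finite n).

Lemma lebesgue_rV_box n (A : 'I_n -> set (measurableTypeR R)) :
  (forall i, measurable (A i)) ->
  lebesgue_rV [set x : 'rV[R]_n | forall i, A i (x ord0 i)] =
  \prod_(i < n) lebesgue_measure (A i).
Proof.
elim: n A => [|n IH] A mA.
  rewrite big_ord0 /= (_ : mkset _ = setT) ?diracT//.
  by apply/seteqP; split => // x _ /= i; case: i.
rewrite big_ord_recl -IH => [|i]; last exact: mA.
have mB : measurable [set x : 'rV[R]_n | forall i, A (lift ord0 i) (x ord0 i)].
  rewrite (_ : mkset _ = \bigcap_(i in [set: 'I_n])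
     (setT `&` (fun x : 'rV[R]_n => x ord0 i) @^-1` A (lift ord0 i))).
    apply: fin_bigcap_measurable => // i _.
    exact: (@measurable_coord R n i).
  apply/seteqP; split => [x Ax i _ //=|x Ax i].
  by have [] := Ax i Logic.I.
transitivity ((lebesgue_measure \x @lebesgue_rV n)
    (A ord0 `*` [set x : 'rV[R]_n | forall i, A (lift ord0 i) (x ord0 i)])); last first.
  exact: product_measure1E.
rewrite /= /pushforward; congr (product_measure1 _ _ _).
apply/seteqP; split => [[a v] /= H|[a v] /= [Ha Hv] i].
  split => [|i] /=.
    by have := H ord0; rewrite !mxE /fcons unlift_none.
  by have := H (lift ord0 i); rewrite !mxE /fcons liftK.
rewrite mxE /fcons; case: (unliftP ord0 i) => [j ->|->] //=; exact: Hv.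
Qed.

End lebesgue_rV.

Section bv_functions.
Context (R : realType) (n : nat).

(* All functions live on R^(n+1), so that the dimension is positive. *)
Local Notation E := 'rV[R]_n.+1.
Local Notation mu := (@lebesgue_rV R n.+1).

(* The norm of 'rV[R]_n in the library is the sup norm. *)
Definition enorm (x : E) : R := Num.sqrt (\sum_i x ord0 i ^+ 2).

Definition Lip_on (K : set E) (alpha : R) (g : E -> R) : \bar R :=
  ereal_sup [set (`|g p.1 - g p.2| / enorm (p.1 - p.2) `^ alpha)%:E
    | p in [set p : E * E | [/\ K p.1, K p.2 & p.1 != p.2]]].

Definition Lip (alpha : R) (g : E -> R) : \bar R := Lip_on setT alpha g.

Definition lipschitzR : set (E -> R) := [set g | Lip 1 g < +oo]%E.

(* jacobian is junk where the map is not differentiable, which for Lipschitz g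
   happens on a null set only. *)
Definition detD (g : 'I_n.+1 -> E -> R) (x : E) : R :=
  \det (jacobian (fun y => \row_i g i y : E) x).

Definition ess_support (u : E -> R) : set E :=
  [set x | forall U, nbhs x U -> ~ {ae mu, forall y, U y -> u y = 0}].

Definition L1c : set (E -> R) :=
  [set u | mu.-integrable setT (EFin \o u) /\ compact (ess_support u)].

Definition L1norm (u : E -> R) : \bar R := ('N[mu]_1[(fun x => (u x)%:E)])%E.

(* Lip alpha f may be +oo when alpha < 1. The convention 0 * +oo = 0 of \bar R is
   immaterial: the integral only depends on f near the support of u, so f can be
   replaced by a bounded Lipschitz function. *)
Definition Valpha (alpha : R) (u : E -> R) : \bar R :=
  ereal_inf [set C | (0 <= C)%E /\
    forall (f : E -> R) (g : 'I_n -> E -> R),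
      lipschitzR f -> (forall i, lipschitzR (g i)) ->
      (`|\int[mu]_x (u x * detD (fcons f g) x)|%:E <=
        C * Lip alpha f * \prod_(i < n) Lip 1 (g i))%E].

Definition BVc_alpha (alpha : R) : set (E -> R) :=
  [set u | L1c u /\ (Valpha alpha u < +oo)%E].

Definition C1_field (phi : E -> E) : Prop :=
  (forall x, differentiable phi x) /\ continuous (jacobian phi).

Definition divergence (phi : E -> E) (x : E) : R :=
  \sum_i 'D_(delta_mx ord0 i) (fun y => phi y ord0 i) x.

Definition Vtotal (u : E -> R) : \bar R :=
  ereal_sup [set (\int[mu]_x (u x * divergence phi x))%:E
    | phi in [set phi | C1_field phi /\ forall x, enorm (phi x) <= 1]].

Definition BVc : set (E -> R) := [set u | L1c u /\ (Vtotal u < +oo)%E].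

Definition current (u f : E -> R) (g : 'I_n.+1 -> E -> R) : R :=
  \int[mu]_x (u x * f x * detD g x).

Section functionals.
Context (m : nat) (K : set E) (gamma : 'I_m -> R).
Implicit Types (h : 'I_m -> E -> R) (T : ('I_m -> E -> R) -> R).

(* The product of the spaces Lip^(gamma i)(K), whose elements are represented by
   functions on the whole space; functional_on makes T depend on their
   restrictions to K only. *)
Definition holder_on : set ('I_m -> E -> R) :=
  [set h | forall i, (Lip_on K (gamma i) (h i) < +oo)%E].

Definition functional_on T : Prop :=
  forall h h', holder_on h -> holder_on h' ->
    (forall i x, K x -> h i x = h' i x) -> T h = T h'.

Definition multilinear_on T : Prop :=
  forall h (i : 'I_m) (a : R) (f1 f2 : E -> R),
    holder_on (dfwith h i f1) -> holder_on (dfwith h i f2) ->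
    T (dfwith h i (fun x => a * f1 x + f2 x)) =
      a * T (dfwith h i f1) + T (dfwith h i f2).

Definition continuous_on T : Prop :=
  forall (h_ : nat -> 'I_m -> E -> R) h, holder_on h ->
    (forall i, {uniform K, (fun k => h_ k i) @ \oo --> h i}) ->
    (forall i, ereal_sup (range (fun k => Lip_on K (gamma i) (h_ k i))) < +oo)%E ->
    T (h_ k) @[k --> \oo] --> T h.

End functionals.

End bv_functions.

(* Main.v *)
(* (1) => (2): u_k is the difference of the mollifications of u at the scales
   2^-k and 2^(1-k). The difference of the two kernels is a divergence
   sum_i d_i F_i with F_i of size 2^-k times that of the kernels, so testing u_k
   against a bounded function, or against a divergence, amounts to integrating u
   against partial derivatives d_i f, which are Jacobians det D(f, x_l)_(l <> i).
   The bounds follow by interpolating Lip^alpha f between sup |f| and Lip f.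

   (2) => (3): on the class of Lipschitz tuples bounded by M and with Hoelder
   constants at most Lam, the current of u is uniformly continuous for the sup
   norm. Replace each function at level j by its inf-convolution with
   2^(j(1 - gamma)) |x|, which has that Lipschitz constant up to Lam and is
   2^(-j gamma) close. Passing from level j to j+1 costs a geometric term: write
   u = s_j + (u - s_j) with s_j the j-th partial sum, use the L^1 bound for
   u - s_j, and for s_j the inequality
     |int v det D(g)| <= C V(v) sup |g_i| prod_(l <> i) Lip(g_l),
   a consequence of the fact that cofactor rows are divergence free. The
   extension is then the limit along Lipschitz approximants.

   (3) => (1): take f = 1 and beta = (delta - (n - 1), 1, ..., 1). If no
   constant worked, normalized tuples violating the bound with constants k^n,
   divided by k, would tend to 0 uniformly with bounded Hoelder constants while
   their currents stay above 1. *)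
From HB Require Import structures.
Require Import Defs.
From mathcomp Require Import all_boot all_order all_algebra.
From mathcomp Require Import all_classical all_reals all_analysis.
From mathcomp Require Import perm lra measurable_realfun.
Import Order.TTheory GRing.Theory Num.Theory.
Import numFieldNormedType.Exports.

Set Implicit Arguments.
Unset Strict Implicit.
Unset Printing Implicit Defensive.

Local Open Scope classical_set_scope.
Local Open Scope ring_scope.

(** * Norms and Lebesgue measure on R^n *)

(** Two obstacles shape the development. [detD] is defined pointwise from the Jacobian, and
    Lipschitz maps are differentiable only almost everywhere: identities between Jacobians rest on
    Rademacher's theorem, and measurability of [detD] on that of the differentiability set. Moreover
    the estimates need functions bounded and Lipschitz on the whole space, while the statement sees
    restrictions to K; truncation and McShane extension pass between the two.

    The two inequalities in (3) are the two rates of the level scheme. Let N be the dimension,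
    [n.+1] in the code. At level j the slopes multiply to 2^(j(N - sum beta)). Moving f costs a
    further 2^(-j alpha), which is summable when alpha + sum beta > N. The L^1 error 2^(j(delta -
    N)), and the variation 2^(j(delta - N + 1)) times the displacement 2^-j per unit slope, both
    lead to 2^(j(delta - sum beta)), summable when delta < sum beta.

    The mollifier is C^2 because the cofactors of smoothed functions, which contain first
    derivatives, must form a C^1 field. *)

Section rV_norm.
Context (R : realType).

Lemma rV_coord_le n (x : 'rV[R]_n) i : `|x ord0 i| <= `|x|.
Proof.
rewrite /Num.Def.normr/= mx_normrE.
exact: (le_bigmax _ (fun ij : 'I_1 * 'I_n => `|x ij.1 ij.2|) (ord0, i)).
Qed.

Lemma rV_norm_le n (x : 'rV[R]_n) (c : R) : 0 <= c ->
  (forall i, `|x ord0 i| <= c) -> `|x| <= c.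
Proof.
move=> c0 xc; rewrite /Num.Def.normr/= mx_normrE.
by apply: bigmax_le => // -[i j] _ /=; rewrite (ord1 i).
Qed.

Lemma enorm_ge n (x : 'rV[R]_n.+1) : `|x| <= enorm x.
Proof.
apply: rV_norm_le => [|i]; first exact: sqrtr_ge0.
rewrite -sqrtr_sqr ler_wsqrtr// (bigD1 i)//= lerDl.
by apply: sumr_ge0 => j _; exact: sqr_ge0.
Qed.

Lemma enorm_le n (x : 'rV[R]_n.+1) : enorm x <= n.+1%:R * `|x|.
Proof.
have h : 0 <= n.+1%:R * `|x| by rewrite mulr_ge0.
rewrite -(ger0_norm h) -sqrtr_sqr ler_wsqrtr// exprMn.
apply: (@le_trans _ _ (\sum_(i < n.+1) `|x| ^+ 2)).
  apply: ler_sum => i _; rewrite -real_normK ?num_real//.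
  by rewrite ler_sqr ?nnegrE// rV_coord_le.
rewrite sumr_const card_ord -[leLHS]mulr_natl; apply: ler_wpM2r.
  exact: sqr_ge0.
by rewrite -natrX ler_nat expnS leq_pmulr.
Qed.

End rV_norm.

Section measurable_open.
Context (R : realType) (n : nat).
Local Notation E := 'rV[R]_n.

(** A countable base of the topology by cubes with rational centres. It makes open sets measurable
    for the product sigma-algebra, and later glues countably many local almost everywhere
    statements. *)
Definition ratbox (p : 'rV[rat]_n * nat) : set E :=
  [set x | forall i, `|x ord0 i - ratr (p.1 ord0 i)| < p.2.+1%:R^-1].

Lemma measurable_ratbox p : measurable (ratbox p).
Proof.
rewrite (_ : ratbox p = \bigcap_(i in [set: 'I_n])
   ((fun x : E => x ord0 i : measurableTypeR R) @^-1`
      [set t : R | `|t - ratr (p.1 ord0 i)| < p.2.+1%:R^-1])); last first.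
  by apply/seteqP; split => [x xp i _|x xp i]; [exact: xp|exact: (xp i)].
apply: fin_bigcap_measurable => // i _.
rewrite -[X in measurable X]setTI; apply: measurable_coord => //.
rewrite (_ : mkset _ = ball (ratr (p.1 ord0 i) : R) (p.2.+1%:R^-1)).
  exact: measurable_ball.
by apply/seteqP; split => t; rewrite /ball/= distrC.
Qed.

Lemma open_ratbox (U : set E) (x : E) : nbhs x U ->
  exists p, ratbox p x /\ ratbox p `<=` U.
Proof.
move=> /nbhs_ballP[e /= e0 eU].
have [k _ ke] := near_infty_natSinv_lt (PosNum (divr_gt0 e0 (ltr0Sn R 1))).
have {}ke : k.+1%:R^-1 < e / 2 := ke k (leqnn k).
have k0 : 0 < k.+1%:R^-1 :> R by rewrite invr_gt0.
have q_ i : exists q : rat, `|x ord0 i - ratr q| < k.+1%:R^-1.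
  have /rat_in_itvoo[q] : x ord0 i - k.+1%:R^-1 < x ord0 i + k.+1%:R^-1.
    by rewrite ltrBlDr -addrA ltrDl addr_gt0.
  rewrite in_itv/= => /andP[h1 h2]; exists q.
  by rewrite ltr_distlC h1 h2.
have [q qP] := choice q_; exists (\row_i q i, k); split => [i|y yp] /=.
  by rewrite mxE.
apply: eU; rewrite -ball_normE/= (@le_lt_trans _ _ (2 * k.+1%:R^-1))//.
  apply: rV_norm_le => [|i]; first by rewrite mulr_ge0// ltW.
  rewrite !mxE; have := yp i; rewrite mxE /= => yi.
  rewrite (le_trans (ler_distD (ratr (q i)) _ _))// mulr_natl mulr2n.
  by apply: lerD; apply: ltW; [exact: qP|rewrite distrC; exact: yi].
by rewrite mulrC -ltr_pdivlMr.
Qed.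

Lemma open_bigcup_ratbox (U : set E) : open U ->
  U = \bigcup_(p in [set p | ratbox p `<=` U]) ratbox p.
Proof.
move=> oU; apply/seteqP; split => [x Ux|x [p /= pU px]]; last exact: pU.
by have [p [px pU]] := open_ratbox (open_nbhs_nbhs (conj oU Ux)); exists p.
Qed.

Lemma measurable_openrV (U : set E) : open U -> measurable U.
Proof.
move=> oU; rewrite (open_bigcup_ratbox oU) bigcup_mkcond.
apply: countable_bigcupT_measurable => [|p]; first exact: countableP.
by case: ifPn => _; [exact: measurable_ratbox|exact: measurable0].
Qed.

Lemma continuous_measurablerV (f : E -> R) :
  continuous f -> measurable_fun setT f.
Proof.
move=> cf; apply: (measurability _ (RGenOInfty.measurableE R)).
move=> _ [_ [a ->] <-]; rewrite setTI; apply: measurable_openrV.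
by move/continuousP : cf; apply; rewrite set_itvE; exact: open_gt.
Qed.

End measurable_open.

Section measure_boxes.
Context (R : realType) (n : nat).
Local Notation E := 'rV[R]_n.
Local Notation mu := (@lebesgue_rV R n).

Definition mbox (A : 'I_n -> set (measurableTypeR R)) : set E :=
  [set x | forall i, A i (x ord0 i)].

Lemma measurable_mbox A : (forall i, measurable (A i)) -> measurable (mbox A).
Proof.
move=> mA; rewrite (_ : mbox A = \bigcap_(i in [set: 'I_n])
   ((fun x : E => x ord0 i : measurableTypeR R) @^-1` A i)); last first.
  by apply/seteqP; split => [x xp i _|x xp i]; [exact: xp|exact: (xp i)].
apply: fin_bigcap_measurable => // i _.
rewrite -[X in measurable X]setTI; exact: measurable_coord.
Qed.

Lemma measurable_mboxE : @measurable _ E =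
  <<s [set mbox A | A in [set A | forall i, measurable (A i)]] >>.
Proof.
apply/seteqP; split; last first.
  apply: smallest_sub; first exact: sigma_algebra_measurable.
  by move=> _ [A mA <-]; exact: measurable_mbox.
apply: smallest_sub; first exact: smallest_sigma_algebra.
move=> B; rewrite -bigcup_seq => -[i _ [C mC <-]].
apply: sub_sigma_algebra.
exists (fun j => if j == i then C else setT).
  by move=> j /=; case: ifP.
apply/seteqP; split => [x xC|x [_ xC] j] /=.
  by split => //; have := xC i; rewrite eqxx.
by case: eqP => // ->.
Qed.

Lemma lebesgue_rV_cube (a : 'I_n -> R) (r : R) : 0 <= r ->
  mu (mbox (fun i => `[a i - r, a i + r]%classic)) = ((2 * r) ^+ n)%:E.
Proof.
move=> r0; rewrite [LHS]lebesgue_rV_box; last by move=> i; exact: measurable_itv.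
rewrite (eq_bigr (fun=> (2 * r)%:E)) => [|i _].
  by rewrite prodEFin prodr_const card_ord.
rewrite /= lebesgue_measure_itv/= lte_fin -EFinB.
by case: ltP => [_|h]; congr (_%:E); lra.
Qed.

(** Boxes are stable under intersection and generate the sigma-algebra, and the cubes of half-side k
    have finite measure and exhaust the space. *)
Lemma lebesgue_rV_unique (m : {measure set E -> \bar R}) :
  (forall A, (forall i, measurable (A i)) ->
    m (mbox A) = \prod_(i < n) lebesgue_measure (A i))%E ->
  forall A, measurable A -> mu A = m A.
Proof.
move=> mE; pose g (k : nat) : set E := mbox (fun=> `[-k%:R, k%:R]%classic).
apply: (measure_unique _ g measurable_mboxE).
- move=> _ _ [A mA <-] [B mB <-]; exists (fun i => A i `&` B i).
    by move=> i; exact: measurableI.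
  by apply/seteqP; split => [x xAB|x [xA xB] i];
    [split => i; have [] := xAB i|split; [exact: xA|exact: xB]].
- by move=> k; exists (fun=> `[-k%:R, k%:R]%classic) => // i; exact: measurable_itv.
- apply/seteqP; split => // x _; exists (Num.bound `|x|) => // i.
  rewrite /= in_itv/= -ler_norml (le_trans (rV_coord_le _ _))//.
  by rewrite ltW// archi_boundP.
- by move=> _ [A mA <-]; rewrite mE//; exact: lebesgue_rV_box.
- move=> k; have := lebesgue_rV_cube (fun=> 0) (ler0n R k).
  under eq_fun do rewrite sub0r add0r.
  by move=> gk; rewrite /= gk; exact: ltry.
Qed.

End measure_boxes.

(** * Translation and reflection invariance of Lebesgue measure *)

Section measure_preserving.
Context d (T : measurableType d) (R : realType) (m : {measure set T -> \bar R}).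
Variable phi : T -> T.
Hypothesis mphi : measurable_fun setT phi.
Hypothesis mE : forall A, measurable A -> pushforward m phi A = m A.

Lemma ge0_integral_preserving (f : T -> \bar R) : measurable_fun setT f ->
  (forall x, 0 <= f x)%E -> (\int[m]_x f (phi x) = \int[m]_x f x)%E.
Proof.
move=> mf f0.
have := @ge0_integral_pushforward _ _ _ _ R _ mphi m setT f measurableT mf (fun x _ => f0 x).
rewrite preimage_setT => <-.
by apply: (eq_measure_integral m) => A mA _; exact: mE.
Qed.

Lemma integrable_preserving (f : T -> R) : m.-integrable setT (EFin \o f) ->
  m.-integrable setT (EFin \o (fun x => f (phi x))).
Proof.
move=> /integrableP[/measurable_EFinP mf foo]; apply/integrableP; split.
  by apply/measurable_EFinP; exact: (measurableT_comp mf mphi).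
rewrite (ge0_integral_preserving (f := fun x => `|(EFin \o f) x|%E))//.
by apply: measurableT_comp => //; exact/measurable_EFinP.
Qed.

Lemma Rintegral_preserving (f : T -> R) : m.-integrable setT (EFin \o f) ->
  \int[m]_x f (phi x) = \int[m]_x f x.
Proof.
move=> fi; rewrite /Rintegral; congr fine.
have := @integral_pushforward _ _ _ _ R _ mphi m setT (EFin \o f)
  (measurable_int _ fi).
rewrite preimage_setT => <- //; last exact: integrable_preserving.
by apply: (eq_measure_integral m) => A mA _; exact: mE.
Qed.

End measure_preserving.

Section lebesgue_affine.
Context (R : realType).
Local Notation lam := (@lebesgue_measure R).

Lemma measurable_addr (a : R) :
  measurable_fun setT (fun t : measurableTypeR R => t + a : measurableTypeR R).
Proof. by apply: continuous_measurable_fun => t; apply: cvgD; [exact: cvg_id|exact: cvg_cst]. Qed.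

Lemma measurable_opp : measurable_fun setT (-%R : measurableTypeR R -> measurableTypeR R).
Proof. by apply: continuous_measurable_fun => t; exact: cvgN. Qed.

Lemma lebesgue_measure_shift (a : R) (A : set (measurableTypeR R)) :
  measurable A -> lam ((fun t => t + a) @^-1` A) = lam A.
Proof.
move=> mA.
have mf : measurable_fun setT (fun t : measurableTypeR R => t + a : measurableTypeR R).
  exact: measurable_addr.
rewrite -[LHS]/(pushforward lam (fun t : measurableTypeR R => t + a : measurableTypeR R) A).
apply/esym/(@lebesgue_measure_unique _ (pushforward lam (fun t : measurableTypeR R => t + a : measurableTypeR R))) => //= _ [[b c]] _ <-.
rewrite /pushforward (_ : _ @^-1` _ = `]b - a, c - a]%classic); last first.
  by apply/seteqP; split => t /=; rewrite !in_itv/= ltrBlDr lerBrDr.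
rewrite !lebesgue_measure_itv/= !lte_fin ltrD2r -!EFinB; case: ifP => // _.
by congr (_%:E); lra.
Qed.

Variable n : nat.
Local Notation E := 'rV[R]_n.
Local Notation mu := (@lebesgue_rV R n).

Lemma measurable_shift (z : E) : measurable_fun setT (fun x : E => x + z).
Proof.
apply: measurable_fun_rVP => i; under eq_fun do rewrite mxE.
apply: (@measurable_funD _ _ _ _ (fun x : E => x ord0 i) (cst (z ord0 i))) => //.
exact: measurable_coord.
Qed.

Lemma measurable_reflect (z : E) : measurable_fun setT (fun x : E => z - x).
Proof.
apply: measurable_fun_rVP => i; under eq_fun do rewrite !mxE.
apply: (@measurable_funB _ _ _ _ (cst (z ord0 i)) (fun x : E => x ord0 i)) => //.
exact: measurable_coord.
Qed.

Lemma lebesgue_rV_shift (z : E) (A : set E) : measurable A ->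
  pushforward mu (fun x => x + z) A = mu A.
Proof.
move=> mA; apply/esym; move: A mA.
apply: (lebesgue_rV_unique (m := measure_function_pushforward__canonical__measure_function_Measure
   mu (@measurable_shift z))) => A mA.
rewrite /= /pushforward [X in mu X = _](_ : _ = mbox (fun i => (fun t => t + z ord0 i) @^-1` A i)).
  rewrite [LHS]lebesgue_rV_box => [|i].
    by apply: eq_bigr => i _; rewrite lebesgue_measure_shift.
  rewrite -[X in measurable X]setTI.
  by apply: measurable_addr.
by apply/seteqP; split => x xA i; have := xA i; rewrite /= mxE.
Qed.

Lemma lebesgue_rV_reflect (z : E) (A : set E) : measurable A ->
  pushforward mu (fun x => z - x) A = mu A.
Proof.
move=> mA; apply/esym; move: A mA.
apply: (lebesgue_rV_unique (m := measure_function_pushforward__canonical__measure_function_Measure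
   mu (@measurable_reflect z))) => A mA.
have mB i : measurable ((fun t => t + z ord0 i) @^-1` A i : set (measurableTypeR R)).
  rewrite -[X in measurable X]setTI.
  by apply: measurable_addr.
rewrite /= /pushforward [X in mu X = _](_ : _ = mbox (fun i => -%R @^-1` ((fun t => t + z ord0 i) @^-1` A i))).
  rewrite [LHS]lebesgue_rV_box => [|i].
    apply: eq_bigr => i _; rewrite -[RHS](lebesgue_measure_shift (z ord0 i))//.
    have := @lebesgue_measureN R _ (mB i); exact.
  by rewrite -[X in measurable X]setTI; apply: measurable_opp.
by apply/seteqP; split => x xA i; have := xA i; rewrite /= !mxE addrC.
Qed.

Lemma integrable_shift (z : E) (f : E -> R) : mu.-integrable setT (EFin \o f) ->
  mu.-integrable setT (EFin \o (fun x => f (x + z))).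
Proof. exact: (integrable_preserving (measurable_shift z) (@lebesgue_rV_shift z)). Qed.

Lemma Rintegral_shift (z : E) (f : E -> R) : mu.-integrable setT (EFin \o f) ->
  \int[mu]_x f (x + z) = \int[mu]_x f x.
Proof. exact: (Rintegral_preserving (measurable_shift z) (@lebesgue_rV_shift z)). Qed.

Lemma ge0_integral_shift (z : E) (f : E -> \bar R) : measurable_fun setT f ->
  (forall x, 0 <= f x)%E ->
  (\int[mu]_x f (x + z)%R = \int[mu]_x f x)%E.
Proof. exact: (ge0_integral_preserving (measurable_shift z) (@lebesgue_rV_shift z)). Qed.

Lemma integrable_reflect (z : E) (f : E -> R) : mu.-integrable setT (EFin \o f) ->
  mu.-integrable setT (EFin \o (fun x => f (z - x))).
Proof. exact: (integrable_preserving (measurable_reflect z) (@lebesgue_rV_reflect z)). Qed.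

Lemma Rintegral_reflect (z : E) (f : E -> R) : mu.-integrable setT (EFin \o f) ->
  \int[mu]_x f (z - x) = \int[mu]_x f x.
Proof. exact: (Rintegral_preserving (measurable_reflect z) (@lebesgue_rV_reflect z)). Qed.

End lebesgue_affine.

Section dominated.
Context d (T : measurableType d) (R : realType) (m : {measure set T -> \bar R}).

Lemma Rdominated_cvg (f_ : (T -> R)^nat) (f g : T -> R) :
  (forall k, measurable_fun setT (f_ k)) -> measurable_fun setT f ->
  {ae m, forall x, f_ ^~ x @ \oo --> f x} ->
  m.-integrable setT (EFin \o g) ->
  (forall k x, `|f_ k x| <= g x) ->
  (\int[m]_x f_ k x) @[k --> \oo] --> \int[m]_x f x.
Proof.
move=> mf_ mf ff ig fg.
have [fi _ cf] : [/\ m.-integrable setT (fun x => (f x)%:E),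
    [sequence (\int[m]_x (fun k y => `|(f_ k y)%:E - (f y)%:E|) k x)%E]_k @ \oo --> 0%E
  & [sequence (\int[m]_x (f_ k x)%:E)%E]_k @ \oo --> (\int[m]_x (f x)%:E)%E].
  apply: (@dominated_convergence _ _ _ m setT measurableT
    (fun k x => (f_ k x)%:E) _ (EFin \o g)) => //.
  - by move=> k; exact/measurable_EFinP.
  - exact/measurable_EFinP.
  - have aeF := ae_filter_ringOfSetsType m.
    by apply: filterS ff => x fx _; apply: cvg_EFin => //; exact: nearW.
  - by apply: aeW => x k _; rewrite /= lee_fin.
apply: fine_cvg; rewrite fineK//; exact: integrable_fin_num.
Qed.

End dominated.

(** * Inf-convolutions *)

Section inf_convolution.
Context (R : realType) (n : nat).
Local Notation E := 'rV[R]_n.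

Definition modulus (w : R -> R) := [/\ w 0 = 0, forall t, 0 <= t -> 0 <= w t,
  forall s t, 0 <= s -> s <= t -> w s <= w t &
  forall s t, 0 <= s -> 0 <= t -> w (s + t) <= w s + w t].

Lemma modulus_linear (L : R) : 0 <= L -> modulus (fun t => L * t).
Proof.
move=> L0; split => [|t t0|s t _ st|s t _ _]; rewrite ?mulr0 ?mulr_ge0 ?mulrDr//.
exact: ler_wpM2l.
Qed.

(** The McShane formula. It serves three ends: Lipschitz approximation of indicator functions, the
    regularization levels, and the extension of Hoelder functions off K. *)
Definition infconv (w : R -> R) (h : E -> R) (x : E) : R :=
  inf (range (fun y => h y + w `|x - y|)).

Context (w : R -> R) (m : R) (h : E -> R).
Hypothesis mw : modulus w.
Hypothesis hm : forall x, m <= h x.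

Let w0 (x : E) : 0 <= w `|x|. Proof. by have [_ + _ _] := mw; apply. Qed.

Lemma infconv_ge (c : R) (x : E) : (forall y, c <= h y + w `|x - y|) ->
  c <= infconv w h x.
Proof.
move=> cy; apply: lb_le_inf; first by exists (h x + w `|x - x|); exists x.
by move=> _ [y _ <-].
Qed.

Lemma infconv_le (x y : E) : infconv w h x <= h y + w `|x - y|.
Proof.
apply: ge_inf; last by exists y.
by exists m => _ [z _ <-]; rewrite (le_trans (hm z))// lerDl.
Qed.

Lemma infconv_le_id (x : E) : infconv w h x <= h x.
Proof.
by have [w00 _ _ _] := mw; rewrite (le_trans (infconv_le x x))// subrr normr0 w00 addr0.
Qed.

Lemma infconv_lb (x : E) : m <= infconv w h x.
Proof. by apply: infconv_ge => y; rewrite (le_trans (hm y))// lerDl. Qed.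

Lemma infconv_lip (x y : E) : `|infconv w h x - infconv w h y| <= w `|x - y|.
Proof.
have le x' y' : infconv w h x' - infconv w h y' <= w `|x' - y'|.
  rewrite lerBlDr -lerBlDl; apply: infconv_ge => z.
  rewrite lerBlDl (le_trans (infconv_le x' z))// addrCA lerD2l.
  have [_ _ wle wD] := mw; rewrite (le_trans _ (wD _ _ _ _))//.
  by rewrite wle// ler_distD.
by rewrite ler_norml le andbT lerNl opprB distrC.
Qed.

End inf_convolution.

Section lipschitz_functions.
Context (R : realType) (n : nat).
Local Notation E := 'rV[R]_n.

Definition lip (L : R) (f : E -> R) := forall x y, `|f x - f y| <= L * `|x - y|.

Lemma lip_continuous L f : lip L f -> continuous f.
Proof.
move=> fL /= x P /= /(nbhs_ballP (f x))[e /= e0 es].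
have L1 : 0 < `|L| + 1 by rewrite ltr_pwDr.
apply/nbhs_ballP; exists (e / (`|L| + 1)); first by rewrite /= divr_gt0.
move=> y; rewrite -!ball_normE/= ltr_pdivlMr// mulrC => xy; apply: es.
rewrite -ball_normE/= (le_lt_trans (fL _ _))// (le_lt_trans _ xy)//.
by rewrite ler_wpM2r// (le_trans (ler_norm _))// lerDl.
Qed.

Lemma lip_measurable L f : lip L f -> measurable_fun setT f.
Proof. by move=> /lip_continuous; exact: continuous_measurablerV. Qed.

End lipschitz_functions.

(** * Almost everywhere vanishing by testing *)

Section test_functions.
Context (R : realType) (n : nat).
Local Notation E := 'rV[R]_n.
Local Notation mu := (@lebesgue_rV R n).

(** The sets of reals whose coordinate preimage lies in the sigma-algebra of the open sets form a
    sigma-algebra containing the open intervals; this gives the nontrivial inclusion. *)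
Lemma measurable_rV_openE : @measurable _ E = <<s [set U : set E | open U] >>.
Proof.
apply/seteqP; split; last first.
  apply: smallest_sub; first exact: sigma_algebra_measurable.
  by move=> U; exact: measurable_openrV.
apply: smallest_sub; first exact: smallest_sigma_algebra.
move=> B; rewrite -bigcup_seq => -[i _ [C mC <-]]; rewrite setTI.
have cc : continuous (fun x : E => x ord0 i).
  by move=> x; exact: coord_continuous.
pose S := [set C : set (measurableTypeR R) |
  <<s [set U : set E | open U] >> ((fun x : E => x ord0 i) @^-1` C)].
suff : measurable `<=` S by exact.
rewrite [X in X `<=` _](_ : _ = <<s @RGenOpens.G R >>); last first.
  exact: RGenOpens.measurableE.
apply: smallest_sub; last first.
  move=> _ [a [b ->]]; apply: sub_sigma_algebra.
  by move/continuousP : cc; apply; exact: interval_open.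
split => /=.
- by rewrite /S/= preimage_set0; exact: sigma_algebra0.
- move=> A SA; rewrite /S/= setTD preimage_setC.
  by rewrite -setTD; apply: sigma_algebraCD.
- by move=> A SA; rewrite /S/= preimage_bigcup; exact: sigma_algebra_bigcup.
Qed.

(* The indicator function of an open set is the increasing limit of its
   inf-convolutions with j|x|, which are Lipschitz. *)
Lemma ae_eq0_test (h : E -> R) : mu.-integrable setT (EFin \o h) ->
  (forall psi L, lip L psi -> (forall x, 0 <= psi x <= 1) ->
    \int[mu]_x (h x * psi x) = 0) ->
  {ae mu, forall x, h x = 0}.
Proof.
move=> ih hpsi.
have mh : measurable_fun setT h by apply/measurable_EFinP; exact: measurable_int ih.
have U0 U : open U -> \int[mu]_x (h x * \1_U x) = 0.
  move=> oU; have mU : measurable (U : set E) := measurable_openrV oU.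
  pose w (j : nat) (t : R) := j%:R * t.
  have mw j : modulus (w j) by exact: modulus_linear.
  pose psi (j : nat) := infconv (w j) (\1_U : E -> R).
  have i0 x : 0 <= (\1_U x : R) by [].
  have p01 j x : 0 <= psi j x <= 1.
    by rewrite /psi infconv_lb//= (le_trans (infconv_le_id (mw j) i0 _)).
  suff : \int[mu]_x (h x * psi j x) @[j --> \oo] --> \int[mu]_x (h x * \1_U x).
    under eq_fun do rewrite (hpsi _ _ (infconv_lip (mw _) i0) (p01 _)).
    by move=> /cvg_lim <-//; apply: lim_cst.
  apply: (@Rdominated_cvg _ _ _ mu _ _ (fun x => `|h x|)).
  - move=> j; apply: measurable_funM => //.
    exact: lip_measurable (infconv_lip (mw _) i0).
  - by apply: measurable_funM => //; exact: measurable_indic.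
  - apply: aeW => x; apply: cvgM; first exact: cvg_cst.
    have [Ux|nUx] := pselect (U x); last first.
      rewrite indicE memNset//; apply: cvg_near_cst; apply: nearW => j.
      apply/eqP; rewrite eq_le (andP (p01 j x)).1 andbT.
      by rewrite (le_trans (infconv_le_id (mw j) i0 _))// indicE memNset.
    rewrite indicE mem_set//; apply: cvg_near_cst.
    have [e /= e0 eU] := (nbhs_ballP _ _).1 (open_nbhs_nbhs (conj oU Ux)).
    (* Points outside U are at distance at least e from x, so their penalty j|x - y| reaches 1 once
       j >= 1/e, and the infimum is exactly 1. *)
    near=> j; apply/eqP; rewrite eq_le (andP (p01 j x)).2/=.
    apply: infconv_ge => y; rewrite indicE.
    have [Uy|nUy] := pselect (U y); first by rewrite mem_set// lerDl mulr_ge0.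
    rewrite memNset// add0r.
    have exy : e <= `|x - y|.
      by rewrite leNgt; apply/negP => xye; apply: nUy; apply: eU; rewrite -ball_normE.
    rewrite (@le_trans _ _ (j%:R * e))//; last by rewrite ler_wpM2l.
    rewrite -ler_pdivrMr// div1r; near: j; exact: nbhs_infty_ger.
  - exact: (integrable_norm ih).
  - move=> j x; rewrite normrM ler_piMr// ger0_norm; by have /andP[] := p01 j x.
(* Dynkin's argument: the measurable sets over which h integrates to zero form a lambda-system, and
   the open sets are a generating pi-system contained in it. *)
pose H : set (set E) := [set A | measurable A /\ \int[mu]_x (h x * \1_A x) = 0].
have ihA A : measurable A -> mu.-integrable setT (EFin \o (fun x => h x * \1_A x)).
  move=> mA; apply: (le_integrable measurableT _ _ ih) => [|x _].
    by apply/measurable_EFinP; apply: measurable_funM => //; exact: measurable_indic.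
  rewrite /= lee_fin normrM ler_piMr// /indic; case: (_ \in _); rewrite ?normr1 ?normr0//.
have HE : @measurable _ E `<=` H.
  rewrite measurable_rV_openE; apply: lambda_system_subset.
  - by move=> A B; exact: openI.
  - split => //.
    + by split; [exact: measurableT|exact/U0/openT].
    + move=> A B BA [mA A0] [mB B0]; split; first exact: measurableD.
      rewrite -[RHS](subrr 0) -[in X in _ = X - _]A0 -[in X in _ = _ - X]B0.
      rewrite -RintegralB//; [|exact: ihA|exact: ihA].
      apply: eq_Rintegral => x _; rewrite -mulrBr !indicE in_setD.
      have [xB|xB] := boolP (x \in B); last by rewrite andbT subr0.
      by rewrite (mem_set (BA _ (set_mem xB))) subrr.
    + move=> F ndF HF; have mF k := (HF k).1.
      have mU : measurable (\bigcup_k F k) by exact: bigcup_measurable.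
      split => //.
      suff : \int[mu]_x (h x * \1_(F k) x) @[k --> \oo] --> \int[mu]_x (h x * \1_(\bigcup_k F k) x).
        under eq_fun do rewrite (HF _).2.
        by move=> /cvg_lim <-//; apply: lim_cst.
      apply: (@Rdominated_cvg _ _ _ mu _ _ (fun x => `|h x|)).
      * by move=> k; apply: measurable_funM => //; exact: measurable_indic.
      * by apply: measurable_funM => //; exact: measurable_indic.
      * apply: aeW => x; apply: cvgM; first exact: cvg_cst.
        have [[k _ Fx]|nFx] := pselect ((\bigcup_k F k) x).
          rewrite indicE mem_set; last by exists k.
          apply: cvg_near_cst; near=> j; rewrite indicE mem_set//.
          have /subsetPset : (F k <= F j)%O by apply: ndF; near: j; exact: nbhs_infty_ge.
          exact.
        rewrite indicE memNset//; apply: cvg_near_cst; apply: nearW => j.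
        by rewrite indicE memNset// => Fx; apply: nFx; exists j.
      * exact: (integrable_norm ih).
      * by move=> k x; rewrite normrM ler_piMr// /indic; case: (_ \in _); rewrite ?normr1 ?normr0.
  - by move=> U oU; split; [exact: measurable_openrV|exact: U0].
  - by [].
have : ae_eq mu setT (EFin \o h) (cst 0%E).
  apply: (@integral_ae_eq _ _ _ mu setT measurableT (cst 0%E) _ ih (measurable_cst _)).
  move=> A _ mA; rewrite integral_cst// mul0e.
  have [_] := HE _ mA; rewrite /Rintegral => hA0.
  rewrite integral_mkcond -[LHS]fineK; last first.
    rewrite (_ : _ \_ _ = EFin \o (fun x => h x * \1_A x)).
      exact/integrable_fin_num/ihA.
    by apply/funext => x; rewrite /patch/= indicE; case: ifP => _; rewrite ?mulr1 ?mulr0.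
  have -> : fine (\int[mu]_x ((EFin \o h) \_ A) x)%E = 0; last by [].
  rewrite -[RHS]hA0; congr fine; apply: eq_integral => x _.
  by rewrite /patch/= indicE; case: ifP => _; rewrite ?mulr1 ?mulr0.
have aeF := ae_filter_ringOfSetsType mu.
by apply: filterS => x /(_ Logic.I) [].
Unshelve. all: by end_near. Qed.

End test_functions.

(** * Rademacher's theorem *)

Section lipschitz_cumulative.
Context (R : realType) (g : R -> R) (L : R).
Hypothesis gL : forall x y, `|g x - g y| <= L * `|x - y|.

(** Adding L x turns an L-Lipschitz function into a nondecreasing one, which has a Stieltjes
    measure. The Lipschitz bound is an argument so that the cumulative structure can be attached to
    [tilted gL]. *)
Definition tilted of (forall x y, `|g x - g y| <= L * `|x - y|) :=
  fun x : R => g x + L * x.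

Let tilted_nd : nondecreasing (tilted gL).
Proof.
move=> x y xy; rewrite /tilted -subr_ge0.
have := gL x y; rewrite ler_norml => /andP[_]; rewrite distrC ger0_norm ?subr_ge0//.
by rewrite mulrBr; lra.
Qed.

Lemma lip1_continuous : continuous g.
Proof.
move=> x P /= /(nbhs_ballP (g x))[e /= e0 es].
have L1 : 0 < `|L| + 1 by rewrite ltr_pwDr.
apply/nbhs_ballP; exists (e / (`|L| + 1)); first by rewrite /= divr_gt0.
move=> y; rewrite -!ball_normE/= ltr_pdivlMr// mulrC => xy; apply: es.
rewrite -ball_normE/= (le_lt_trans (gL _ _))// (le_lt_trans _ xy)//.
by rewrite ler_wpM2r// (le_trans (ler_norm _))// lerDl.
Qed.

Let tilted_rc : right_continuous (tilted gL).
Proof.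
apply: right_continuousW => x; apply: cvgD; first exact: lip1_continuous.
by apply: cvgMr; exact: cvg_id.
Qed.

HB.instance Definition _ :=
  isCumulative.Build R _ R (tilted gL) tilted_nd tilted_rc.

Definition tilted_cumulative : cumulative R R := tilted gL.

Lemma stieltjes_tiltedE (a b : R) : a <= b ->
  lebesgue_stieltjes_measure tilted_cumulative `]a, b]%classic =
  (tilted gL b - tilted gL a)%:E.
Proof.
move=> ab; rewrite /lebesgue_stieltjes_measure /measure_extension/= measurable_mu_extE/=; last exact: is_ocitv.
rewrite wlength_itv/= lte_fin EFinB; case: ltP => // ba.
by have /eqP -> : a == b; [rewrite eq_le ab ba|rewrite subee].
Qed.

End lipschitz_cumulative.

Section rademacher1.
Context (R : realType) (f : R -> R) (L : R).
Local Notation lam := (@lebesgue_measure R).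
Hypothesis L0 : 0 < L.
Hypothesis fL : forall x y, `|f x - f y| <= L * `|x - y|.

Let fN x y : `|- f x - - f y| <= L * `|x - y|.
Proof. by rewrite -opprD normrN. Qed.

Let nu := lebesgue_stieltjes_measure (tilted_cumulative fL).
Let nu' := lebesgue_stieltjes_measure (tilted_cumulative fN).

(** The functions f + L x and -f + L x add up to 2 L x, so their Stieltjes measures add up to 2 L
    times Lebesgue measure; each of them is therefore absolutely continuous. *)
Let lamE (A : set (measurableTypeR R)) : measurable A ->
  lam A = ((2 * L)^-1%:E * (nu A + nu' A))%E.
Proof.
have L2 : 0 <= (2 * L)^-1 by rewrite invr_ge0 mulr_ge0// ltW.
pose m : {measure set (measurableTypeR R) -> \bar R} :=
  mscale (NngNum L2) (measure_add nu nu').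
have mE B : m B = ((2 * L)^-1%:E * (nu B + nu' B))%E.
  transitivity ((2 * L)^-1%:E * measure_add nu nu' B)%E; first by [].
  by congr (_ * _)%E; exact: measure_addE.
move=> mA; rewrite -mE; move: A mA; apply: lebesgue_measure_unique.
move=> _ [[a b] _ <-] /=; rewrite [RHS]mE.
have [ab|ba] := leP a b; last first.
  have -> : `]a, b]%classic = set0 :> set R by rewrite set_itv_ge// bnd_simp -leNgt ltW.
  by rewrite /nu /nu' !measure0 adde0 mule0.
rewrite /nu /nu' !stieltjes_tiltedE// lebesgue_measure_itv/= lte_fin -EFinD -EFinM.
have -> : (2 * L)^-1 * (tilted fL b - tilted fL a + (tilted fN b - tilted fN a)) = b - a.
  rewrite /tilted; have L2' : 2 * L != 0 by rewrite mulf_neq0// gt_eqF.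
  by apply: (mulfI L2'); rewrite mulVKf//; lra.
by case: ltP => // ba; congr (_%:E); lra.
Qed.

Let I (M : nat) : set (measurableTypeR R) := `]- M%:R, M%:R]%classic.

Let mI M : measurable (I M). Proof. exact: measurable_itv. Qed.

Let nu_dom (M : nat) (h : (nu (I M) < +oo)%E) : mfrestr (mI M) h `<< lam.
Proof.
apply/null_content_dominatesP => A mA A0; rewrite /mfrestr /mrestr.
apply/eqP; rewrite -measure_le0; have : (nu A <= 0)%E.
  have : lam A = 0%E by exact: A0.
  rewrite lamE// => /eqP; rewrite mule_eq0 => /orP[|].
    by rewrite eqe invr_eq0 gt_eqF// mulr_gt0.
  by rewrite padde_eq0 ?measure_ge0// => /andP[/eqP -> _].
move=> nuA0; apply: (le_trans _ nuA0).
by apply: le_measure; rewrite ?inE//; exact: measurableI.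
Qed.

(** By Radon-Nikodym the tilted function is, up to a constant, the indefinite integral of an
    integrable density, and Lebesgue differentiation applies. Restricting to a bounded interval
    makes the Stieltjes measure finite. *)
Let rademacher_itv (M : nat) :
  {ae lam, forall x, x \in `]- M%:R, M%:R[ -> derivable f x 1}.
Proof.
have M0 : - M%:R <= M%:R :> R by rewrite ge0_cp//.
have nuoo : (nu (I M) < +oo)%E by rewrite /nu /I stieltjes_tiltedE// ltry.
have [g [g0 gfin gi gE]] := radon_nikodym_sigma_finite (nu_dom nuoo).
pose g' := fine \o g.
have g'E : EFin \o g' = g by apply/funext => x; rewrite /= fineK.
have FE (x : R) : x \in `]- M%:R, M%:R[ ->
  \int[lam]_(t in `](- M%:R), x]) g' t = tilted fL x - tilted fL (- M%:R).
  rewrite in_itv/= => /andP[Mx xM].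
  pose J : set (measurableTypeR R) := `]- M%:R, x]%classic.
  have : nu (J `&` I M) = (\int[lam]_(t in J) g t)%E.
    by have := gE J (measurable_itv _); exact.
  rewrite setIidl; last first.
    by apply: subset_itvl; rewrite bnd_simp ltW.
  rewrite /nu stieltjes_tiltedE ?ltW// => gx.
  by rewrite /Rintegral -[RHS]/(fine (_%:E)) gx; congr fine; apply: eq_integral => t _; rewrite /g'/= fineK.
have gi' : lam.-integrable setT (EFin \o g') by rewrite g'E.
have gl : locally_integrable setT g' by apply: open_integrable_locally => //; exact: openT.
have giA y : lam.-integrable [set` Interval (BRight (- M%:R)) (BRight y)] (EFin \o g').
  by apply: integrableS gi' => //; exact: measurable_itv.
have := FTC1 giA gl.
have aeF := ae_filter_ringOfSetsType lam.
apply: filterS => x /= FTCx xM.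
have Mx : (BRight (- M%:R) < BRight x)%O.
  by move: xM; rewrite in_itv/= bnd_simp => /andP[].
have [dF _] := FTCx Mx.
have dt : derivable (tilted fL) x 1.
  have : derivable (fun y : R => \int[lam]_(t in `](- M%:R), y]) g' t + tilted fL (- M%:R)) x 1.
    by apply: derivableD; [exact: dF|exact: derivable_cst].
  apply: near_eq_derivable.
  near=> y; rewrite FE; first by rewrite subrK.
  by near: y; exact: near_in_itvoo.
rewrite (_ : f = tilted fL - (fun x => L * x)); last first.
  by apply/funext => y; rewrite /tilted fctE addrK.
by apply: derivableB; [exact: dt|apply: derivableM; [exact: derivable_cst|exact: derivable_id]].
Unshelve. all: by end_near. Qed.

Lemma rademacher1 : {ae lam, forall x, derivable f x 1}.
Proof.
have : {ae lam, forall x, forall M : nat, x \in `]- M%:R, M%:R[ -> derivable f x 1}.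
  exact/ae_foralln/rademacher_itv.
have aeF := ae_filter_ringOfSetsType lam.
apply: filterS => x /(_ (Num.bound `|x|)); apply.
by rewrite in_itv/= -ltr_norml archi_boundP.
Qed.

End rademacher1.

Section countable.
Context d (T : measurableType d) (R : realType) (m : {measure set T -> \bar R}).

Lemma ae_forall_count (I : countType) (P : I -> T -> Prop) :
  (forall i, {ae m, forall x, P i x}) -> {ae m, forall x, forall i, P i x}.
Proof.
move=> aeP.
have : {ae m, forall x, forall k : nat, forall i, unpickle k = Some i -> P i x}.
  apply: ae_foralln => k; case uk: (unpickle k) => [i|]; last exact: aeW.
  have aeF := ae_filter_ringOfSetsType m.
  by apply: filterS (aeP i) => x Pix _ [<-].
have aeF := ae_filter_ringOfSetsType m.
by apply: filterS => x Px i; apply: (Px (pickle i)); exact: pickleK.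
Qed.

Lemma measurable_exists (I : countType) (A : I -> set T) :
  (forall i, measurable (A i)) -> measurable [set x | exists i, A i x].
Proof.
move=> mA; rewrite (_ : mkset _ = \bigcup_i A i).
  by apply: countable_bigcupT_measurable => //; exact: countableP.
by apply/seteqP; split => [x [i Aix]|x [i _ Aix]]; exists i.
Qed.

Lemma measurable_forall (I : countType) (A : I -> set T) :
  (forall i, measurable (A i)) -> measurable [set x | forall i, A i x].
Proof.
move=> mA; rewrite -[X in measurable X]setCK; apply: measurableC.
rewrite (_ : ~` _ = [set x | exists i, (~` A i) x]).
  by apply: measurable_exists => i; exact: measurableC.
by apply/seteqP; split => [x /existsNP//|x [i Aix] /(_ i)].
Qed.

End countable.

Section bounded_integrals.
Context (R : realType) (n : nat).
Local Notation E := 'rV[R]_n.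
Local Notation mu := (@lebesgue_rV R n).
Context (a : E) (B r : R) (f : E -> R).
Hypothesis r0 : 0 <= r.
Hypothesis mf : measurable_fun setT f.
Hypothesis fB : forall x, `|f x| <= B.
Hypothesis fr : forall x, r < `|x - a| -> f x = 0.

Let Q : set E := mbox (fun i => `[a ord0 i - r, a ord0 i + r]%classic).

Let mQ : measurable Q.
Proof. by apply: measurable_mbox => i; exact: measurable_itv. Qed.

Let fQ x : `|f x| <= B * \1_Q x.
Proof.
rewrite indicE; have [Qx|nQx] := pselect (Q x); first by rewrite mem_set// mulr1.
rewrite memNset// mulr0 fr ?normr0// ltNge; apply: contra_notN nQx => xa i.
by rewrite /= in_itv/= -ler_distlC (le_trans _ xa)// distrC; have := rV_coord_le (x - a) i; rewrite !mxE.
Qed.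

Let i1Q : (\int[mu]_x `|(B * \1_Q x)%:E|)%E = (`|B| * (2 * r) ^+ n)%:E.
Proof.
transitivity (\int[mu]_x (`|B|%:E * (\1_Q x)%:E))%E.
  by apply: eq_integral => x _; rewrite -EFinM/= normrM (ger0_norm (_ : 0 <= \1_Q x)).
rewrite ge0_integralZl//; last exact/measurable_EFinP/measurable_indic.
have -> : (\int[mu]_x (\1_Q x)%:E = ((2 * r) ^+ n)%:E)%E; last by [].
by rewrite integral_indic// setIT; exact: lebesgue_rV_cube.
Qed.

Lemma integrable_bounded : mu.-integrable setT (EFin \o f).
Proof.
have iQ : mu.-integrable setT (EFin \o (fun x => B * \1_Q x)).
  apply/integrableP; split; last by rewrite i1Q ltry.
  apply/measurable_EFinP; apply: measurable_funM => //; exact: measurable_indic.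
apply: (le_integrable measurableT _ _ iQ); first exact/measurable_EFinP.
move=> x _ /=; rewrite lee_fin (le_trans (fQ x))// normrM (ger0_norm (_ : 0 <= \1_Q x))//.
by rewrite ler_wpM2r// ler_norm.
Qed.

Lemma Rintegral_bounded : `|\int[mu]_x f x| <= B * (2 * r) ^+ n.
Proof.
have B0 : 0 <= B by rewrite (le_trans _ (fB 0)).
rewrite -lee_fin EFin_normr_Rintegral//; last exact: integrable_bounded.
rewrite (le_trans (le_abse_integral _ measurableT _))//; first exact/measurable_EFinP.
rewrite -[in leRHS](ger0_norm B0) -i1Q; apply: ge0_le_integral => //.
- by apply/measurable_EFinP/measurableT_comp.
- apply/measurable_EFinP/measurableT_comp => //; apply: measurable_funM => //; exact: measurable_indic.
- by move=> x _ /=; rewrite lee_fin normrM (ger0_norm B0) (ger0_norm (_ : 0 <= \1_Q x))// fQ.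
Qed.

End bounded_integrals.

Section linear_form.
Context (R : realType) (n : nat).
Local Notation E := 'rV[R]_n.

Definition linform (a : 'I_n -> R) (h : E) : R := \sum_i a i * h ord0 i.

Lemma linform_is_linear a : linear (linform a).
Proof.
move=> k x y; rewrite /linform scaler_sumr -big_split/=; apply: eq_bigr => i _.
by rewrite !mxE mulrDr mulrCA.
Qed.

HB.instance Definition _ a :=
  GRing.isLinear.Build R E R _ (linform a) (linform_is_linear a).

Lemma linform_le a h : `|linform a h| <= (\sum_i `|a i|) * `|h|.
Proof.
rewrite (le_trans (ler_norm_sum _ _ _))// mulr_suml; apply: ler_sum => i _.
by rewrite normrM ler_wpM2l// rV_coord_le.
Qed.

Lemma linform_lip a : lip (\sum_i `|a i|) (linform a).
Proof. by move=> x y; rewrite -linearB linform_le. Qed.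

Lemma linform_delta a i : linform a (delta_mx ord0 i) = a i.
Proof.
rewrite /linform (bigD1 i)//= mxE !eqxx mulr1 big1 ?addr0// => j ji.
by rewrite mxE (negPf ji) mulr0.
Qed.

Lemma differentiable_linform (f : E -> R) (x : E) (a : 'I_n -> R) :
  (forall e : R, 0 < e -> exists2 d : R, 0 < d & forall h : E, `|h| < d ->
    `|f (h + x) - f x - linform a h| <= e * `|h|) ->
  differentiable f x /\ 'd f x = linform a :> (E -> R).
Proof.
move=> fx.
have ca : continuous (linform a) by exact: lip_continuous (linform_lip a).
have body (e : R) : 0 < e -> \forall h \near (0 : E),
    `|(f \o shift x - (cst (f x) + linform a)) h| <= e * `|id h|.
  move=> e0; have [d d0 fd] := fx _ e0.
  apply/nbhs_ballP; exists d => // h; rewrite -ball_normE/= sub0r normrN => hd.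
  by rewrite !fctE /= opprD addrA; exact: fd.
have dE : 'd f x = linform a :> (E -> R) by apply: diff_unique => //; exact/eqaddoP.
split => //; apply/diff_locallyP; split; first by rewrite dE.
by rewrite dE; exact/eqaddoP.
Qed.

Lemma differentiable_eps (f : E -> R) (x : E) : differentiable f x ->
  forall e : R, 0 < e -> exists2 d : R, 0 < d & forall h : E, `|h| < d ->
    `|f (h + x) - f x - 'd f x h| <= e * `|h|.
Proof.
move=> /diff_locallyP[_] /eqaddoP fx e e0.
have /nbhs_ballP[d /= d0 fd] := fx _ e0; exists d => // h hd.
have := fd h; rewrite -ball_normE/= sub0r normrN => /(_ hd).
by rewrite !fctE /= opprD addrA.
Qed.

End linear_form.

Lemma cvgn_norm_le (R : realType) (u : nat -> R) (l B : R) :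
  u @ \oo --> l -> (forall k, `|u k| <= B) -> `|l| <= B.
Proof.
move=> ul uB; have nul : `|u k| @[k --> \oo] --> `|l| by exact: cvg_norm.
rewrite -(cvg_lim _ nul)//.
by apply: limr_le; [apply/cvg_ex; exists (`|l|)|exact: nearW].
Qed.

Section difference_quotients.
Context (R : realType) (n : nat).
Local Notation E := 'rV[R]_n.
Local Notation mu := (@lebesgue_rV R n).
Context (f : E -> R) (L : R).
Hypothesis fL : lip L f.

Definition dquot (v : E) (t : R) (x : E) : R := t^-1 * (f (t *: v + x) - f x).

Lemma dquot_le v t x : `|dquot v t x| <= `|L| * `|v|.
Proof.
rewrite /dquot; have [->|t0] := eqVneq t 0; first by rewrite invr0 mul0r normr0 mulr_ge0.
rewrite normrM normfV ler_pdivrMl ?normr_gt0// (le_trans (fL _ _))// addrK normrZ.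
by rewrite mulrCA ler_wpM2l// ler_wpM2r// ler_norm.
Qed.

Lemma dquot_measurable v t : measurable_fun setT (dquot v t).
Proof.
have mf := lip_measurable fL.
apply: measurable_funM => //; apply: measurable_funB => //.
under eq_fun do rewrite addrC.
exact: (measurableT_comp mf (measurable_shift _)).
Qed.

Lemma derivable_dquot v x : derivable f x v -> forall e : R, 0 < e ->
  exists2 d : R, 0 < d & forall t : R, t != 0 -> `|t| < d -> `|dquot v t x - 'D_v f x| < e.
Proof.
move=> dfx e e0.
have /cvgrPdist_lt/(_ _ e0) : dquot v t x @[t --> 0^'] --> 'D_v f x by exact: dfx.
move=> /nbhs_ballP[d /= d0 fd]; exists d => // t t0 td.
by rewrite distrC; apply: fd => //; rewrite -ball_normE/= sub0r normrN.
Qed.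

Lemma dquot_derivable v x :
  (forall e : R, 0 < e -> exists2 d : R, 0 < d & forall s t : R, s != 0 -> t != 0 ->
    `|s| < d -> `|t| < d -> `|dquot v s x - dquot v t x| < e) ->
  derivable f x v.
Proof.
move=> fx; rewrite /derivable.
suff : cvg (dquot v t x @[t --> 0^']) by [].
apply/cauchy_cvgP; apply/cauchyP => /= e e0; have [d d0 fd] := fx _ e0.
exists (dquot v (d / 2) x); apply/nbhs_ballP; exists d => // t /= td t0.
have d20 : 0 < d / 2 by rewrite divr_gt0.
rewrite -ball_normE/=; apply: fd => //; first by rewrite gt_eqF.
- by rewrite gtr0_norm// ltr_pdivrMr// ltr_pMr// ltr1n.
- by move: td; rewrite -ball_normE/= sub0r normrN.
Qed.

(** The quotient is continuous in a nonzero increment, so rational increments approximate real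
    ones. *)
Let dquot_rat v x (e d s : R) : 0 < e -> 0 < d -> s != 0 -> `|s| < d ->
  exists q : rat, [/\ ratr q != 0 :> R, `|ratr q| < d & `|dquot v s x - dquot v (ratr q) x| < e].
Proof.
move=> e0 d0 s0 sd.
have cq : {for s, continuous (fun t => dquot v t x)}.
  apply: cvgM; first exact: (cvgV s0 cvg_id).
  apply: cvgB; last exact: cvg_cst.
  have cf := lip_continuous fL.
  apply: (continuous_comp (f := fun t : R => t *: v + x)); last exact: cf.
  by apply: cvgD; [apply: cvgZr_tmp; exact: cvg_id|exact: cvg_cst].
have [d1 /= d10 H] : exists2 d1, 0 < d1 & forall t, `|s - t| < d1 ->
   [/\ t != 0, `|t| < d & `|dquot v s x - dquot v t x| < e].
  have /cvgrPdist_lt/(_ _ e0)/nbhs_ballP[d2 /= d20 H] := cq.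
  exists (Num.min d2 (Num.min (d - `|s|) `|s|)).
    by rewrite !lt_min d20 subr_gt0 sd normr_gt0.
  move=> t; rewrite !lt_min => /and3P[h1 h2 h3]; split.
  - by apply: contraTneq h3 => ->; rewrite subr0 ltxx.
  - by have := ler_distD s t 0; rewrite !subr0 distrC; move: h2; lra.
  - by apply: H; rewrite -ball_normE.
have /rat_in_itvoo[q] : s < s + d1 by rewrite ltrDl.
rewrite in_itv/= => /andP[sq qs]; exists q; apply: H.
by rewrite distrC gtr0_norm ?subr_gt0// ltrBlDl.
Qed.

(** The Cauchy criterion for difference quotients with rational increments only: this exhibits the
    derivability set as measurable. *)
Definition dquot_cauchy (v : E) : set E :=
  [set x | forall m : nat, exists k : nat, forall p : rat * rat,
    ratr p.1 != 0 :> R -> ratr p.2 != 0 :> R ->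
    `|ratr p.1| < k.+1%:R^-1 :> R -> `|ratr p.2| < k.+1%:R^-1 :> R ->
    `|dquot v (ratr p.1) x - dquot v (ratr p.2) x| <= m.+1%:R^-1].

Lemma dquot_cauchyP v x : dquot_cauchy v x <-> derivable f x v.
Proof.
split => [Cx|/derivable_dquot dfx m]; last first.
  have m0 : 0 < m.+1%:R^-1 / 2 :> R by rewrite divr_gt0.
  have [d d0 fd] := dfx _ m0.
  have [k _ kd] := near_infty_natSinv_lt (PosNum d0).
  exists k => -[p q]/= p0 q0 pk qk; have {}kd := kd k (leqnn k).
  rewrite (le_trans (ler_distD ('D_v f x) _ _))// (splitr m.+1%:R^-1) lerD//.
    by apply/ltW/fd => //; exact: lt_trans kd.
  by rewrite distrC; apply/ltW/fd => //; exact: lt_trans kd.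
apply: dquot_derivable => e e0.
have e40 : 0 < e / 4 by rewrite divr_gt0.
have [m _ me] := near_infty_natSinv_lt (PosNum e40).
have {}me : m.+1%:R^-1 < e / 4 := me m (leqnn m).
have [k fk] := Cx m; have k0 : 0 < k.+1%:R^-1 :> R by rewrite invr_gt0.
exists k.+1%:R^-1 => // s t s0 t0 sk tk.
have [p [p0 pk pe]] := dquot_rat v x e40 k0 s0 sk.
have [q [q0 qk qe]] := dquot_rat v x e40 k0 t0 tk.
have pq := fk (p, q) p0 q0 pk qk; rewrite /= in pq.
rewrite (le_lt_trans (ler_distD (dquot v (ratr p) x) _ _))//.
have := ler_distD (dquot v (ratr q) x) (dquot v (ratr p) x) (dquot v t x).
move=> h.
have {}qe : `|dquot v (ratr q) x - dquot v t x| < e / 4 by rewrite distrC.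
have := lerD (ltW pe) (le_trans h (lerD (le_trans pq (ltW me)) (ltW qe))).
by move=> /le_lt_trans; apply; lra.
Qed.

Lemma measurable_derivable v : measurable [set x | derivable f x v].
Proof.
rewrite (_ : mkset _ = dquot_cauchy v); last first.
  by apply/seteqP; split => x /dquot_cauchyP.
apply: measurable_forall => m; apply: measurable_exists => k.
apply: measurable_forall => -[p q] /=.
have [p0|p0] := boolP ((ratr p != 0 :> R) && ((ratr q != 0 :> R) &&
   ((`|ratr p| < k.+1%:R^-1 :> R) && (`|ratr q| < k.+1%:R^-1 :> R)))); last first.
  rewrite [X in measurable X](_ : _ = setT); first exact: measurableT.
  apply/seteqP; split => // x _ h1 h2 h3 h4; exfalso; move/negP : p0; apply.
  by rewrite h1 h2 h3 h4.
have [h1 h2 h3 h4] := and4P p0.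
rewrite [X in measurable X](_ : _ = (fun x => `|dquot v (ratr p) x - dquot v (ratr q) x| <= m.+1%:R^-1) @^-1` [set true]); last first.
  by apply/seteqP; split => x /= => [|-> //]; apply.
rewrite -[X in measurable X]setTI; apply: measurable_fun_ler => //.
by apply: measurableT_comp => //; apply: measurable_funB; exact: dquot_measurable.
Qed.

(** A measurable substitute for the derivative along v, defined everywhere. Clipping the upper limit
    makes the Lipschitz bound [dlim_le] hold at every point. *)
Definition dlim (v : E) (x : E) : R :=
  Num.max (- (`|L| * `|v|)) (Num.min (`|L| * `|v|) (limn_sup (fun k => dquot v k.+1%:R^-1 x))).

Lemma dlim_le v x : `|dlim v x| <= `|L| * `|v|.
Proof.
have B0 : 0 <= `|L| * `|v| by rewrite mulr_ge0.
by rewrite ler_norml /dlim le_max lexx/= ge_max ge_min lexx/= andbT; lra.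
Qed.

Lemma measurable_dlim v : measurable_fun setT (dlim v).
Proof.
apply: measurable_maxr => //; apply: measurable_minr => //.
apply: measurable_fun_limn_sup => [x _|x _|k]; last exact: dquot_measurable.
- by exists (`|L| * `|v|) => _ [k _ <-]; rewrite (le_trans (ler_norm _))// dquot_le.
- exists (- (`|L| * `|v|)) => _ [k _ <-].
  by rewrite lerNl (le_trans _ (dquot_le v k.+1%:R^-1 x))// -normrN ler_norm.
Qed.

Lemma dquot_cvg v x : derivable f x v -> dquot v k.+1%:R^-1 x @[k --> \oo] --> 'D_v f x.
Proof.
move=> dfx; apply/cvgrPdist_lt => e e0; have [d d0 fd] := derivable_dquot dfx e0.
near=> k; rewrite distrC; apply: fd; first by rewrite invr_eq0.
by rewrite ger0_norm//; near: k; exact: (near_infty_natSinv_lt (PosNum d0)).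
Unshelve. all: by end_near. Qed.

Lemma dlimE v x : derivable f x v -> dlim v x = 'D_v f x.
Proof.
move=> dfx; have h := dquot_cvg dfx.
have lE : limn_sup (fun k => dquot v k.+1%:R^-1 x) = 'D_v f x.
  by rewrite cvg_limn_supE; [exact/cvg_lim|apply/cvg_ex; exists ('D_v f x)].
have := cvgn_norm_le h (fun k => dquot_le v k.+1%:R^-1 x).
by rewrite ler_norml /dlim lE => /andP[h1 h2]; rewrite min_r// max_r.
Qed.

(* By translation invariance, mu A is the integral over t in [0, 1] of the
   measure of A - t v, and each line in direction v meets the exceptional set A
   in a null set. *)
Lemma ae_derivable v : {ae mu, forall x, derivable f x v}.
Proof.
set A := ~` [set x | derivable f x v].
have mA : measurable A by apply: measurableC; exact: measurable_derivable.
suff A0 : mu A = 0%E by exists A; split.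
pose I : set (measurableTypeR R) := `[0, 1]%classic.
have mI : measurable I by exact: measurable_itv.
pose phi (p : measurableTypeR R * E) : \bar R := (\1_I p.1 * \1_A (p.2 + p.1 *: v))%:E.
have mphi : measurable_fun setT phi.
  apply/measurable_EFinP; apply: measurable_funM.
    by apply: measurableT_comp => //; exact: measurable_fst.
  apply: (measurableT_comp (measurable_indic mA)); apply: measurable_fun_rVP => i.
  under eq_fun do rewrite !mxE.
  apply: measurable_funD; first exact: (measurableT_comp (@measurable_coord R n i) measurable_snd).
  by apply: measurable_funM => //; exact: measurable_fst.
have phi0 p : (0 <= phi p)%E by rewrite lee_fin mulr_ge0.
have := fubini_tonelli (m1 := @lebesgue_measure R) (m2 := mu) phi mphi phi0.
have -> : (\int[lebesgue_measure]_t \int[mu]_x phi (t, x) = mu A)%E.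
  transitivity (\int[lebesgue_measure]_t ((\1_I t)%:E * mu A))%E.
    apply: eq_integral => t _; rewrite /phi/=; under eq_integral do rewrite EFinM.
    rewrite ge0_integralZl//; last first.
      apply/measurable_EFinP.
      exact: (measurableT_comp (measurable_indic mA) (measurable_shift _)).
    rewrite (ge0_integral_shift (t *: v) (f := fun x => (\1_A x)%:E))//.
      by rewrite integral_indic// setIT.
    by apply/measurable_EFinP; exact: measurable_indic.
  rewrite ge0_integralZr//; last exact/measurable_EFinP/measurable_indic.
  have -> : (\int[lebesgue_measure]_t (\1_I t)%:E = lebesgue_measure I)%E.
    by rewrite integral_indic// setIT.
  by rewrite /I lebesgue_measure_itv/= lte_fin ltr01 oppr0 adde0 mul1e.
move=> ->; apply: integral0_eq => x _.
(* The one-dimensional theorem asks for a positive Lipschitz constant, hence the added 1: L or v may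
   vanish. *)
have L1 : 0 < `|L| * `|v| + 1 by rewrite ltr_wpDl// mulr_ge0.
have lipx s t : `|f (s *: v + x) - f (t *: v + x)| <= (`|L| * `|v| + 1) * `|s - t|.
  rewrite (le_trans (fL _ _))// opprD addrACA subrr addr0 -scalerBl normrZ.
  rewrite mulrCA mulrC ler_wpM2r// (@le_trans _ _ (`|L| * `|v|)) ?lerDl//.
  by rewrite ler_wpM2r// ler_norm.
rewrite -[RHS](integral0 (@lebesgue_measure R) setT).
have mx : measurable_fun setT (fun t => phi (t, x)).
  apply: (measurableT_comp mphi); apply/measurable_fun_pair => //=.
apply: (ge0_ae_eq_integral measurableT mx (measurable_cst _) (fun t _ => phi0 (t, x)) (fun _ _ => lexx _)).
  have aeF := ae_filter_ringOfSetsType (@lebesgue_measure R).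
  apply: filterS (rademacher1 L1 lipx) => t dt _; rewrite /phi/=.
  rewrite [\1_A _]indicE memNset ?mulr0//; apply; rewrite addrC.
  rewrite /= /derivable.
  have -> : (fun h => h^-1 *: ((f \o shift (t *: v + x)) (h *: v) - f (t *: v + x))) =
      (fun h => h^-1 *: (((fun s => f (s *: v + x)) \o shift t) (h *: 1) - f (t *: v + x))).
    apply/funext => h /=; have -> : h *: (1 : R) = h by rewrite /GRing.scale/= mulr1.
    by rewrite scalerDl addrA.
  exact: dt.
Qed.

End difference_quotients.

(** * Rademacher's theorem in several variables *)

Section rademacher.
Context (R : realType) (n : nat).
Local Notation E := 'rV[R]_n.
Local Notation mu := (@lebesgue_rV R n).

Definition cutoff (M : R) (x : E) : R := Num.max 0 (Num.min 1 (M - `|x|)).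

Lemma cutoff01 M x : 0 <= cutoff M x <= 1.
Proof. by rewrite /cutoff le_max lexx/= ge_max ler01/= ge_min lexx. Qed.

Lemma cutoff_eq0 M x : M < `|x| -> cutoff M x = 0.
Proof. by move=> Mx; rewrite /cutoff; apply/max_idPl; rewrite ge_min subr_le0 (ltW Mx) orbT. Qed.

Lemma cutoff_eq1 M x : `|x| + 1 <= M -> cutoff M x = 1.
Proof. by move=> Mx; rewrite /cutoff min_l ?max_r// lerBrDl. Qed.

Lemma clip_lip (a b s t : R) : a <= b ->
  `|Num.max a (Num.min b s) - Num.max a (Num.min b t)| <= `|s - t|.
Proof.
move=> ab; rewrite ler_norml.
have h1 := ler_norm (s - t); have := ler_norm (t - s); rewrite distrC => h2.
case: (leP b s) => hs; case: (leP b t) => ht; rewrite ?(max_r ab).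
- by apply/andP; split; lra.
- by case: (leP a t) => hat; apply/andP; split; lra.
- by case: (leP a s) => has; apply/andP; split; lra.
- by case: (leP a t) => hat; case: (leP a s) => has; apply/andP; split; lra.
Qed.

Lemma cutoff_lip M : lip 1 (cutoff M).
Proof.
move=> x y; rewrite (le_trans (clip_lip _ _ ler01))//.
have -> : M - `|x| - (M - `|y|) = `|y| - `|x| by lra.
by rewrite mul1r distrC ler_dist_dist.
Qed.

Lemma lipM (K1 K2 M1 M2 : R) (f g : E -> R) : lip K1 f -> lip K2 g ->
  (forall x, `|f x| <= M1) -> (forall x, `|g x| <= M2) ->
  lip (M1 * K2 + K1 * M2) (f \* g).
Proof.
move=> fK gK fM gM x y /=.
have -> : f x * g x - f y * g y = f x * (g x - g y) + (f x - f y) * g y by lra.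
rewrite (le_trans (ler_normD _ _))// [leRHS]mulrDl; apply: lerD.
  by rewrite normrM -mulrA ler_pM.
by rewrite normrM -mulrA (mulrC M2) mulrA ler_pM.
Qed.

Context (f : E -> R) (L : R).
Hypothesis fL : lip L f.

(* f (x + t (a + b)) - f (x + t a) is a translate of f (x + t b) - f x by t a;
   the translation is moved to the test function. *)
Lemma dlimD_test (a b : E) (M : R) (w : E -> R) (K : R) : 0 <= M -> lip K w ->
  (forall x, `|w x| <= 1) -> (forall x, M < `|x| -> w x = 0) ->
  \int[mu]_x ((dlim f L (a + b) x - dlim f L a x - dlim f L b x) * w x) = 0.
Proof.
move=> M0 wK w1 wM.
have mw := lip_measurable wK.
pose q k v x := dquot f v k.+1%:R^-1 x.
have mq k v : measurable_fun setT (q k v) by exact: dquot_measurable fL _ _.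
pose B : R := `|L| * `|a + b| + `|L| * `|a| + `|L| * `|b|.
have cvg1 : \int[mu]_x ((q k (a + b) x - q k a x - q k b x) * w x) @[k --> \oo] -->
  \int[mu]_x ((dlim f L (a + b) x - dlim f L a x - dlim f L b x) * w x).
  apply: (@Rdominated_cvg _ _ _ mu _ _ (fun x => B * `|w x|)).
  - move=> k; apply: measurable_funM => //.
    by apply: measurable_funB => //; apply: measurable_funB.
  - apply: measurable_funM => //; apply: measurable_funB; last exact: measurable_dlim fL _.
    by apply: measurable_funB; exact: measurable_dlim fL _.
  - have aeF := ae_filter_ringOfSetsType mu.
    apply: filterS3 (ae_derivable fL (a + b)) (ae_derivable fL a) (ae_derivable fL b) => x d1 d2 d3.
    apply: cvgM; last exact: cvg_cst.
    rewrite !dlimE//; apply: cvgB; last exact: dquot_cvg.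
    by apply: cvgB; exact: dquot_cvg.
  - apply: (@integrable_bounded _ _ 0 B M) => //.
    + by apply: measurable_funM => //; exact: measurableT_comp.
    + by move=> x; rewrite normrM normr_id ger0_norm ?addr_ge0 ?mulr_ge0// ler_piMr// !addr_ge0 ?mulr_ge0.
    + by move=> x; rewrite subr0 => Mx; rewrite wM// normr0 mulr0.
  - move=> k x; rewrite normrM ler_wpM2r// (le_trans (ler_normB _ _))//.
    rewrite lerD ?dquot_le// (le_trans (ler_normB _ _))//.
    by rewrite lerD ?dquot_le.
(* The factors bound the quotient along b, the increment of w under a shift by t a (up to the factor
   t), and the volume of a cube containing both supports, as t <= 1. The remaining t = 1/(k+1)
   drives the integrals to 0. *)
pose C := `|L| * `|b| * (`|K| * `|a|) * (2 * (M + `|a|)) ^+ n.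
have qC k : `|\int[mu]_x ((q k (a + b) x - q k a x - q k b x) * w x)| <= C * k.+1%:R^-1.
  pose t : R := k.+1%:R^-1.
  have t0 : 0 < t by rewrite invr_gt0.
  have t1 : t <= 1 by rewrite invf_le1// ler1n.
  have i1 : mu.-integrable setT (EFin \o (fun x => q k b x * w (x - t *: a))).
    apply: (@integrable_bounded _ _ (t *: a) (`|L| * `|b|) M) => //.
    + apply: measurable_funM => //.
      by have := measurableT_comp mw (measurable_shift (- (t *: a))).
    + by move=> x; rewrite normrM -[leRHS]mulr1 ler_pM// dquot_le.
    + by move=> x Mx; rewrite wM ?mulr0.
  have i2 : mu.-integrable setT (EFin \o (fun x => q k b x * w x)).
    apply: (@integrable_bounded _ _ 0 (`|L| * `|b|) M) => //.
    + exact: measurable_funM.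
    + by move=> x; rewrite normrM -[leRHS]mulr1 ler_pM// dquot_le.
    + by move=> x; rewrite subr0 => Mx; rewrite wM ?mulr0.
  have -> : \int[mu]_x ((q k (a + b) x - q k a x - q k b x) * w x) =
      \int[mu]_x (q k b x * w (x - t *: a) - q k b x * w x).
    rewrite [RHS]RintegralB// -(Rintegral_shift (t *: a) i1).
    rewrite -[RHS]RintegralB//; last exact: (integrable_shift (t *: a) i1).
    apply: eq_Rintegral => x _; rewrite addrK -mulrBl; congr (_ * _); congr (_ - _).
    rewrite /q /dquot -mulrBr; congr (_ * _).
    have -> : k.+1%:R^-1 *: (a + b) + x = k.+1%:R^-1 *: b + (x + t *: a).
      by rewrite scalerDr addrAC addrC [_ *: a + x]addrC.
    by rewrite [_ *: a + x]addrC opprB addrA subrK.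
  have -> : C * k.+1%:R^-1 = (`|L| * `|b| * (`|K| * (t * `|a|))) * (2 * (M + `|a|)) ^+ n.
    by rewrite /C -/t; lra.
  apply: (@Rintegral_bounded _ _ 0) => //.
  - by rewrite addr_ge0.
  - apply: measurable_funB; apply: measurable_funM => //.
    by have := measurableT_comp mw (measurable_shift (- (t *: a))).
  - move=> x; rewrite -mulrBr normrM ler_pM ?dquot_le// (le_trans (wK _ _))//.
    rewrite addrAC subrr add0r normrN normrZ gtr0_norm//.
    by rewrite ler_wpM2r ?ler_norm// mulr_ge0// ltW.
  - move=> x; rewrite subr0 => Mx.
    have ta : `|t *: a| <= `|a| by rewrite normrZ gtr0_norm// ler_piMl.
    rewrite !wM ?subrr ?mulr0 ?subrr//.
      by rewrite (le_lt_trans _ Mx)// lerDl.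
    rewrite (lt_le_trans _ (lerB_dist _ _))// ltrBrDr (le_lt_trans _ Mx)// lerD2l//.
have /cvg_lim <- // := cvg1.
apply/cvg_lim => //; apply/norm_cvg0P.
apply: (@squeeze_cvgr _ _ _ _ (cst 0) (fun k => C * k.+1%:R^-1)); last 2 first.
- exact: cvg_cst.
- by rewrite -[X in _ --> X](mulr0 C); apply: cvgM; [exact: cvg_cst|exact: cvg_harmonic].
by apply: nearW => k; rewrite normr_ge0 qC.
Qed.

(** [ae_eq0_test] needs an integrable function, so the defect of additivity is cut off; cutoffs at
    all natural radii exhaust the space. *)
Lemma ae_dlimD (a b : E) : {ae mu, forall x, dlim f L (a + b) x = dlim f L a x + dlim f L b x}.
Proof.
have aeF := ae_filter_ringOfSetsType mu.
pose h x := dlim f L (a + b) x - dlim f L a x - dlim f L b x.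
have mh : measurable_fun setT h.
  apply: measurable_funB; last exact: measurable_dlim fL _.
  by apply: measurable_funB; exact: measurable_dlim fL _.
have hM (M : nat) : {ae mu, forall x, h x * cutoff M%:R x = 0}.
  have mhc : measurable_fun setT (fun x => h x * cutoff M%:R x).
    by apply: measurable_funM => //; exact: lip_measurable (cutoff_lip _).
  apply: ae_eq0_test.
    apply: (@integrable_bounded _ _ 0 (`|L| * `|a + b| + `|L| * `|a| + `|L| * `|b|) M%:R) => //.
    - move=> x; have /andP[c0 c1] := cutoff01 M%:R x.
      rewrite normrM (ger0_norm c0) (le_trans (ler_piMr _ c1))//.
      rewrite (le_trans (ler_normB _ _))// lerD ?dlim_le// (le_trans (ler_normB _ _))//.
      by rewrite lerD ?dlim_le.
    - by move=> x; rewrite subr0 => Mx; rewrite cutoff_eq0 ?mulr0.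
  move=> psi K psiK psi01.
  have psi1 x : `|psi x| <= 1 by have /andP[p0 p1] := psi01 x; rewrite ger0_norm.
  have c1 x : `|cutoff M%:R x| <= 1 by have /andP[p0 p1] := cutoff01 M%:R x; rewrite ger0_norm.
  under eq_Rintegral do rewrite -mulrA.
  have w1 x : `|(cutoff M%:R \* psi) x| <= 1 by rewrite /= normrM -[leRHS]mulr1 ler_pM.
  have wM x : M%:R < `|x| -> (cutoff M%:R \* psi) x = 0 by move=> Mx /=; rewrite cutoff_eq0 ?mul0r.
  exact: (@dlimD_test a b M%:R (cutoff M%:R \* psi) _ (ler0n _ M) (lipM (cutoff_lip M%:R) psiK c1 psi1) w1 wM).
apply: filterS (ae_foralln hM) => x /(_ (Num.bound (`|x| + 1))).
rewrite cutoff_eq1 ?mulr1; last by rewrite ltW// archi_boundP// addr_ge0.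
by rewrite /h; lra.
Qed.

Let iv (w : 'rV[int]_n) : E := map_mx intr w.

(** Countably many conditions, each measurable and of full measure. Integer vectors suffice because
    increments get rescaled. By [diff_setP] this is exactly the differentiability set, which is
    thereby measurable. *)
Definition diff_set : set E := [set x | (forall w, derivable f x (iv w)) /\
  forall p : 'rV[int]_n * 'rV[int]_n,
    dlim f L (iv p.1 + iv p.2) x = dlim f L (iv p.1) x + dlim f L (iv p.2) x].

Lemma measurable_diff_set : measurable diff_set.
Proof.
apply: measurableI.
  by apply: measurable_forall => w; exact: (measurable_derivable fL).
apply: measurable_forall => p; rewrite -[X in measurable X]setTI.
have : measurable_fun setT (fun x => dlim f L (iv p.1 + iv p.2) x ==
     dlim f L (iv p.1) x + dlim f L (iv p.2) x).
  apply: measurable_fun_eqr; first exact: measurable_dlim fL _.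
  by apply: measurable_funD; exact: measurable_dlim fL _.
move=> /(_ measurableT [set true]); rewrite (_ : _ @^-1` [set true] = [set x | dlim f L (iv p.1 + iv p.2) x =
     dlim f L (iv p.1) x + dlim f L (iv p.2) x]); first exact.
by apply/seteqP; split => x /= /eqP.
Qed.

Lemma ae_diff_set : {ae mu, forall x, diff_set x}.
Proof.
have aeF := ae_filter_ringOfSetsType mu.
have h1 : {ae mu, forall x, forall w, derivable f x (iv w)}.
  by apply: ae_forall_count => w; exact: ae_derivable fL _.
have h2 : {ae mu, forall x, forall p : 'rV[int]_n * 'rV[int]_n,
    dlim f L (iv p.1 + iv p.2) x = dlim f L (iv p.1) x + dlim f L (iv p.2) x}.
  by apply: ae_forall_count => p; exact: ae_dlimD.
by apply: filterS2 h1 h2 => x; split.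
Qed.

Let ivD a b : iv (a + b) = iv a + iv b.
Proof. by apply/rowP => i; rewrite !mxE rmorphD. Qed.

(* On a cone around each direction in a finite net of integer directions, f is
   within a small multiple of |h| of its linearization, since f is Lipschitz. *)
Lemma differentiable_diff_set x : diff_set x -> differentiable f x.
Proof.
move=> [dx lx]; pose G (w : 'rV[int]_n) := dlim f L (iv w) x.
have GD a b : G (a + b) = G a + G b by have := lx (a, b); rewrite /G ivD.
have G0 : G 0 = 0 by have := GD 0 0; rewrite addr0; lra.
have GN a : G (- a) = - G a by have := GD a (- a); rewrite subrr G0; lra.
have GB : zmod_morphism G by move=> a b; rewrite GD GN.
pose GA := HB.pack_for {additive 'rV[int]_n -> R} G (GRing.isZmodMorphism.Build _ _ G GB).
pose g i := G (delta_mx ord0 i).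
have GE w : G w = linform g (iv w).
  rewrite -[G w]/(GA w) [w in LHS]row_sum_delta raddf_sum /linform; apply: eq_bigr => i _.
  by rewrite -[w 0 i in LHS]intz scaler_int raddfMz mxE mulrzr.
pose Gam := \sum_i `|g i|.
have Gam0 : 0 <= Gam by apply: sumr_ge0.
apply: (proj1 (differentiable_linform (a := g) _)) => e e0.
(* Three errors of size t = |h|/K occur: the difference quotient contributes 1, and moving from the
   net point to h contributes |L| in f and [Gam] in the linear form. *)
pose c := 1 + `|L| + Gam; have c0 : 0 < c by rewrite /c ltr_wpDr ?ltr_wpDr.
pose K := (Num.bound (c / e)).+1.
have K0 : 0 < K%:R :> R by [].
have cK : c / K%:R <= e.
  rewrite ler_pdivrMr// mulrC -ler_pdivrMr//.
  rewrite ltW// (lt_le_trans (archi_boundP _))// ?ler_nat//.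
  by rewrite divr_ge0// ltW.
pose net (j : {ffun 'I_n -> 'I_(K + K).+1}) : 'rV[int]_n := \row_i ((j i : nat)%:Z - K%:Z).
have [d d0 dP] : exists2 d, 0 < d & forall j (t : R), t != 0 -> `|t| < d ->
    `|dquot f (iv (net j)) t x - G (net j)| < 1.
  have dj j : exists d, 0 < d /\ forall t, t != 0 -> `|t| < d ->
      `|dquot f (iv (net j)) t x - G (net j)| < 1.
    have [d d0 dP] := derivable_dquot (dx (net j)) ltr01.
    by exists d; split => // t t0 td; rewrite /G dlimE//; exact: dP.
  have [df dfP] := choice dj.
  exists (\big[Num.min/1]_j df j).
    apply: (big_ind (fun z : R => 0 < z)) => // [y z y0 z0|j _]; last exact: (dfP j).1.
    by rewrite lt_min y0.
  move=> j t t0 td; apply: (dfP j).2 => //; apply: (lt_le_trans td).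
  exact: bigmin_le_cond.
exists d => // h hd; have [->|h0] := eqVneq h 0.
  by rewrite add0r subrr linear0 subr0 normr0 normr0 mulr0.
(* At this scale every coordinate of h/t lies in [-K, K]; rounding down gives a vector of the net
   which, multiplied by t, is within t of h. *)
pose t := `|h| / K%:R; have t0 : 0 < t by rewrite divr_gt0// normr_gt0.
have hK i : `|h ord0 i / t| <= K%:R.
  by rewrite normrM normfV (gtr0_norm t0) ler_pdivrMr// /t mulrC divfK ?gt_eqF// rV_coord_le.
pose w i := Num.floor (h ord0 i / t).
have wK i : (0 <= w i + K%:Z) && (w i + K%:Z <= (K + K)%N%:Z).
  have := hK i; rewrite ler_norml => /andP[h1 h2].
  have a1 : - K%:Z <= w i by rewrite floor_ge_int rmorphN.
  have a2 : w i <= K%:Z by rewrite -(ler_int R) (le_trans (floor_le _)).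
  by rewrite -lerBlDr sub0r a1 /= PoszD lerD2r.
have [j jE] : exists j, net j = \row_i w i.
  exists [ffun i => inord (absz (w i + K%:Z))]; apply/rowP => i; rewrite !mxE ffunE.
  have /andP[h1 h2] := wK i.
  rewrite inordK; last by rewrite ltnS -lez_nat gez0_abs.
  by rewrite gez0_abs// addrK.
have hw : `|h - t *: iv (net j)| <= t.
  apply: rV_norm_le => [|i]; first exact: ltW.
  rewrite jE !mxE; have := floor_le (h ord0 i / t); have := floorD1_gt (h ord0 i / t).
  rewrite -/(w i) ltr_pdivrMr// ler_pdivlMr// intrD1 mulrDl mul1r => h1 h2.
  by rewrite ger0_norm; lra.
have td : `|t| < d.
  rewrite gtr0_norm// (le_lt_trans _ hd)// /t ler_pdivrMr// ler_peMr//.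
  by rewrite ler1n.
have := dP j t (lt0r_neq0 t0) td; rewrite GE /dquot => H1.
have {}H1 : `|f (t *: iv (net j) + x) - f x - t * linform g (iv (net j))| <= t.
  have -> : f (t *: iv (net j) + x) - f x - t * linform g (iv (net j)) =
     t * (t^-1 * (f (t *: iv (net j) + x) - f x) - linform g (iv (net j))).
    by rewrite mulrBr mulVKf// gt_eqF.
  by rewrite normrM (gtr0_norm t0) ger_pMr// ltW.
have H2 : `|f (h + x) - f (t *: iv (net j) + x)| <= `|L| * t.
  rewrite (le_trans (fL _ _))// opprD addrACA subrr addr0.
  by rewrite (@le_trans _ _ (`|L| * `|h - t *: iv (net j)|)) ?ler_wpM2r ?ler_norm ?ler_wpM2l.
have H3 : `|linform g h - t * linform g (iv (net j))| <= Gam * t.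
  rewrite -[t * _]/(t *: (linform g (iv (net j)) : R^o)) -linearZ -linearB.
  by rewrite (le_trans (linform_le _ _))// ler_wpM2l.
have -> : f (h + x) - f x - linform g h = (f (h + x) - f (t *: iv (net j) + x)) +
  (f (t *: iv (net j) + x) - f x - t * linform g (iv (net j))) - (linform g h - t * linform g (iv (net j))) by lra.
rewrite (le_trans (ler_normB _ _))//.
rewrite (@le_trans _ _ (c / K%:R * `|h|))//; last by rewrite ler_wpM2r.
have -> : c / K%:R * `|h| = (`|L| * t + t) + Gam * t by rewrite /t /c; lra.
by rewrite lerD// (le_trans (ler_normD _ _))// lerD.
Qed.

Lemma diff_setP x : diff_set x <-> differentiable f x.
Proof.
split; first exact: differentiable_diff_set.
move=> dfx; have dv v : derivable f x v by exact: diff_derivable.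
split => [w|p]; first exact: dv.
rewrite !(dlimE fL); [|exact: dv|exact: dv|exact: dv].
by rewrite !deriveE// linearD.
Qed.

Lemma measurable_differentiable : measurable [set x | differentiable f x].
Proof.
have := measurable_diff_set; rewrite (_ : [set x | _] = diff_set)//.
by apply/seteqP; split => x /diff_setP.
Qed.

Lemma rademacher : {ae mu, forall x, differentiable f x}.
Proof.
have aeF := ae_filter_ringOfSetsType mu.
by apply: filterS ae_diff_set => x /diff_setP.
Qed.

End rademacher.

(** * Jacobians of Lipschitz maps *)

Section detD.
Context (R : realType) (n : nat).
Local Notation E := 'rV[R]_n.+1.

(** The differential is chosen with the zero map as default. So [detD] vanishes, rather than being
    arbitrary, where some component is not differentiable, which keeps it measurable and bounded
    everywhere. *)
Lemma nondifferentiable_diff (F : E -> E) x : ~ differentiable F x -> 'd F x = 0 :> (E -> E).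
Proof.
move=> nF; rewrite /diff getPN// => df dfP; apply: nF; apply/diffP.
pose P (df : {linear E -> E}) := continuous df /\ forall y,
  F y = F (lim (nbhs x)) + df (y - lim (nbhs x)) +o_(y \near x) (y - lim (nbhs x)).
have : P ('d F x) by exact: (getPex (ex_intro P df dfP)).
exact.
Qed.

Lemma differentiable_rowP (g : 'I_n.+1 -> E -> R) (x : E) :
  differentiable (fun y => \row_i g i y : E) x <-> forall i, differentiable (g i) x.
Proof.
split => [dF i|dg].
  rewrite (_ : g i = (fun N : E => N ord0 i) \o (fun y => \row_i g i y)); last first.
    by apply/funext => y; rewrite /= mxE.
  by apply: differentiable_comp => //; exact: differentiable_coord.
rewrite (_ : (fun y => _) = \sum_i (fun y => g i y *: (delta_mx ord0 i : E))); last first.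
  apply/funext => y; rewrite fct_sumE; apply/rowP => j; rewrite !mxE summxE.
  rewrite (bigD1 j)//= !mxE !eqxx mulr1 big1 ?addr0// => k kj.
  by rewrite !mxE eqxx/= [j == k]eq_sym (negPf kj) mulr0.
apply: differentiable_sum => i; exact: differentiableZl.
Qed.

Lemma detDE (g : 'I_n.+1 -> E -> R) x : (forall i, differentiable (g i) x) ->
  detD g x = \det (\matrix_(i, j) 'D_(delta_mx ord0 j) (g i) x).
Proof.
move=> dg; have dF := (differentiable_rowP _ _).2 dg.
rewrite /detD -det_tr; congr (\det _); apply/matrixP => i j; rewrite !mxE.
rewrite -deriveE// derive_mx; last exact: diff_derivable.
by rewrite mxE; congr ('D_ _ _ _); apply/funext => y; rewrite mxE.
Qed.

Lemma detD_nondifferentiable (g : 'I_n.+1 -> E -> R) x :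
  ~ (forall i, differentiable (g i) x) -> detD g x = 0.
Proof.
move=> ng; rewrite /detD (_ : jacobian _ _ = 0) ?det0//.
have nF : ~ differentiable (fun y => \row_i g i y : E) x by move=> /differentiable_rowP.
by apply/matrixP => i j; rewrite !mxE nondifferentiable_diff// mxE.
Qed.

Lemma det_le m (A : 'M[R]_m) (c : 'I_m -> R) : (forall i j, `|A i j| <= c i) ->
  `|\det A| <= m`!%:R * \prod_i c i.
Proof.
move=> Ac; rewrite /determinant (le_trans (ler_norm_sum _ _ _))//.
rewrite (@le_trans _ _ (\sum_(s : 'S_m) \prod_i c i))//.
  apply: ler_sum => s _; rewrite normrM normrX normrN1 expr1n mul1r normr_prod.
  by apply: ler_prod => i _; rewrite normr_ge0 Ac.
by rewrite sumr_const -card_Sn mulr_natl lexx.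
Qed.

Lemma detD_lin (g : 'I_n.+1 -> E -> R) (i : 'I_n.+1) (f0 f1 f2 : E -> R) (b c : R) x :
  (forall l, differentiable (g l) x) -> differentiable f0 x ->
  differentiable f1 x -> differentiable f2 x ->
  (forall v, 'D_v f0 x = b * 'D_v f1 x + c * 'D_v f2 x) ->
  detD (dfwith g i f0) x = b * detD (dfwith g i f1) x + c * detD (dfwith g i f2) x.
Proof.
move=> dg d0 d1 d2 fE.
have dd f : differentiable f x -> forall l, differentiable (dfwith g i f l) x.
  by move=> df l; have [->|il] := eqVneq l i; rewrite ?dfwithin// dfwithout// eq_sym.
rewrite !detDE; [|exact: dd..]; apply: (determinant_multilinear (i0 := i)).
- by apply/rowP => j; rewrite !mxE !dfwithin fE.
- by apply/matrixP => l j; rewrite !mxE !dfwithout// neq_lift.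
- by apply/matrixP => l j; rewrite !mxE !dfwithout// neq_lift.
Qed.

(** The Leibniz rule in row i, by multilinearity of the determinant. It trades the derivative of
    [g i] for a derivative of f and a pure Jacobian. *)
Lemma detDM (g : 'I_n.+1 -> E -> R) (i : 'I_n.+1) (f : E -> R) x :
  (forall l, differentiable (g l) x) -> differentiable f x ->
  f x * detD g x = detD (dfwith g i (f \* g i)) x - g i x * detD (dfwith g i f) x.
Proof.
move=> dg df; have gE : dfwith g i (g i) = g.
  by apply/funext => l; have [->|il] := eqVneq l i; rewrite ?dfwithin// dfwithout// eq_sym.
rewrite (@detD_lin g i (f \* g i) (g i) f (f x) (g i x))// ?gE; last 2 first.
- exact: differentiableM.
- move=> v; have d1 : derivable f x v by exact: diff_derivable.
  have d2 : derivable (g i) x v by exact: diff_derivable.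
  by rewrite -[f \* g i]/(f * g i) deriveM.
by rewrite addrK.
Qed.

Lemma detD_eq0 (g : 'I_n.+1 -> E -> R) (i : 'I_n.+1) x :
  (forall v, 'D_v (g i) x = 0) -> detD g x = 0.
Proof.
move=> gi; have [dg|] := pselect (forall l, differentiable (g l) x); last exact: detD_nondifferentiable.
by rewrite detDE// (expand_det_row _ i) big1// => j _; rewrite mxE gi mul0r.
Qed.

Lemma detD_near (g g' : 'I_n.+1 -> E -> R) x :
  (forall l, differentiable (g l) x) -> (forall l, differentiable (g' l) x) ->
  (forall l, \forall y \near x, g l y = g' l y) -> detD g x = detD g' x.
Proof.
move=> dg dg' gg'; rewrite !detDE//; congr (\det _); apply/matrixP => i j; rewrite !mxE.
exact: near_eq_derive.
Qed.

End detD.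

#[local] Opaque detD.

Section detD_lipschitz.
Context (R : realType) (n : nat).
Local Notation E := 'rV[R]_n.+1.
Local Notation mu := (@lebesgue_rV R n.+1).

Lemma derive_lip_le (L : R) (f : E -> R) x v : lip L f -> derivable f x v ->
  `|'D_v f x| <= `|L| * `|v|.
Proof. by move=> fL dfx; rewrite -(dlimE fL)// dlim_le. Qed.

Lemma norm_delta_le (j : 'I_n.+1) : `|delta_mx ord0 j : E| <= 1.
Proof. by apply: rV_norm_le => // i; rewrite mxE; case: (_ && _); rewrite ?normr1 ?normr0. Qed.

Lemma lip_ge0 (L : R) (f : E -> R) : lip L f -> 0 <= L.
Proof.
move=> fL; have := fL (delta_mx ord0 ord0) 0; rewrite subr0 => h.
have d0 : 0 < `|delta_mx ord0 ord0 : E|.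
  rewrite normr_gt0; apply/eqP => /rowP /(_ ord0); rewrite !mxE eqxx/=.
  by move/eqP; rewrite oner_eq0.
by rewrite -(pmulr_lge0 _ d0) (le_trans _ h).
Qed.

Context (g : 'I_n.+1 -> E -> R) (L : 'I_n.+1 -> R).
Hypothesis gL : forall i, lip (L i) (g i).

Lemma detD_le x : `|detD g x| <= n.+1`!%:R * \prod_i L i.
Proof.
have L0 i := lip_ge0 (gL i).
have [dg|ng] := pselect (forall i, differentiable (g i) x); last first.
  by rewrite detD_nondifferentiable// normr0 mulr_ge0// prodr_ge0.
rewrite detDE//; apply: det_le => i j; rewrite mxE.
have dij : derivable (g i) x (delta_mx ord0 j) by exact: diff_derivable.
rewrite (le_trans (derive_lip_le (gL i) dij))// ger0_norm//.
by rewrite ler_piMr// norm_delta_le.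
Qed.

(** On the measurable set where all components are differentiable the partial derivatives are the
    measurable functions [dlim]; off it the Jacobian is 0. *)
Lemma measurable_detD : measurable_fun setT (detD g).
Proof.
pose D : set E := \bigcap_(i in [set: 'I_n.+1]) [set x | differentiable (g i) x].
have mD : measurable D.
  by apply: fin_bigcap_measurable => // i _; exact: measurable_differentiable (gL i).
pose h x := \det (\matrix_(i, j) dlim (g i) (L i) (delta_mx ord0 j) x).
rewrite (_ : detD g = (fun x => h x * \1_D x)); last first.
  apply/funext => x; rewrite indicE; have [Dx|nDx] := pselect (D x).
    rewrite mem_set// mulr1 detDE => [|i]; last exact: Dx.
    congr (\det _); apply/matrixP => i j; rewrite !mxE (dlimE (gL i))//.
    by apply: diff_derivable; exact: Dx.
  by rewrite memNset// mulr0 detD_nondifferentiable// => dg; apply: nDx => i _.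
apply: measurable_funM; last exact: measurable_indic.
apply: measurable_sum => s; apply: measurable_funM => //.
apply: measurable_prod => i _; under eq_fun do rewrite mxE.
exact: measurable_dlim (gL i) _.
Qed.

Lemma ae_differentiable : {ae mu, forall x, forall i, differentiable (g i) x}.
Proof. by apply: ae_forall_count => i; exact: rademacher (gL i). Qed.

Lemma integrable_mul_bounded (u f : E -> R) (B : R) : mu.-integrable setT (EFin \o u) ->
  measurable_fun setT f -> (forall x, `|f x| <= B) ->
  mu.-integrable setT (EFin \o (fun x => u x * f x)).
Proof.
move=> iu mf fB; have B0 : 0 <= B by rewrite (le_trans _ (fB 0)).
have mu' : measurable_fun setT u by apply/measurable_EFinP; exact: measurable_int iu.
have iBu : mu.-integrable setT (EFin \o (fun x => B * u x)).
  by have := integrableZl measurableT B iu; apply: eq_integrable.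
apply: (le_integrable measurableT _ _ iBu).
  by apply/measurable_EFinP; exact: measurable_funM.
by move=> x _ /=; rewrite lee_fin !normrM mulrC (ger0_norm B0) ler_wpM2r.
Qed.

Lemma Rintegral_mul_le (u f : E -> R) (B : R) : mu.-integrable setT (EFin \o u) ->
  measurable_fun setT f -> (forall x, `|f x| <= B) ->
  `|\int[mu]_x (u x * f x)| <= (\int[mu]_x `|u x|) * B.
Proof.
move=> iu mf fB; have iuf := integrable_mul_bounded iu mf fB.
rewrite (le_trans (le_normr_Rintegral measurableT iuf))//.
rewrite -RintegralZr//; last exact: (integrable_norm iu).
apply: le_Rintegral => //.
- exact: (integrable_norm iuf).
- by have := integrableZr measurableT B (integrable_norm iu); apply: eq_integrable.
- by move=> x _; rewrite normrM ler_wpM2l.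
Qed.

Context (u : E -> R).
Hypothesis iu : mu.-integrable setT (EFin \o u).

Lemma integrable_detD : mu.-integrable setT (EFin \o (fun x => u x * detD g x)).
Proof. exact: integrable_mul_bounded iu measurable_detD detD_le. Qed.

Context (f : E -> R) (B : R).
Hypotheses (mf : measurable_fun setT f) (fB : forall x, `|f x| <= B).

Let mfdet : measurable_fun setT (fun x => f x * detD g x).
Proof. by apply: measurable_funM => //; exact: measurable_detD. Qed.

Let fdetB x : `|f x * detD g x| <= B * (n.+1`!%:R * \prod_i L i).
Proof. by rewrite normrM ler_pM// detD_le. Qed.

Lemma integrable_current :
  mu.-integrable setT (EFin \o (fun x => u x * f x * detD g x)).
Proof.
have := integrable_mul_bounded iu mfdet fdetB; apply: eq_integrable => // x _.
by rewrite /= mulrA.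
Qed.

Lemma current_le : `|current u f g| <=
  (\int[mu]_x `|u x|) * (B * (n.+1`!%:R * \prod_i L i)).
Proof.
rewrite /current; under eq_Rintegral do rewrite -mulrA.
exact: Rintegral_mul_le iu mfdet fdetB.
Qed.

End detD_lipschitz.

Section current_linear.
Context (R : realType) (n : nat).
Local Notation E := 'rV[R]_n.+1.
Local Notation mu := (@lebesgue_rV R n.+1).

Lemma lip_comb (a L1 L2 : R) (f1 f2 : E -> R) : lip L1 f1 -> lip L2 f2 ->
  lip (`|a| * L1 + L2) (fun x => a * f1 x + f2 x).
Proof.
move=> h1 h2 x y; have -> : a * f1 x + f2 x - (a * f1 y + f2 y) =
  a * (f1 x - f1 y) + (f2 x - f2 y) by lra.
rewrite (le_trans (ler_normD _ _))// mulrDl lerD//.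
by rewrite normrM -mulrA ler_wpM2l.
Qed.

Lemma lip_dfwith (g : 'I_n.+1 -> E -> R) (L : 'I_n.+1 -> R) i (f : E -> R) (K : R) :
  (forall l, l != i -> lip (L l) (g l)) -> lip K f ->
  forall l, lip (dfwith L i K l) (dfwith g i f l).
Proof.
move=> gL fK l; have [->|li] := eqVneq l i; first by rewrite !dfwithin.
by rewrite !dfwithout 1?eq_sym//; exact: gL.
Qed.

Lemma eq_Rintegral_ae (f1 f2 : E -> R) : measurable_fun setT f1 -> measurable_fun setT f2 ->
  {ae mu, forall x, f1 x = f2 x} -> \int[mu]_x f1 x = \int[mu]_x f2 x.
Proof.
move=> m1 m2 f12; rewrite /Rintegral; congr fine; apply: ae_eq_integral => //.
- exact/measurable_EFinP.
- exact/measurable_EFinP.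
- have aeF := ae_filter_ringOfSetsType mu.
  by apply: filterS f12 => x -> _.
Qed.

Lemma Rintegral_ae_lin (a : R) (h0 h1 h2 : E -> R) : measurable_fun setT h0 ->
  mu.-integrable setT (EFin \o h1) -> mu.-integrable setT (EFin \o h2) ->
  {ae mu, forall x, h0 x = a * h1 x + h2 x} ->
  \int[mu]_x h0 x = a * (\int[mu]_x h1 x) + \int[mu]_x h2 x.
Proof.
move=> m0 i1 i2 h0E.
have ai1 : mu.-integrable setT (EFin \o (fun x => a * h1 x)).
  by have := integrableZl measurableT a i1; apply: eq_integrable.
rewrite -RintegralZl// -RintegralD//; apply: eq_Rintegral_ae => //.
by apply/measurable_EFinP; exact: measurable_int (integrableD measurableT ai1 i2).
Qed.

Context (u f : E -> R) (B : R) (g : 'I_n.+1 -> E -> R) (L : 'I_n.+1 -> R).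
Hypothesis iu : mu.-integrable setT (EFin \o u).
Hypotheses (mf : measurable_fun setT f) (fB : forall x, `|f x| <= B).

Lemma current_lin i (a K1 K2 : R) (f1 f2 : E -> R) :
  (forall l, l != i -> lip (L l) (g l)) -> lip K1 f1 -> lip K2 f2 ->
  current u f (dfwith g i (fun x => a * f1 x + f2 x)) =
  a * current u f (dfwith g i f1) + current u f (dfwith g i f2).
Proof.
move=> gL l1 l2; have l0 := lip_comb a l1 l2.
have L0 := lip_dfwith gL l0; have L1 := lip_dfwith gL l1; have L2 := lip_dfwith gL l2.
apply: Rintegral_ae_lin.
- by apply/measurable_EFinP; exact: measurable_int (integrable_current L0 iu mf fB).
- exact: (integrable_current L1 iu mf fB).
- exact: (integrable_current L2 iu mf fB).
have aeF := ae_filter_ringOfSetsType mu.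
apply: filterS3 (ae_differentiable L0) (ae_differentiable L1) (ae_differentiable L2).
move=> x d0 d1 d2.
have df0 := d0 i; have df1 := d1 i; have df2 := d2 i; rewrite !dfwithin in df0 df1 df2.
pose g' := dfwith g i f1.
have gg' h : dfwith g i h = dfwith g' i h.
  apply/funext => l; have [->|li] := eqVneq l i; first by rewrite !dfwithin.
  by rewrite !dfwithout 1?eq_sym// /g' dfwithout 1?eq_sym.
have fE v : 'D_v (fun x => a * f1 x + f2 x) x = a * 'D_v f1 x + 1 * 'D_v f2 x.
  have dv1 : derivable f1 x v by exact: diff_derivable.
  have dv2 : derivable f2 x v by exact: diff_derivable.
  have da1 : derivable (a \*o f1) x v by exact: (derivableZ (k := a) dv1).
  by rewrite mul1r -(deriveMl a dv1); exact: (deriveD da1 dv2).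
have := @detD_lin R n g' i _ f1 f2 a 1 x d1 df0 df1 df2 fE.
rewrite -!gg'; move: (detD _ x) (detD _ x) (detD _ x) => D0 D1 D2 ->.
rewrite mul1r mulrDr; congr (_ + _).
by rewrite mulrCA.
Qed.

(** Derivatives are local: the components of g must agree near the points carrying u, whereas f only
    matters at these points. *)
Lemma current_near (f' : E -> R) (g' : 'I_n.+1 -> E -> R) (L' : 'I_n.+1 -> R) (S : set E) :
  measurable_fun setT f' ->
  (forall l, lip (L l) (g l)) -> (forall l, lip (L' l) (g' l)) ->
  {ae mu, forall x, ~ S x -> u x = 0} ->
  (forall x, S x -> f x = f' x) ->
  (forall x l, S x -> \forall y \near x, g l y = g' l y) ->
  current u f g = current u f' g'.
Proof.
move=> mf' gL gL' uS ff' gg'.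
have mu' : measurable_fun setT u by apply/measurable_EFinP; exact: measurable_int iu.
have m1 : measurable_fun setT (fun x => u x * f x * detD g x).
  by apply: measurable_funM; [exact: measurable_funM|exact: measurable_detD gL].
have m2 : measurable_fun setT (fun x => u x * f' x * detD g' x).
  by apply: measurable_funM; [exact: measurable_funM|exact: measurable_detD gL'].
apply: (eq_Rintegral_ae m1 m2).
have aeF := ae_filter_ringOfSetsType mu.
apply: filterS3 uS (ae_differentiable gL) (ae_differentiable gL') => x uS dg dg'.
have [Sx|nSx] := pselect (S x).
  have -> := detD_near dg dg' (fun l => gg' x l Sx).
  by have -> := ff' x Sx.
have -> := uS nSx.
move: (detD g x) (detD g' x) => a b.
by rewrite !mul0r.
Qed.

End current_linear.

(** * Mollification *)

Section profiles.
Context (R : realType).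
Implicit Types (p q : R -> R) (a b c t s h B r e : R).

Lemma normD_le (a b A B : R) : `|a| <= A -> `|b| <= B -> `|a + b| <= A + B.
Proof. by move=> aA bB; rewrite (le_trans (ler_normD _ _))// lerD. Qed.

Lemma normM_le (a b A B : R) : `|a| <= A -> `|b| <= B -> `|a * b| <= A * B.
Proof. by move=> aA bB; rewrite normrM ler_pM. Qed.

Definition clamp1 t : R := Num.max (-1) (Num.min 1 t).

Lemma clamp1_norm t : `|clamp1 t| <= 1.
Proof.
rewrite /clamp1 ler_norml le_max lexx/= ge_max ge_min lexx/= andbT; lra.
Qed.

Lemma clamp1_lip s t : `|clamp1 s - clamp1 t| <= `|s - t|.
Proof. by apply: clip_lip; lra. Qed.

Lemma clamp1_id t : `|t| <= 1 -> clamp1 t = t.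
Proof.
rewrite ler_norml => /andP[t1 t2].
by rewrite /clamp1 (min_idPr t2) (max_idPr t1).
Qed.

Lemma clamp1_gt t : 1 <= t -> clamp1 t = 1.
Proof. by move=> t1; rewrite /clamp1 (min_idPl _)// (max_idPr _)//; lra. Qed.

Lemma clamp1_lt t : t <= -1 -> clamp1 t = -1.
Proof. by move=> t1; rewrite /clamp1 (min_idPr _) ?(max_idPl _)//; lra. Qed.

Lemma clamp1_out t : 1 <= `|t| -> clamp1 t = 1 \/ clamp1 t = -1.
Proof.
by rewrite ler_normr => /orP[/clamp1_gt ?|t1]; [left|right; apply: clamp1_lt; lra].
Qed.

Lemma poly_bound (q : {poly R}) : exists B : R, forall s t : R, `|s| <= 1 -> `|t| <= 1 ->
  [/\ `|q.[s]| <= B, `|q^`().[s]| <= B, `|q.[t] - q.[s]| <= B * `|t - s| &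
      `|q.[t] - q.[s] - q^`().[s] * (t - s)| <= B * `|t - s| ^+ 2].
Proof.
elim/poly_ind: q => [|q c [B qB]].
  by exists 0 => s t _ _; rewrite deriv0 !horner0 !mul0r !subr0 !normr0.
have B0 : 0 <= B by have [] := qB 0 0; rewrite ?normr0// => h _ _ _; rewrite (le_trans _ h).
exists (2 * B + `|c|) => s t s1 t1; have [b0 b1 b2 b3] := qB s t s1 t1.
rewrite derivD derivC addr0 derivM derivX mulr1 !(hornerD, hornerM, hornerX, hornerC).
have c0 := normr_ge0 c; have ts0 := normr_ge0 (t - s).
have le1 x y : `|x| <= y -> `|x * s| <= y by move=> xy; rewrite -[y]mulr1 normM_le.
have le1' x y : `|x| <= y -> `|x * t| <= y by move=> xy; rewrite -[y]mulr1 normM_le.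
split.
- rewrite (le_trans (normD_le (le1 _ _ b0) (lexx _)))//; lra.
- rewrite (le_trans (normD_le (le1 _ _ b1) b0))//; lra.
- rewrite (_ : _ - _ = (q.[t] - q.[s]) * t + q.[s] * (t - s)); last by lra.
  rewrite (le_trans (normD_le (le1' _ _ b2) (normM_le b0 (lexx _))))//.
  by rewrite -mulrDl ler_wpM2r//; lra.
- rewrite (_ : _ - _ = (q.[t] - q.[s] - q^`().[s] * (t - s)) * t +
    q^`().[s] * ((t - s) * (t - s))); last by lra.
  rewrite (le_trans (normD_le (le1' _ _ b3) (normM_le b1 (lexx _))))//.
  have -> : `|(t - s) * (t - s)| = `|t - s| ^+ 2 by rewrite normrM expr2.
  by have := mulr_ge0 c0 (exprn_ge0 2 ts0); lra.
Qed.

(* [q] is the derivative of [p], quantitatively. *)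
Definition c11 p q := exists B : R, [/\
  forall t, `|p t| <= B /\ `|q t| <= B,
  forall t h, `|p (t + h) - p t| <= B * `|h| /\ `|q (t + h) - q t| <= B * `|h| &
  forall t h, `|p (t + h) - p t - q t * h| <= B * `|h| ^+ 2].

Lemma c11_comb a b p1 q1 p2 q2 : c11 p1 q1 -> c11 p2 q2 ->
  c11 (fun t => a * p1 t + b * p2 t) (fun t => a * q1 t + b * q2 t).
Proof.
move=> [B [h1 h2 h3]] [C [k1 k2 k3]]; exists (`|a| * B + `|b| * C).
have M x y A D : `|x| <= B * A -> `|y| <= C * A -> `|a * x + b * y| <= (`|a| * B + `|b| * C) * A.
  by move=> xA yA; rewrite mulrDl -!mulrA normD_le// normM_le.
split.
- move=> t; have [? ?] := h1 t; have [? ?] := k1 t.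
  by split; rewrite -[_ + _ * C]mulr1; apply: M; rewrite ?mulr1.
- move=> t h; have [? ?] := h2 t h; have [? ?] := k2 t h; split.
    rewrite (_ : _ - _ = a * (p1 (t + h) - p1 t) + b * (p2 (t + h) - p2 t)); last by lra.
    exact: M.
  rewrite (_ : _ - _ = a * (q1 (t + h) - q1 t) + b * (q2 (t + h) - q2 t)); last by lra.
  exact: M.
- move=> t h; rewrite (_ : _ - _ = a * (p1 (t + h) - p1 t - q1 t * h) +
    b * (p2 (t + h) - p2 t - q2 t * h)); last by lra.
  exact: M (h3 t h) (k3 t h).
Qed.

Lemma c11_scale e p q : 0 < e -> c11 p q ->
  c11 (fun t => p (t / e)) (fun t => e^-1 * q (t / e)).
Proof.
move=> e0 [B [h1 h2 h3]].
have ei0 : 0 < e^-1 by rewrite invr_gt0.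
have B0 : 0 <= B by rewrite (le_trans (normr_ge0 (p 0))) ?(h1 0).1.
exists (B * (1 + e^-1 + e^-1 ^+ 2)).
have c0 : 0 <= e^-1 ^+ 2 by rewrite exprn_ge0// ltW.
have N x : `|e^-1 * x| = e^-1 * `|x| by rewrite normrM gtr0_norm.
split.
- move=> t; have [? ?] := h1 (t / e); split.
    by rewrite (le_trans (y := B))// ler_peMr//; lra.
  rewrite N (le_trans (y := B * e^-1))//; first by rewrite mulrC ler_wpM2r// ltW.
  by rewrite ler_wpM2l//; lra.
- move=> t h; rewrite mulrDl; have [u1 u2] := h2 (t / e) (h / e); split.
    rewrite (le_trans u1)// [`|h / e|]normrM [`|e^-1|]gtr0_norm// -mulrA ler_wpM2l//.
    by rewrite mulrC ler_wpM2r//; lra.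
  rewrite -mulrBr N (le_trans (y := e^-1 * (B * `|h / e|)))//; first by rewrite ler_wpM2l// ltW.
  rewrite [`|h / e|]normrM [`|e^-1|]gtr0_norm//.
  rewrite (_ : _ * (_ * _) = B * e^-1 ^+ 2 * `|h|); last by rewrite expr2; lra.
  by rewrite ler_wpM2r// ler_wpM2l//; lra.
- move=> t h; rewrite mulrDl; have := h3 (t / e) (h / e).
  rewrite (_ : _ * (h / e) = e^-1 * q (t / e) * h); last by lra.
  move/le_trans; apply; rewrite [`|h / e|]normrM [`|e^-1|]gtr0_norm// exprMn mulrA.
  rewrite mulrAC ler_wpM2r ?exprn_ge0// ler_wpM2l//; lra.
Qed.

(** The corners of [clamp1] are harmless because q' vanishes there: when t + h leaves the interval,
    |q'(t)| is at most C |h|, and it multiplies a length at most |h|. *)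
Lemma c11_poly_clamp (q : {poly R}) : q^`().[1] = 0 -> q^`().[-1] = 0 ->
  c11 (fun t => q.[clamp1 t]) (fun t => q^`().[clamp1 t]).
Proof.
move=> q1 q2; have [B qB] := poly_bound q; have [C qC] := poly_bound q^`().
have B0 : 0 <= B by have [] := qB 0 0; rewrite ?normr0// => h _ _ _; rewrite (le_trans _ h).
have C0 : 0 <= C by have [] := qC 0 0; rewrite ?normr0// => h _ _ _; rewrite (le_trans _ h).
have D t h : `|clamp1 (t + h) - clamp1 t| <= `|h|.
  by rewrite (le_trans (clamp1_lip _ _))// [t + h]addrC addrK.
exists (B + C); split.
- move=> t; have [b0 b1 _ _] := qB _ _ (clamp1_norm t) (clamp1_norm t).
  by split; [rewrite (le_trans b0)|rewrite (le_trans b1)]; lra.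
- move=> t h; have [_ _ b2 _] := qB _ _ (clamp1_norm t) (clamp1_norm (t + h)).
  have [_ _ c2 _] := qC _ _ (clamp1_norm t) (clamp1_norm (t + h)).
  split; [rewrite (le_trans b2)//|rewrite (le_trans c2)//].
    by rewrite ler_pM//; lra.
  by rewrite ler_pM//; lra.
- move=> t h; have [_ _ _ b3] := qB _ _ (clamp1_norm t) (clamp1_norm (t + h)).
  rewrite (_ : _ - _ = (q.[clamp1 (t + h)] - q.[clamp1 t] -
    q^`().[clamp1 t] * (clamp1 (t + h) - clamp1 t)) +
    - (q^`().[clamp1 t] * (h - (clamp1 (t + h) - clamp1 t)))); last by lra.
  rewrite mulrDl normD_le//.
    rewrite (le_trans b3)// ler_wpM2l// lerXn2r// nnegrE//.
  rewrite normrN.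
  have [t1|t1] := leP 1 `|t|.
    by have [->|->] := clamp1_out t1; rewrite ?q1 ?q2 mul0r normr0 mulr_ge0// exprn_ge0.
  rewrite (clamp1_id (ltW t1)).
  have [th1|th1] := leP `|t + h| 1.
    by rewrite (clamp1_id th1) [t + h]addrC addrK subrr mulr0 normr0 mulr_ge0// exprn_ge0.
  have hz : `|q^`().[t]| <= C * `|h|.
    have [_ _ c2 _] := qC _ _ (clamp1_norm (t + h)) (ltW t1).
    have : `|q^`().[t] - q^`().[clamp1 (t + h)]| <= C * `|h|.
      rewrite (le_trans c2)// ler_wpM2l// -{1}(clamp1_id (ltW t1)) distrC; exact: D.
    by have [->|->] := clamp1_out (ltW th1); rewrite ?q1 ?q2 subr0.
  have hh : `|h - (clamp1 (t + h) - t)| <= `|h|.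
    move: (th1) (t1); rewrite ltr_norml lter_normr => /orP[a|a] /andP[c c'].
      have -> : clamp1 (t + h) = 1 by rewrite /clamp1 (min_idPl _) ?(max_idPr _)//; lra.
      by rewrite !ger0_norm; lra.
    have -> : clamp1 (t + h) = -1 by rewrite /clamp1 (min_idPr _) ?(max_idPl _)//; lra.
    by rewrite !ler0_norm; lra.
  by rewrite (le_trans (normM_le hz hh))// expr2 mulrA.
Qed.

Lemma poly_primitive (q : {poly R}) : exists p : {poly R}, p^`() = q.
Proof.
exists (\poly_(i < (size q).+1) (q`_i.-1 / i%:R)).
apply/polyP => i; rewrite coef_deriv coef_poly ltnS /=; case: ltnP => iq.
  by rewrite -[LHS]mulr_natr divfK// pnatr_eq0.
by rewrite mul0rn nth_default.
Qed.

(** The triple zeros at -1 and 1 make the clamped polynomial and its first two derivatives vanish at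
    the ends, so that a polynomial profile gives a C^2 mollifier. *)
Definition Q0 : {poly R} := (1 - 'X^2) ^+ 3.

Definition Qm1 : {poly R} := sval (cid (poly_primitive Q0)).

Lemma Qm1E : Qm1^`() = Q0. Proof. exact: svalP (cid (poly_primitive Q0)). Qed.

(* [bump e 0] is a multiple of a C^2 mollifier at scale [e], [bump e m] its derivatives. *)
Definition bump e (m : nat) t : R := e^-1 ^+ m.+1 * (Q0^`(m)).[clamp1 (t / e)].

(** A primitive of [bump e 0]. Its constant values beyond distance e do not depend on e, so the
    difference of ramps at two scales has compact support. *)
Definition ramp e t : R := Qm1.[clamp1 (t / e)].

Lemma Q0_root : [/\ Q0.[1] = 0, Q0.[-1] = 0, Q0^`().[1] = 0 & Q0^`().[-1] = 0] /\
  Q0^`(2).[1] = 0 /\ Q0^`(2).[-1] = 0.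
Proof.
pose A : {poly R} := 1 - 'X^2.
have A1 : A.[1] = 0 by rewrite /A !hornerE expr1n subrr.
have A2 : A.[-1] = 0 by rewrite /A !hornerE sqrrN expr1n subrr.
have -> : Q0 = A ^+ 3 by [].
move: A A1 A2 => A A1 A2; rewrite derivnS derivn1 !deriv_exp /= derivMn derivM !deriv_exp /=.
by rewrite !hornerE A1 A2 !expr0n /= !(mulr0, mul0r, mul0rn, addr0).
Qed.

Lemma c11_bump e m : 0 < e -> (m < 2)%N -> c11 (bump e m) (bump e m.+1).
Proof.
move=> e0 m2; have := c11_scale e0 (@c11_poly_clamp Q0^`(m) _ _).
rewrite -derivnS; have [[_ _ a b] [c d]] := Q0_root.
have -> : Q0^`(m.+1).[1] = 0 by case: m m2 => [|[|]].
have -> : Q0^`(m.+1).[-1] = 0 by case: m m2 => [|[|]].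
move=> /(_ erefl erefl) H; have := c11_comb (e^-1 ^+ m.+1) 0 H H.
have [E1 E2] : (fun t => e^-1 ^+ m.+1 * (Q0^`(m)).[clamp1 (t / e)] + 0 * (Q0^`(m)).[clamp1 (t / e)]) = bump e m /\
  (fun t => e^-1 ^+ m.+1 * (e^-1 * (Q0^`(m.+1)).[clamp1 (t / e)]) +
  0 * (e^-1 * (Q0^`(m.+1)).[clamp1 (t / e)])) = bump e m.+1.
  by split; apply/funext => t; rewrite /bump mul0r addr0// mulrA -exprSr.
by rewrite E1 E2.
Qed.

Lemma c11_ramp e : 0 < e -> c11 (ramp e) (bump e 0).
Proof.
move=> e0; have := c11_scale e0 (@c11_poly_clamp Qm1 _ _); rewrite Qm1E.
have [[-> -> _ _] _] := Q0_root => /(_ erefl erefl).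
by rewrite /bump expr1.
Qed.

Lemma bump_out e m t : 0 < e -> (m <= 2)%N -> e < `|t| -> bump e m t = 0.
Proof.
move=> e0 m2 et; rewrite /bump.
have te : 1 <= `|t / e|.
  by rewrite normrM [`|e^-1|]gtr0_norm ?invr_gt0// ler_pdivlMr// mul1r ltW.
have [[a b c d] [f g]] := Q0_root.
have [->|->] := clamp1_out te.
  by case: m m2 => [|[|[|]]]// _; rewrite ?derivn0 ?derivn1 ?a ?c ?f mulr0.
by case: m m2 => [|[|[|]]]// _; rewrite ?derivn0 ?derivn1 ?b ?d ?g mulr0.
Qed.

Lemma ramp_out e t : 0 < e -> 2 * e < `|t| -> ramp e t - ramp (2 * e) t = 0.
Proof.
move=> e0 et.
have e20 : 0 < 2 * e by lra.
rewrite /ramp; move: et; rewrite lter_normr => /orP[t0|t0].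
  by rewrite !clamp1_gt ?subrr// ler_pdivlMr//; lra.
by rewrite !clamp1_lt ?subrr// ler_pdivrMr//; lra.
Qed.

Lemma Q0E t : Q0.[t] = (1 - t ^+ 2) ^+ 3.
Proof. by rewrite /Q0 !hornerE. Qed.

Lemma bump_ge0 e t : 0 < e -> 0 <= bump e 0 t.
Proof.
move=> e0; have e1 : 0 <= e^-1 by rewrite invr_ge0 ltW.
rewrite /bump derivn0 Q0E mulr_ge0 ?exprn_ge0//.
by rewrite subr_ge0 -real_normK ?num_real// expr_le1// clamp1_norm.
Qed.

Lemma bump_le : exists2 B : R, 0 <= B & forall e m t, 0 < e -> (m <= 2)%N ->
  `|bump e m t| <= B / e ^+ m.+1.
Proof.
have [B b] := poly_bound Q0; have [C c] := poly_bound Q0^`().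
have B0 : 0 <= B by have [] := b 0 0; rewrite ?normr0// => h _ _ _; rewrite (le_trans _ h).
have C0 : 0 <= C by have [] := c 0 0; rewrite ?normr0// => h _ _ _; rewrite (le_trans _ h).
exists (B + C) => [|e m t e0 m2]; first exact: addr_ge0.
have [b1 _ _ _] := b _ _ (clamp1_norm (t / e)) (clamp1_norm (t / e)).
have [c1 c2 _ _] := c _ _ (clamp1_norm (t / e)) (clamp1_norm (t / e)).
have e1 : 0 <= e^-1 by rewrite invr_ge0 ltW.
rewrite /bump normrM mulrC -exprVn [`|e^-1 ^+ _|]ger0_norm ?exprn_ge0//.
rewrite ler_wpM2r ?exprn_ge0//.
case: m m2 => [|[|[|]]]// _; rewrite ?derivn0 ?derivn1 ?(derivnS _ 1) ?derivn1.
- by rewrite (le_trans b1)// lerDl.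
- by rewrite (le_trans c1)// lerDr.
- by rewrite (le_trans c2)// lerDr.
Qed.

Lemma bump_center : exists2 c : R, 0 < c & forall t, `|t| <= 1/2 -> c <= bump 1 0 t.
Proof.
exists ((1/2) ^+ 3) => [|t t1]; first by rewrite exprn_gt0//; lra.
rewrite /bump divr1 invr1 expr1n [1 * _.[_]]mul1r derivn0 Q0E clamp1_id; last by lra.
have : `|t| ^+ 2 <= (1/2) ^+ 2 by rewrite lerXn2r ?nnegrE//; lra.
rewrite real_normK ?num_real// => t2.
by rewrite lerXn2r ?nnegrE//; lra.
Qed.

Lemma ramp_le : exists2 B : R, 0 <= B & forall e t, `|ramp e t| <= B.
Proof.
have [B b] := poly_bound Qm1.
have B0 : 0 <= B by have [] := b 0 0; rewrite ?normr0// => h _ _ _; rewrite (le_trans _ h).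
by exists B => // e t; have [] := b _ _ (clamp1_norm (t / e)) (clamp1_norm (t / e)).
Qed.

End profiles.

Section tensor.
Context (R : realType) (n : nat).
Local Notation E := 'rV[R]_n.
Implicit Types (p q : 'I_n -> R -> R) (z h : E).

Definition tens p z := \prod_i p i (z ord0 i).

Lemma tens_lip_seq p : (forall i, exists B : R, forall t h : R,
    `|p i t| <= B /\ `|p i (t + h) - p i t| <= B * `|h|) ->
  forall r : seq 'I_n, exists B : R, forall z h, `|\prod_(i <- r) p i (z ord0 i)| <= B /\
    `|\prod_(i <- r) p i ((z + h) ord0 i) - \prod_(i <- r) p i (z ord0 i)| <= B * `|h|.
Proof.
move=> hp; elim=> [|a r [B IH]].
  by exists 1 => z h; rewrite !big_nil subrr normr0 normr1 mul1r.
have [A hA] := hp a; exists (A * B + A * B) => z h; rewrite !big_cons.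
have [A1 A2] := hA (z ord0 a) (h ord0 a); have [B1 B2] := IH z h; have [B3 _] := IH (z + h) 0.
have AB0 : 0 <= A * B by rewrite mulr_ge0// ?(le_trans _ A1)// (le_trans _ B1).
split; first by rewrite (le_trans (normM_le A1 B1))// lerDl.
set P' := \prod_(i <- r) _ in B3 B2 *; set P := \prod_(i <- r) _ in B1 B2 *.
rewrite (_ : _ - _ = (p a ((z + h) ord0 a) - p a (z ord0 a)) * P' + p a (z ord0 a) * (P' - P)); last by lra.
rewrite [leRHS]mulrDl normD_le//.
  by rewrite mxE (le_trans (normM_le A2 B3))// mulrAC ler_wpM2l// rV_coord_le.
by rewrite (le_trans (normM_le A1 B2))// mulrA.
Qed.

Lemma dfwith_neq p (a j : 'I_n) (f : R -> R) : j != a -> dfwith p j f a = p a.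
Proof. by move=> ja; rewrite dfwithout. Qed.

(** Induction on the factors. With the first one split off, the remainder consists of its own
    remainder times the shifted product, a mixed term of order |h|^2, and the factor times the
    inductive remainder. *)
Lemma tens_taylor_seq p q : (forall i, c11 (p i) (q i)) -> forall r : seq 'I_n, uniq r ->
  exists B : R, forall z h, `|\prod_(i <- r) p i ((z + h) ord0 i) - \prod_(i <- r) p i (z ord0 i)
     - \sum_(j <- r) (\prod_(i <- r) dfwith p j (q j) i (z ord0 i)) * h ord0 j| <= B * `|h| ^+ 2.
Proof.
move=> pq; elim=> [_|a r IH /= /andP[ar ur]].
  by exists 0 => z h; rewrite !big_nil subrr subr0 normr0 mul0r.
have [A [A1 A2 A3]] := pq a; have [B hB] := IH ur.
have hp i : exists B : R, forall t h : R, `|p i t| <= B /\ `|p i (t + h) - p i t| <= B * `|h|.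
  by have [C [C1 C2 _]] := pq i; exists C => t h; have [? _] := C1 t; have [? _] := C2 t h.
have [D hD] := tens_lip_seq hp r.
exists (A * D + A * D + A * B) => z h; rewrite !big_cons.
have [a1 a2] := A1 (z ord0 a); have a3 := A3 (z ord0 a) (h ord0 a).
have [_ D2] := hD z h; have [D3 _] := hD (z + h) 0; have b := hB z h.
rewrite (_ : \prod_(i <- r) dfwith p a (q a) i (z ord0 i) = \prod_(i <- r) p i (z ord0 i)); last first.
  apply: eq_big_seq => i ir; rewrite dfwith_neq//.
  by apply/eqP => ai; move: ar; rewrite ai ir.
rewrite (_ : \sum_(j <- r) _ = p a (z ord0 a) * \sum_(j <- r)
    (\prod_(i <- r) dfwith p j (q j) i (z ord0 i)) * h ord0 j); last first.
  rewrite mulr_sumr; apply: eq_big_seq => j jr; rewrite big_cons dfwith_neq ?mulrA//.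
  by apply/eqP => aj; move: ar; rewrite -aj jr.
rewrite dfwithin; move: b D2 D3.
set P' := \prod_(i <- r) p i ((z + h) ord0 i); set P := \prod_(i <- r) p i (z ord0 i).
set S := \sum_(j <- r) _ => b D2 D3.
have ha : `|h ord0 a| <= `|h| by exact: rV_coord_le.
have A0 : 0 <= A by rewrite (le_trans _ a1).
have D0 : 0 <= D by rewrite (le_trans _ D3).
rewrite (_ : _ - _ = (p a ((z + h) ord0 a) - p a (z ord0 a) - q a (z ord0 a) * h ord0 a) * P' +
  q a (z ord0 a) * (h ord0 a * (P' - P)) + p a (z ord0 a) * (P' - P - S)); last by lra.
rewrite ![in leRHS]mulrDl; apply: normD_le; first apply: normD_le.
- rewrite mxE (le_trans (normM_le a3 D3))// mulrAC ler_wpM2l ?mulr_ge0//.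
  by rewrite lerXn2r// nnegrE.
- rewrite (le_trans (normM_le a2 (normM_le ha D2)))// expr2.
  by rewrite -[leRHS]mulrA [X in A * X <= _]mulrCA.
- by rewrite (le_trans (normM_le a1 b))// mulrA.
Qed.

(* [dk] is the gradient of [k], quantitatively; both vanish outside the ball of radius [r]. *)
Definition kernel1 (r : R) (k : E -> R) (dk : 'I_n -> E -> R) := exists B : R, [/\
  forall z, `|k z| <= B /\ forall j, `|dk j z| <= B,
  lip B k /\ forall j, lip B (dk j),
  forall z h, `|k (z + h) - k z - \sum_j dk j z * h ord0 j| <= B * `|h| ^+ 2 &
  forall z, r < `|z| -> k z = 0 /\ forall j, dk j z = 0].

Lemma tens_lip p : (forall i, exists B : R, forall t h : R,
    `|p i t| <= B /\ `|p i (t + h) - p i t| <= B * `|h|) ->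
  exists B : R, (forall z, `|tens p z| <= B) /\ lip B (tens p).
Proof.
move=> /tens_lip_seq /(_ (index_enum 'I_n)) [B hB]; exists B; split => [z|z h].
  by have [] := hB z 0.
by have [_] := hB h (z - h); rewrite [h + _]addrC subrK.
Qed.

Lemma tens_out (r : R) p z : 0 <= r -> (forall i t, r < `|t| -> p i t = 0) ->
  r < `|z| -> tens p z = 0.
Proof.
move=> r0 pr rz; have [i ri] : exists i, r < `|z ord0 i|.
  apply: contrapT => /forallNP h; move: rz; rewrite ltNge => /negP; apply.
  by apply: rV_norm_le => // i; rewrite leNgt; exact/negP/h.
by rewrite /tens (bigD1 i)//= pr// mul0r.
Qed.

(* [P l m] stands for the m-th derivative of the profile in the l-th variable. *)
Definition mtens (P : 'I_n -> nat -> R -> R) (a : 'I_n -> nat) : E -> R :=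
  tens (fun l => P l (a l)).

Definition incr (a : 'I_n -> nat) (j : 'I_n) : 'I_n -> nat := fun l => ((l == j) + a l)%N.

Lemma incrC a i j : incr (incr a i) j = incr (incr a j) i.
Proof. by apply/funext => l; rewrite /incr addnCA. Qed.

Lemma kernel1_mtens (r : R) (P : 'I_n -> nat -> R -> R) a : 0 <= r ->
  (forall l, c11 (P l (a l)) (P l (a l).+1)) ->
  (forall l t, r < `|t| -> P l (a l) t = 0 /\ P l (a l).+1 t = 0) ->
  kernel1 r (mtens P a) (fun j => mtens P (incr a j)).
Proof.
move=> r0 Pc Pr.
have PE j : (fun l => P l (incr a j l)) =
    dfwith (fun l => P l (a l)) j (P j (a j).+1) :> ('I_n -> R -> R).
  apply/funext => l; rewrite /incr; have [->|lj] := eqVneq l j; first by rewrite dfwithin.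
  by rewrite dfwith_neq// eq_sym.
have cb l : exists B : R, forall t h : R, `|P l (a l) t| <= B /\
    `|P l (a l) (t + h) - P l (a l) t| <= B * `|h|.
  by have [C [C1 C2 _]] := Pc l; exists C => t h; have [? _] := C1 t; have [? _] := C2 t h.
have cb' l : exists B : R, forall t h : R, `|P l (a l).+1 t| <= B /\
    `|P l (a l).+1 (t + h) - P l (a l).+1 t| <= B * `|h|.
  by have [C [C1 C2 _]] := Pc l; exists C => t h; have [_ ?] := C1 t; have [_ ?] := C2 t h.
have [B0 [b1 b2]] := tens_lip cb.
have cbj j l : exists B : R, forall t h : R, `|P l (incr a j l) t| <= B /\
    `|P l (incr a j l) (t + h) - P l (incr a j l) t| <= B * `|h|.
  by rewrite /incr; case: (_ == _); [exact: cb'|exact: cb].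
have /choice[B1 B1P] j := tens_lip (cbj j).
have [B2 b3] := tens_taylor_seq Pc (index_enum_uniq 'I_n).
have B00 : 0 <= B0 by rewrite (le_trans _ (b1 0)).
have B10 j : 0 <= B1 j by have [b _] := B1P j; rewrite (le_trans _ (b 0)).
have S0 : 0 <= \sum_j B1 j by apply: sumr_ge0.
have S1 j : B1 j <= \sum_j B1 j by rewrite (bigD1 j)//= lerDl sumr_ge0.
have B2n := normr_ge0 B2.
exists (B0 + \sum_j B1 j + `|B2|); split.
- move=> z; split => [|j]; first by rewrite (le_trans (b1 z))//; lra.
  by have [b _] := B1P j; rewrite (le_trans (b z))// (le_trans (S1 j))//; lra.
- split => [x y|j x y]; first by rewrite (le_trans (b2 x y))// ler_wpM2r//; lra.
  have [_ b] := B1P j; rewrite (le_trans (b x y))// ler_wpM2r//.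
  by rewrite (le_trans (S1 j))//; lra.
- move=> z h; have := b3 z h.
  under [X in _ - X]eq_bigr do rewrite -PE.
  move=> /le_trans; apply; rewrite ler_wpM2r ?exprn_ge0//.
  by rewrite (le_trans (ler_norm _))//; lra.
- move=> z rz; split => [|j].
    by apply: (tens_out r0) rz => i t /(Pr i)[].
  by apply: (tens_out r0) rz => i t /(Pr i); rewrite /incr; case: (_ == _) => -[].
Qed.

End tensor.

(** * Convolution with differentiable kernels *)

Section convolution.
Context (R : realType) (n : nat).
Local Notation E := 'rV[R]_n.+1.
Local Notation mu := (@lebesgue_rV R n.+1).
Implicit Types (k phi : E -> R) (x y z : E).

Lemma eps_continuous (f : E -> R) : (forall y, forall e : R, 0 < e -> exists2 d : R, 0 < d &
  forall y', `|y' - y| < d -> `|f y' - f y| <= e) -> continuous f.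
Proof.
move=> hf y; apply/(@cvgrPdist_le _ _ _ (nbhs y)) => e /(hf y)[d d0 hd].
by apply/nbhs_ballP; exists d => //= y'; rewrite -ball_normE/= distrC [leLHS]distrC; exact: hd.
Qed.

Lemma Rintegral_sum (I : Type) (f : I -> E -> R) (s : seq I) :
  (forall i, mu.-integrable setT (EFin \o f i)) ->
  mu.-integrable setT (EFin \o (fun x => \sum_(i <- s) f i x)) /\
  \int[mu]_x (\sum_(i <- s) f i x) = \sum_(i <- s) \int[mu]_x f i x.
Proof.
move=> fi; elim: s => [|a s [IH1 IH2]].
  rewrite big_nil (_ : (fun x => _) = cst 0); last by apply/funext => x; rewrite big_nil.
  by split; [exact: integrable0|rewrite Rintegral_cst// mul0r].
have E0 : (fun x => \sum_(i <- a :: s) f i x) = (fun x => f a x + \sum_(i <- s) f i x).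
  by apply/funext => x; rewrite big_cons.
rewrite E0 big_cons -IH2; split; last exact: RintegralD.
exact: (integrableD measurableT (fi a) IH1).
Qed.

Definition conv k phi y := \int[mu]_x (phi x * k (y - x)).

Definition locbd phi := forall r : R, exists B : R, forall x, `|x| <= r -> `|phi x| <= B.

Lemma measurable_reflect_comp k y : measurable_fun setT k ->
  measurable_fun setT (fun x => k (y - x)).
Proof. by move=> mk; exact: measurableT_comp mk (measurable_reflect y). Qed.

Section bound.
Context (r c B : R) (k phi : E -> R) (y : E).
Hypotheses (r0 : 0 <= r) (mk : measurable_fun setT k) (mphi : measurable_fun setT phi).
Hypotheses (kc : forall z, `|k z| <= c) (kr : forall z, r < `|z| -> k z = 0).
Hypothesis phiB : forall x, `|x - y| <= r -> `|phi x| <= B.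

Let hB x : `|phi x * k (y - x)| <= B * c.
Proof.
have [xr|xr] := leP `|x - y| r; first by rewrite normM_le// phiB.
rewrite kr 1?distrC// mulr0 normr0 mulr_ge0//.
  by rewrite (le_trans _ (phiB (x := y) _))// subrr normr0.
by rewrite (le_trans _ (kc 0)).
Qed.

Let h0 x : r < `|x - y| -> phi x * k (y - x) = 0.
Proof. by move=> xr; rewrite kr 1?distrC// mulr0. Qed.

Let mh : measurable_fun setT (fun x => phi x * k (y - x)).
Proof. by apply: measurable_funM => //; exact: measurable_reflect_comp. Qed.

Lemma integrable_conv : mu.-integrable setT (EFin \o (fun x => phi x * k (y - x))).
Proof. exact: (integrable_bounded (a := y) r0 mh hB). Qed.

Lemma conv_le : `|conv k phi y| <= B * c * (2 * r) ^+ n.+1.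
Proof. exact: (Rintegral_bounded (a := y) r0 mh hB). Qed.

End bound.

Section differentiable.
Context (r : R) (phi : E -> R).
Hypotheses (r0 : 0 <= r) (mphi : measurable_fun setT phi) (bphi : locbd phi).

Let phi_near y (s : R) : exists2 B : R, 0 <= B & forall x, `|x - y| <= s -> `|phi x| <= B.
Proof.
have [B hB] := bphi (s + `|y|); exists `|B| => // x xs.
by rewrite (le_trans (hB _ _)) ?ler_norm// -[x](subrK y) (le_trans (ler_normD _ _))// lerD2r.
Qed.

Lemma integrable_conv_lip (k : E -> R) (B : R) y : lip B k -> (forall z, `|k z| <= B) ->
  (forall z, r < `|z| -> k z = 0) ->
  mu.-integrable setT (EFin \o (fun x => phi x * k (y - x))).
Proof.
move=> kl kB kr; have [C _ hC] := phi_near y r.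
exact: (integrable_conv r0 (lip_measurable kl) mphi kB kr hC).
Qed.

Lemma conv_continuous (k : E -> R) (B : R) : lip B k -> (forall z, `|k z| <= B) ->
  (forall z, r < `|z| -> k z = 0) -> continuous (conv k phi).
Proof.
move=> kl kB kr; apply: eps_continuous => y e e0.
have [C C0 hC] := phi_near y (r + 1).
have B0 : 0 <= B by rewrite (le_trans _ (kB 0)).
pose M := C * B * (2 * (r + 1)) ^+ n.+1.
have r10 : 0 <= 2 * (r + 1) by rewrite mulr_ge0 ?addr_ge0.
have M0 : 0 <= M by apply: mulr_ge0; [exact: mulr_ge0|exact: exprn_ge0].
have d0 : 0 < Num.min 1 (e / (M + 1)) by rewrite lt_min ltr01 divr_gt0//; lra.
exists (Num.min 1 (e / (M + 1))) => //= y'.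
rewrite lt_min => /andP[y1 ye].
pose h := y' - y.
have kh z : `|k (z + h) - k z| <= B * `|h| by rewrite (le_trans (kl _ _))// [z + h]addrC addrK.
have mkh : measurable_fun setT (fun z => k (z + h) - k z).
  apply: measurable_funB; last exact: lip_measurable kl.
  by apply: measurableT_comp (lip_measurable kl) (measurable_shift h).
have krh z : r + 1 < `|z| -> k (z + h) - k z = 0.
  move=> rz; rewrite !kr ?subrr//; first by lra.
  have := lerB_dist z (- h); rewrite opprK normrN => zh; rewrite /h in zh *; lra.
have i1 := integrable_conv_lip y' kl kB kr; have i2 := integrable_conv_lip y kl kB kr.
have := conv_le (r := r + 1) _ mkh mphi kh krh hC; rewrite /conv.
have -> : \int[mu]_x (phi x * (k (y - x + h) - k (y - x))) = conv k phi y' - conv k phi y.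
  rewrite /conv -RintegralB//; apply: eq_Rintegral => x _.
  rewrite mulrBr; congr (phi x * k _ - _).
  by rewrite /h [LHS]addrC addrA subrK.
move=> /(_ _)/le_trans; apply; first lra.
rewrite -/h mulrA mulrAC -/M (le_trans (ler_wpM2l M0 (ltW ye)))//.
by rewrite mulrA ler_pdivrMr//; nra.
Qed.

(** The Taylor remainder of k is itself a kernel, of size |h|^2 and supported in the ball of radius
    r + 1 for |h| < 1; [conv_le] turns it into the remainder of the convolution. *)
Lemma conv_differentiable (k : E -> R) (dk : 'I_n.+1 -> E -> R) : kernel1 r k dk ->
  forall y, differentiable (conv k phi) y /\
    'd (conv k phi) y = linform (fun j => conv (dk j) phi y) :> (E -> R).
Proof.
move=> [B [kB [kl dkl] kT kr]] y; apply: differentiable_linform => e e0.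
have [C C0 hC] := phi_near y (r + 1).
have B0 : 0 <= B by rewrite (le_trans _ (kB 0).1).
pose M := C * B * (2 * (r + 1)) ^+ n.+1.
have r10 : 0 <= 2 * (r + 1) by rewrite mulr_ge0 ?addr_ge0.
have M0 : 0 <= M by apply: mulr_ge0; [exact: mulr_ge0|exact: exprn_ge0].
exists (Num.min 1 (e / (M + 1))); first by rewrite lt_min ltr01 divr_gt0//; lra.
move=> h; rewrite lt_min => /andP[h1 he].
pose K z := k (z + h) - k z - \sum_j dk j z * h ord0 j.
have mK : measurable_fun setT K.
  apply: measurable_funB; first apply: measurable_funB; last 2 first.
  - exact: lip_measurable kl.
  - by apply: measurable_sum => j; apply: measurable_funM => //; exact: lip_measurable (dkl j).
  - by apply: measurableT_comp (lip_measurable kl) (measurable_shift h).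
have Kr z : r + 1 < `|z| -> K z = 0.
  move=> rz; rewrite /K; have rz' : r < `|z| by rewrite (lt_trans _ rz)// ltrDl.
  have [-> zj] := kr z rz'.
  rewrite big1 => [|j _]; last by rewrite zj mul0r.
  rewrite (kr _ _).1 ?subrr ?subr0//.
  have := lerB_dist z (- h); rewrite opprK normrN => zh; lra.
have i1 := integrable_conv_lip (h + y) kl (fun z => (kB z).1) (fun z rz => (kr z rz).1).
have i2 := integrable_conv_lip y kl (fun z => (kB z).1) (fun z rz => (kr z rz).1).
have := conv_le (r := r + 1) _ mK mphi (fun z => kT z h) Kr hC.
have -> : conv K phi y = conv k phi (h + y) - conv k phi y -
    linform (fun j => conv (dk j) phi y) h.
  have ik j : mu.-integrable setT (EFin \o (fun x => phi x * dk j (y - x) * h ord0 j)).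
    have i3 := integrable_conv_lip y (dkl j) (fun z => (kB z).2 j) (fun z rz => (kr z rz).2 j).
    by have := integrableZr measurableT (h ord0 j) i3; apply: eq_integrable.
  have [iS SE] := Rintegral_sum (index_enum 'I_n.+1) ik.
  have i12 : mu.-integrable setT
      (EFin \o (fun x => phi x * k (h + y - x) - phi x * k (y - x))).
    exact: (integrableB measurableT i1 i2).
  have -> : linform (fun j => conv (dk j) phi y) h =
      \int[mu]_x (\sum_j phi x * dk j (y - x) * h ord0 j).
    rewrite SE; apply: eq_bigr => j _; rewrite /conv RintegralZr//.
    exact: integrable_conv_lip (dkl j) (fun z => (kB z).2 j) (fun z rz => (kr z rz).2 j).
  rewrite /conv -RintegralB// -RintegralB//; apply: eq_Rintegral => x _.
  rewrite /K !mulrBr mulr_sumr; congr (_ * k _ - _ - _); first by rewrite addrC addrA.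
  by apply: eq_bigr => j _; rewrite mulrA.
move=> /(_ _)/le_trans; apply; first lra.
rewrite mulrA mulrAC -/M expr2 mulrA ler_wpM2r// (le_trans (ler_wpM2l M0 (ltW he)))//.
by rewrite mulrA ler_pdivrMr//; nra.
Qed.

End differentiable.

End convolution.

Section conv_facts.
Context (R : realType) (n : nat).
Local Notation E := 'rV[R]_n.+1.
Local Notation mu := (@lebesgue_rV R n.+1).
Implicit Types (k phi : E -> R) (x y z : E).

Lemma lip_locbd (L : R) (f : E -> R) : lip L f -> locbd f.
Proof.
move=> fL r; have L0 := lip_ge0 fL; exists (L * r + `|f 0|) => x xr.
rewrite -[f x](subrK (f 0)) normD_le// (le_trans (fL _ _))// subr0.
exact: ler_wpM2l.
Qed.

Lemma lip_cst (c : R) : lip 0 (fun _ : E => c).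
Proof. by move=> x y; rewrite subrr normr0 mul0r. Qed.

Lemma differentiable_lip (f : E -> R) (C : R) : (forall x, differentiable f x) ->
  (forall x h, `|'d f x h| <= C * `|h|) -> lip C f.
Proof.
move=> df fC x y; pose v := x - y; pose g (t : R) := f (t *: v + y).
have dg (t : R) : is_derive t (1 : R) g ('d f (t *: v + y) v).
  have E1 : (fun h : R => h^-1 *: (g (h *: 1 + t) - g t)) =
            (fun h : R => h^-1 *: (f (h *: v + (t *: v + y)) - f (t *: v + y))).
    by apply/funext => h; rewrite /g addrA -scalerDl [h *: 1]mulr1.
  have dfv : derivable f (t *: v + y) v by exact: diff_derivable.
  split; first by rewrite /derivable E1.
  by rewrite /derive E1 -deriveE.
have cg : {within `[0, 1], continuous g}.
  apply: derivable_within_continuous => t _.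
  by have [] := dg t.
have [t _] := @MVT R g (fun t => 'd f (t *: v + y) v) 0 1 ltr01 (fun t _ => dg t) cg.
by rewrite /g scale1r scale0r add0r subr0 mulr1 subrK => ->; exact: fC.
Qed.

Lemma convE k phi y : mu.-integrable setT (EFin \o (fun x => phi x * k (y - x))) ->
  conv k phi y = \int[mu]_z (phi (y - z) * k z).
Proof.
move=> ik; rewrite /conv -(Rintegral_reflect y ik); apply: eq_Rintegral => x _.
by rewrite subKr.
Qed.

Lemma integrable_reflect_conv k phi y : mu.-integrable setT (EFin \o (fun x => phi x * k (y - x))) ->
  mu.-integrable setT (EFin \o (fun z => phi (y - z) * k z)).
Proof.
move=> ik; have := integrable_reflect y ik; apply: eq_integrable => // x _ /=.
by rewrite subKr.
Qed.

Section kernel.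
Context (r : R) (k : E -> R) (dk : 'I_n.+1 -> E -> R).
Hypotheses (r0 : 0 <= r) (kk : kernel1 r k dk).

Lemma integrable_kernel phi y : measurable_fun setT phi -> locbd phi ->
  mu.-integrable setT (EFin \o (fun x => phi x * k (y - x))).
Proof.
have [B [kB [kl dkl] _ kr]] := kk => mphi bphi.
exact: (integrable_conv_lip r0 mphi bphi y kl (fun z => (kB z).1) (fun z rz => (kr z rz).1)).
Qed.

Lemma integrable_dkernel j phi y : measurable_fun setT phi -> locbd phi ->
  mu.-integrable setT (EFin \o (fun x => phi x * dk j (y - x))).
Proof.
have [B [kB [kl dkl] _ kr]] := kk => mphi bphi.
exact: (integrable_conv_lip r0 mphi bphi y (dkl j) (fun z => (kB z).2 j) (fun z rz => (kr z rz).2 j)).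
Qed.

Lemma integrable_kernel1 : mu.-integrable setT (EFin \o k).
Proof.
have mc : measurable_fun setT (fun _ : E => 1 : R) by exact: measurable_cst.
have := integrable_reflect_conv (integrable_kernel 0 mc (lip_locbd (lip_cst 1))).
by apply: eq_integrable => // x _; rewrite /= mul1r.
Qed.

Lemma conv1 y : conv k (fun=> 1) y = \int[mu]_z k z.
Proof.
have mc : measurable_fun setT (fun _ : E => 1 : R) by exact: measurable_cst.
rewrite (convE (integrable_kernel y mc (lip_locbd (lip_cst 1)))).
by apply: eq_Rintegral => z _; rewrite mul1r.
Qed.

(** The convolution of k with 1 is constant, so its derivative vanishes: the kernels [dk j] have
    mean zero. *)
Lemma dconv1 j y : conv (dk j) (fun=> 1) y = 0.
Proof.
have mc : measurable_fun setT (fun _ : E => 1 : R) by exact: measurable_cst.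
have [_ dE] := conv_differentiable r0 mc (lip_locbd (lip_cst 1)) kk y.
rewrite -(linform_delta (fun j => conv (dk j) (fun=> 1) y)) -dE.
rewrite (_ : conv k (fun=> 1) = cst (\int[mu]_z k z)) ?diff_cst//.
by apply/funext => z; rewrite conv1.
Qed.

Hypothesis k0 : forall z, 0 <= k z.

Lemma conv_bound phi (c : R) y : measurable_fun setT phi -> (forall x, `|phi x| <= c) ->
  `|conv k phi y| <= c * \int[mu]_z k z.
Proof.
move=> mphi phic; have bphi : locbd phi by move=> s; exists c => x _.
have ik := integrable_kernel y mphi bphi.
rewrite (convE ik).
under eq_Rintegral do rewrite mulrC.
have mr : measurable_fun setT (fun z => phi (y - z)) by exact: measurable_reflect_comp.
rewrite (le_trans (Rintegral_mul_le integrable_kernel1 mr (fun z => phic _)))// mulrC.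
by rewrite (_ : \int[mu]_x `|k x| = \int[mu]_z k z)//; apply: eq_Rintegral => z _; rewrite ger0_norm.
Qed.

Lemma conv_lip phi (L : R) : lip L phi -> lip ((\int[mu]_z k z) * L) (conv k phi).
Proof.
move=> pl y y'; have mphi := lip_measurable pl; have bphi := lip_locbd pl.
have i1 := integrable_kernel y mphi bphi; have i2 := integrable_kernel y' mphi bphi.
rewrite (convE i1) (convE i2).
have i1' := integrable_reflect_conv i1; have i2' := integrable_reflect_conv i2.
rewrite -RintegralB//.
under eq_Rintegral do rewrite -mulrBl mulrC.
have mr : measurable_fun setT (fun z => phi (y - z) - phi (y' - z)).
  by apply: measurable_funB; exact: measurable_reflect_comp.
rewrite (le_trans (Rintegral_mul_le integrable_kernel1 mr (B := L * `|y - y'|) _))//.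
  move=> z; rewrite (le_trans (pl _ _))//.
  by rewrite (_ : _ - _ - _ = y - y')// opprB addrA subrK.
rewrite (_ : \int[mu]_x `|k x| = \int[mu]_z k z) ?mulrA//.
by apply: eq_Rintegral => z _; rewrite ger0_norm.
Qed.

(** Convolving a linear form with k multiplies it by the mass of k, up to an additive constant.
    Differentiating gives the first moments of [dk j] without integrating by parts. *)
Lemma dconv_linform (a : 'I_n.+1 -> R) j y : conv (dk j) (linform a) y = (\int[mu]_z k z) * a j.
Proof.
have ll := linform_lip a; have ml := lip_measurable ll; have bl := lip_locbd ll.
have [_ dE] := conv_differentiable r0 ml bl kk y.
rewrite -(linform_delta (fun j => conv (dk j) (linform a) y)) -dE.
set I := \int[mu]_z k z.
have fE : conv k (linform a) = (fun y => I * linform a y + conv k (linform a) 0).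
  apply/funext => z; have i1 := integrable_kernel z ml bl; have i2 := integrable_kernel 0 ml bl.
  rewrite (convE i1) (convE i2).
  have i2' := integrable_reflect_conv i2.
  have ik := integrable_kernel1.
  rewrite mulrC -RintegralZl//; rewrite -RintegralD//; last first.
    by have := integrableZl measurableT (linform a z) ik; apply: eq_integrable.
  by apply: eq_Rintegral => w _; rewrite -mulrDl -linearD/= addrA addr0.
have dl : differentiable (linform a) y by apply: linear_differentiable; exact: lip_continuous ll.
rewrite -deriveE; last by have [] := conv_differentiable r0 ml bl kk y.
rewrite fE deriveD//=; last by apply: derivableM => //; exact: diff_derivable.
rewrite derive_cst addr0 deriveMl; last exact: diff_derivable.
rewrite deriveE//.
have := @diff_lin R E R (linform a) y (lip_continuous ll).
move=> ->.
congr (_ * _); exact: linform_delta.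
Qed.

End kernel.


Lemma conv_sumk (I : Type) (s : seq I) (K : I -> E -> R) phi y :
  (forall i, mu.-integrable setT (EFin \o (fun x => phi x * K i (y - x)))) ->
  conv (fun z => \sum_(i <- s) K i z) phi y = \sum_(i <- s) conv (K i) phi y.
Proof.
move=> iK; have [_ <-] := Rintegral_sum s iK.
by apply: eq_Rintegral => x _; rewrite mulr_sumr.
Qed.

End conv_facts.

(** * Dyadic mollifiers *)

Section mollifiers.
Context (R : realType) (n : nat).
Local Notation E := 'rV[R]_n.+1.
Local Notation mu := (@lebesgue_rV R n.+1).
Implicit Types (phi : E -> R) (x y z : E) (e : R) (a : 'I_n.+1 -> nat).

Definition moll e a : E -> R := mtens (fun=> bump e) a.

Let a0 : 'I_n.+1 -> nat := fun=> 0%N.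

Lemma kernel1_moll e a : 0 < e -> (forall l, a l <= 1)%N ->
  kernel1 e (moll e a) (fun j => moll e (incr a j)).
Proof.
move=> e0 a1; apply: kernel1_mtens; first exact: ltW.
- by move=> l; apply: c11_bump => //; rewrite ltnS a1.
- by move=> l t et; rewrite !bump_out// ?ltnS ?a1// ltnW// ltnS a1.
Qed.

Lemma moll_ge0 e z : 0 < e -> 0 <= moll e a0 z.
Proof. by move=> e0; apply: prodr_ge0 => l _; exact: bump_ge0. Qed.

(* The kernels whose divergence telescopes [moll e - moll (2 * e)]. *)
Definition tele e (i l : 'I_n.+1) : nat -> R -> R :=
  if (l < i)%N then bump (2 * e) else
  if l == i then (fun m t => if m is m'.+1 then bump e m' t - bump (2 * e) m' t
                             else ramp e t - ramp (2 * e) t)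
  else bump e.

Definition telek e i a : E -> R := mtens (tele e i) a.

Lemma kernel1_telek e i : 0 < e -> kernel1 (2 * e) (telek e i a0) (fun j => telek e i (incr a0 j)).
Proof.
move=> e0; have e20 : 0 < 2 * e by rewrite mulr_gt0.
apply: kernel1_mtens; first exact: ltW.
- move=> l; rewrite /tele /a0.
  have [li|li] := boolP (l < i)%N; first exact: c11_bump.
  have [_|_] := boolP (l == i); last exact: c11_bump.
  have := c11_comb 1 (-1) (c11_ramp e0) (c11_ramp e20).
  by congr c11; apply/funext => t; rewrite mul1r mulN1r.
- move=> l t et; rewrite /tele /a0.
  have et1 : e < `|t| by rewrite (lt_trans _ et)// ltr_pMl// ltr1n.
  have [li|li] := boolP (l < i)%N; first by rewrite !bump_out.
  have [_|_] := boolP (l == i); last by rewrite !bump_out.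
  by rewrite ramp_out// !bump_out ?subr0.
Qed.

Lemma prod_telescope m (A B : 'I_m -> R) : \prod_l A l - \prod_l B l =
  \sum_(i < m) \prod_(l < m) (if (l < i)%N then B l else if l == i then A l - B l else A l).
Proof.
pose T (i : nat) := \prod_(l < m) (if (l < i)%N then B l else A l).
have T0 : \prod_l A l = T 0%N by apply: eq_bigr.
have Tm : \prod_l B l = T m by apply: eq_bigr => l _; rewrite ltn_ord.
rewrite T0 Tm -opprB -(telescope_sumr _ (leq0n m)) big_mkord -sumrN; apply: eq_bigr => i _.
rewrite opprB /T (bigD1 i)//= [X in _ - X](bigD1 i)//= [RHS](bigD1 i)//= ltnn ltnSn eqxx mulrBl.
congr (_ * _ - _ * _); apply: eq_bigr => l li; first by rewrite (negPf li); case: ifP.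
rewrite ltnS leq_eqVlt (negPf li).
by rewrite (_ : (l == i :> nat) = false) ?orFb; [case: ifP|apply/negbTE].
Qed.

(** Passing from scale e to 2e one variable at a time, the i-th term has the factor
    [bump e 0 - bump (2 * e) 0] in variable i. This is the derivative of the compactly supported
    difference of ramps. *)
Lemma moll_telescope e z : moll e a0 z - moll (2 * e) a0 z =
  \sum_i telek e i (incr a0 i) z.
Proof.
rewrite [LHS]prod_telescope; apply: eq_bigr => i _; apply: eq_bigr => l _.
rewrite /tele /incr /a0; have [li|li] := boolP (l < i)%N.
  by have [il|_] := eqVneq l i => //; move: li; rewrite il ltnn.
by have [->|_] := eqVneq l i.
Qed.

Lemma mtens_bound (P : 'I_n.+1 -> nat -> R -> R) a (A e : R) (b : 'I_n.+1 -> nat) z :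
  (forall l t, `|P l (a l) t| <= A / e ^+ b l) ->
  `|mtens P a z| <= A ^+ n.+1 / e ^+ (\sum_l b l).
Proof.
move=> PA; rewrite -prodrXr -prodfV -[X in _ ^+ X](card_ord n.+1) -prodr_const -big_split/=.
by rewrite /mtens /tens normr_prod; apply: ler_prod => l _; rewrite normr_ge0 PA.
Qed.

Lemma sum_incr (b : 'I_n.+1 -> nat) j : (\sum_l (incr a0 j l + b l) = (\sum_l b l).+1)%N.
Proof.
under eq_bigr do rewrite /incr /a0 addn0.
by rewrite big_split/= (bigD1 j)//= eqxx big1 ?addn0 ?add1n// => l /negPf ->.
Qed.

(** Counting exponents in dimension n + 1: each bump factor and each derivative contributes 1/e,
    while the difference of ramps is of size 1. So [telek] gains a factor e over the mollifiers. *)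
Lemma moll_bounds : exists2 C : R, 0 <= C & forall e, 0 < e -> forall z j,
  `|moll e (incr a0 j) z| <= C / e ^+ n.+2 /\
  forall i, `|telek e i a0 z| <= C / e ^+ n /\ `|telek e i (incr a0 j) z| <= C / e ^+ n.+1.
Proof.
have [B B0 hB] := @bump_le R; have [B' B'0 hB'] := @ramp_le R.
have A0 : 0 <= 2 * B + 2 * B' by rewrite addr_ge0 ?mulr_ge0.
exists ((2 * B + 2 * B') ^+ n.+1) => [|e e0 z j]; first exact: exprn_ge0.
have ei k : 0 <= (e ^+ k)^-1 by rewrite invr_ge0 exprn_ge0// ltW.
have BA : B <= 2 * B + 2 * B' by lra.
have hb m t : (m <= 2)%N -> `|bump e m t| <= (2 * B + 2 * B') / e ^+ m.+1.
  by move=> m2; rewrite (le_trans (hB _ _ _ e0 m2))// ler_wpM2r.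
have hb2 m t : (m <= 2)%N -> `|bump (2 * e) m t| <= B / e ^+ m.+1.
  move=> m2; rewrite (le_trans (hB _ _ _ _ m2)) ?mulr_gt0// ler_wpM2l//.
  rewrite lef_pV2 ?posrE ?exprn_gt0 ?mulr_gt0// lerXn2r ?nnegrE ?mulr_ge0 ?ltW//.
  by rewrite ltr_pMl// ltr1n.
have hb3 m t : (m <= 2)%N -> `|bump (2 * e) m t| <= (2 * B + 2 * B') / e ^+ m.+1.
  by move=> m2; rewrite (le_trans (hb2 _ _ m2))// ler_wpM2r.
have inc2 l : (incr a0 j l <= 1)%N by rewrite /incr /a0 addn0; case: (_ == _).
have sN : (\sum_(l < n.+1) 1 = n.+1)%N by rewrite sum_nat_const card_ord muln1.
have sn (i : 'I_n.+1) : (\sum_l (l != i) = n)%N.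
  rewrite (bigD1 i)//= eqxx add0n (eq_bigr (fun=> 1%N)) => [|l ->]//.
  by rewrite sum1_card cardC1 card_ord.
have ht i l m t : (m <= 1)%N -> `|tele e i l m t| <= (2 * B + 2 * B') / e ^+ (m + (l != i)).
  move=> m1; rewrite /tele; have [li|li] := boolP (l < i)%N.
    have -> : (l != i) = true by apply/negP => /eqP il; move: li; rewrite il ltnn.
    by rewrite addn1 hb3// ltnW// ltnS.
  have [_|_] := eqVneq l i; last by rewrite addn1 hb// ltnW// ltnS.
  rewrite addn0; case: m m1 => [|[|]]// _.
    rewrite expr0 divr1 (le_trans (ler_normB _ _))//.
    by have := hB' e t; have := hB' (2 * e) t; lra.
  rewrite (le_trans (ler_normB _ _))// (le_trans (lerD (hB _ _ _ e0 (leq0n 2)) (hb2 0 t (leq0n 2))))//.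
  by rewrite -mulrDl ler_wpM2r//; lra.
split.
  have -> : n.+2 = (\sum_l (incr a0 j l + 1))%N by rewrite sum_incr sN.
  apply: mtens_bound => l t.
  by rewrite addn1 hb// ltnW// ltnS.
move=> i; split.
  have := @mtens_bound (tele e i) a0 _ e (fun l => nat_of_bool (l != i)) z (fun l t => ht i l 0%N t isT).
  by rewrite sn.
have := @mtens_bound (tele e i) (incr a0 j) _ e (fun l => incr a0 j l + (l != i))%N z
  (fun l t => ht i l _ t (inc2 l)).
by rewrite sum_incr sn.
Qed.

Definition mass : R := \int[mu]_z moll 1 a0 z.

Lemma mass_gt0 : 0 < mass.
Proof.
have [c c0 hc] := @bump_center R.
have ik := integrable_kernel1 ler01 (kernel1_moll ltr01 (fun=> leq0n 1) : kernel1 1 (moll 1 a0) _).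
pose Q : set E := mbox (fun=> `[0 - (1/2), 0 + 1/2]%classic).
have mQ : measurable Q by apply: measurable_mbox => i; exact: measurable_itv.
have r0 : 0 <= 1 / 2 :> R by rewrite divr_ge0.
have muQ : mu Q = 1%:E by rewrite (lebesgue_rV_cube (fun=> 0) r0) mulrC divfK ?expr1n// pnatr_eq0.
have I1 : (\int[mu]_x (\1_Q x)%:E = 1%:E)%E.
  by rewrite integral_indic// setIT; exact: muQ.
have iQ1 : mu.-integrable setT (EFin \o \1_Q).
  apply/integrableP; split; first exact/measurable_EFinP/measurable_indic.
  under eq_integral do rewrite /= ger0_norm//.
  by rewrite [X in (X < _)%E]I1 ltry.
have iQ : mu.-integrable setT (EFin \o (fun z => c ^+ n.+1 * \1_Q z)).
  by have := integrableZl measurableT (c ^+ n.+1) iQ1; apply: eq_integrable.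
apply: (@lt_le_trans _ _ (\int[mu]_z (c ^+ n.+1 * \1_Q z))).
  rewrite RintegralZl// /Rintegral [X in fine X]I1 mulr1.
  exact: exprn_gt0.
apply: le_Rintegral => // z _; rewrite indicE; have [Qz|nQz] := boolP (z \in Q); last first.
  by rewrite mulr0 moll_ge0.
rewrite mulr1 /moll /mtens /tens -[X in _ ^+ X](card_ord n.+1) -prodr_const; apply: ler_prod => l _.
rewrite (ltW c0)/= hc//; move: Qz; rewrite inE => /(_ l)/=; rewrite in_itv/= ler_norml sub0r add0r.
by [].
Qed.

Definition dyad (m : nat) : R := 2^-1 ^+ m.

Lemma dyad_gt0 m : 0 < dyad m. Proof. by rewrite exprn_gt0// invr_gt0. Qed.

Lemma dyadS m : 2 * dyad m.+1 = dyad m.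
Proof. by rewrite /dyad exprS mulrA divff ?mul1r// pnatr_eq0. Qed.

(** Consecutive dyadic mollifiers differ by a divergence of compactly supported kernels, which has
    integral 0 by [dconv1]; no change of variables is involved. *)
Lemma moll_mass m : \int[mu]_z moll (dyad m) a0 z = mass.
Proof.
elim: m => [|m IH]; first by rewrite /dyad expr0.
have d0 := dyad_gt0 m.+1; have d1 := dyad_gt0 m.
have mc : measurable_fun setT (fun _ : E => 1 : R) by exact: measurable_cst.
have bc := lip_locbd (lip_cst (n := n) (1 : R)).
have kS : kernel1 (dyad m.+1) (moll (dyad m.+1) a0) _ := kernel1_moll d0 (fun=> leq0n 1).
have k0 : kernel1 (dyad m) (moll (dyad m) a0) _ := kernel1_moll d1 (fun=> leq0n 1).
have iS := integrable_kernel1 (ltW d0) kS; have i0 := integrable_kernel1 (ltW d1) k0.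
rewrite -IH; apply/eqP; rewrite -subr_eq0; apply/eqP.
rewrite -RintegralB//.
have it i : kernel1 (2 * dyad m.+1) (telek (dyad m.+1) i a0) _ := kernel1_telek i d0.
have teleE z : moll (dyad m.+1) a0 z - moll (dyad m) a0 z = \sum_i telek (dyad m.+1) i (incr a0 i) z.
  by rewrite -moll_telescope dyadS.
under eq_Rintegral do rewrite teleE.
have e20 : 0 <= 2 * dyad m.+1 by rewrite ltW// mulr_gt0.
have ii i := integrable_dkernel e20 (it i) i 0 mc bc.
have ii' i : mu.-integrable setT (EFin \o telek (dyad m.+1) i (incr a0 i)).
  have := integrable_reflect_conv (ii i).
  by apply: eq_integrable => // z _; rewrite /= mul1r.
have [_ ->] := Rintegral_sum (index_enum 'I_n.+1) ii'.
rewrite big1// => i _; rewrite -[RHS](dconv1 e20 (it i) i 0) (convE (ii i)).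
by apply: eq_Rintegral => z _; rewrite mul1r.
Qed.

Lemma dyad_cvg : dyad m @[m --> \oo] --> 0.
Proof. by apply: cvg_expr; rewrite gtr0_norm ?invr_gt0// invf_lt1// ltr1n. Qed.

Lemma diff_linform (f : E -> R) x : differentiable f x ->
  'd f x = linform (fun j => 'D_(delta_mx ord0 j) f x) :> (E -> R).
Proof.
move=> df; apply/funext => h; rewrite {1}[h]row_sum_delta linear_sum; apply: eq_bigr => j _.
by rewrite linearZ/= -deriveE// mulrC.
Qed.

(** The affine Taylor polynomial of g at y is differentiated exactly, by [dconv1] and
    [dconv_linform]. On the ball of radius r = [dyad m] the remainder is at most e' r, against a
    kernel of size r^-(n+2) and a volume of order r^(n+1). *)
Lemma moll_grad_cvg (L : R) (g : E -> R) : lip L g -> forall y j, differentiable g y ->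
  mass^-1 * conv (moll (dyad m) (incr a0 j)) g y @[m --> \oo] --> 'D_(delta_mx ord0 j) g y.
Proof.
move=> gL y j dg; have M0 := mass_gt0; have mg := lip_measurable gL; have bg := lip_locbd gL.
have Mi0 : 0 <= mass^-1 by rewrite invr_ge0 ltW.
have kS m : kernel1 (dyad m) (moll (dyad m) a0) _ := kernel1_moll (dyad_gt0 m) (fun=> leq0n 1).
have inc1 (l : 'I_n.+1) : (incr a0 j l <= 1)%N by rewrite /incr /a0 addn0; case: (_ == _).
have kj m : kernel1 (dyad m) (moll (dyad m) (incr a0 j)) _ := kernel1_moll (dyad_gt0 m) inc1.
have d0 m := ltW (dyad_gt0 m).
pose a j := 'D_(delta_mx ord0 j) g y.
have [C C0 Cb] := moll_bounds.
have mc : measurable_fun setT (fun _ : E => 1 : R) by exact: measurable_cst.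
have bc := lip_locbd (lip_cst (n := n) (1 : R)).
have ll := linform_lip a; have ml := lip_measurable ll; have bl := lip_locbd ll.
pose c := g y - linform a y.
pose r x := g x - (linform a x + c * 1).
have mr : measurable_fun setT r.
  by apply: measurable_funB => //; apply: measurable_funD => //; exact: measurable_cst.
have rE m : conv (moll (dyad m) (incr a0 j)) r y =
    conv (moll (dyad m) (incr a0 j)) g y - mass * a j.
  have i1 := integrable_dkernel (d0 m) (kS m) j y mg bg.
  have i2 := integrable_dkernel (d0 m) (kS m) j y ml bl.
  have i3 := integrable_dkernel (d0 m) (kS m) j y mc bc.
  have i3c : mu.-integrable setT (EFin \o (fun x => c * (1 * moll (dyad m) (incr a0 j) (y - x)))).
    by have := integrableZl measurableT c i3; apply: eq_integrable.
  have i23 := integrableD measurableT i2 i3c.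
  transitivity (\int[mu]_x (g x * moll (dyad m) (incr a0 j) (y - x) -
      (linform a x * moll (dyad m) (incr a0 j) (y - x) +
       c * (1 * moll (dyad m) (incr a0 j) (y - x))))).
    apply: eq_Rintegral => x _; rewrite /r; move: (moll _ _ _) (g x) (linform a x) => K G A.
    by lra.
  rewrite RintegralB//; congr (_ - _).
  rewrite RintegralD// RintegralZl//.
  have E1 : \int[mu]_x (1 * moll (dyad m) (incr a0 j) (y - x)) = 0 := dconv1 (d0 m) (kS m) j y.
  have E2 : \int[mu]_x (linform a x * moll (dyad m) (incr a0 j) (y - x)) = mass * a j.
    have := dconv_linform (d0 m) (kS m) a j y.
    by rewrite moll_mass.
  by rewrite E1 E2 mulr0 addr0.
apply/cvgrPdist_le => /= e e0.
have C1 : 0 < C * 2 ^+ n.+1 + 1 by rewrite ltr_wpDl// mulr_ge0// exprn_ge0.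
(* Chosen so that e' C 2^(n+1), divided by the mass, stays below e; the added 1 avoids a division by
   zero. *)
have e'0 : 0 < e * mass / (C * 2 ^+ n.+1 + 1) by rewrite divr_gt0 ?mulr_gt0.
have [s s0 hs] := differentiable_eps dg e'0.
have := dyad_cvg; move/cvgrPdist_lt => /(_ _ s0); apply: filterS => m.
rewrite sub0r normrN (ger0_norm (d0 m)) => ms.
set e' := e * mass / _ in e'0 hs.
have rB x : `|x - y| <= dyad m -> `|r x| <= e' * dyad m.
  move=> xy; have := hs (x - y) (le_lt_trans xy ms); rewrite subrK diff_linform// linearB/=.
  rewrite (_ : _ - _ - _ = r x); last by rewrite /r /c; lra.
  by move/le_trans; apply; rewrite ler_wpM2l// ltW.
have [K [kB [kl _] _ kr]] := kj m.
have := conv_le (d0 m) (lip_measurable kl) mr (fun z => (Cb _ (dyad_gt0 m) z j).1)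
  (fun z rz => (kr z rz).1) rB.
rewrite rE; set cv := conv _ g y => cvB.
have -> : 'D_(delta_mx ord0 j) g y - mass^-1 * cv = - (mass^-1 * (cv - mass * a j)).
  by rewrite mulrBr mulrA mulVf ?gt_eqF// mul1r opprB.
rewrite normrN normrM (ger0_norm Mi0) mulrC ler_pdivrMr//.
rewrite (le_trans cvB)//.
have dn0 : dyad m * dyad m ^+ n.+1 != 0 by rewrite mulf_neq0 ?expf_neq0 ?gt_eqF// dyad_gt0.
rewrite exprMn [dyad m ^+ n.+2]exprS.
have -> : e' * dyad m * (C / (dyad m * dyad m ^+ n.+1)) * (2 ^+ n.+1 * dyad m ^+ n.+1) =
    e' * (C * 2 ^+ n.+1) * (dyad m * dyad m ^+ n.+1 / (dyad m * dyad m ^+ n.+1)).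
  by set X := (dyad m * _)^-1; clearbody X; move: (2 ^+ _) (dyad m ^+ _) => Y Z; lra.
rewrite divff// mulr1 /e' mulrAC ler_pdivrMr// ler_wpM2l ?mulr_ge0 ?(ltW e0) ?(ltW M0)//.
by rewrite lerDl.
Qed.

(** All that the determinant inequality uses of mollification: C^2 approximations with symmetric
    second derivatives which keep the gradient and sup bounds, and whose gradients converge wherever
    g is differentiable. *)
Lemma smoothing (L : R) (g : E -> R) : lip L g ->
  exists (G : nat -> E -> R) (D : nat -> 'I_n.+1 -> E -> R)
    (DD : nat -> 'I_n.+1 -> 'I_n.+1 -> E -> R),
  [/\ forall m y, differentiable (G m) y /\ forall j, 'D_(delta_mx ord0 j) (G m) y = D m j y,
      forall m j y, differentiable (D m j) y /\
        forall l, 'D_(delta_mx ord0 l) (D m j) y = DD m j l y,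
      forall m j l, continuous (DD m j l) /\ DD m j l = DD m l j,
      forall m j y, `|D m j y| <= L &
      (forall rho : R, (forall x, `|g x| <= rho) -> forall m x, `|G m x| <= rho) /\
      (forall y j, differentiable g y -> D m j y @[m --> \oo] --> 'D_(delta_mx ord0 j) g y)].
Proof.
move=> gL; have M0 := mass_gt0; have mg := lip_measurable gL; have bg := lip_locbd gL.
have L0 := lip_ge0 gL.
have Mn0 : 0 <= mass^-1 by rewrite invr_ge0 ltW.
have kS m : kernel1 (dyad m) (moll (dyad m) a0) _ := kernel1_moll (dyad_gt0 m) (fun=> leq0n 1).
have inc1 (j l : 'I_n.+1) : (incr a0 j l <= 1)%N by rewrite /incr /a0 addn0; case: (_ == _).
have kj m j : kernel1 (dyad m) (moll (dyad m) (incr a0 j)) _ := kernel1_moll (dyad_gt0 m) (inc1 j).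
have d0 m := ltW (dyad_gt0 m).
pose G m y := mass^-1 * conv (moll (dyad m) a0) g y.
pose D m j y := mass^-1 * conv (moll (dyad m) (incr a0 j)) g y.
pose DD m j l y := mass^-1 * conv (moll (dyad m) (incr (incr a0 j) l)) g y.
have dZ (f : E -> R) (a : 'I_n.+1 -> R) y : differentiable f y -> 'd f y = linform a :> (E -> R) ->
    differentiable (fun y => mass^-1 * f y) y /\
    forall j, 'D_(delta_mx ord0 j) (fun y => mass^-1 * f y) y = mass^-1 * a j.
  move=> df fE; split=> [|j]; first exact: differentiableM.
  have dfj : derivable f y (delta_mx ord0 j) by exact: diff_derivable.
  have := deriveMl mass^-1 dfj; rewrite (deriveE _ df) fE => ->.
  by congr (_ * _); exact: linform_delta.
have GD m y : differentiable (G m) y /\ forall j, 'D_(delta_mx ord0 j) (G m) y = D m j y.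
  have [df fE] := conv_differentiable (d0 m) mg bg (kS m) y.
  exact: (dZ _ _ _ df fE).
have Glip m : lip L (G m).
  have cl := conv_lip (d0 m) (kS m) (fun z => moll_ge0 z (dyad_gt0 m)) gL.
  move=> x y; rewrite /G -mulrBr normrM (ger0_norm Mn0) mulrC ler_pdivrMr//.
  by rewrite (le_trans (cl x y))// moll_mass -mulrA mulrC.
exists G, D, DD; split => //.
- move=> m j y; have [df fE] := conv_differentiable (d0 m) mg bg (kj m j) y.
  exact: (dZ _ _ _ df fE).
- move=> m j l; split; last by rewrite /DD incrC.
  have [B [kB [kl dkl] _ kr]] := kj m j.
  have cc := conv_continuous (d0 m) mg bg (dkl l) (fun z => (kB z).2 l) (fun z rz => (kr z rz).2 l).
  by move=> x; exact: (cvgM (cvg_cst _) (cc x)).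
- move=> m j y; have [df <-] := GD m y.
  have dj : derivable (G m) y (delta_mx ord0 j) by exact: diff_derivable.
  rewrite (le_trans (derive_lip_le (Glip m) dj))// (ger0_norm L0).
  by rewrite ler_piMr// norm_delta_le.
split => [rho grho m x|y j dg].
  rewrite /G normrM (ger0_norm Mn0) mulrC ler_pdivrMr// -(moll_mass m).
  exact: (conv_bound (d0 m) (kS m) (fun z => moll_ge0 z (dyad_gt0 m)) x mg grho).
exact: moll_grad_cvg gL y j dg.
Qed.

End mollifiers.

Section continuity.
Context (R : realType) (n : nat).
Local Notation E := 'rV[R]_n.+1.

Lemma contC (c : R) : continuous (fun _ : E => c).
Proof. exact: cst_continuous. Qed.

Lemma contD (f g : E -> R) : continuous f -> continuous g -> continuous (fun x => f x + g x).
Proof. by move=> cf cg x; exact: (cvgD (cf x) (cg x)). Qed.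

Lemma contM (f g : E -> R) : continuous f -> continuous g -> continuous (fun x => f x * g x).
Proof. by move=> cf cg x; exact: (cvgM (cf x) (cg x)). Qed.

Lemma mx_continuous (p q : nat) (M : E -> 'M[R]_(p, q)) :
  (forall i j, continuous (fun x => M x i j)) -> continuous M.
Proof.
move=> cM x A [P Px PA].
have FF : Filter (nbhs x) by exact: nbhs_filter.
have H : nbhs x [set y | forall i j, P i j (M y i j)].
  have Hi i : nbhs x [set y | forall j, P i j (M y i j)].
    have Hij j : nbhs x [set y | P i j (M y i j)] by apply: (cM i j x); exact: Px.
    exact: (filter_forall FF Hij).
  exact: (filter_forall FF Hi).
by apply: filterS H => y Py; exact: PA.
Qed.

Lemma continuous_bsum (I : Type) (r : seq I) (P : pred I) (f : I -> E -> R) :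
  (forall i, continuous (f i)) -> continuous (fun x => \sum_(i <- r | P i) f i x).
Proof.
move=> cf; elim: r => [|a r IH].
  rewrite (_ : (fun y => _) = cst 0); last by apply/funext => y; rewrite big_nil.
  exact: cst_continuous.
rewrite (_ : (fun y => _) = (fun y => if P a then f a y + \sum_(i <- r | P i) f i y
  else \sum_(i <- r | P i) f i y)); last by apply/funext => y; rewrite big_cons.
by case: (P a) => //; exact: contD.
Qed.

Lemma continuous_bprod (I : Type) (r : seq I) (P : pred I) (f : I -> E -> R) :
  (forall i, continuous (f i)) -> continuous (fun x => \prod_(i <- r | P i) f i x).
Proof.
move=> cf; elim: r => [|a r IH].
  rewrite (_ : (fun y => _) = cst 1); last by apply/funext => y; rewrite big_nil.
  exact: cst_continuous.
rewrite (_ : (fun y => _) = (fun y => if P a then f a y * \prod_(i <- r | P i) f i y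
  else \prod_(i <- r | P i) f i y)); last by apply/funext => y; rewrite big_cons.
by case: (P a) => //; exact: contM.
Qed.

Lemma cvg_det (T : Type) (F : set_system T) (FF : Filter F) (m : nat)
    (A : T -> 'M[R]_m) (B : 'M[R]_m) :
  (forall i j, A t i j @[t --> F] --> B i j) -> \det (A t) @[t --> F] --> \det B.
Proof.
move=> AB; apply: cvg_big => //; first exact: add_continuous.
move=> s _; apply: cvgM; first exact: cvg_cst.
by apply: cvg_big => //; exact: mul_continuous.
Qed.

Lemma derive_prod (I : eqType) (r : seq I) (f : I -> E -> R) (x : E) :
  uniq r -> (forall i, differentiable (f i) x) ->
  differentiable (fun y => \prod_(i <- r) f i y) x /\
  forall v, 'D_v (fun y => \prod_(i <- r) f i y) x =
    \sum_(i <- r) 'D_v (f i) x * \prod_(l <- r | l != i) f l x.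
Proof.
move=> + df; elim: r => [_|a r IH /= /andP[ar ur]].
  rewrite (_ : (fun y => _) = cst 1); last by apply/funext => y; rewrite big_nil.
  by split => [|v]; [exact: differentiable_cst|rewrite derive_cst big_nil].
rewrite (_ : (fun y => _) = f a * (fun y => \prod_(i <- r) f i y)); last first.
  by apply/funext => y; rewrite big_cons.
have [d1 d2] := IH ur; split => [|v]; first exact: differentiableM.
have d3 : derivable (f a) x v by exact: diff_derivable.
have d4 : derivable (fun y => \prod_(i <- r) f i y) x v by exact: diff_derivable.
rewrite deriveM// d2 big_cons addrC; congr (_ + _).
  rewrite big_cons eqxx/= /GRing.scale/= mulrC; congr (_ * _).
  rewrite big_seq [RHS]big_seq_cond; apply: eq_bigl => l.
  by case: eqVneq => [->|]; rewrite ?andbT// (negPf ar).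
rewrite /GRing.scale/= mulr_sumr; apply: eq_big_seq => i ir.
rewrite big_cons (_ : a != i); first by rewrite mulrCA.
by apply: contraNneq ar => ->.
Qed.

Lemma derive_bsum (I : Type) (r : seq I) (f : I -> E -> R) (x : E) :
  (forall i, differentiable (f i) x) ->
  differentiable (fun y => \sum_(i <- r) f i y) x /\
  forall v, 'D_v (fun y => \sum_(i <- r) f i y) x = \sum_(i <- r) 'D_v (f i) x.
Proof.
move=> df; elim: r => [|a r [d1 d2]].
  rewrite (_ : (fun y => _) = cst 0); last by apply/funext => y; rewrite big_nil.
  by split => [|v]; [exact: differentiable_cst|rewrite derive_cst big_nil].
rewrite (_ : (fun y => _) = f a + (fun y => \sum_(i <- r) f i y)); last first.
  by apply/funext => y; rewrite big_cons.
split => [|v]; first exact: differentiableD.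
have d3 : derivable (f a) x v by exact: diff_derivable.
have d4 : derivable (fun y => \sum_(i <- r) f i y) x v by exact: diff_derivable.
by rewrite (deriveD d3 d4) d2 big_cons.
Qed.

End continuity.

(** * Jacobians as divergences *)

Section piola.
Context (R : realType) (n : nat).
Local Notation E := 'rV[R]_n.+1.
Local Notation mu := (@lebesgue_rV R n.+1).
Implicit Types x y : E.

(** A weak form of [Vtotal v <= W], tested only on fields with continuous and bounded divergence.
    For these the integrals against integrable functions are finite, so that the bounds add up
    ([tv_leD]). *)
Definition tv_le (v : E -> R) (W : R) := forall phi : E -> E,
  C1_field phi -> (forall x, enorm (phi x) <= 1) ->
  continuous (divergence phi) -> (exists B : R, forall x, `|divergence phi x| <= B) ->
  \int[mu]_x (v x * divergence phi x) <= W.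

Context (G : 'I_n.+1 -> E -> R) (D : 'I_n.+1 -> 'I_n.+1 -> E -> R)
  (DD : 'I_n.+1 -> 'I_n.+1 -> 'I_n.+1 -> E -> R).
Hypotheses (GD : forall l y, differentiable (G l) y /\
    forall j, 'D_(delta_mx ord0 j) (G l) y = D l j y)
  (DDD : forall l j y, differentiable (D l j) y /\
    forall k, 'D_(delta_mx ord0 k) (D l j) y = DD l j k y)
  (DDc : forall l j k, continuous (DD l j k) /\ DD l j k = DD l k j).

(* The i-th row of cofactors of the Jacobian matrix of G. *)
Definition cof (i j : 'I_n.+1) x : R :=
  \sum_(s : 'S_n.+1) (-1) ^+ s * ((s i == j)%:R * \prod_(l | l != i) D l (s l) x).

Definition dcof (i j k : 'I_n.+1) x : R :=
  \sum_(s : 'S_n.+1) (-1) ^+ s * ((s i == j)%:R *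
    \sum_(m | m != i) DD m (s m) k x * \prod_(l | (l != i) && (l != m)) D l (s l) x).

Lemma cof_det i x : \sum_j D i j x * cof i j x = \det (\matrix_(l, j) D l j x).
Proof.
under eq_bigr do rewrite mulr_sumr.
rewrite exchange_big/=; apply: eq_bigr => s _.
rewrite (bigD1 (s i))//= [X in _ + X]big1 ?addr0 => [|j /negPf sij].
  rewrite eqxx mul1r mulrCA; congr (_ * _); rewrite [RHS](bigD1 i)//= mxE; congr (_ * _).
  by apply: eq_bigr => l _; rewrite mxE.
by rewrite eq_sym sij mul0r !mulr0.
Qed.

Lemma cof_diff i j x : differentiable (cof i j) x /\
  forall k, 'D_(delta_mx ord0 k) (cof i j) x = dcof i j k x.
Proof.
have ds (s : 'S_n.+1) : differentiable (fun y => \prod_(l | l != i) D l (s l) y) x /\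
    forall k, 'D_(delta_mx ord0 k) (fun y => \prod_(l | l != i) D l (s l) y) x =
    \sum_(m | m != i) DD m (s m) k x * \prod_(l | (l != i) && (l != m)) D l (s l) x.
  have := @derive_prod R n _ [seq l <- index_enum 'I_n.+1 | l != i] (fun l => D l (s l)) x
    (filter_uniq _ (index_enum_uniq _)) (fun l => (DDD l (s l) x).1).
  rewrite (_ : (fun y => _) = (fun y => \prod_(l | l != i) D l (s l) y)); last first.
    by apply/funext => y; rewrite big_filter.
  move=> [d1 d2]; split => // k; rewrite d2 big_filter; apply: eq_bigr => m _.
  by rewrite (DDD _ _ _).2 big_filter_cond.
have ds' (s : 'S_n.+1) : differentiable (fun y => (-1) ^+ s * ((s i == j)%:R * \prod_(l | l != i) D l (s l) y)) x /\
    forall k, 'D_(delta_mx ord0 k) (fun y => (-1) ^+ s * ((s i == j)%:R * \prod_(l | l != i) D l (s l) y)) x =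
    (-1) ^+ s * ((s i == j)%:R *
    \sum_(m | m != i) DD m (s m) k x * \prod_(l | (l != i) && (l != m)) D l (s l) x).
  have [d1 d2] := ds s.
  have d3 : differentiable (fun y => (s i == j)%:R * \prod_(l | l != i) D l (s l) y) x.
    exact: differentiableM.
  split=> [|k]; first exact: differentiableM.
  have d1' : derivable (fun y => \prod_(l | l != i) D l (s l) y) x (delta_mx ord0 k).
    exact: diff_derivable.
  have d3' : derivable (fun y => (s i == j)%:R * \prod_(l | l != i) D l (s l) y) x (delta_mx ord0 k).
    exact: diff_derivable.
  rewrite (deriveMl _ d3') -d2; congr (_ * _); exact: (deriveMl _ d1').
have [d1 d2] := derive_bsum (index_enum _) (fun s => (ds' s).1).
by split=> // k; rewrite d2; apply: eq_bigr => s _; exact: (ds' s).2.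
Qed.

(** Composing s with the transposition of i and m flips the sign and exchanges the two indices of
    the symmetric [DD m], so each inner sum equals its own opposite. *)
Lemma piola i x : \sum_j dcof i j j x = 0.
Proof.
pose T m (s : 'S_n.+1) := DD m (s m) (s i) x * \prod_(l | (l != i) && (l != m)) D l (s l) x.
transitivity (\sum_(m | m != i) \sum_(s : 'S_n.+1) (-1) ^+ s * T m s).
  rewrite [LHS]exchange_big [RHS]exchange_big/=; apply: eq_bigr => s _.
  rewrite (bigD1 (s i))//= [X in _ + X]big1 ?addr0 => [|j /negPf sij].
    by rewrite eqxx mul1r mulr_sumr.
  by rewrite eq_sym sij mul0r !mulr0.
rewrite big1// => m mi.
have E1 : \sum_(s : 'S_n.+1) (-1) ^+ s * T m s = - \sum_(s : 'S_n.+1) (-1) ^+ s * T m s.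
  rewrite {1}(reindex_inj (mulgI (tperm i m)))/= -sumrN; apply: eq_bigr => s _.
  rewrite odd_permM odd_tperm eq_sym mi signr_addb expr1 mulN1r mulNr; congr (- (_ * _)).
  rewrite /T !permM tpermL tpermR (DDc _ _ _).2; congr (_ * _).
  by apply: eq_bigr => l /andP[li lm]; rewrite permM tpermD// eq_sym.
by move: E1; move: (\sum_s _) => A; lra.
Qed.


Context (L : 'I_n.+1 -> R) (v : E -> R) (W : R).
Hypotheses (DL : forall l j y, `|D l j y| <= L l) (iv : mu.-integrable setT (EFin \o v))
  (vW : tv_le v W).

Lemma cof_le i j x : `|cof i j x| <= n.+1`!%:R * \prod_(l | l != i) L l.
Proof.
have L0 l : 0 <= L l by rewrite (le_trans _ (DL l ord0 0)).
rewrite /cof (le_trans (ler_norm_sum _ _ _))//.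
rewrite (@le_trans _ _ (\sum_(s : 'S_n.+1) \prod_(l | l != i) L l))//; last first.
  by rewrite sumr_const -card_Sn mulr_natl lexx.
apply: ler_sum => s _; rewrite normrM normrX normrN1 expr1n mul1r normrM normr_prod.
rewrite -[leRHS]mul1r ler_pM//; first by apply: prodr_ge0.
  by case: (_ == _); rewrite ?normr1 ?normr0.
by apply: ler_prod => l _; rewrite normr_ge0 DL.
Qed.

Lemma dcof_continuous i j k : continuous (dcof i j k).
Proof.
have cD l m : continuous (D l m) by move=> y; apply: differentiable_continuous; exact: (DDD l m y).1.
apply: continuous_bsum => s; apply: contM; first exact: contC.
apply: contM; first exact: contC.
apply: (@continuous_bsum _ _ _ _ (fun m => m != i)) => m.
apply: contM; first exact: (DDc m (s m) k).1.
by apply: (@continuous_bprod _ _ _ _ (fun l => (l != i) && (l != m))) => l; exact: cD.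
Qed.

Lemma cof_continuous i j : continuous (cof i j).
Proof. by move=> y; apply: differentiable_continuous; exact: (cof_diff i j y).1. Qed.

(** The field [G i] times the i-th cofactor row has the Jacobian as divergence, the other term being
    killed by [piola]. Division by t, which dominates its Euclidean norm, makes it admissible; both
    signs give the absolute value. *)
Lemma piola_le i (rho t : R) : 0 < t -> (forall x, `|G i x| <= rho) ->
  n.+1%:R * (rho * (n.+1`!%:R * \prod_(l | l != i) L l)) <= t ->
  `|\int[mu]_x (v x * \det (\matrix_(l, j) D l j x))| <= W * t.
Proof.
move=> t0 Grho rt.
suff H (c : R) : `|c| = t^-1 -> c * \int[mu]_x (v x * \det (\matrix_(l, j) D l j x)) <= W.
  have ti0 : 0 < t^-1 by rewrite invr_gt0.
  have h1 := H t^-1 (gtr0_norm ti0).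
  have h2 : - t^-1 * \int[mu]_x (v x * \det (\matrix_(l, j) D l j x)) <= W.
    by apply: H; rewrite normrN gtr0_norm.
  move: h1 h2; move: (\int[mu]_x _) => I h1 h2.
  rewrite -ler_pdivrMr// mulrC -(gtr0_norm ti0) -normrM ler_norml h1 andbT.
  by rewrite -lerN2 opprK -mulNr.
move=> ct.
pose phi_ j x := c * (G i x * cof i j x).
pose phi x : E := \row_j phi_ j x.
have dphi_ j x : differentiable (phi_ j) x /\ forall k, 'D_(delta_mx ord0 k) (phi_ j) x =
    c * (G i x * dcof i j k x + cof i j x * D i k x).
  have [g1 g2] := GD i x; have [c1 c2] := cof_diff i j x.
  have d1 : differentiable (fun x => G i x * cof i j x) x by exact: differentiableM.
  split=> [|k]; first exact: differentiableM.
  have g1' : derivable (G i) x (delta_mx ord0 k) by exact: diff_derivable.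
  have c1' : derivable (cof i j) x (delta_mx ord0 k) by exact: diff_derivable.
  have d1' : derivable (fun x => G i x * cof i j x) x (delta_mx ord0 k) by exact: diff_derivable.
  by rewrite (deriveMl _ d1') (deriveM g1' c1') -c2 -g2.
have dphi x : differentiable phi x by apply/differentiable_rowP => j; exact: (dphi_ j x).1.
have cG : continuous (G i) by move=> y; apply: differentiable_continuous; exact: (GD i y).1.
have cD l m : continuous (D l m) by move=> y; apply: differentiable_continuous; exact: (DDD l m y).1.
have C1 : C1_field phi.
  split=> //; apply: mx_continuous => a b.
  rewrite (_ : (fun x => _) = (fun x => c * (G i x * dcof i b a x + cof i b x * D i a x))).
    apply: contM; first exact: contC.
    by apply: contD; apply: contM; [exact: cG|exact: dcof_continuous|exact: cof_continuous|exact: cD].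
  apply/funext => x; rewrite -(dphi_ b x).2 /jacobian mxE -deriveE//.
  rewrite derive_mx; last exact: diff_derivable.
  by rewrite mxE; congr ('D_ _ _ _); apply/funext => y; rewrite mxE.
have phi1 x : enorm (phi x) <= 1.
  rewrite (le_trans (enorm_le _))// -ler_pdivlMl// mulr1; apply: rV_norm_le; first by rewrite invr_ge0.
  move=> j; rewrite mxE /phi_ normrM ct ler_pdivrMl// ler_pdivlMr// mulrC.
  by rewrite (le_trans _ rt)// ler_wpM2l// normM_le// cof_le.
have divE : divergence phi = (fun x => c * \det (\matrix_(l, j) D l j x)).
  apply/funext => x; rewrite /divergence -(cof_det i).
  transitivity (\sum_j c * (G i x * dcof i j j x + cof i j x * D i j x)).
    apply: eq_bigr => j _; rewrite -(dphi_ j x).2; congr ('D_ _ _ _).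
    by apply/funext => y; rewrite mxE.
  rewrite -mulr_sumr big_split/= -mulr_sumr piola mulr0 add0r; congr (_ * _).
  by apply: eq_bigr => j _; rewrite mulrC.
have cdet : continuous (fun x => \det (\matrix_(l, j) D l j x)).
  apply: continuous_bsum => s; apply: contM; first exact: contC.
  rewrite (_ : (fun y => _) = (fun y => \prod_l D l (s l) y)); last first.
    by apply/funext => w; apply: eq_bigr => l _; rewrite mxE.
  by apply: continuous_bprod => l; exact: cD.
have bdet x : `|\det (\matrix_(l, j) D l j x)| <= n.+1`!%:R * \prod_l L l.
  by apply: det_le => l j; rewrite mxE.
have cdiv : continuous (divergence phi) by rewrite divE; apply: contM => //; exact: contC.
have bdiv : exists B : R, forall x, `|divergence phi x| <= B.
  by exists (`|c| * (n.+1`!%:R * \prod_l L l)) => x; rewrite divE normM_le.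
have := vW C1 phi1 cdiv bdiv; congr (_ <= _); rewrite -RintegralZl//; last first.
  exact: (integrable_mul_bounded iv (continuous_measurablerV cdet) bdet).
by apply: eq_Rintegral => x _; rewrite divE mulrCA.
Qed.

End piola.

Fact slot_algebra (R : realType) (W C F rho P I N K : R) :
  W * (C * (F * rho * P)) + I * (rho * (N * (K * P))) = P * (rho * (W * C * F + I * N * K)).
Proof. lra. Qed.

Section total_variation.
Context (R : realType) (n : nat).
Local Notation E := 'rV[R]_n.+1.
Local Notation mu := (@lebesgue_rV R n.+1).
Implicit Types (u v r f : E -> R) (g : 'I_n.+1 -> E -> R) (L : 'I_n.+1 -> R).

Lemma tv_le_ge0 v (W : R) : tv_le v W -> 0 <= W.
Proof.
move=> vW; pose phi (x : E) : E := 0.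
have d0 x : differentiable phi x by exact: differentiable_cst.
have C1 : C1_field phi.
  split => //; rewrite (_ : jacobian phi = cst 0); first exact: cst_continuous.
  by apply/funext => x; apply/matrixP => i j; rewrite !mxE diff_cst mxE.
have phi1 (x : E) : enorm (phi x) <= 1.
  by rewrite /enorm /phi big1 ?sqrtr0// => i _; rewrite mxE expr0n.
have divE : divergence phi = cst 0.
  apply/funext => x; rewrite /divergence big1// => i _.
  rewrite (_ : (fun y => _) = cst 0) ?derive_cst//.
  by apply/funext => y; rewrite mxE.
have := vW phi C1 phi1; rewrite divE => H.
have {H} := H (@cst_continuous _ _ _) (ex_intro _ 0 (fun=> _)).
rewrite (_ : (fun x => _) = (fun=> 0)); last by apply/funext => x; rewrite mulr0.
rewrite Rintegral_cst// mul0r; apply.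
by move=> ?; rewrite normr0.
Qed.

(** The factor [n.+1] passes from the sup norm of the cofactor field to the Euclidean one; the
    factorial counts the permutations in a cofactor. *)
Definition det_const : R := n.+1%:R * n.+1`!%:R.

Lemma det_const_ge0 : 0 <= det_const. Proof. by rewrite mulr_ge0. Qed.

(** [piola_le] for the mollified functions, then dominated convergence: their gradients converge
    almost everywhere and stay within fixed bounds. *)
Lemma tv_detD v (W : R) g L i (rho : R) : mu.-integrable setT (EFin \o v) -> tv_le v W ->
  (forall l, lip (L l) (g l)) -> (forall x, `|g i x| <= rho) ->
  `|\int[mu]_x (v x * detD g x)| <= W * (det_const * (rho * \prod_(l | l != i) L l)).
Proof.
move=> iv vW gL grho; have W0 := tv_le_ge0 vW.
have L0 l : 0 <= L l := lip_ge0 (gL l).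
have rho0 : 0 <= rho by rewrite (le_trans _ (grho 0)).
have /choice[G] := fun l => smoothing (gL l).
move=> /choice[D] /choice[DD] H.
have P0 : 0 <= \prod_(l | l != i) L l by exact: prodr_ge0.
set Bd := det_const * _; have Bd0 : 0 <= Bd by rewrite mulr_ge0 ?det_const_ge0// mulr_ge0.
have mv : measurable_fun setT v by apply/measurable_EFinP; exact: measurable_int iv.
have cD m l j : continuous (D l m j).
  by have [_ h _ _ _] := H l => y; apply: differentiable_continuous; exact: (h m j y).1.
have md m : measurable_fun setT (fun x => \det (\matrix_(l, j) D l m j x)).
  apply: continuous_measurablerV; apply: continuous_bsum => s.
  apply: contM; first exact: contC.
  rewrite (_ : (fun y => _) = (fun y => \prod_l D l m (s l) y)); last first.
    by apply/funext => w; apply: eq_bigr => l _; rewrite mxE.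
  by apply: continuous_bprod => l; exact: cD.
(* [piola_le] divides by t, and [Bd] may be 0: the bound is proved for every t > [Bd], and t then
   decreases to [Bd]. *)
have Ht (t : R) : Bd < t -> `|\int[mu]_x (v x * detD g x)| <= W * t.
  move=> Bt; have t0 := le_lt_trans Bd0 Bt.
  apply: (@cvgn_norm_le _ (fun m => \int[mu]_x (v x * \det (\matrix_(l, j) D l m j x)))); last first.
    move=> m; apply: (@piola_le R n (fun l => G l m) (fun l => D l m) (fun l => DD l m)
      _ _ _ L v W _ iv vW i rho t t0).
    - by move=> l y; have [h _ _ _ _] := H l; exact: h.
    - by move=> l j y; have [_ h _ _ _] := H l; exact: h.
    - by move=> l j k; have [_ _ h _ _] := H l; exact: h.
    - by move=> l j y; have [_ _ _ h _] := H l; exact: h.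
    - by move=> x; have [_ _ _ _ [h _]] := H i; exact: h.
    - rewrite (le_trans _ (ltW Bt))// /Bd /det_const -!mulrA ler_wpM2l//; rewrite mulrCA.
      by [].
  apply: (@Rdominated_cvg _ _ _ mu _ _ (fun x => `|v x| * (n.+1`!%:R * \prod_l L l))).
  - by move=> m; exact: measurable_funM.
  - by apply: measurable_funM => //; exact: measurable_detD gL.
  - have aeF := ae_filter_ringOfSetsType mu.
    apply: filterS (ae_differentiable gL) => x dg; apply: cvgM; first exact: cvg_cst.
    rewrite detDE//; apply: cvg_det => l j.
    rewrite mxE; under eq_fun do rewrite mxE.
    by have [_ _ _ _ [_ h]] := H l; exact: h.
  - by have := integrableZr measurableT (n.+1`!%:R * \prod_l L l) (integrable_norm iv); apply: eq_integrable.
  - move=> m x; rewrite normrM ler_wpM2l//; apply: det_le => l j; rewrite mxE.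
    by have [_ _ _ h _] := H l; exact: h.
apply/ler_addgt0Pr => e e0.
have e1 : 0 < e / (W + 1) by rewrite divr_gt0// ltr_wpDl.
rewrite (le_trans (Ht (Bd + e / (W + 1)) _)) ?ltrDl// mulrDr lerD2l mulrA ler_pdivrMr ?ltr_wpDl//.
by rewrite mulrC ler_wpM2l// ?(ltW e0)// lerDl.
Qed.

(* The product of [f] with the [i]-th function splits off a pure Jacobian, to which
   [tv_detD] applies, and a term without derivatives of that function. *)
Lemma current_slot_le v (W : R) f (F Lf : R) g L i (rho : R) :
  mu.-integrable setT (EFin \o v) -> tv_le v W ->
  lip Lf f -> (forall x, `|f x| <= F) ->
  (forall l, lip (L l) (g l)) -> (forall x, `|g i x| <= rho) ->
  `|current v f g| <= (\prod_(l | l != i) L l) * (rho *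
    (W * det_const * F + (\int[mu]_x `|v x|) * n.+1`!%:R * Lf)).
Proof.
move=> iv vW fL fF gL grho.
have L0 l : 0 <= L l := lip_ge0 (gL l).
have F0 : 0 <= F by rewrite (le_trans _ (fF 0)).
have fgL : lip (F * L i + Lf * rho) (f \* g i) := lipM fL (gL i) fF grho.
have fgB x : `|(f \* g i) x| <= F * rho by exact: normM_le.
have L1 := lip_dfwith (fun l _ => gL l) fgL (i := i).
have L2 := lip_dfwith (fun l _ => gL l) fL (i := i).
have mg : measurable_fun setT (g i) by exact: lip_measurable (gL i).
have i1 := integrable_detD L1 iv; have i2 := integrable_current L2 iv mg grho.
have E1 : current v f g = \int[mu]_x (v x * detD (dfwith g i (f \* g i)) x) -
    current v (g i) (dfwith g i f).
  have mf := lip_measurable fL.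
  have i0 := integrable_current gL iv mf fF.
  have m0 : measurable_fun setT (fun x => v x * f x * detD g x).
    by apply/measurable_EFinP; exact: measurable_int i0.
  have H0 : {ae mu, forall x, v x * f x * detD g x =
      -1 * (v x * g i x * detD (dfwith g i f) x) + v x * detD (dfwith g i (f \* g i)) x}.
    have aeF := ae_filter_ringOfSetsType mu.
    apply: filterS2 (ae_differentiable gL) (ae_differentiable (fun _ : 'I_n.+1 => fL)) => x dg df.
    have := detDM i dg (df i); move: (detD g x) (detD _ x) (detD _ x) => a b c abc.
    by rewrite mulN1r addrC -!mulrA -mulrBr abc.
  have := Rintegral_ae_lin m0 i2 i1 H0; rewrite mulN1r addrC.
  exact.
have PE K : \prod_(l | l != i) dfwith L i K l = \prod_(l | l != i) L l.
  by apply: eq_bigr => l li; rewrite dfwithout// eq_sym.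
have h1 := tv_detD iv vW L1 (i := i) (rho := F * rho).
have h2 := current_le L2 iv mg grho.
rewrite E1 (le_trans (ler_normB _ _))//.
rewrite PE in h1; rewrite (bigD1 i)//= PE dfwithin in h2.
have h3 : `|\int[mu]_x (v x * detD (dfwith g i (f \* g i)) x)| <=
    W * (det_const * (F * rho * \prod_(l | l != i) L l)).
  by apply: h1 => x; rewrite dfwithin.
rewrite (le_trans (lerD h3 h2))//.
rewrite le_eqVlt; apply/orP; left; apply/eqP; exact: slot_algebra.
Qed.

Lemma currentD v r f (F : R) g L : mu.-integrable setT (EFin \o v) ->
  mu.-integrable setT (EFin \o r) -> measurable_fun setT f -> (forall x, `|f x| <= F) ->
  (forall l, lip (L l) (g l)) ->
  current (fun x => v x + r x) f g = current v f g + current r f g.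
Proof.
move=> iv ir mf fF gL.
have i1 := integrable_current gL iv mf fF; have i2 := integrable_current gL ir mf fF.
have H0 : {ae mu, forall x, (v x + r x) * f x * detD g x =
    1 * (v x * f x * detD g x) + r x * f x * detD g x}.
  apply: aeW => x; move: (detD g x) => a; by rewrite mul1r !mulrDl.
have m0 : measurable_fun setT (fun x => (v x + r x) * f x * detD g x).
  apply: measurable_funM; last exact: measurable_detD gL.
  apply: measurable_funM => //; apply: measurable_funD.
    by apply/measurable_EFinP; exact: measurable_int iv.
  by apply/measurable_EFinP; exact: measurable_int ir.
have := Rintegral_ae_lin m0 i1 i2 H0; rewrite mul1r.
exact.
Qed.

Lemma current_linl v f1 f2 (F1 F2 a : R) g L : mu.-integrable setT (EFin \o v) ->
  measurable_fun setT f1 -> (forall x, `|f1 x| <= F1) ->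
  measurable_fun setT f2 -> (forall x, `|f2 x| <= F2) ->
  (forall l, lip (L l) (g l)) ->
  current v (fun x => a * f1 x + f2 x) g = a * current v f1 g + current v f2 g.
Proof.
move=> iv m1 F1B m2 F2B gL.
have i1 := integrable_current gL iv m1 F1B; have i2 := integrable_current gL iv m2 F2B.
have H0 : {ae mu, forall x, v x * (a * f1 x + f2 x) * detD g x =
    a * (v x * f1 x * detD g x) + v x * f2 x * detD g x}.
  by apply: aeW => x; move: (detD g x) => b; lra.
have m0 : measurable_fun setT (fun x => v x * (a * f1 x + f2 x) * detD g x).
  apply: measurable_funM; last exact: measurable_detD gL.
  apply: measurable_funM; first by apply/measurable_EFinP; exact: measurable_int iv.
  by apply: measurable_funD => //; exact: measurable_funM.
have := Rintegral_ae_lin m0 i1 i2 H0.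
exact.
Qed.

End total_variation.

Fact step_algebra1 (R : realType) (U t L N P : R) :
  U * (t * L * (N * P)) = P * (U * N * L * t).
Proof. lra. Qed.

Fact step_algebra2 (R : realType) (I M N P t W C S L : R) :
  I * (M * (N * (2 * P))) + t * P * (W * C * M + S * N * L) =
  P * (I * M * N * 2 + t * (W * C * M + S * N * L)).
Proof. lra. Qed.

(** * Currents of tuples *)

Section tuple_current.
Context (R : realType) (n : nat).
Local Notation E := 'rV[R]_n.+1.
Local Notation mu := (@lebesgue_rV R n.+1).
Local Notation tuple := ('I_n.+2 -> E -> R).
Implicit Types (u v s : E -> R) (h : tuple).

Definition tcurrent u h : R := current u (h ord0) (fun i => h (lift ord0 i)).

Lemma tcurrent_fcons u f g : tcurrent u (fcons f g) = current u f g.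
Proof.
rewrite /tcurrent {1}/fcons unlift_none/=; congr (current _ _ _).
by apply/funext => i; rewrite /fcons liftK.
Qed.

Definition bounded_lip (M : R) (f : E -> R) := (exists L, lip L f) /\ forall x, `|f x| <= M.

Lemma tcurrent_lin u h k (a M : R) f1 f2 : mu.-integrable setT (EFin \o u) ->
  (forall l, bounded_lip M (h l)) -> bounded_lip M f1 -> bounded_lip M f2 ->
  tcurrent u (dfwith h k (fun x => a * f1 x + f2 x)) =
  a * tcurrent u (dfwith h k f1) + tcurrent u (dfwith h k f2).
Proof.
move=> iu hb [[L1 f1L] f1M] [[L2 f2L] f2M].
have /choice[L hL] := fun l => (hb l).1.
case: (unliftP ord0 k) => [j ->|->]; rewrite /tcurrent.
  rewrite !dfwithout 1?eq_sym ?neq_lift//.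
  have dE F : (fun i => dfwith h (lift ord0 j) F (lift ord0 i)) =
      dfwith (fun i => h (lift ord0 i)) j F.
    apply/funext => i; have [->|ij] := eqVneq i j; first by rewrite !dfwithin.
    by rewrite !dfwithout// 1?eq_sym// (inj_eq lift_inj) eq_sym.
  rewrite !dE; apply: (current_lin iu _ (hb ord0).2 (L := fun i => L (lift ord0 i))) f1L f2L => [|l _].
    exact: lip_measurable (hL ord0).
  exact: hL.
have dE F : (fun i => dfwith h ord0 F (lift ord0 i)) = (fun i => h (lift ord0 i)).
  by apply/funext => i; rewrite dfwithout// neq_lift.
rewrite !dE !dfwithin.
exact: (current_linl a iu (lip_measurable f1L) f1M (lip_measurable f2L) f2M (fun l => hL _)).
Qed.

(** The k-th term in the telescoping of a multilinear form between h and h'. *)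
Definition hybrid h h' (k l : 'I_n.+2) : E -> R :=
  if (l < k)%N then h' l else if l == k then (fun x => -1 * h l x + h' l x) else h l.

Lemma tcurrent_telescope u h h' (M : R) : mu.-integrable setT (EFin \o u) ->
  (forall l, bounded_lip M (h l)) -> (forall l, bounded_lip M (h' l)) ->
  tcurrent u h' - tcurrent u h = \sum_k tcurrent u (hybrid h h' k).
Proof.
move=> iu hM h'M; pose T (i : nat) : tuple := fun l => if (l < i)%N then h' l else h l.
have T0 : h = T 0%N by [].
have TN : h' = T n.+2 by apply/funext => l; rewrite /T ltn_ord.
rewrite [in LHS]TN [X in _ - tcurrent _ X]T0 -(telescope_sumr (fun i => tcurrent u (T i)) (leq0n n.+2)) big_mkord.
apply: eq_bigr => k _.
have Tb i l : bounded_lip M (T i l) by rewrite /T; case: ifP.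
have hE : hybrid h h' k = dfwith (T k) k (fun x => -1 * h k x + h' k x).
  apply/funext => l; rewrite /hybrid; have [->|lk] := eqVneq l k; first by rewrite ltnn dfwithin.
  by rewrite dfwithout 1?eq_sym//.
have T1 : dfwith (T k) k (h k) = T k.
  apply/funext => l; have [->|lk] := eqVneq l k; first by rewrite dfwithin /T ltnn.
  by rewrite dfwithout 1?eq_sym//.
have T2 : dfwith (T k) k (h' k) = T k.+1.
  apply/funext => l; have [->|lk] := eqVneq l k; first by rewrite dfwithin /T ltnSn.
  rewrite dfwithout 1?eq_sym// /T ltnS [in RHS]leq_eqVlt.
  by rewrite (_ : (l == k :> nat) = false)//; exact/negbTE.
by rewrite hE (tcurrent_lin _ _ iu (Tb k) (hM k) (h'M k)) T1 T2 mulN1r addrC.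
Qed.

(** A change of f costs only the mass of u, as no derivative falls on it. A change in a Jacobian
    slot meets u - s through Lipschitz constants alone, and meets s through the smallness of the
    change, by [current_slot_le]. *)
Lemma tcurrent_step u s (W M tau : R) h h' (L : 'I_n.+2 -> R) :
  mu.-integrable setT (EFin \o u) -> mu.-integrable setT (EFin \o s) -> tv_le s W ->
  0 <= tau -> (forall l x, `|h l x| <= M) -> (forall l x, `|h' l x| <= M) ->
  (forall l, lip (L l) (h l)) -> (forall l, lip (L l) (h' l)) ->
  (forall l x, `|h' l x - h l x| <= tau * L l) ->
  `|tcurrent u h' - tcurrent u h| <= (\prod_i L (lift ord0 i)) *
    ((\int[mu]_x `|u x|) * n.+1`!%:R * L ord0 * tau + n.+1%:R *
      ((\int[mu]_x `|u x - s x|) * M * n.+1`!%:R * 2 +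
       tau * (W * det_const R n * M + (\int[mu]_x `|s x|) * n.+1`!%:R * L ord0))).
Proof.
move=> iu is_ sW tau0 hM h'M hL h'L hh'.
have L0 l : 0 <= L l := lip_ge0 (hL l).
have M0 : 0 <= M by rewrite (le_trans _ (hM ord0 0)).
have hb l : bounded_lip M (h l) by split; [exists (L l)|exact: hM].
have h'b l : bounded_lip M (h' l) by split; [exists (L l)|exact: h'M].
have hd l x : `|-1 * h l x + h' l x| <= tau * L l by rewrite mulN1r addrC.
have hdL l : lip (L l + L l) (fun x => -1 * h l x + h' l x).
  by have := lip_comb (-1) (hL l) (h'L l); rewrite normrN1 mul1r.
set P := \prod_i _; set U := \int[mu]_x `|u x|.
have P0 : 0 <= P by exact: prodr_ge0.
rewrite (tcurrent_telescope iu hb h'b) big_ord_recl mulrDr.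
rewrite (le_trans (ler_normD _ _))// lerD//.
  rewrite /tcurrent /hybrid /= (_ : (fun i => _) = (fun i => h (lift ord0 i)))//.
  rewrite (le_trans (current_le (fun l => hL _) iu (lip_measurable (hdL ord0)) (hd ord0)))//.
  rewrite -/P -/U le_eqVlt; apply/orP; left; apply/eqP; exact: step_algebra1.
set X := (X in n.+1%:R * X).
have -> : P * (n.+1%:R * X) = \sum_(k < n.+1) P * X.
  by rewrite sumr_const card_ord -[RHS]mulr_natl mulrCA.
rewrite (le_trans (ler_norm_sum _ _ _))//; apply: ler_sum => k _.
(* Slot k holds a difference, whose Lipschitz constant is only known to be at most twice that of its
   terms; this is the 2 in front of the L^1 error. *)
pose L' i := dfwith (fun i => L (lift ord0 i)) k (L (lift ord0 k) + L (lift ord0 k)) i.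
pose g i := hybrid h h' (lift ord0 k) (lift ord0 i).
have gL l : lip (L' l) (g l).
  rewrite /L' /g /hybrid; have [->|lk] := eqVneq l k.
    by rewrite ltnn eqxx dfwithin; exact: hdL.
  rewrite dfwithout 1?eq_sym//; case: ifP => _; first exact: h'L.
  case: ifP => [/eqP /lift_inj lk'|_]; last exact: hL.
  by rewrite lk' eqxx in lk.
have gk x : `|g k x| <= tau * L (lift ord0 k) by rewrite /g /hybrid ltnn eqxx; exact: hd.
have g0 : hybrid h h' (lift ord0 k) ord0 = h' ord0 by rewrite /hybrid /=.
have ius : mu.-integrable setT (EFin \o (fun x => u x - s x)) by exact: (integrableB measurableT iu is_).
have -> : tcurrent u (hybrid h h' (lift ord0 k)) = current (fun x => u x - s x) (h' ord0) g +
    current s (h' ord0) g.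
  rewrite -(currentD ius is_ (lip_measurable (h'L ord0)) (h'M ord0) gL) /tcurrent g0.
  by congr (current _ _ _); apply/funext => x; rewrite subrK.
have P1 : \prod_l L' l = 2 * P.
  rewrite (bigD1 k)//= /L' dfwithin /P [in RHS](bigD1 k)//= -mulr2n mulrA mulr_natl; congr (_ * _).
  by apply: eq_bigr => l lk; rewrite dfwithout// eq_sym.
have P2 : (\prod_(l | l != k) L' l) * (tau * L (lift ord0 k)) = tau * P.
  have PE : \prod_(l | l != k) L' l = \prod_(l | l != k) L (lift ord0 l).
    by apply: eq_bigr => l lk; rewrite /L' dfwithout// eq_sym.
  by rewrite PE /P [in RHS](bigD1 k)//= mulrCA [X in _ * X]mulrC.
have h1 := current_le gL ius (lip_measurable (h'L ord0)) (h'M ord0).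
have h2 := current_slot_le is_ sW (h'L ord0) (h'M ord0) gL gk.
rewrite P1 in h1; rewrite mulrA P2 in h2.
rewrite (le_trans (ler_normD _ _))// (le_trans (lerD h1 h2))// /X.
rewrite le_eqVlt; apply/orP; left; apply/eqP.
exact: step_algebra2.
Qed.

End tuple_current.

(** * Powers of two and regularization levels *)

Section powers.
Context (R : realType).
Implicit Types (a b c t g : R).

Lemma pow2D a b : 2 `^ (a + b) = 2 `^ a * 2 `^ b :> R.
Proof. by rewrite powRD// pnatr_eq0 implybT. Qed.

Lemma pow2_gt0 a : 0 < 2 `^ a :> R. Proof. exact: powR_gt0. Qed.

Lemma pow2M (j : nat) a : 2 `^ (j%:R * a) = (2 `^ a) ^+ j :> R.
Proof. by rewrite mulrC powRrM powR_mulrn// powR_ge0. Qed.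

Lemma pow2_gt1 a : 0 < a -> 1 < 2 `^ a :> R.
Proof.
have h : 1 `^ a = 1 :> R by rewrite powR1.
by move=> a0; rewrite -[ltLHS]h gt0_ltr_powR ?nnegrE// ltr1n.
Qed.

Lemma pow2_lt1 a : a < 0 -> 2 `^ a < 1 :> R.
Proof.
move=> a0; rewrite -[a]opprK powRN invf_lt1 ?pow2_gt0// pow2_gt1//.
by rewrite oppr_gt0.
Qed.

Lemma pow2N1 : 2 `^ (-1) = 2^-1 :> R.
Proof. exact: powR_inv1. Qed.

Lemma pow2_le a b : a <= b -> 2 `^ a <= 2 `^ b :> R.
Proof. by move=> ab; rewrite ler_powR// ler1n. Qed.

Lemma pow2_ge1 a : 0 <= a -> 1 <= 2 `^ a :> R.
Proof. by move=> a0; rewrite -[leLHS](powRr0 2) pow2_le. Qed.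

Lemma pow2_sum (I : Type) (r : seq I) (f : I -> R) :
  2 `^ (\sum_(i <- r) f i) = \prod_(i <- r) 2 `^ f i :> R.
Proof.
elim: r => [|i r IH]; first by rewrite !big_nil powRr0.
by rewrite !big_cons pow2D IH.
Qed.

Lemma powR_le1D t g : 0 <= t -> 0 <= g <= 1 -> t `^ g <= t + 1.
Proof.
move=> t0 /andP[g0 g1]; have [t1|t1] := leP t 1.
  have := @ge0_ler_powR _ g g0 t 1; rewrite !nnegrE powR1 => /(_ t0 ler01 t1) h.
  by rewrite (le_trans h)// lerDr.
rewrite (le_trans (y := t)) ?lerDl//.
by rewrite ler1_powR// ltW.
Qed.

Lemma powR_modulus (Lam g : R) : 0 <= Lam -> 0 < g <= 1 -> modulus (fun t => Lam * t `^ g).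
Proof.
move=> L0 /andP[g0 g1]; split.
- by rewrite powR0 ?mulr0// gt_eqF.
- by move=> t t0; rewrite mulr_ge0// powR_ge0.
- by move=> s t s0 st; rewrite ler_wpM2l// ge0_ler_powR// ?nnegrE// ?(ltW g0)// (le_trans s0).
- move=> s t s0 t0; rewrite -mulrDr ler_wpM2l//.
  have := addr_ge0 s0 t0; rewrite le_eqVlt => /orP[/eqP st0|st0].
    by rewrite -st0 powR0 ?gt_eqF// addr_ge0// powR_ge0.
  (* The quotients s/(s+t) and t/(s+t) lie in [0, 1], where x <= x^g, and they add up to 1. *)
  have H r : 0 <= r -> r <= s + t -> r / (s + t) * (s + t) `^ g <= r `^ g.
    move=> r0 rst; rewrite {2}(_ : r = r / (s + t) * (s + t)); last by rewrite divfK// gt_eqF.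
    rewrite powRM ?divr_ge0 ?(ltW st0)// ler_wpM2r ?powR_ge0//.
    move: r0; rewrite le_eqVlt => /orP[/eqP <-|r0]; first by rewrite mul0r powR_ge0.
    by rewrite ger1_powR// divr_gt0//= ler_pdivrMr// mul1r.
  have := lerD (H s s0 _) (H t t0 _).
  rewrite -mulrDl -mulrDl divff ?gt_eqF// mul1r; apply.
    by rewrite lerDl.
  by rewrite lerDr.
Qed.

Lemma pow_large (b L : R) : 1 < b -> exists J : nat, L <= b ^+ J.
Proof.
move=> b1; have b0 : 0 < b by rewrite (lt_trans ltr01).
have Z : (b^-1) ^+ j @[j --> \oo] --> 0 by apply: cvg_expr; rewrite gtr0_norm ?invr_gt0// invf_lt1.
have L1 : 0 < (`|L| + 1)^-1 by rewrite invr_gt0 ltr_wpDl.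
have [J _ /(_ J (leqnn J))] := (cvgrPdist_le _ _).1 Z _ L1.
rewrite /= sub0r normrN ger0_norm ?exprn_ge0 ?invr_ge0 ?(ltW b0)// exprVn => h; exists J.
move: h; rewrite lef_pV2 ?posrE ?exprn_gt0 ?ltr_wpDl//; apply: le_trans.
by rewrite (le_trans (ler_norm _))// lerDl.
Qed.

End powers.

Section levels.
Context (R : realType) (n : nat).
Local Notation E := 'rV[R]_n.+1.
Implicit Types (M Lam g : R) (f : E -> R).

Definition holder Lam g f := forall x y, `|f x - f y| <= Lam * `|x - y| `^ g.

Definition level Lam g (j : nat) f : E -> R := infconv (fun t => Lam * (2 `^ (1 - g)) ^+ j * t) f.

Section facts.
Context (M Lam g : R) (j : nat) (f : E -> R).
Hypotheses (Lam1 : 1 <= Lam) (g01 : 0 < g <= 1) (fM : forall x, `|f x| <= M).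

Lemma slope_ge1 : 1 <= Lam * (2 `^ (1 - g)) ^+ j.
Proof.
rewrite -[leLHS]mulr1 ler_pM// exprn_ege1// pow2_ge1// subr_ge0.
by have /andP[] := g01.
Qed.

Let mw : modulus (fun t => Lam * (2 `^ (1 - g)) ^+ j * t).
Proof. by apply: modulus_linear; rewrite (le_trans ler01)// slope_ge1. Qed.

Let fm x : - M <= f x. Proof. by have := fM x; rewrite ler_norml => /andP[]. Qed.

Lemma level_lip : lip (Lam * (2 `^ (1 - g)) ^+ j) (level Lam g j f).
Proof. by move=> x y; exact: (infconv_lip mw fm). Qed.

Lemma level_le x : level Lam g j f x <= f x.
Proof. exact: (infconv_le_id mw fm). Qed.

Lemma level_bound x : `|level Lam g j f x| <= M.
Proof.
rewrite ler_norml (infconv_lb mw fm)/= (le_trans (level_le x))//.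
by have := fM x; rewrite ler_norml => /andP[].
Qed.

Lemma level_ge x : holder Lam g f ->
  f x - 2^-1 ^+ j * (Lam * (2 `^ (1 - g)) ^+ j) <= level Lam g j f x.
Proof.
move=> fh; have /andP[g0 g1] := g01; apply: infconv_ge => y.
have Lam0 : 0 <= Lam by rewrite (le_trans ler01).
have := fh x y; rewrite ler_norml => /andP[_]; rewrite lerBlDr => h.
set t := `|x - y| in h *; have t0 : 0 <= t by rewrite normr_ge0.
set b := (2 `^ (1 - g)) ^+ j; set tau := 2^-1 ^+ j.
have b0 : 0 <= b by rewrite exprn_ge0// powR_ge0.
have tau0 : 0 <= tau by rewrite exprn_ge0// invr_ge0.
have tauE : 2 ^+ j * tau = 1 by rewrite /tau -exprMn divff ?pnatr_eq0// expr1n.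
have tauG : tau `^ g = tau * b.
  rewrite /tau -pow2N1 -exprMn -pow2D -!pow2M -powRrM.
  congr (2 `^ _); lra.
(* This is x^g <= x + 1 at x = 2^j t, rescaled: t^g exceeds the slope term by at most 2^(-j g), so
   no competitor y undercuts f by more than [Lam] times that. *)
have key : t `^ g <= b * t + tau * b.
  rewrite {1}(_ : t = (2 ^+ j * t) * tau); last by rewrite mulrAC tauE mul1r.
  rewrite powRM ?mulr_ge0 ?exprn_ge0// tauG.
  rewrite (le_trans (ler_wpM2r (mulr_ge0 tau0 b0) (powR_le1D (t := 2 ^+ j * t) (g := g) _ _))) ?mulr_ge0 ?exprn_ge0 ?(ltW g0)//.
  by rewrite mulrDl mul1r lerD2r mulrACA [2 ^+ j * _ * _]mulrC tauE mulr1 mulrC.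
have k2 := ler_wpM2l Lam0 key.
rewrite lerBlDr (le_trans h)// addrC -addrA lerD2l (le_trans k2)//.
by rewrite mulrDr mulrA lerD2l mulrCA.
Qed.

Lemma level_id L : lip L f -> L <= Lam * (2 `^ (1 - g)) ^+ j -> level Lam g j f = f.
Proof.
move=> fL Lj; apply/funext => x; apply/eqP; rewrite eq_le level_le/=.
apply: infconv_ge => y; have := fL x y; rewrite ler_norml => /andP[_]; rewrite lerBlDr addrC => h.
by rewrite (le_trans h)// lerD2l ler_wpM2r.
Qed.

End facts.

Lemma level_near (M Lam g rho : R) (j : nat) f f' : 1 <= Lam -> 0 < g <= 1 ->
  (forall x, `|f x| <= M) -> (forall x, `|f' x| <= M) ->
  (forall x, `|f' x - f x| <= rho) ->
  forall x, `|level Lam g j f' x - level Lam g j f x| <= rho.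
Proof.
move=> Lam1 g01 fM f'M ff'.
have H (f1 f2 : E -> R) x : (forall x, `|f1 x| <= M) -> (forall x, `|f2 x| <= M) ->
    (forall x, `|f2 x - f1 x| <= rho) -> level Lam g j f2 x - rho <= level Lam g j f1 x.
  move=> f1M f2M f12; apply: infconv_ge => y.
  have := infconv_le (modulus_linear (le_trans ler01 (slope_ge1 j Lam1 g01))) (m := - M) (h := f2) _ x y.
  move=> /(_ _) h; rewrite lerBlDr (le_trans (h _))//.
    by move=> z; have := f2M z; rewrite ler_norml => /andP[].
  have := f12 y; rewrite ler_norml => /andP[_]; rewrite lerBlDr => h'.
  by rewrite [leRHS]addrAC lerD2r addrC.
move=> x; rewrite ler_norml lerBrDl lerBlDr.
have h1 := H f f' x fM f'M ff'.
have h2 : level Lam g j f x - rho <= level Lam g j f' x.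
  by apply: H => // y; rewrite distrC.
by rewrite -lerBlDr h2/= lerBlDl -lerBlDr.
Qed.

(** A Lipschitz function is fixed by an inf-convolution of larger slope. The slopes tend to infinity
    unless g = 1, and then the Hoelder bound already gives the Lipschitz constant [Lam]. *)
Lemma level_stationary (M Lam g L : R) f : 1 <= Lam -> 0 < g <= 1 -> (forall x, `|f x| <= M) ->
  holder Lam g f -> lip L f -> exists J : nat, forall j, (J <= j)%N -> level Lam g j f = f.
Proof.
move=> Lam1 g01 fM fh fL; have /andP[g0 g1] := g01.
have Lam0 : 0 <= Lam by rewrite (le_trans ler01).
move: g1; rewrite le_eqVlt => /orP[/eqP g1|g1].
  exists 0%N => j _; apply: (level_id Lam1 g01 fM (L := Lam)).
    by move=> x y; rewrite (le_trans (fh x y))// g1 powRr1.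
  by rewrite g1 subrr powRr0 expr1n mulr1.
have b1 : 1 < 2 `^ (1 - g) :> R by rewrite pow2_gt1// subr_gt0.
have [J hJ] := pow_large L b1.
exists J => j Jj; apply: (level_id Lam1 g01 fM fL).
rewrite (le_trans hJ)// -[leLHS]mul1r ler_pM ?exprn_ge0 ?powR_ge0//.
by rewrite ler_eXn2l.
Qed.

End levels.

Fact rate_algebra (R : realType) (P U N L t D I M S S0 W Cd a b : R) :
  0 <= U -> 0 <= N -> 0 <= D -> 0 <= M -> 0 <= Cd -> 0 <= P * L * t -> 0 <= S0 ->
  P * L * t <= a -> P * I <= b -> P * t * W <= b -> S <= S0 ->
  P * (U * N * L * t + D * (I * M * N * 2 + t * (W * Cd * M + S * N * L))) <=
  U * N * a + D * (b * M * N * 2 + (b * Cd * M + S0 * N * a)).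
Proof.
move=> U0 N0 D0 M0 Cd0 PLt0 S00 ha hb hb' hS.
rewrite (_ : P * _ = U * N * (P * L * t) + D * ((P * I) * (M * N * 2) +
  ((P * t * W) * (Cd * M) + S * (N * (P * L * t))))); last by lra.
move: (P * L * t) PLt0 ha => X X0 ha.
apply: lerD; first by rewrite ler_wpM2l ?mulr_ge0.
rewrite ler_wpM2l//.
have -> : b * M * N * 2 = b * (M * N * 2) by lra.
apply: lerD; first by rewrite ler_wpM2r ?mulr_ge0.
have -> : b * Cd * M = b * (Cd * M) by lra.
apply: lerD; first by rewrite ler_wpM2r ?mulr_ge0.
rewrite -[leRHS]mulrA (le_trans (ler_wpM2r (mulr_ge0 N0 X0) hS))//.
by rewrite ler_wpM2l// ler_wpM2l.
Qed.

Fact rate_algebra2 (R : realType) (A L U N D C M Cd S q : R) :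
  U * N * (A * L * q) + D * (A * C * q * M * N * 2 + (A * C * q * Cd * M + S * N * (A * L * q))) =
  A * (U * N * L + D * (C * M * N * 2 + C * Cd * M + S * N * L)) * q.
Proof. lra. Qed.

Fact exponent_algebra (R : realType) (a c g : R) : a - c + (1 - g) + -1 = a - (g + c).
Proof. lra. Qed.

Fact level_algebra (R : realType) (t L B b : R) : 0 <= t -> 0 <= L -> 0 <= B -> b <= 2 ->
  2^-1 * t * (L * (b * B)) <= t * (2 * L * B).
Proof.
move=> t0 L0 B0 b2.
have -> : 2^-1 * t * (L * (b * B)) = (t * L * B) * (b / 2) by lra.
have -> : t * (2 * L * B) = (t * L * B) * 2 by lra.
by rewrite ler_wpM2l ?mulr_ge0//; lra.
Qed.

Fact sandwich_algebra (R : realType) (f H H' d d' c : R) : H <= f -> H' <= f -> f - d <= H ->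
  f - d' <= H' -> d' <= c -> d <= c -> - c <= H' - H <= c.
Proof. by move=> *; apply/andP; split; lra. Qed.

Fact rate_algebra4 (R : realType) (A P L B T : R) : A * L * (P * B * T) = A * P * (L * B) * T.
Proof. lra. Qed.

Fact rate_algebra5 (R : realType) (A P T C Y : R) : A * C * (P * Y * T) = A * P * T * (C * Y).
Proof. lra. Qed.

Fact rate_algebra6 (R : realType) (P U N L r D I M w S : R) :
  P * (U * N * L * r + D * (I * M * N * 2 + r * (w + S * N * L))) =
  D * (P * I * M * N * 2) + r * (P * (U * N * L + D * (w + S * N * L))).
Proof. lra. Qed.

Fact rate_algebra7 (R : realType) (D a X Y : R) : 0 <= D -> 0 <= X -> 0 <= Y ->
  D * a <= X + D * (a + Y).
Proof. by move=> D0 X0 Y0; rewrite mulrDr addrCA lerDl addr_ge0// mulr_ge0. Qed.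

Fact telescope_algebra (R : realType) (K q a b : R) : 1 - q != 0 ->
  K / (1 - q) * (b - a) + K * a = K / (1 - q) * (b - q * a).
Proof.
move=> q1; have -> : b - q * a = (b - a) + (1 - q) * a by lra.
rewrite [RHS]mulrDr; congr (_ + _).
by rewrite mulrA divfK.
Qed.

Fact uc_algebra (R : realType) (a k x r e : R) : 0 <= x -> (a + a + k + 1) * x <= e / 2 ->
  r <= e / 2 -> a * x + (k * x + r) + a * x <= e.
Proof. by move=> x0 h1 h2; lra. Qed.

(** * Uniform continuity of currents on Hoelder classes *)

Section uniform_continuity.
Context (R : realType) (n : nat).
Local Notation E := 'rV[R]_n.+1.
Local Notation mu := (@lebesgue_rV R n.+1).
Local Notation tuple := ('I_n.+2 -> E -> R).
Implicit Types (h : tuple).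

Context (u : E -> R) (gam : 'I_n.+2 -> R) (delta C : R).
Hypotheses (iu : mu.-integrable setT (EFin \o u)) (gam01 : forall l, 0 < gam l <= 1)
  (C0 : 0 <= C) (deltaN : delta < n.+1%:R)
  (hdec : forall j : nat, exists s, [/\ mu.-integrable setT (EFin \o s),
     \int[mu]_x `|u x - s x| <= C * (2 `^ (delta - n.+1%:R)) ^+ j &
     tv_le s (C * (2 `^ (delta - n%:R)) ^+ j)])
  (gamN : n.+1%:R < \sum_l gam l) (gamd : delta < \sum_i gam (lift ord0 i)).

Definition lip_holder (M Lam : R) h := forall l, [/\ exists L, lip L (h l),
  forall x, `|h l x| <= M & holder Lam (gam l) (h l)].

Definition lev (Lam : R) j h : tuple := fun l => level Lam (gam l) j (h l).

Let b l : R := 2 `^ (1 - gam l).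

Let b_ge1 l : 1 <= b l.
Proof. by rewrite pow2_ge1// subr_ge0; have /andP[] := gam01 l. Qed.

Let b_le2 l : b l <= 2.
Proof.
rewrite -[leRHS]powRr1// pow2_le// gerBl ltW//.
by have /andP[] := gam01 l.
Qed.

(** Here [r1] is the geometric ratio for moving f, and [r2] the common ratio of the L^1 and
    variation terms; [gamN] and [gamd] put them below 1. *)
Let r1 : R := 2 `^ (n.+1%:R - \sum_l gam l).
Let r2 : R := 2 `^ (delta - \sum_i gam (lift ord0 i)).
Let q : R := Num.max r1 r2.

Let q0 : 0 < q. Proof. by rewrite lt_max pow2_gt0. Qed.
Let q1 : q < 1. Proof. by rewrite gt_max !pow2_lt1 ?subr_lt0. Qed.

Let p : R := \prod_(i < n.+1) b (lift ord0 i).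

Let pE : p = 2 `^ (n.+1%:R - \sum_i gam (lift ord0 i)).
Proof.
rewrite /p -pow2_sum; congr (2 `^ _).
by rewrite big_split/= sumrN sumr_const card_ord.
Qed.

Let pb0 : p * b ord0 * 2^-1 = r1.
Proof.
rewrite pE -pow2N1 /b -!pow2D /r1 [in RHS]big_ord_recl; congr (2 `^ _); exact: exponent_algebra.
Qed.

Let px : p * 2 `^ (delta - n.+1%:R) = r2.
Proof. by rewrite pE -pow2D /r2; congr (2 `^ _); lra. Qed.

Let py : p * 2 `^ (delta - n%:R) * 2^-1 = r2.
Proof.
rewrite pE -pow2N1 -!pow2D /r2; congr (2 `^ _).
by rewrite -natr1; lra.
Qed.

Let U := \int[mu]_x `|u x|.

Let U0 : 0 <= U. Proof. by apply: Rintegral_ge0 => x _. Qed.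

Let S0 : R := U + C.

Lemma dec_bound (s : E -> R) j : mu.-integrable setT (EFin \o s) ->
  \int[mu]_x `|u x - s x| <= C * (2 `^ (delta - n.+1%:R)) ^+ j -> \int[mu]_x `|s x| <= S0.
Proof.
move=> is_ us.
have ius : mu.-integrable setT (EFin \o (fun x => u x - s x)) by exact: (integrableB measurableT iu is_).
have iu' := integrable_norm iu; have ius' := integrable_norm ius; have is' := integrable_norm is_.
have h : \int[mu]_x `|u x - s x| <= C.
  rewrite (le_trans us)// ler_piMr// exprn_ile1 ?powR_ge0// ltW// pow2_lt1// subr_lt0//.
rewrite (le_trans _ (lerD (lexx U) h))// /U -RintegralD//.
apply: le_Rintegral => //; first exact: (integrableD measurableT iu' ius').
by move=> x _; rewrite -{1}(subrK (u x) (s x)) addrC distrC (le_trans (ler_normD _ _))// normrN.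
Qed.

Lemma step_bound (M Lam : R) (j : nat) (tau : R) h h' : 0 <= M -> 1 <= Lam -> 0 <= tau ->
  (forall l x, `|h l x| <= M) -> (forall l x, `|h' l x| <= M) ->
  (forall l, lip (2 * Lam * b l ^+ j) (h l)) -> (forall l, lip (2 * Lam * b l ^+ j) (h' l)) ->
  (forall l x, `|h' l x - h l x| <= tau * (2 * Lam * b l ^+ j)) ->
  exists (s : E -> R) (W I : R), [/\ (0 <= \int[mu]_x `|s x| <= S0),
   I <= C * (2 `^ (delta - n.+1%:R)) ^+ j, 0 <= I,
   W = C * (2 `^ (delta - n%:R)) ^+ j &
  `|tcurrent u h' - tcurrent u h| <= ((2 * Lam) ^+ n.+1 * p ^+ j) *
    (U * n.+1`!%:R * (2 * Lam * b ord0 ^+ j) * tau + n.+1%:R *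
      (I * M * n.+1`!%:R * 2 +
       tau * (W * det_const R n * M + (\int[mu]_x `|s x|) * n.+1`!%:R * (2 * Lam * b ord0 ^+ j))))].
Proof.
move=> M0 Lam1 tau0 hM h'M hL h'L hh'.
have [s [is_ us sW]] := hdec j.
exists s, (C * (2 `^ (delta - n%:R)) ^+ j), (\int[mu]_x `|u x - s x|).
have h1 := tcurrent_step iu is_ sW tau0 hM h'M hL h'L hh'.
split=> //.
- apply/andP; split; last exact: dec_bound us.
  by apply: Rintegral_ge0 => x _.
- by apply: Rintegral_ge0 => x _.
rewrite (le_trans h1)//.
have -> : \prod_(i < n.+1) (2 * Lam * b (lift ord0 i) ^+ j) = (2 * Lam) ^+ n.+1 * p ^+ j; last by [].
by rewrite big_split/= prodr_const card_ord /p prodrXl.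
Qed.

Let Nf : R := n.+1`!%:R.
Let D : R := n.+1%:R.

(** The second estimate compares the same level of two nearby tuples. The part u - s gains nothing
    from their closeness and leaves [K * q ^+ j]; [Kj] may grow with j, since j will be fixed before
    rho. *)
Lemma lev_rate (M Lam : R) : 0 <= M -> 1 <= Lam -> exists2 K : R, 0 <= K &
  (forall h j, lip_holder M Lam h -> `|tcurrent u (lev Lam j.+1 h) - tcurrent u (lev Lam j h)| <= K * q ^+ j) /\
  forall j, exists2 Kj : R, 0 <= Kj & forall h h' (rho : R), 0 <= rho -> lip_holder M Lam h -> lip_holder M Lam h' ->
    (forall l x, `|h' l x - h l x| <= rho) ->
    `|tcurrent u (lev Lam j h') - tcurrent u (lev Lam j h)| <= K * q ^+ j + rho * Kj.
Proof.
move=> M0 Lam1; have Lam0 : 0 <= Lam by rewrite (le_trans ler01).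
have L20 : 0 <= 2 * Lam by rewrite mulr_ge0.
pose A := (2 * Lam) ^+ n.+1; have A0 : 0 <= A by rewrite exprn_ge0.
have S00 : 0 <= S0 by rewrite addr_ge0.
have Nf0 : 0 <= Nf by rewrite ler0n.
have Cd0 := det_const_ge0 R n.
exists (A * (U * Nf * (2 * Lam) + D * (C * M * Nf * 2 + C * det_const R n * M + S0 * Nf * (2 * Lam)))).
  by rewrite !(mulr_ge0, addr_ge0).
have bj l j : 1 <= b l ^+ j by rewrite exprn_ege1.
have bj0 l j : 0 <= b l ^+ j by rewrite (le_trans ler01).
have p0 : 0 <= p by apply: prodr_ge0 => i _; rewrite powR_ge0.
have levM j h l x : lip_holder M Lam h -> `|lev Lam j h l x| <= M.
  by move=> hL; have [_ hM _] := hL l; exact: level_bound.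
have levL j h l : lip_holder M Lam h -> lip (2 * Lam * b l ^+ j) (lev Lam j h l).
  move=> hL x y; have [_ hM _] := hL l; have lL := level_lip j Lam1 (gam01 l) hM x y.
  rewrite (le_trans lL)// ler_wpM2r// ler_wpM2r//.
  by rewrite ler_peMl// ler1n.
(* As [b l <= 2], the slopes of level j + 1 also obey the bound [2 * Lam * b l ^+ j]: this is why
   the constants carry a 2. *)
have levL' j h l : lip_holder M Lam h -> lip (2 * Lam * b l ^+ j) (lev Lam j.+1 h l).
  move=> hL x y; have [_ hM _] := hL l; have lL := level_lip j.+1 Lam1 (gam01 l) hM x y.
  rewrite (le_trans lL)// ler_wpM2r// exprS mulrA ler_wpM2r//.
  by rewrite mulrC ler_wpM2r// b_le2.
have r1q j : r1 ^+ j <= q ^+ j by rewrite lerXn2r ?nnegrE ?powR_ge0 ?(ltW q0)// le_max lexx.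
have r2q j : r2 ^+ j <= q ^+ j by rewrite lerXn2r ?nnegrE ?powR_ge0 ?(ltW q0)// le_max lexx orbT.
have PI j I : I <= C * (2 `^ (delta - n.+1%:R)) ^+ j -> A * p ^+ j * I <= A * C * q ^+ j.
  move=> hI; rewrite (le_trans (ler_wpM2l (mulr_ge0 A0 (exprn_ge0 _ p0)) hI))//.
  rewrite mulrACA -exprMn px ler_wpM2l ?mulr_ge0//.
split=> [h j hL|j].
  have tau0 : 0 <= 2^-1 ^+ j :> R by rewrite exprn_ge0// invr_ge0.
  have hd l x : `|lev Lam j.+1 h l x - lev Lam j h l x| <= 2^-1 ^+ j * (2 * Lam * b l ^+ j).
    have [_ hM hh] := hL l.
    have a1 := level_le j Lam1 (gam01 l) hM x; have a2 := level_le j.+1 Lam1 (gam01 l) hM x.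
    have a3 := level_ge j Lam1 (gam01 l) x hh; have a4 := level_ge j.+1 Lam1 (gam01 l) x hh.
    have a5 : 2^-1 ^+ j.+1 * (Lam * b l ^+ j.+1) <= 2^-1 ^+ j * (2 * Lam * b l ^+ j).
      by rewrite !exprS; apply: level_algebra.
    have a6 : 2^-1 ^+ j * (Lam * b l ^+ j) <= 2^-1 ^+ j * (2 * Lam * b l ^+ j).
      by rewrite ler_wpM2l// ler_wpM2r// ler_peMl// ler1n.
    by rewrite /lev ler_norml; exact: (sandwich_algebra a1 a2 a3 a4 a5 a6).
  have [s [W [I [/andP[s0 sS] IC I0 WE]]]] := step_bound M0 Lam1 tau0
    (fun l x => levM j h l x hL) (fun l x => levM j.+1 h l x hL)
    (fun l => levL j h l hL) (fun l => levL' j h l hL) hd.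
  move=> /le_trans; apply; rewrite -/A -/Nf -/D -rate_algebra2.
  apply: rate_algebra => //.
  - by rewrite !mulr_ge0// exprn_ge0.
  - rewrite -rate_algebra4 -!exprMn pb0 ler_wpM2l ?mulr_ge0//.
  - exact: PI.
  - by rewrite WE -rate_algebra5 -!exprMn py ler_wpM2l ?mulr_ge0.
have [Kj Kj0 hK] : exists2 Kj : R, 0 <= Kj & (A * p ^+ j) *
    (U * Nf * (2 * Lam * b ord0 ^+ j) + D *
       (C * (2 `^ (delta - n%:R)) ^+ j * det_const R n * M + S0 * Nf * (2 * Lam * b ord0 ^+ j))) = Kj.
  by eexists; [|reflexivity]; rewrite !(mulr_ge0, addr_ge0, exprn_ge0)// powR_ge0.
exists Kj => // h h' rho rho0 hL h'L hh'.
have hd l x : `|lev Lam j h' l x - lev Lam j h l x| <= rho * (2 * Lam * b l ^+ j).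
  have [_ hM _] := hL l; have [_ h'M _] := h'L l.
  rewrite (le_trans (level_near j Lam1 (gam01 l) hM h'M (hh' l) x))// ler_peMr//.
  by rewrite -[leLHS]mulr1 ler_pM// -[leLHS]mulr1 ler_pM// ler1n.
have [s [W [I [/andP[s0 sS] IC I0 WE]]]] := step_bound M0 Lam1 rho0
    (fun l x => levM j h l x hL) (fun l x => levM j h' l x h'L)
    (fun l => levL j h l hL) (fun l => levL j h' l h'L) hd.
move=> /le_trans; apply; rewrite -/A -/Nf -/D -hK WE.
rewrite rate_algebra6; apply: lerD; last first.
  rewrite ler_wpM2l// ler_wpM2l ?mulr_ge0 ?exprn_ge0// lerD2l ler_wpM2l// lerD2l.
  by rewrite ler_wpM2r ?mulr_ge0// ler_wpM2r.
rewrite -rate_algebra2 (le_trans (y := D * (A * C * q ^+ j * M * Nf * 2)))//.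
  by rewrite ler_wpM2l// -!mulrA mulrA mulrA [in leRHS]mulrA [in leRHS]mulrA ler_wpM2r ?mulr_ge0// PI.
have qj0 : 0 <= q ^+ j by rewrite exprn_ge0// ltW.
by apply: rate_algebra7; rewrite ?addr_ge0// !mulr_ge0.
Qed.

Lemma lev_stationary (M Lam : R) h : 1 <= Lam -> lip_holder M Lam h ->
  exists J : nat, forall i, (J <= i)%N -> lev Lam i h = h.
Proof.
move=> Lam1 hL.
have H l : exists J : nat, forall j, (J <= j)%N -> level Lam (gam l) j (h l) = h l.
  have [[L hl] hM hh] := hL l; exact: level_stationary Lam1 (gam01 l) hM hh hl.
have [J hJ] := choice H; exists (\max_l J l) => i Ji.
apply/funext => l; apply: hJ; rewrite (leq_trans _ Ji)//; exact: leq_bigmax.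
Qed.

(** Compare each tuple with its level j, and the two levels with each other. Lipschitz tuples
    coincide with their levels from some index on, so the telescoping sums are finite. *)
Lemma tcurrent_uniform_continuity (M Lam e : R) : 0 <= M -> 1 <= Lam -> 0 < e ->
  exists2 rho : R, 0 < rho & forall h h', lip_holder M Lam h -> lip_holder M Lam h' ->
    (forall l x, `|h' l x - h l x| <= rho) -> `|tcurrent u h' - tcurrent u h| <= e.
Proof.
move=> M0 Lam1 e0; have [K K0 [hA hB]] := lev_rate M0 Lam1.
have q1' : 1 - q != 0 by rewrite subr_eq0 eq_sym lt_eqF.
have Kq0 : 0 <= K / (1 - q) by rewrite divr_ge0// subr_ge0 ltW.
have qj0 j : 0 <= q ^+ j by rewrite exprn_ge0// ltW.
have T h j m : lip_holder M Lam h ->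
    `|tcurrent u (lev Lam (j + m) h) - tcurrent u (lev Lam j h)| <= K / (1 - q) * (q ^+ j - q ^+ (j + m)).
  move=> hL; elim: m => [|m IH]; first by rewrite addn0 !subrr normr0 mulr0.
  rewrite addnS [q ^+ _.+1]exprS -telescope_algebra// [leRHS]addrC.
  rewrite (_ : tcurrent u (lev Lam (j + m).+1 h) - _ = (tcurrent u (lev Lam (j + m).+1 h) -
    tcurrent u (lev Lam (j + m) h)) + (tcurrent u (lev Lam (j + m) h) - tcurrent u (lev Lam j h))).
    by apply: normD_le => //; exact: hA.
  by rewrite addrA subrK.
have T' h j : lip_holder M Lam h -> `|tcurrent u h - tcurrent u (lev Lam j h)| <= K / (1 - q) * q ^+ j.
  move=> hL; have [J hJ] := lev_stationary Lam1 hL.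
  have := T h j J hL; rewrite hJ ?leq_addl//; move/le_trans; apply.
  by rewrite ler_wpM2l// gerBl.
(* Two tails [K / (1 - q)], the error K at level j, and 1 for positivity. *)
pose Q : R := K / (1 - q) + K / (1 - q) + K + 1.
have Q0 : 0 < Q by rewrite ltr_wpDl ?addr_ge0.
have [j hj] : exists j : nat, Q * q ^+ j <= e / 2.
  have qi : 1 < q^-1 by rewrite invf_gt1.
  have [j hj] := pow_large (2 * Q / e) qi; exists j.
  move: hj; rewrite exprVn -[X in _ <= X]mul1r ler_pdivlMr ?exprn_gt0// mulrAC ler_pdivrMr// mul1r.
  by rewrite ler_pdivlMr// -mulrA [_ * 2]mulrC mulrA.
have [Kj Kj0 hKj] := hB j.
exists (e / 2 / (Kj + 1)) => [|h h' hL h'L hh']; first by rewrite !divr_gt0// ltr_wpDl.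
have rho0 : 0 <= e / 2 / (Kj + 1) by rewrite !divr_ge0 ?(ltW e0)// addr_ge0.
have h1 := T' h j hL; have h2 := T' h' j h'L; have h3 := hKj h h' _ rho0 hL h'L hh'.
have h4 : e / 2 / (Kj + 1) * Kj <= e / 2.
  by rewrite mulrAC ler_pdivrMr ?ltr_wpDl// ler_wpM2l ?lerDl// divr_ge0// ltW.
rewrite (_ : tcurrent u h' - tcurrent u h = (tcurrent u h' - tcurrent u (lev Lam j h')) +
  (tcurrent u (lev Lam j h') - tcurrent u (lev Lam j h)) + - (tcurrent u h - tcurrent u (lev Lam j h))); last first.
  by rewrite opprB !addrA subrK subrK.
have h1' : `|- (tcurrent u h - tcurrent u (lev Lam j h))| <= K / (1 - q) * q ^+ j.
  rewrite normrN; exact: h1.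
apply: (le_trans (normD_le (normD_le h2 h3) h1')).
exact: (uc_algebra (qj0 j) hj h4).
Qed.

End uniform_continuity.

(** * Extension to Hoelder tuples *)

Section locality.
Context (R : realType) (n : nat).
Local Notation E := 'rV[R]_n.+1.
Local Notation mu := (@lebesgue_rV R n.+1).
Local Notation tuple := ('I_n.+2 -> E -> R).
Implicit Types (h : tuple).

(** A point off K lies in a rational cube on which u vanishes almost everywhere, and there are only
    countably many such cubes. *)
Lemma ess_support_ae (u : E -> R) (K : set E) : ess_support u `<=` K ->
  {ae mu, forall x, ~ K x -> u x = 0}.
Proof.
move=> uK.
pose good p := {ae mu, forall y, ratbox p y -> u y = 0}.
have H : {ae mu, forall y, forall p : 'rV[rat]_n.+1 * nat, good p -> ratbox p y -> u y = 0}.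
  apply: ae_forall_count => p.
  have aeF := ae_filter_ringOfSetsType mu.
  have [gp|ngp] := pselect (good p); last exact: aeW.
  by apply: filterS gp => y uy _.
have aeF := ae_filter_ringOfSetsType mu.
apply: filterS H => x ux nKx.
have nx : ~ ess_support u x by move=> /uK.
have [U /not_implyP[Ux /contrapT uU]] := (existsNP _).2 nx.
have [p [px pU]] := open_ratbox Ux.
apply: ux px; have aeF' := ae_filter_ringOfSetsType mu.
by apply: filterS uU => y uy /pU; exact: uy.
Qed.

Lemma clip_norm (rho t : R) : 0 <= rho -> `|Num.max (- rho) (Num.min rho t)| <= rho.
Proof.
move=> r0; rewrite ler_norml le_max lexx/= ge_max ge_min lexx/= andbT; lra.
Qed.

Lemma clip_id (rho t : R) : `|t| <= rho -> Num.max (- rho) (Num.min rho t) = t.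
Proof. by rewrite ler_norml => /andP[t1 t2]; rewrite (min_idPr t2) (max_idPr t1). Qed.

Context (gam : 'I_n.+2 -> R) (u : E -> R) (K : set E).
Hypotheses (iu : mu.-integrable setT (EFin \o u)) (gam01 : forall l, 0 < gam l <= 1)
  (uK : {ae mu, forall x, ~ K x -> u x = 0}).
Hypothesis UC : forall M Lam e : R, 0 <= M -> 1 <= Lam -> 0 < e ->
  exists2 rho : R, 0 < rho & forall h h', lip_holder gam M Lam h -> lip_holder gam M Lam h' ->
    (forall l x, `|h' l x - h l x| <= rho) -> `|tcurrent u h' - tcurrent u h| <= e.

Lemma tcurrent_near h h' : (forall l, exists L, lip L (h l)) -> (forall l, exists L, lip L (h' l)) ->
  (forall x l, K x -> \forall y \near x, h l y = h' l y) -> tcurrent u h = tcurrent u h'.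
Proof.
move=> /choice[L hL] /choice[L' h'L] hh'.
apply: (current_near iu _ _ (fun l => hL _) (fun l => h'L _) uK).
- exact: lip_measurable (hL ord0).
- exact: lip_measurable (h'L ord0).
- by move=> x /hh' => /(_ ord0) /nbhs_singleton.
- by move=> x l Kx; exact: hh'.
Qed.

Lemma lip_holder_W (M M' Lam Lam' : R) h : M <= M' -> Lam <= Lam' -> lip_holder gam M Lam h -> lip_holder gam M' Lam' h.
Proof.
move=> MM' LL' hL l; have [h1 h2 h3] := hL l; split => // [x|x y].
  exact: le_trans (h2 x) MM'.
by rewrite (le_trans (h3 x y))// ler_wpM2r// powR_ge0.
Qed.

(* Truncating [h' - h] at twice its size on K leaves [h] near K. *)
Lemma tcurrent_uniform_continuity_on (M Lam e : R) : 0 <= M -> 1 <= Lam -> 0 < e ->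
  exists2 rho : R, 0 < rho & forall h h', lip_holder gam M Lam h -> lip_holder gam M Lam h' ->
    (forall l x, K x -> `|h' l x - h l x| <= rho) -> `|tcurrent u h' - tcurrent u h| <= e.
Proof.
move=> M0 Lam1 e0.
(* The truncated tuple is bounded by M + 2 rho with rho <= 1, and combines three functions of
   Hoelder constant [Lam]. *)
have M20 : 0 <= M + 2 by rewrite addr_ge0.
have Lam3 : 1 <= 3 * Lam by lra.
have [rho1 rho10 H] := UC M20 Lam3 e0.
pose rho := Num.min 1 (rho1 / 2).
have rho0 : 0 < rho by rewrite lt_min ltr01 divr_gt0.
have rho20 : 0 <= 2 * rho by rewrite mulr_ge0// ltW.
exists rho => // h h' hL h'L hh'.
pose c (t : R) := Num.max (- (2 * rho)) (Num.min (2 * rho) t).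
have cl s t : `|c s - c t| <= `|s - t| by apply: clip_lip; lra.
pose h2 : tuple := fun l x => h' l x - c (h' l x - h l x).
have E1 l x y : h2 l x - h2 l y = (h' l x - h' l y) + - (c (h' l x - h l x) - c (h' l y - h l y)).
  by rewrite /h2; move: (c _) (c _) => a b; lra.
have E2 l x y : h' l x - h l x - (h' l y - h l y) = (h' l x - h' l y) + - (h l x - h l y) by lra.
have h2L : lip_holder gam (M + 2) (3 * Lam) h2.
  move=> l; have [[L1 l1] b1 o1] := hL l; have [[L2 l2] b2 o2] := h'L l; split.
  - exists (L2 + (L2 + L1)) => x y; rewrite E1 mulrDl normD_le// normrN (le_trans (cl _ _))//.
    by rewrite E2 mulrDl normD_le// normrN.
  - move=> x; rewrite normD_le// normrN (le_trans (clip_norm _ rho20))//.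
    by rewrite -[leRHS]mulr1 ler_wpM2l// ge_min lexx.
  - move=> x y; rewrite E1 (_ : 3 * Lam = Lam + (Lam + Lam)); last by lra.
    rewrite mulrDl normD_le// normrN (le_trans (cl _ _))//.
    by rewrite E2 mulrDl normD_le// normrN.
have h'L2 : lip_holder gam (M + 2) (3 * Lam) h' by apply: lip_holder_W h'L; lra.
have -> : tcurrent u h = tcurrent u h2.
  apply: tcurrent_near => [l|l|x l Kx].
  - by have [] := hL l.
  - by have [] := h2L l.
  have [[L1 l1] _ _] := hL l; have [[L2 l2] _ _] := h'L l.
  have L10 := lip_ge0 l1; have L20 := lip_ge0 l2.
  apply/nbhs_ballP; exists (rho / (L2 + L1 + 1)); first by rewrite /= divr_gt0// ltr_wpDl// addr_ge0.
  move=> y; rewrite -ball_normE/= ltr_pdivlMr ?ltr_wpDl ?addr_ge0// => xy.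
  rewrite /h2 /c clip_id; first by rewrite subKr.
  have -> : h' l y - h l y = (h' l x - h l x) - (h' l x - h l x - (h' l y - h l y)) by lra.
  rewrite (_ : 2 * rho = rho + rho); last by lra.
  rewrite normD_le ?hh'// normrN E2 (le_trans _ (ltW xy))//.
  rewrite mulrDr mulr1 mulrC (le_trans (y := (L2 + L1) * `|x - y|)) ?lerDl//.
  by rewrite mulrDl normD_le// normrN.
apply: (H h2 h' h2L h'L2) => l x; rewrite /h2 subKr (le_trans (clip_norm _ rho20))//.
by rewrite mulrC -ler_pdivlMr// ge_min lexx orbT.
Qed.

Definition on_bounds (M Lam : R) h := forall l,
  (forall x, K x -> `|h l x| <= M) /\
  (forall x y, K x -> K y -> `|h l x - h l y| <= Lam * `|x - y| `^ gam l).

(** Inf-convolution commutes with translations: a competitor z for y becomes z + (x - y) for x, at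
    the cost of the Hoelder bound of f. *)
Lemma level_holder (M Lam g : R) j (f : E -> R) : 1 <= Lam -> 0 < g <= 1 -> (forall x, `|f x| <= M) ->
  holder Lam g f -> holder Lam g (level Lam g j f).
Proof.
move=> Lam1 g01 fM fh.
have mw := modulus_linear (le_trans ler01 (slope_ge1 j Lam1 g01)).
have fm x : - M <= f x by have := fM x; rewrite ler_norml => /andP[].
have H x y : level Lam g j f x - level Lam g j f y <= Lam * `|x - y| `^ g.
  rewrite lerBlDr -lerBlDl; apply: infconv_ge => z; rewrite lerBlDl.
  rewrite (le_trans (infconv_le mw fm x (z + (x - y))))//.
  rewrite (_ : x - (z + (x - y)) = y - z); last by rewrite opprD opprB addrA addrAC addrCA subrr addr0 addrC.
  rewrite [leRHS]addrA lerD2r -lerBlDr.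
  have := fh (z + (x - y)) z; rewrite (addrC z) addrK.
  by apply: le_trans; exact: ler_norm.
by move=> x y; rewrite ler_norml H andbT lerNl opprB distrC.
Qed.

(** Each entry is extended from K by the McShane formula with modulus Lam t^gam, then made Lipschitz
    by passing to a level j, with error Lam 2^(-j gam). *)
Lemma on_approx (M Lam rho : R) h : 0 <= M -> 1 <= Lam -> 0 < rho -> on_bounds M Lam h ->
  exists2 a, lip_holder gam M Lam a & forall l x, K x -> `|a l x - h l x| <= rho.
Proof.
move=> M0 Lam1 rho0 hb; have Lam0 : 0 <= Lam by rewrite (le_trans ler01).
suff H l : exists f : E -> R, [/\ exists L, lip L f, forall x, `|f x| <= M, holder Lam (gam l) f &
    forall x, K x -> `|f x - h l x| <= rho].
  have [a aP] := choice H.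
  exists a => [l|l x Kx]; first by have [? ? ? _] := aP l; split.
  by have [_ _ _] := aP l; exact.
have [hM hh] := hb l; have g01 := gam01 l; have /andP[g0 g1] := g01.
(* M is the largest admissible value, so points off K never lower the infimum at a point of K. *)
pose hM' x := if pselect (K x) then h l x else M.
have hM'b x : `|hM' x| <= M by rewrite /hM'; case: pselect => Kx; [exact: hM|rewrite ger0_norm].
have hm x : - M <= hM' x by have := hM'b x; rewrite ler_norml => /andP[].
have mw := powR_modulus Lam0 g01.
pose ext := infconv (fun t => Lam * t `^ gam l) hM'.
have extM x : `|ext x| <= M.
  rewrite ler_norml (infconv_lb mw hm)/= (le_trans (infconv_le_id mw hm x))//.
  by have := hM'b x; rewrite ler_norml => /andP[].
have exth : holder Lam (gam l) ext by move=> x y; exact: (infconv_lip mw hm).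
have extK x : K x -> ext x = h l x.
  move=> Kx; apply/eqP; rewrite eq_le; apply/andP; split.
    rewrite (le_trans (infconv_le_id mw hm x))// /hM'.
    by case: pselect.
  apply: infconv_ge => y; rewrite /hM'; case: pselect => Ky /=.
    have := hh x y Kx Ky; rewrite ler_norml => /andP[_]; rewrite lerBlDr addrC.
    exact.
  have := hM x Kx; rewrite ler_norml => /andP[_ h1].
  by rewrite (le_trans h1)// lerDl mulr_ge0// powR_ge0.
have [j hj] : exists j : nat, 2^-1 ^+ j * (Lam * (2 `^ (1 - gam l)) ^+ j) <= rho.
  have [j hj] := pow_large (Lam / rho) (pow2_gt1 g0); exists j.
  have -> : 2^-1 ^+ j * (Lam * (2 `^ (1 - gam l)) ^+ j) = Lam * (2 `^ (gam l))^-1 ^+ j.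
    rewrite mulrCA -exprMn -powRN -pow2N1 -pow2D; congr (_ * (2 `^ _) ^+ _); lra.
  move: hj; rewrite ler_pdivrMr// exprVn => hj.
  by rewrite ler_pdivrMr ?exprn_gt0 ?pow2_gt0// mulrC.
exists (level Lam (gam l) j ext); split.
- by exists (Lam * (2 `^ (1 - gam l)) ^+ j); exact: level_lip Lam1 g01 extM.
- exact: level_bound Lam1 g01 extM.
- exact: level_holder Lam1 g01 extM exth.
- move=> x Kx; rewrite -extK// distrC ger0_norm ?subr_ge0 ?(level_le j Lam1 g01 extM)//.
  rewrite (le_trans _ hj)// lerBlDr -lerBlDl.
  exact: level_ge Lam1 g01 _ exth.
Qed.

(* t is the value at h of the continuous extension. *)
Definition ext_val h (t : R) := forall M Lam e : R, 0 <= M -> 1 <= Lam -> 0 < e ->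
  exists2 rho : R, 0 < rho & forall a, lip_holder gam M Lam a ->
    (forall l x, K x -> `|a l x - h l x| <= rho) -> `|tcurrent u a - t| <= e.

Lemma ext_val_unique (M Lam : R) h t t' : 0 <= M -> 1 <= Lam -> on_bounds M Lam h ->
  ext_val h t -> ext_val h t' -> t = t'.
Proof.
move=> M0 Lam1 hb ht ht'; apply/eqP; rewrite -subr_eq0 -normr_le0; apply/ler_addgt0Pr => e e0.
have e20 : 0 < e / 2 by rewrite divr_gt0.
have [r1 r10 h1] := ht M Lam _ M0 Lam1 e20; have [r2 r20 h2] := ht' M Lam _ M0 Lam1 e20.
have r0 : 0 < Num.min r1 r2 by rewrite lt_min r10.
have [a aL ah] := on_approx M0 Lam1 r0 hb.
have a1 : `|tcurrent u a - t| <= e / 2 by apply: h1 => // l x Kx; rewrite (le_trans (ah l x Kx))// ge_min lexx.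
have a2 : `|tcurrent u a - t'| <= e / 2 by apply: h2 => // l x Kx; rewrite (le_trans (ah l x Kx))// ge_min lexx orbT.
rewrite distrC in a1; rewrite add0r (splitr e).
have -> : t - t' = (t - tcurrent u a) + (tcurrent u a - t') by rewrite addrA subrK.
exact: normD_le.
Qed.

Lemma ext_val_exists (M Lam : R) h : 0 <= M -> 1 <= Lam -> on_bounds M Lam h ->
  exists t, ext_val h t.
Proof.
move=> M0 Lam1 hb.
have rk (k : nat) : 0 < k.+1%:R^-1 :> R by rewrite invr_gt0.
have H (k : nat) : exists a, lip_holder gam M Lam a /\ forall l x, K x -> `|a l x - h l x| <= k.+1%:R^-1.
  by have [b b1 b2] := on_approx M0 Lam1 (rk k) hb; exists b.
have [a aP] := choice H.
have small (r : R) : 0 < r -> exists N : nat, forall k, (N <= k)%N -> k.+1%:R^-1 <= r.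
  move=> r0; have [N _ hN] := near_infty_natSinv_lt (PosNum r0).
  by exists N => k Nk; rewrite ltW//; exact: hN.
have close M' Lam' b (r1 r2 : R) k : lip_holder gam M' Lam' b ->
    (forall l x, K x -> `|b l x - h l x| <= r1) -> k.+1%:R^-1 <= r2 ->
    forall l x, K x -> `|b l x - a k l x| <= r1 + r2.
  move=> bL bh kr l x Kx; rewrite -(subrK (h l x) (b l x)) -addrA normD_le ?bh//.
  by rewrite distrC (le_trans ((aP k).2 l x Kx)).
have cv : cvgn (fun k => tcurrent u (a k)).
  apply: cauchy_cvg; apply: cauchy_exP => e e0.
  have e20 : 0 < e / 2 by rewrite divr_gt0.
  have [rho rho0 hr] := tcurrent_uniform_continuity_on M0 Lam1 e20.
  have r20 : 0 < rho / 2 by rewrite divr_gt0.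
  have [N hN] := small _ r20; exists (tcurrent u (a N)); exists N => // k /= Nk.
  rewrite -ball_normE /ball_/= (@le_lt_trans _ _ (e / 2)) ?gtr_pMr ?invf_lt1 ?ltr1n//.
  apply: hr; [exact: (aP k).1|exact: (aP N).1|move=> l x Kx].
  rewrite [leRHS](splitr rho); apply: (close M Lam) => //; first exact: (aP N).1.
    by move=> l' x' Kx'; rewrite (le_trans ((aP N).2 l' x' Kx'))// hN.
  exact: hN.
exists (lim (tcurrent u (a k) @[k --> \oo])) => M' Lam' e M'0 Lam'1 e0.
have e20 : 0 < e / 2 by rewrite divr_gt0.
(* Adding the bounds puts the approximating sequence and the competitor in one class, to which
   uniform continuity applies. *)
have [rho rho0 hr] := @tcurrent_uniform_continuity_on (M + M') (Lam + Lam') (e / 2)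
  (addr_ge0 M0 M'0) (ler_wpDl (le_trans ler01 Lam1) Lam'1) e20.
have r20 : 0 < rho / 2 by rewrite divr_gt0.
exists (rho / 2) => // b bL bh; have [N hN] := small _ r20.
have : forall k, (N <= k)%N -> `|tcurrent u b - tcurrent u (a k)| <= e.
  move=> k Nk; rewrite (le_trans (y := e / 2))//; last by rewrite ler_piMr ?(ltW e0)// invf_le1// ler1n.
  apply: hr.
  - apply: lip_holder_W (aP k).1; [by rewrite lerDl|by rewrite lerDl (le_trans ler01)].
  - apply: lip_holder_W bL; [by rewrite lerDr|by rewrite lerDr (le_trans ler01)].
  - by move=> l x Kx; rewrite [leRHS](splitr rho); apply: (close M' Lam' b) => //; exact: hN.
move=> hk.
have nc : `|tcurrent u b - tcurrent u (a k)| @[k --> \oo] --> `|tcurrent u b - lim (tcurrent u (a k) @[k --> \oo])|.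
  by apply: cvg_norm; apply: cvgB => //; exact: cvg_cst.
rewrite -(cvg_lim _ nc)//; apply: limr_le; first exact: cvgP nc.
by exists N.
Qed.

End locality.

Section bounds.
Context (R : realType) (n : nat).
Local Notation E := 'rV[R]_n.+1.
Implicit Types (K : set E).

Lemma uniform_cvgP K (f_ : nat -> E -> R) (f : E -> R) :
  {uniform K, f_ @ \oo --> f} <->
  forall rho : R, 0 < rho -> exists k0 : nat, forall k, (k0 <= k)%N ->
    forall x, K x -> `|f_ k x - f x| < rho.
Proof.
split=> [ff rho rho0|H P /uniform_nbhs[A [entA AP]]].
  have : nbhs (f : {uniform` K -> R}) [set h | forall y, K y -> `|h y - f y| < rho].
    apply/uniform_nbhs; exists [set xy | ball xy.1 rho xy.2]; split; first exact: (entourage_ball _ (PosNum rho0)).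
    by move=> h /= hf y Ky; have := hf y Ky; rewrite -ball_normE/= distrC.
  by move=> /ff [k0 _ hk0]; exists k0 => k k0k x Kx; exact: hk0.
move: entA; rewrite -entourage_ballE => -[/= rho rho0 hrho].
have [k0 hk0] := H rho rho0; exists k0 => // k /= k0k; apply: AP => y Ky.
apply: hrho; rewrite -ball_normE/= distrC; exact: hk0.
Qed.

Lemma Lip_on_le K (c g : R) (f : E -> R) : 0 < g <= 1 -> (Lip_on K g f <= c%:E)%E ->
  forall x y, K x -> K y -> `|f x - f y| <= `|c| * n.+1%:R * `|x - y| `^ g.
Proof.
move=> /andP[g0 g1] fc x y Kx Ky; have [->|xy] := eqVneq x y.
  by rewrite !subrr normr0 !mulr_ge0// powR_ge0.
have xy0 : 0 < `|x - y| by rewrite normr_gt0 subr_eq0.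
have e0 : 0 < enorm (x - y) := lt_le_trans xy0 (enorm_ge _).
have h : `|f x - f y| / enorm (x - y) `^ g <= c.
  rewrite -lee_fin (le_trans _ fc)//; apply: ereal_sup_ubound.
  by exists (x, y) => /=.
rewrite ler_pdivrMr ?powR_gt0// in h; rewrite (le_trans h)//.
rewrite (le_trans (y := `|c| * enorm (x - y) `^ g))//; last first.
  rewrite -mulrA ler_wpM2l//.
  rewrite (le_trans (y := (n.+1%:R * `|x - y|) `^ g))//.
    by rewrite ge0_ler_powR ?nnegrE ?(ltW g0) ?(ltW e0) ?mulr_ge0// enorm_le.
  rewrite powRM// ler_wpM2r ?powR_ge0//.
  by rewrite ler1_powR// ler1n.
by rewrite ler_wpM2r ?powR_ge0// ler_norm.
Qed.

Lemma lt_pinfty_le (x : \bar R) : (x < +oo)%E -> exists c : R, (x <= c%:E)%E.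
Proof. by case: x => [r _|//|_]; [exists r|exists 0; exact: leNye]. Qed.

Lemma lipschitzR_lip (f : E -> R) : lipschitzR f -> exists L, lip L f.
Proof.
move=> /lt_pinfty_le[c fc]; exists (`|c| * n.+1%:R) => x y.
have g1 : (0 < 1 :> R) && (1 <= 1 :> R) by rewrite ltr01 lexx.
by have := Lip_on_le g1 fc (x := x) (y := y) Logic.I Logic.I; rewrite powRr1.
Qed.

Lemma compact_norm_le K : compact K -> exists2 D : R, 0 <= D & forall x, K x -> `|x| <= D.
Proof.
move=> /compact_bounded bK; have [D D0 hD] := pinfty_ex_gt0 bK.
by exists D => //; exact: ltW.
Qed.

End bounds.

Fact multilinear_algebra (R : realType) (a c1 c2 c3 t1 t2 t3 d : R) : `|c1 - t1| <= d ->
  `|c2 - t2| <= d -> `|c3 - t3| <= d -> c1 = a * c2 + c3 ->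
  `|t1 - (a * t2 + t3)| <= d * (2 + `|a|).
Proof.
move=> k1 k2 k3 cE.
have -> : t1 - (a * t2 + t3) = - (c1 - t1) + (a * (c2 - t2) + (c3 - t3)) by rewrite cE; lra.
have k1' : `|- (c1 - t1)| <= d by rewrite normrN.
rewrite (le_trans (normD_le k1' (normD_le (normM_le (lexx `|a|) k2) k3)))//.
by move: `|a| => A; lra.
Qed.

Fact dist_le (R : realType) (c t1 t2 d1 d2 : R) : `|c - t1| <= d1 -> `|c - t2| <= d2 ->
  `|t2 - t1| <= d1 + d2.
Proof.
move=> h1; rewrite distrC => h2.
by rewrite -(subrK c t2) -addrA addrC normD_le.
Qed.

(** * The extended functional and its properties *)

Section extension.
Context (R : realType) (n : nat).
Local Notation E := 'rV[R]_n.+1.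
Local Notation mu := (@lebesgue_rV R n.+1).
Local Notation tuple := ('I_n.+2 -> E -> R).
Implicit Types (h : tuple).

Context (gam : 'I_n.+2 -> R) (u : E -> R) (K : set E).
Hypotheses (iu : mu.-integrable setT (EFin \o u)) (gam01 : forall l, 0 < gam l <= 1)
  (uK : {ae mu, forall x, ~ K x -> u x = 0}) (cK : compact K).
Hypothesis UC : forall M Lam e : R, 0 <= M -> 1 <= Lam -> 0 < e ->
  exists2 rho : R, 0 < rho & forall h h', lip_holder gam M Lam h -> lip_holder gam M Lam h' ->
    (forall l x, `|h' l x - h l x| <= rho) -> `|tcurrent u h' - tcurrent u h| <= e.

Lemma on_bounds_W (M M' Lam Lam' : R) h : M <= M' -> Lam <= Lam' ->
  on_bounds gam K M Lam h -> on_bounds gam K M' Lam' h.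
Proof.
move=> MM' LL' hb l; have [h1 h2] := hb l; split=> [x Kx|x y Kx Ky].
  by rewrite (le_trans (h1 x Kx)).
by rewrite (le_trans (h2 x y Kx Ky))// ler_wpM2r// powR_ge0.
Qed.

Lemma Lip_on_bounds (c : 'I_n.+2 -> R) (B : R) h :
  (forall l, (Lip_on K (gam l) (h l) <= (c l)%:E)%E) ->
  (forall l x, K x -> `|h l x| <= B) ->
  on_bounds gam K B (1 + \sum_l `|c l| * n.+1%:R) h.
Proof.
move=> hc hB l; split=> [x Kx|x y Kx Ky]; first exact: hB.
rewrite (le_trans (Lip_on_le (gam01 l) (hc l) Kx Ky))// ler_wpM2r ?powR_ge0//.
rewrite (bigD1 l)//= addrCA lerDl; apply: addr_ge0 => //.
by apply: sumr_ge0 => i _; exact: mulr_ge0.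
Qed.

Lemma holder_on_bounds h : holder_on K gam h ->
  exists M Lam : R, [/\ 0 <= M, 1 <= Lam & on_bounds gam K M Lam h].
Proof.
move=> hh; have [c hc] := choice (fun l => lt_pinfty_le (hh l)).
have [D D0 hD] := compact_norm_le cK.
have [[x0 Kx0]|K0] := pselect (exists x, K x); last first.
  exists 0, (1 + \sum_l `|c l| * n.+1%:R); split => //.
    by rewrite lerDl sumr_ge0// => l _; exact: mulr_ge0.
  by apply: Lip_on_bounds => // l x Kx; exfalso; apply: K0; exists x.
(* K has diameter at most [D + D] and t^g <= t + 1; summing over l gives one bound for all
   entries. *)
pose B := \sum_l (`|h l x0| + `|c l| * n.+1%:R * (D + D + 1)).
have B0 l : 0 <= `|h l x0| + `|c l| * n.+1%:R * (D + D + 1).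
  by rewrite addr_ge0// !mulr_ge0// !addr_ge0.
exists B, (1 + \sum_l `|c l| * n.+1%:R); split.
- by apply: sumr_ge0.
- by rewrite lerDl sumr_ge0// => l _; exact: mulr_ge0.
apply: Lip_on_bounds => // l x Kx.
rewrite (le_trans (y := `|h l x0| + `|c l| * n.+1%:R * (D + D + 1)))//; last first.
  by rewrite /B (bigD1 l)//= lerDl sumr_ge0.
rewrite -(subrK (h l x0) (h l x)) addrC normD_le//.
rewrite (le_trans (Lip_on_le (gam01 l) (hc l) Kx Kx0))// ler_wpM2l ?mulr_ge0//.
have /andP[g0 g1] := gam01 l.
rewrite (le_trans (powR_le1D _ _)) ?(ltW g0)// lerD2r.
by rewrite (le_trans (ler_normB _ _))// lerD// hD.
Qed.

Definition extT h : R := get (ext_val gam u K h).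

Lemma extTP (M Lam : R) h : 0 <= M -> 1 <= Lam -> on_bounds gam K M Lam h ->
  ext_val gam u K h (extT h).
Proof.
move=> M0 Lam1 hb; apply: getPex.
exact: (ext_val_exists iu gam01 uK UC M0 Lam1 hb).
Qed.

Lemma extT_unique (M Lam : R) h t : 0 <= M -> 1 <= Lam -> on_bounds gam K M Lam h ->
  ext_val gam u K h t -> extT h = t.
Proof.
move=> M0 Lam1 hb ht.
exact: (ext_val_unique gam01 M0 Lam1 hb (extTP M0 Lam1 hb) ht).
Qed.

Lemma extT_functional : functional_on K gam extT.
Proof.
move=> h h' hh hh' hE; have [M [Lam [M0 Lam1 hb]]] := holder_on_bounds hh.
apply: (extT_unique M0 Lam1 hb) => M' Lam' e M'0 Lam'1 e0.
have [M2 [Lam2 [M20 Lam21 hb']]] := holder_on_bounds hh'.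
have [rho rho0 H] := extTP M20 Lam21 hb' M'0 Lam'1 e0.
by exists rho => // a aL ah; apply: H => // l x Kx; rewrite -hE//; exact: ah.
Qed.

Lemma lip_holder_comb (M Lam a : R) i b c : lip_holder gam M Lam b -> lip_holder gam M Lam c -> 1 <= Lam -> 0 <= M ->
  lip_holder gam (`|a| * M + M) (`|a| * Lam + Lam) (dfwith b i (fun x => a * b i x + c i x)).
Proof.
move=> bL cL Lam1 M0 l; have Lam0 : 0 <= Lam by rewrite (le_trans ler01).
have [->|li] := eqVneq l i; last first.
  rewrite dfwithout 1?eq_sym//.
  by have := lip_holder_W (M' := `|a| * M + M) (Lam' := `|a| * Lam + Lam) _ _ bL l; apply; rewrite lerDr mulr_ge0.
rewrite dfwithin; have [[L1 b1] b2 b3] := bL i; have [[L2 c1] c2 c3] := cL i; split.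
- by exists (`|a| * L1 + L2); exact: lip_comb.
- by move=> x; apply: normD_le => //; apply: normM_le.
- move=> x y; rewrite (_ : _ - _ = a * (b i x - b i y) + (c i x - c i y)); last by lra.
  by rewrite mulrDl normD_le// -mulrA normM_le.
Qed.

Lemma dfwith_id (T : Type) m (b : 'I_m -> T) i : dfwith b i (b i) = b.
Proof.
apply/funext => l; have [->|li] := eqVneq l i; first by rewrite dfwithin.
by rewrite dfwithout 1?eq_sym.
Qed.

Lemma lip_holder_bounded_lip (M Lam : R) h : lip_holder gam M Lam h -> forall l, bounded_lip M (h l).
Proof. by move=> hL l; have [h1 h2 _] := hL l. Qed.

Lemma extT_multilinear : multilinear_on K gam extT.
Proof.
move=> h i a f1 f2 hh1 hh2.
have [M1 [Lam1 [M10 L11 hb1]]] := holder_on_bounds hh1.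
have [M2 [Lam2 [M20 L21 hb2]]] := holder_on_bounds hh2.
pose M := M1 + M2; pose Lam := Lam1 + Lam2.
have M0 : 0 <= M by exact: addr_ge0.
have L1 : 1 <= Lam by rewrite /Lam; lra.
have b1 : on_bounds gam K M Lam (dfwith h i f1) by apply: on_bounds_W hb1; rewrite /M /Lam; lra.
have b2 : on_bounds gam K M Lam (dfwith h i f2) by apply: on_bounds_W hb2; rewrite /M /Lam; lra.
have a0 := normr_ge0 a.
have M'0 : 0 <= `|a| * M + M by rewrite addr_ge0// mulr_ge0.
have L'1 : 1 <= `|a| * Lam + Lam by rewrite (le_trans L1)// lerDr mulr_ge0// (le_trans ler01).
have b0 : on_bounds gam K (`|a| * M + M) (`|a| * Lam + Lam) (dfwith h i (fun x => a * f1 x + f2 x)).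
  move=> l; have [->|li] := eqVneq l i; last first.
    have -> : dfwith h i (fun x => a * f1 x + f2 x) l = dfwith h i f1 l by rewrite !dfwithout// eq_sym.
    by apply: (on_bounds_W _ _ b1); rewrite lerDr mulr_ge0// (le_trans ler01).
  have := b1 i; have := b2 i; rewrite !dfwithin => -[g2 g2'] [g1 g1']; split=> [x Kx|x y Kx Ky].
    by rewrite normD_le ?normM_le// ?g1 ?g2.
  rewrite (_ : _ - _ = a * (f1 x - f1 y) + (f2 x - f2 y)); last by lra.
  by rewrite mulrDl normD_le ?g2'// -mulrA normM_le// g1'.
apply/eqP; rewrite -subr_eq0 -normr_le0; apply/ler_addgt0Pr => e e0; rewrite add0r.
(* Three errors enter, one of them multiplied by a, for a total of 2 + |a| times this quantity. *)
have e'0 : 0 < e / (2 + `|a|) by rewrite divr_gt0// ltr_wpDr.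
have [r0 r00 H0] := extTP M'0 L'1 b0 M'0 L'1 e'0.
have [r1 r10 H1] := extTP M0 L1 b1 M0 L1 e'0.
have [r2 r20 H2] := extTP M0 L1 b2 M0 L1 e'0.
(* The combination in slot i is off by at most (|a| + 1) rho, which must stay below [r0]. *)
pose rho := Num.min (r0 / (`|a| + 1)) (Num.min r1 r2).
have a1 : 0 < `|a| + 1 by rewrite ltr_wpDl.
have rho0 : 0 < rho by rewrite !lt_min divr_gt0//= r10.
have rho_r0 : rho <= r0 / (`|a| + 1) by rewrite ge_min lexx.
have rho_r1 : rho <= r1 by rewrite !ge_min lexx orbT.
have rho_r2 : rho <= r2 by rewrite !ge_min lexx !orbT.
have [b bL bh] := on_approx gam01 M0 L1 rho0 b1.
have [c cL ch] := on_approx gam01 M0 L1 rho0 b2.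
have b'L : lip_holder gam M Lam (dfwith b i (c i)).
  move=> l; have [->|li] := eqVneq l i; first by rewrite dfwithin; exact: cL.
  by rewrite dfwithout 1?eq_sym//; exact: bL.
have k0 : `|tcurrent u (dfwith b i (fun x => a * b i x + c i x)) -
    extT (dfwith h i (fun x => a * f1 x + f2 x))| <= e / (2 + `|a|).
  apply: H0 => [|l x Kx]; first exact: lip_holder_comb.
  have [->|li] := eqVneq l i; last first.
    have := bh l x Kx; rewrite !dfwithout 1?eq_sym// => /le_trans; apply.
    rewrite (le_trans rho_r0)// ler_pdivrMr// ler_peMr ?(ltW r00)//.
    by rewrite lerDr.
  have := bh i x Kx; have := ch i x Kx; rewrite !dfwithin => h2 h1.
  rewrite (_ : _ - _ = a * (b i x - f1 x) + (c i x - f2 x)); last by lra.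
  rewrite (le_trans (normD_le (normM_le (lexx _) h1) h2))//.
  by rewrite -[X in _ + X]mul1r -mulrDl mulrC -ler_pdivlMr.
have k1 : `|tcurrent u b - extT (dfwith h i f1)| <= e / (2 + `|a|).
  by apply: H1 => // l x Kx; rewrite (le_trans (bh l x Kx)).
have k2 : `|tcurrent u (dfwith b i (c i)) - extT (dfwith h i f2)| <= e / (2 + `|a|).
  apply: H2 => // l x Kx; rewrite (le_trans _ rho_r2)//.
  have [->|li] := eqVneq l i; first by have := ch i x Kx; rewrite !dfwithin.
  by have := bh l x Kx; rewrite !dfwithout// 1?eq_sym.
have := tcurrent_lin i a iu (lip_holder_bounded_lip bL) (lip_holder_bounded_lip bL i) (lip_holder_bounded_lip cL i); rewrite dfwith_id => cE.
have := multilinear_algebra k0 k1 k2 cE; by rewrite divfK.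
Qed.

(** For large k a single Lipschitz tuple, close to [h_ k] on K within a tolerance depending on k, is
    also close to h, so its current is near both values. *)
Lemma extT_continuous : continuous_on K gam extT.
Proof.
move=> h_ h hh hcv hLip.
have [M [Lam [M0 Lam1 hb]]] := holder_on_bounds hh.
have [c hc] := choice (fun l => lt_pinfty_le (hLip l)).
have M'0 : 0 <= M + 1 by rewrite addr_ge0.
have Lam0 : 0 <= Lam by rewrite (le_trans ler01).
pose Lc := 1 + \sum_l `|c l| * n.+1%:R.
have Lc1 : 1 <= Lc by rewrite lerDl sumr_ge0// => l _; exact: mulr_ge0.
have Lc0 : 0 <= Lc by rewrite (le_trans ler01).
have L'1 : 1 <= Lam + Lc by rewrite (le_trans Lam1)// lerDl.
have hb' : on_bounds gam K (M + 1) (Lam + Lc) h by apply: on_bounds_W hb; rewrite lerDl.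
have unif (r : R) : 0 < r -> exists k0 : nat, forall k, (k0 <= k)%N -> forall l x, K x ->
    `|h_ k l x - h l x| <= r.
  move=> r0; have H l := (uniform_cvgP K (fun k => h_ k l) (h l)).1 (hcv l) r r0.
  have [k0 hk0] := choice H; exists (\max_l k0 l) => k kk l x Kx.
  by rewrite ltW// hk0// (leq_trans _ kk)//; exact: leq_bigmax.
have [k1 hk1] := unif 1 ltr01.
have hkb k : (k1 <= k)%N -> on_bounds gam K (M + 1) (Lam + Lc) (h_ k).
  move=> kk; apply: (@on_bounds_W (M + 1) (M + 1) Lc (Lam + Lc)) => //; first by rewrite lerDr.
  apply: Lip_on_bounds => l.
    by rewrite (le_trans _ (hc l))//; apply: ereal_sup_ubound; exists k.
  move=> x Kx; rewrite -(subrK (h l x) (h_ k l x)) addrC normD_le//; first exact: (hb l).1.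
  exact: hk1.
apply/cvgrPdist_le => e e0.
have e20 : 0 < e / 2 by rewrite divr_gt0.
have [rho rho0 H] := extTP M'0 L'1 hb' M'0 L'1 e20.
have r20 : 0 < rho / 2 by rewrite divr_gt0.
have [k2 hk2] := unif _ r20.
exists (maxn k1 k2) => // k /=; rewrite geq_max => /andP[kk1 kk2].
have [rk rk0 Hk] := extTP M'0 L'1 (hkb k kk1) M'0 L'1 e20.
have m0 : 0 < Num.min (rho / 2) rk by rewrite lt_min r20.
have [a aL ah] := on_approx gam01 M'0 L'1 m0 (hkb k kk1).
have a1 : `|tcurrent u a - extT (h_ k)| <= e / 2.
  by apply: Hk => // l x Kx; rewrite (le_trans (ah l x Kx))// ge_min lexx orbT.
have a2 : `|tcurrent u a - extT h| <= e / 2.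
  apply: H => // l x Kx; rewrite -(subrK (h_ k l x) (a l x)) -addrA [leRHS]splitr normD_le//.
    by rewrite (le_trans (ah l x Kx))// ge_min lexx.
  exact: hk2.
rewrite (splitr e); exact: (dist_le a1 a2).
Qed.

(** Lipschitz functions may be unbounded and fail to be Hoelder globally. Truncation above their
    size on K makes them bounded and Hoelder without changing the current. *)
Lemma extT_lipschitz h : (forall l, exists L, lip L (h l)) -> extT h = tcurrent u h.
Proof.
move=> hl; have [L hL] := choice hl.
have [D D0 hD] := compact_norm_le cK.
have L0 l : 0 <= L l := lip_ge0 (hL l).
(* The extra 1 keeps the truncation inactive on a neighbourhood of K and not merely on K, as
   [tcurrent_near] requires. *)
pose M := 1 + \sum_l (`|h l 0| + L l * D).
have M1 l x : K x -> `|h l x| <= M - 1.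
  move=> Kx; rewrite /M addrC addKr (bigD1 l)//= ler_wpDr//.
    by apply: sumr_ge0 => i _; rewrite addr_ge0// mulr_ge0.
  rewrite -(subrK (h l 0) (h l x)) addrC normD_le// (le_trans (hL l _ _))// subr0.
  by rewrite ler_wpM2l// hD.
have M0 : 0 <= M.
  by rewrite addr_ge0// sumr_ge0// => l _; rewrite addr_ge0// mulr_ge0.
pose h2 : tuple := fun l x => Num.max (- M) (Num.min M (h l x)).
pose Lam := 1 + \sum_l (L l + 2 * M).
have LM0 l : 0 <= L l + 2 * M by rewrite addr_ge0// mulr_ge0.
have Lam1 : 1 <= Lam by rewrite lerDl sumr_ge0.
have cl s t : `|Num.max (- M) (Num.min M s) - Num.max (- M) (Num.min M t)| <= `|s - t|.
  by apply: clip_lip; lra.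
have h2L : lip_holder gam M Lam h2.
  move=> l; have l2 : lip (L l) (h2 l) by move=> x y; exact: le_trans (cl _ _) (hL l x y).
  have b2 x : `|h2 l x| <= M by exact: clip_norm.
  split => //; first by exists (L l).
  move=> x y; have /andP[g0 g1] := gam01 l.
  rewrite (le_trans (y := (L l + 2 * M) * `|x - y| `^ gam l))//; last first.
    rewrite ler_wpM2r ?powR_ge0// /Lam (bigD1 l)//= addrCA lerDl addr_ge0//.
    exact: sumr_ge0.
  (* Up to distance 1 the Lipschitz bound implies the Hoelder one; beyond it, the bound 2 M on
     differences suffices. *)
  have [xy|xy] := leP `|x - y| 1.
    rewrite (le_trans (l2 x y))// ler_pM// ?lerDl ?mulr_ge0//.
    have := normr_ge0 (x - y); rewrite le_eqVlt => /orP[/eqP <-|xy0]; first exact: powR_ge0.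
    by rewrite ger1_powR// xy0.
  have M20 : 0 <= 2 * M by rewrite mulr_ge0.
  have p1 : 1 <= `|x - y| `^ gam l by rewrite -[leLHS](powRr0 `|x - y|) ler_powR// ltW.
  have h1 : `|h2 l x - h2 l y| <= 2 * M.
    by rewrite (le_trans (ler_normB _ _))// mulr_natl mulr2n lerD.
  by rewrite (le_trans h1)// -[leLHS]mulr1 ler_pM// lerDr.
have hE l x : K x -> h2 l x = h l x.
  by move=> Kx; rewrite /h2 clip_id// (le_trans (M1 l x Kx))// gerBl.
have hb2 : on_bounds gam K M Lam h.
  move=> l; have [_ b2 o2] := h2L l; split=> [x Kx|x y Kx Ky]; first by rewrite -hE.
  by rewrite -!hE.
have hval : ext_val gam u K h (tcurrent u h2).
  move=> M' Lam' e M'0 Lam'1 e0.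
  have [rho rho0 H] := tcurrent_uniform_continuity_on iu uK UC (addr_ge0 M0 M'0)
    (ler_wpDl (le_trans ler01 Lam1) Lam'1) e0.
  exists rho => // a aL ah; apply: (H h2 a).
  - by apply: lip_holder_W h2L; rewrite lerDl// (le_trans ler01).
  - by apply: lip_holder_W aL; rewrite lerDr// (le_trans ler01).
  - by move=> l x Kx; rewrite hE//; exact: ah.
have cE : tcurrent u h = tcurrent u h2.
  apply: (tcurrent_near iu uK hl) => [l|x l Kx]; first by have [] := h2L l.
  apply/nbhs_ballP; exists (1 / (L l + 1)); first by rewrite /= divr_gt0// ltr_wpDl.
  move=> y; rewrite -ball_normE/= ltr_pdivlMr ?ltr_wpDl// => xy.
  rewrite /h2 clip_id//.
  have -> : h l y = h l x - (h l x - h l y) by rewrite subKr.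
  rewrite (_ : M = M - 1 + 1); last by rewrite subrK.
  rewrite normD_le ?M1// normrN (le_trans (hL l x y))// (le_trans _ (ltW xy))//.
  by rewrite mulrC ler_wpM2l// lerDl.
exact: (extT_unique M0 Lam1 hb2 (@eq_ind_r R _ (ext_val gam u K h) hval _ cE)).
Qed.

End extension.

(** * From a dyadic decomposition to the extension *)

Section decomposition.
Context (R : realType) (n : nat).
Local Notation E := 'rV[R]_n.+1.
Local Notation mu := (@lebesgue_rV R n.+1).
Implicit Types (u v : E -> R).

Lemma L1normE u : mu.-integrable setT (EFin \o u) -> L1norm u = (\int[mu]_x `|u x|)%:E.
Proof.
move=> iu; rewrite /L1norm Lnorm1 /Rintegral fineK.
  by apply: eq_integral => x _.
exact/integrable_fin_num/integrable_norm.
Qed.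

Lemma Vtotal_tv_le u (W : R) : (Vtotal u <= W%:E)%E -> tv_le u W.
Proof.
move=> uW phi C1 phi1 _ _; rewrite -lee_fin (le_trans _ uW)//.
by apply: ereal_sup_ubound; exists phi.
Qed.

Lemma tv_leD u v (W1 W2 : R) : mu.-integrable setT (EFin \o u) -> mu.-integrable setT (EFin \o v) ->
  tv_le u W1 -> tv_le v W2 -> tv_le (fun x => u x + v x) (W1 + W2).
Proof.
move=> iu iv uW vW phi C1 phi1 cd bd; have [B hB] := bd.
have md := continuous_measurablerV cd.
have i1 := integrable_mul_bounded iu md hB; have i2 := integrable_mul_bounded iv md hB.
under eq_Rintegral do rewrite mulrDl.
by rewrite RintegralD// lerD// ?uW ?vW.
Qed.

Lemma tv_le_sum (I : Type) (r : seq I) (v : I -> E -> R) (W : I -> R) :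
  (forall i, mu.-integrable setT (EFin \o v i)) -> (forall i, tv_le (v i) (W i)) ->
  tv_le (fun x => \sum_(i <- r) v i x) (\sum_(i <- r) W i).
Proof.
move=> iv vW; elim: r => [|i r IH].
  rewrite big_nil (_ : (fun x => _) = fun=> 0); last by apply/funext => x; rewrite big_nil.
  move=> phi _ _ _ _; rewrite (_ : (fun x => _) = fun=> 0); last by apply/funext => x; rewrite mul0r.
  by rewrite Rintegral_cst// mul0r.
rewrite big_cons (_ : (fun x => _) = fun x => v i x + \sum_(i <- r) v i x); last first.
  by apply/funext => x; rewrite big_cons.
by apply: tv_leD => //; exact: (Rintegral_sum r iv).1.
Qed.

Lemma geometric_tail (x : R) (j m : nat) : 0 <= x -> x < 1 ->
  \sum_(j <= k < j + m) x ^+ k <= x ^+ j / (1 - x).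
Proof.
move=> x0 x1; have x10 : 0 < 1 - x by rewrite subr_gt0.
suff -> : \sum_(j <= k < j + m) x ^+ k = (x ^+ j - x ^+ (j + m)) / (1 - x).
  by rewrite ler_pM2r ?invr_gt0// gerBl exprn_ge0.
elim: m => [|m IH]; first by rewrite addn0 big_geq// subrr mul0r.
rewrite addnS big_nat_recr ?leq_addr//= IH exprS.
apply: (@mulIf _ (1 - x)); first by rewrite gt_eqF.
by rewrite mulrDl !divfK ?gt_eqF//; move: (x ^+ _) => y; lra.
Qed.

Lemma geometric_head (y : R) (j : nat) : 1 < y -> \sum_(0 <= k < j) y ^+ k <= (y - 1)^-1 * y ^+ j.
Proof.
move=> y1; have y10 : 0 < y - 1 by rewrite subr_gt0.
suff -> : \sum_(0 <= k < j) y ^+ k = (y - 1)^-1 * (y ^+ j - 1).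
  by rewrite ler_pM2l ?invr_gt0// gerBl.
elim: j => [|j IH]; first by rewrite big_geq// expr0 subrr mulr0.
rewrite big_nat_recr//= IH exprS; apply: (@mulfI _ (y - 1)); first by rewrite gt_eqF.
by rewrite mulrDr !mulVKf ?gt_eqF//; move: (y ^+ _) => z; lra.
Qed.

(** As delta > n, the variation bounds grow geometrically and the partial sum is controlled by its
    last term; as delta < n + 1, the L^1 bounds decay and the tail is controlled by its first
    term. *)
Lemma partial_decomposition u (u_ : nat -> E -> R) (delta C : R) :
  n%:R < delta -> delta < n.+1%:R -> 0 <= C -> mu.-integrable setT (EFin \o u) ->
  (forall k, mu.-integrable setT (EFin \o u_ k)) ->
  L1norm (fun x => u x - \sum_(0 <= k < N) u_ k x) @[N --> \oo] --> 0%E ->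
  (forall k, (L1norm (u_ k) <= (C * 2 `^ (k%:R * (delta - n.+1%:R)))%:E)%E) ->
  (forall k, (Vtotal (u_ k) <= (C * 2 `^ (k%:R * (delta - n%:R)))%:E)%E) ->
  exists2 C' : R, 0 <= C' & forall j : nat, exists s, [/\ mu.-integrable setT (EFin \o s),
     \int[mu]_x `|u x - s x| <= C' * (2 `^ (delta - n.+1%:R)) ^+ j &
     tv_le s (C' * (2 `^ (delta - n%:R)) ^+ j)].
Proof.
move=> nd dN C0 iu iu_ cv uL uV.
pose x : R := 2 `^ (delta - n.+1%:R); pose y : R := 2 `^ (delta - n%:R).
have x0 : 0 < x by exact: pow2_gt0.
have x1 : x < 1 by rewrite pow2_lt1// subr_lt0.
have y1 : 1 < y by rewrite pow2_gt1// subr_gt0.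
have x10 : 0 < (1 - x)^-1 by rewrite invr_gt0 subr_gt0.
have y10 : 0 < (y - 1)^-1 by rewrite invr_gt0 subr_gt0.
exists (C * (1 - x)^-1 + C * (y - 1)^-1); first by rewrite addr_ge0// mulr_ge0// ltW.
move=> j; pose s (N : nat) z := \sum_(0 <= k < N) u_ k z.
have is_ N : mu.-integrable setT (EFin \o s N) by exact: (Rintegral_sum _ iu_).1.
have ius N : mu.-integrable setT (EFin \o (fun z => u z - s N z)).
  exact: (integrableB measurableT iu (is_ N)).
exists (s j); split => //; last first.
  have uk k : tv_le (u_ k) (C * y ^+ k) by apply: Vtotal_tv_le; rewrite -pow2M.
  move=> phi C1 phi1 cd bd; have := @tv_le_sum _ (index_iota 0 j) u_ _ iu_ uk phi C1 phi1 cd bd.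
  move/le_trans; apply; rewrite -mulr_sumr mulrDl.
  rewrite (le_trans (ler_wpM2l C0 (geometric_head j y1)))// mulrA lerDr.
  by rewrite !mulr_ge0// ?exprn_ge0 ?(ltW x10)// ltW// (lt_trans ltr01).
(* The series converges to u only in L^1, so the tail is measured against a later partial sum that
   is e-close to u. *)
apply/ler_addgt0Pr => e e0.
have cv' : (\int[mu]_z `|u z - s N z|) @[N --> \oo] --> 0.
  rewrite (_ : (fun N => _) = (fun N => fine (L1norm (fun z => u z - s N z)))).
    exact: (fine_cvg cv).
  by apply/funext => N; rewrite L1normE.
have [N0 _ hN0] := (cvgrPdist_le _ _).1 cv' _ e0.
have := hN0 (j + N0)%N (leq_addl _ _); rewrite /= sub0r normrN ger0_norm; last first.
  by apply: Rintegral_ge0 => z _.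
move=> he.
have iabs N := integrable_norm (ius N).
have iuk k := integrable_norm (iu_ k).
have [iS SE] := Rintegral_sum (index_iota j (j + N0)) iuk.
have SE' : \int[mu]_z (\sum_(j <= k < j + N0) `|u_ k z|) =
    \sum_(j <= k < j + N0) \int[mu]_z `|u_ k z| by exact: SE.
have h1 : \int[mu]_z `|u z - s j z| <=
    \int[mu]_z (`|u z - s (j + N0)%N z| + \sum_(j <= k < j + N0) `|u_ k z|).
  have iL := iabs j; have iR := integrableD measurableT (iabs (j + N0)%N) iS.
  apply: le_Rintegral => //.
  move=> z _; rewrite (_ : u z - s j z = (u z - s (j + N0)%N z) + \sum_(j <= k < j + N0) u_ k z).
    by rewrite normD_le// ler_norm_sum.
  by rewrite /s (big_cat_nat (leq0n j) (leq_addr N0 j))/= opprD addrA subrK.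
have E2 : \int[mu]_z (`|u z - s (j + N0)%N z| + \sum_(j <= k < j + N0) `|u_ k z|) =
    \int[mu]_z `|u z - s (j + N0)%N z| + \int[mu]_z (\sum_(j <= k < j + N0) `|u_ k z|).
  exact: (RintegralD measurableT (iabs _) iS).
rewrite (le_trans h1)// E2 SE' addrC lerD// mulrDl ler_wpDr//.
  by rewrite !mulr_ge0// ?exprn_ge0// ltW.
rewrite (le_trans (y := \sum_(j <= k < j + N0) C * x ^+ k))//.
  apply: ler_sum => k _; rewrite -lee_fin -L1normE// (le_trans (uL k))//.
  by rewrite pow2M.
by rewrite -mulr_sumr -mulrA ler_wpM2l// mulrC geometric_tail// ltW.
Qed.

Lemma decomposition_extension u (d : R) (K : set E) (u_ : nat -> E -> R) :
  L1c u -> n%:R < d -> d < n.+1%:R -> compact K -> ess_support u `<=` K ->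
  (forall k, BVc (u_ k)) ->
  L1norm (fun x => u x - \sum_(0 <= k < N) u_ k x) @[N --> \oo] --> 0%E ->
  (forall delta : R, d < delta -> delta < n.+1%:R ->
     exists2 C : R, 0 <= C & forall k : nat,
       (L1norm (u_ k) <= (C * 2 `^ (k%:R * (delta - n.+1%:R)))%:E)%E /\
       (Vtotal (u_ k) <= (C * 2 `^ (k%:R * (delta - n%:R)))%:E)%E) ->
  forall (alpha : R) (beta : 'I_n.+1 -> R), 0 < alpha <= 1 -> (forall i, 0 < beta i <= 1) ->
    n.+1%:R < alpha + \sum_i beta i -> d < \sum_i beta i ->
  exists T : ('I_n.+2 -> E -> R) -> R,
        [/\ functional_on K (fcons alpha beta) T,
            multilinear_on K (fcons alpha beta) T,
            continuous_on K (fcons alpha beta) T &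
            forall (f : E -> R) (g : 'I_n.+1 -> E -> R),
              lipschitzR f -> (forall i, lipschitzR (g i)) ->
              T (fcons f g) = current u f g].
Proof.
move=> [iu _] nd dN cK uK hBV cv hdec alpha beta a01 b01 abN db.
(* The exponent delta must exceed d, for the decomposition bounds, and stay below the dimension and
   the sum of the beta, for the rates. *)
pose m := Num.min n.+1%:R (\sum_i beta i).
have dm : d < m by rewrite lt_min dN.
pose delta := (d + m) / 2.
have dd : d < delta by rewrite /delta; lra.
have dlm : delta < m by rewrite /delta; lra.
have dN' : delta < n.+1%:R by rewrite (lt_le_trans dlm)// ge_min lexx.
have db' : delta < \sum_i beta i by rewrite (lt_le_trans dlm)// ge_min lexx orbT.
have [C C0 hC] := hdec delta dd dN'.
have iu_ k : mu.-integrable setT (EFin \o u_ k) by have [[]] := hBV k.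
have [C' C'0 hs] := partial_decomposition (lt_trans nd dd) dN' C0 iu iu_ cv
  (fun k => (hC k).1) (fun k => (hC k).2).
pose gam := fcons alpha beta.
have gamE i : gam (lift ord0 i) = beta i by rewrite /gam /fcons liftK.
have gam0 : gam ord0 = alpha by rewrite /gam /fcons unlift_none.
have gam01 l : 0 < gam l <= 1.
  by case: (unliftP ord0 l) => [i ->|->]; rewrite ?gamE ?gam0.
have gS : \sum_i gam (lift ord0 i) = \sum_i beta i by apply: eq_bigr => i _; rewrite gamE.
have gN : n.+1%:R < \sum_l gam l by rewrite big_ord_recl gam0 gS.
have gd : delta < \sum_i gam (lift ord0 i) by rewrite gS.
have UC M Lam e := @tcurrent_uniform_continuity R n u gam delta C' iu gam01 C'0 dN' hs gN gd M Lam e.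
have uK' := ess_support_ae uK.
exists (extT gam u K); split.
- exact: extT_functional iu gam01 uK' cK UC.
- exact: extT_multilinear iu gam01 uK' cK UC.
- exact: extT_continuous iu gam01 uK' cK UC.
move=> f g fL gL; rewrite -tcurrent_fcons.
apply: (extT_lipschitz iu gam01 uK' cK UC) => l; rewrite /fcons.
by case: unliftP => [i _|_] /=; exact: lipschitzR_lip.
Qed.

End decomposition.

(** * Dyadic pieces of a function *)

Section correlation.
Context (R : realType) (n : nat).
Local Notation E := 'rV[R]_n.+1.
Local Notation mu := (@lebesgue_rV R n.+1).

Lemma continuous_locbd (f : E -> R) : continuous f -> locbd f.
Proof.
move=> cf r; pose s := `|r| + 1.
have s0 : 0 < s by rewrite ltr_wpDl.
have cA : compact (closed_ball (0 : E) s).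
  apply: bounded_closed_compact; last exact: closed_ball_closed.
  exists s; split; first exact: num_real.
  move=> M sM x; rewrite closed_ballE// /closed_ball_/= sub0r normrN => /le_trans; apply; exact: ltW.
have cfA : compact (f @` closed_ball (0 : E) s).
  by apply: continuous_compact => //; exact: continuous_subspaceT.
have [B _ hB] := pinfty_ex_gt0 (compact_bounded cfA).
exists B => x xr; apply: hB; exists x => //.
rewrite closed_ballE// /closed_ball_/= sub0r normrN (le_trans xr)// /s.
by rewrite (le_trans (ler_norm r))// lerDl.
Qed.

(* Differentiation under the integral sign on the side of phi; together with
   [conv_differentiable] this is integration by parts. *)
Lemma conv_ibp (r : R) (K : E -> R) dK (phi : E -> R) i y : 0 <= r -> kernel1 r K dK ->
  (forall x, differentiable phi x) -> continuous (fun x => 'D_(delta_mx ord0 i) phi x) ->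
  conv K (fun x => 'D_(delta_mx ord0 i) phi x) y = conv (dK i) phi y.
Proof.
move=> r0 kK dphi cD; set v : E := delta_mx ord0 i; set D := fun x => 'D_v phi x.
have cphi : continuous phi by move=> x; exact: differentiable_continuous.
have mphi : measurable_fun setT phi := continuous_measurablerV cphi.
have bphi := continuous_locbd cphi.
have mD : measurable_fun setT D := continuous_measurablerV cD.
have bD : locbd D := continuous_locbd cD.
have [dK1 dKE] := conv_differentiable r0 mphi bphi kK y.
have dcv : 'D_v (conv K phi) y = conv (dK i) phi y.
  by rewrite deriveE// dKE; exact: linform_delta.
have c1 : dquot (conv K phi) v k.+1%:R^-1 y @[k --> \oo] --> conv (dK i) phi y.
  by rewrite -dcv; apply: dquot_cvg; exact: diff_derivable.
have [B hB] := bD (`|y| + r + 1).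
have B0 : 0 <= B.
  by rewrite (le_trans _ (hB 0 _))// normr0 !addr_ge0.
have v1 : `|v| <= 1 := norm_delta_le R i.
(* The mean value theorem bounds the quotients uniformly on the support of the kernel, so that the
   limit passes under the integral. *)
have dq (t : R) x : 0 < t -> t <= 1 -> `|x| <= `|y| + r -> `|dquot phi v t x| <= B.
  move=> t0 t1 xr.
  have dg (s : R) : is_derive s (1 : R) (fun s => phi (s *: v + x)) (D (s *: v + x)).
    have E1 : (fun h : R => h^-1 *: (phi ((h *: 1 + s) *: v + x) - phi (s *: v + x))) =
              (fun h : R => h^-1 *: (phi (h *: v + (s *: v + x)) - phi (s *: v + x))).
      by apply/funext => h; rewrite addrA -scalerDl [h *: 1]mulr1.
    have dfv : derivable phi (s *: v + x) v by exact: diff_derivable.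
    split; first by rewrite /derivable E1.
    by rewrite /derive E1.
  have cg : {within `[0, t], continuous (fun s => phi (s *: v + x))}.
    apply: derivable_within_continuous => s _; by have [] := dg s.
  have [s] := @MVT R _ (fun s => D (s *: v + x)) 0 t t0 (fun s _ => dg s) cg.
  rewrite in_itv/= scale0r add0r subr0 => /andP[s0 st] phiE.
  rewrite /dquot phiE [D _ * t]mulrC mulKf ?gt_eqF// hB//.
  rewrite (le_trans (ler_normD _ _))// addrC lerD// normrZ gtr0_norm//.
  by rewrite mulr_ile1// ltW// (lt_le_trans st).
have iK := integrable_kernel1 r0 kK.
have [C [kB [kl _] _ kr]] := kK.
have mK : measurable_fun setT K := lip_measurable kl.
have ii x := integrable_kernel r0 kK x mphi bphi.
have E2 k : dquot (conv K phi) v k.+1%:R^-1 y = \int[mu]_z (dquot phi v k.+1%:R^-1 (y - z) * K z).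
  have j1 := integrable_reflect_conv (ii (k.+1%:R^-1 *: v + y)).
  have j2 := integrable_reflect_conv (ii y).
  have j3 := integrableB measurableT j1 j2.
  rewrite /dquot (convE (ii _)) (convE (ii y)) -(RintegralB measurableT j1 j2).
  rewrite -(RintegralZl _ measurableT j3); apply: eq_Rintegral => z _.
  by rewrite -mulrA mulrBl addrA.
have mr (f : E -> R) : measurable_fun setT f -> measurable_fun setT (fun z : E => f (y - z)).
  by move=> mf; exact: measurable_reflect_comp.
have c2 : (\int[mu]_z (dquot phi v k.+1%:R^-1 (y - z) * K z)) @[k --> \oo] -->
    \int[mu]_z (D (y - z) * K z).
  apply: (@Rdominated_cvg _ _ _ mu _ _ (fun z => B * `|K z|)).
  - move=> k; apply: measurable_funM => //; apply: (mr (dquot phi v k.+1%:R^-1)).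
    apply: measurable_funM => //; apply: measurable_funB => //.
    by under eq_fun do rewrite addrC; exact: (measurableT_comp mphi (measurable_shift _)).
  - by apply: measurable_funM => //; exact: mr.
  - by apply: aeW => z; apply: cvgMl; apply: dquot_cvg; exact: diff_derivable.
  - have := integrableZl measurableT B (integrable_norm iK); by apply: eq_integrable.
  move=> k z; rewrite normrM; have [zr|rz] := leP `|z| r; last first.
    by have [-> _] := kr z rz; rewrite normr0 !mulr0.
  rewrite ler_wpM2r// dq// ?invr_gt0//.
    by rewrite invf_le1// ler1n.
  by rewrite (le_trans (ler_normB _ _))// lerD2l.
have c2' : dquot (conv K phi) v k.+1%:R^-1 y @[k --> \oo] --> conv K D y.
  rewrite (convE (integrable_kernel r0 kK y mD bD)).
  by rewrite (funext E2).
exact: (cvg_unique _ c2' c1).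
Qed.

Context (u : E -> R).
Hypothesis iu : mu.-integrable setT (EFin \o u).

(** The adjoint of [conv K]: a correlation rather than a convolution, so that duality needs no
    symmetry of K. *)
Definition corr (K : E -> R) x := \int[mu]_y (u y * K (y - x)).

Let U := \int[mu]_y `|u y|.

Lemma measurable_corr_section (K : E -> R) (x : E) : measurable_fun setT K ->
  measurable_fun setT (fun y : E => K (y - x)).
Proof. by move=> mK; exact: (measurableT_comp mK (measurable_shift (- x))). Qed.

Lemma integrable_corr_section (K : E -> R) (c : R) x : measurable_fun setT K ->
  (forall z, `|K z| <= c) -> mu.-integrable setT (EFin \o (fun y => u y * K (y - x))).
Proof.
move=> mK Kc; exact: (integrable_mul_bounded iu (measurable_corr_section x mK) (fun y => Kc _)).
Qed.

Lemma corr_lip (K : E -> R) (L c : R) : lip L K -> (forall z, `|K z| <= c) -> lip (U * L) (corr K).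
Proof.
move=> KL Kc x x'; have mK := lip_measurable KL.
have i1 := integrable_corr_section x mK Kc; have i2 := integrable_corr_section x' mK Kc.
rewrite /corr -(RintegralB measurableT i1 i2).
under eq_Rintegral do rewrite -mulrBr.
rewrite -mulrA; apply: Rintegral_mul_le => //.
  by apply: measurable_funB; exact: measurable_corr_section.
by move=> y; rewrite (le_trans (KL _ _))// (_ : y - x - (y - x') = x' - x) 1?distrC//; rewrite opprB addrC addrA subrK.
Qed.

Lemma corr_out (K : E -> R) (c r D : R) x : measurable_fun setT K -> (forall z, `|K z| <= c) ->
  (forall z, r < `|z| -> K z = 0) -> {ae mu, forall y, ~ (`|y| <= D) -> u y = 0} ->
  D + r < `|x| -> corr K x = 0.
Proof.
move=> mK Kc Kr uD xr; rewrite -[RHS](_ : \int[mu]_y (0 : R) = 0); last first.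
  by rewrite Rintegral_cst ?mul0r.
apply: eq_Rintegral_ae => //; first by apply/measurable_EFinP; exact: measurable_int (integrable_corr_section x mK Kc).
have aeF := ae_filter_ringOfSetsType mu; apply: filterS uD => y uy.
have [yD|yD] := leP `|y| D; last by rewrite uy ?mul0r//; apply/negP; rewrite -ltNge.
rewrite Kr ?mulr0//; have := lerB_dist x y; rewrite distrC.
move: `|y - x| `|x| `|y| yD xr => A B C; lra.
Qed.

(** Fubini's theorem: the bounds on psi and K and the compact support of K bound the inner integral
    by a multiple of |u y|, which is integrable. *)
Lemma corr_dual (r c B : R) (K psi : E -> R) : 0 <= r -> measurable_fun setT K ->
  (forall z, `|K z| <= c) -> (forall z, r < `|z| -> K z = 0) ->
  measurable_fun setT psi -> (forall x, `|psi x| <= B) ->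
  \int[mu]_x (corr K x * psi x) = \int[mu]_y (u y * conv K psi y).
Proof.
move=> r0 mK Kc Kr mpsi psiB.
pose F (p : E * E) : R := u p.2 * K (p.2 - p.1) * psi p.1.
have mu_ : measurable_fun setT u by apply/measurable_EFinP; exact: measurable_int iu.
have msub : measurable_fun setT (fun p : E * E => p.2 - p.1).
  apply: measurable_fun_rVP => i; under eq_fun do rewrite !mxE.
  apply: measurable_funB.
    exact: (measurableT_comp (@measurable_coord R n.+1 i) measurable_snd).
  exact: (measurableT_comp (@measurable_coord R n.+1 i) measurable_fst).
have mF : measurable_fun setT F.
  apply: measurable_funM; first apply: measurable_funM.
  - exact: (measurableT_comp mu_ measurable_snd).
  - exact: (measurableT_comp mK msub).
  - exact: (measurableT_comp mpsi measurable_fst).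
have mEF : measurable_fun setT (EFin \o F) by exact/measurable_EFinP.
have ic y : mu.-integrable setT (EFin \o (fun x => psi x * K (y - x))).
  exact: (integrable_conv r0 mK mpsi Kc Kr (fun x _ => psiB x)).
have iFx y : mu.-integrable setT (EFin \o (fun x => F (x, y))).
  by have := integrableZl measurableT (u y) (ic y); apply: eq_integrable => // x _ /=;
    rewrite -EFinM /F/= -mulrA [psi x * _]mulrC.
have iFy x : mu.-integrable setT (EFin \o (fun y => F (x, y))).
  by have := integrableZr measurableT (psi x) (integrable_corr_section x mK Kc); apply: eq_integrable.
pose M := B * c * (2 * r) ^+ n.+1.
have FM y : (\int[mu]_x `|(F (x, y))%:E| <= (`|u y| * M)%:E)%E.
  have ie := integrable_norm (iFx y).
  have -> : (\int[mu]_x `|(F (x, y))%:E| = (\int[mu]_x `|F (x, y)|)%:E)%E.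
    by rewrite /Rintegral fineK//; exact: integrable_fin_num ie.
  rewrite lee_fin (_ : \int[mu]_x `|F (x, y)| = `|u y| * \int[mu]_x `|psi x * K (y - x)|).
    rewrite ler_wpM2l//.
    have mn : measurable_fun setT (fun x => `|psi x * K (y - x)|).
      by apply/measurable_EFinP; exact: measurable_int (integrable_norm (ic y)).
    have hle := Rintegral_bounded (a := y) (B := B * c) r0 mn.
    rewrite (le_trans (ler_norm _))// hle// => x.
      by rewrite normr_id normM_le.
    by move=> xr; rewrite Kr ?mulr0 ?normr0// distrC.
  rewrite -(RintegralZl _ measurableT (integrable_norm (ic y))).
  by apply: eq_Rintegral => x _; rewrite /= -normrM /F/= -mulrA [psi x * _]mulrC.
have iF : (mu \x mu)%E.-integrable setT (EFin \o F).
  apply/(integrable21ltyP mu mu mEF).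
  have iuM : mu.-integrable setT (EFin \o (fun y => `|u y| * M)).
    by have := integrableZr measurableT M (integrable_norm iu); apply: eq_integrable.
  apply: (@le_lt_trans _ _ (\int[mu]_y (`|u y| * M)%:E)%E).
    apply: ge0_le_integral => //.
    - by move=> y _; apply: integral_ge0.
    - apply: (measurable_fun_fubini_tonelli_G (abse \o (EFin \o F))) => //.
      + exact: measurableT_comp mEF.
      + by move=> p; exact: abse_ge0.
    - exact: (measurable_int mu iuM).
    - by move=> y _; exact: FM.
  have := integrable_fin_num measurableT iuM; rewrite fin_numElt => /andP[_]; exact.
have FE := Fubini iF.
rewrite /Rintegral; congr fine.
transitivity (\int[mu]_x \int[mu]_y (F (x, y))%:E)%E.
  apply: eq_integral => x _; rewrite -[in RHS](fineK (integrable_fin_num measurableT (iFy x))).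
  congr EFin; have ix := integrable_corr_section x mK Kc.
  by rewrite /corr -(RintegralZr _ measurableT ix).
transitivity (\int[mu]_y \int[mu]_x (F (x, y))%:E)%E; first exact: FE.
apply: eq_integral => y _; rewrite -(fineK (integrable_fin_num measurableT (iFx y))).
congr EFin; rewrite /conv -(RintegralZl _ measurableT (ic y)); apply: eq_Rintegral => x _.
by rewrite /F/= -mulrA [psi x * _]mulrC.
Qed.

(* Only the values of psi within distance r of the support of u matter. *)
Lemma corr_dual_loc (r c D : R) (K psi : E -> R) : 0 <= r -> lip c K ->
  (forall z, `|K z| <= c) -> (forall z, r < `|z| -> K z = 0) ->
  {ae mu, forall y, ~ (`|y| <= D) -> u y = 0} ->
  measurable_fun setT psi -> locbd psi ->
  \int[mu]_x (corr K x * psi x) = \int[mu]_y (u y * conv K psi y).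
Proof.
move=> r0 KL Kc Kr uD mpsi bpsi; have [B hB] := bpsi (D + r).
have mK := lip_measurable KL.
pose psi' x := Num.max (- `|B|) (Num.min `|B| (psi x)).
have mpsi' : measurable_fun setT psi' by apply: measurable_maxr => //; exact: measurable_minr.
have psi'B x : `|psi' x| <= `|B| by exact: clip_norm.
have psi'E x : `|x| <= D + r -> psi' x = psi x.
  by move=> xD; apply: clip_id; rewrite (le_trans (hB x xD))// ler_norm.
transitivity (\int[mu]_x (corr K x * psi' x)).
  apply: eq_Rintegral => x _; have [xD|xD] := leP `|x| (D + r); first by rewrite psi'E.
  by rewrite (corr_out mK Kc Kr uD xD) !mul0r.
rewrite (corr_dual r0 mK Kc Kr mpsi' psi'B).
have mu_ : measurable_fun setT u by apply/measurable_EFinP; exact: measurable_int iu.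
have ic (f : E -> R) : measurable_fun setT f -> locbd f ->
    measurable_fun setT (fun y => u y * conv K f y).
  move=> mf bf; apply: measurable_funM => //.
  have cc := conv_continuous r0 mf bf KL Kc Kr.
  exact: continuous_measurablerV cc.
have bpsi' : locbd psi' by move=> s; exists `|B| => x _.
have aeF := ae_filter_ringOfSetsType mu.
apply: eq_Rintegral_ae; [exact: ic|exact: ic|].
apply: filterS uD => y uy; have [yD|yD] := leP `|y| D; last first.
  by rewrite uy ?mul0r//; apply/negP; rewrite -ltNge.
congr (_ * _); apply: eq_Rintegral => x _; have [xr|xr] := leP `|y - x| r; last first.
  by rewrite Kr ?mulr0.
rewrite psi'E// -[x](subrK y) (le_trans (ler_normD _ _))// addrC lerD// distrC//.
Qed.

End correlation.

(** * From the extension to fractional variation *)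

Section extension_BV.
Context (R : realType) (n : nat).
Local Notation E := 'rV[R]_n.+1.
Local Notation mu := (@lebesgue_rV R n.+1).

Lemma Lip_onP (K : set E) (a A : R) (f : E -> R) :
  (forall x y, K x -> K y -> `|f x - f y| <= A * enorm (x - y) `^ a) ->
  (Lip_on K a f <= A%:E)%E.
Proof.
move=> fA; apply: ge_ereal_sup => _ [[x y] /= [Kx Ky xy]] <-; rewrite lee_fin.
rewrite ler_pdivrMr ?fA// powR_gt0// (lt_le_trans _ (enorm_ge _))// normr_gt0 subr_eq0//.
Qed.

Lemma Lip_on_bound (K : set E) (a A : R) (f : E -> R) : 0 <= A -> (Lip_on K a f <= A%:E)%E ->
  forall x y, K x -> K y -> `|f x - f y| <= A * enorm (x - y) `^ a.
Proof.
move=> A0 fA x y Kx Ky; have [->|xy] := eqVneq x y.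
  by rewrite subrr normr0 mulr_ge0// powR_ge0.
have e0 : 0 < enorm (x - y) by rewrite (lt_le_trans _ (enorm_ge _))// normr_gt0 subr_eq0.
rewrite -ler_pdivrMr ?powR_gt0// -lee_fin (le_trans _ fA)//.
by apply: ereal_sup_ubound; exists (x, y).
Qed.

Lemma Lip_ge0 (a : R) (f : E -> R) : (0 <= Lip a f)%E.
Proof.
pose x : E := delta_mx ord0 ord0.
have x0 : x != 0.
  by apply/eqP => /rowP /(_ ord0); rewrite !mxE eqxx/= => /eqP; rewrite oner_eq0.
apply: (@le_trans _ _ (`|f x - f 0| / enorm (x - 0) `^ a)%:E).
  by rewrite lee_fin divr_ge0// powR_ge0.
by apply: ereal_sup_ubound; exists (x, 0).
Qed.

Lemma detD_affine (g : 'I_n.+1 -> E -> R) (c b : 'I_n.+1 -> R) x : (forall i, c i != 0) ->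
  detD (fun i y => c i * (g i y - b i)) x = (\prod_i c i) * detD g x.
Proof.
move=> c0.
have cB i : differentiable (g i) x -> differentiable (fun y => c i * (g i y - b i)) x /\
    forall v, 'D_v (fun y => c i * (g i y - b i)) x = c i * 'D_v (g i) x.
  move=> dg; have db : differentiable (fun y => g i y - b i) x by exact: differentiableB.
  split=> [|v]; first exact: differentiableM.
  rewrite deriveMl; last exact: diff_derivable.
  rewrite deriveB; [|exact: diff_derivable|exact: derivable_cst].
  by rewrite derive_cst subr0.
have [dg|ndg] := pselect (forall i, differentiable (g i) x); last first.
  rewrite !detD_nondifferentiable ?mulr0// => dg; apply: ndg => i.
  rewrite (_ : g i = fun y => (c i)^-1 * (c i * (g i y - b i)) + b i).
    by apply: differentiableD => //; apply: differentiableM.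
  by apply/funext => y; rewrite mulKf// subrK.
rewrite !detDE//; last by move=> i; have [] := cB i (dg i).
rewrite (_ : \matrix_(i, j) _ = diag_mx (\row_i c i) *m \matrix_(i, j) 'D_(delta_mx ord0 j) (g i) x).
  by rewrite det_mulmx det_diag; congr (_ * _); apply: eq_bigr => i _; rewrite mxE.
by apply/matrixP => i j; rewrite mul_diag_mx !mxE; have [_ ->] := cB i (dg i).
Qed.

(** A zero constant would make one function constant and the Jacobian vanish; an infinite [Lip a f]
    would make the bound trivial. So a violating tuple can be divided by its constants, and shifted
    to vanish at [x0]. *)
Lemma normalized_tuple (u : E -> R) (a C : R) f (g : 'I_n -> E -> R) (x0 : E) :
  mu.-integrable setT (EFin \o u) -> 0 < C -> lipschitzR f -> (forall i, lipschitzR (g i)) ->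
  ~ (`|\int[mu]_x (u x * detD (fcons f g) x)|%:E <=
        C%:E * Lip a f * \prod_(i < n) Lip 1 (g i))%E ->
  exists h : 'I_n.+1 -> E -> R, [/\ forall i, (Lip (fcons a (fun=> 1%R) i) (h i) <= 1%:E)%E,
    forall i, exists L, lip L (h i), forall i, h i x0 = 0 &
    C < `|\int[mu]_x (u x * detD h x)|].
Proof.
move=> iu C0 lf lg; pose I := \int[mu]_x (u x * detD (fcons f g) x) => nI.
have hI : (C%:E * Lip a f * \prod_(i < n) Lip 1 (g i) < `|I|%:E)%E by rewrite ltNge; exact/negP.
move: hI; clear nI.
pose G := fcons f g; pose b := fcons a (fun _ : 'I_n => 1 : R).
have b0 : b ord0 = a by rewrite /b /fcons unlift_none.
have bS i : b (lift ord0 i) = 1 by rewrite /b /fcons liftK.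
have G0 : G ord0 = f by rewrite /G /fcons unlift_none.
have GS i : G (lift ord0 i) = g i by rewrite /G /fcons liftK.
have GL' l : exists L : R, lip L (G l).
  by apply: lipschitzR_lip; case: (unliftP ord0 l) => [i ->|->]; rewrite ?GS ?G0.
have [L GL] := choice GL'.
have RE : (C%:E * Lip a f * \prod_(i < n) Lip 1 (g i) = C%:E * \prod_i Lip (b i) (G i))%E.
  rewrite big_ord_recl b0 G0 muleA; congr (_ * _)%E.
  by apply: eq_bigr => i _; rewrite bS GS.
rewrite RE => {RE} hI.
have Lp l : (0 < Lip (b l) (G l))%E.
  rewrite lt_neqAle Lip_ge0 andbT; apply/eqP => l0.
  have I0 : I = 0.
    rewrite /I (_ : (fun x => _) = cst 0) ?Rintegral_cst ?mul0r//.
    apply/funext => x; rewrite (@detD_eq0 _ _ _ l) ?mulr0// => v.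
    rewrite (_ : fcons f g l = cst (G l 0)) ?derive_cst//.
    apply/funext => y; apply/eqP; rewrite -subr_eq0 -normr_le0.
    have h0 : (Lip (b l) (G l) <= 0%:E)%E by rewrite -l0.
    by rewrite (le_trans (Lip_on_bound (lexx 0) h0 _ _))// mul0r.
  move: hI; rewrite I0 normr0 ltNge mule_ge0 ?lee_fin ?(ltW C0)//.
  by apply: prode_ge0 => i _; exact: Lip_ge0.
have Lf l : (Lip (b l) (G l) < +oo)%E.
  case: (unliftP ord0 l) => [i ->|->]; first by rewrite bS GS; exact: lg.
  rewrite ltNge leye_eq; apply/eqP => foo.
  move: hI; rewrite big_ord_recl foo gt0_mulye; last first.
    by apply: (big_ind (fun x : \bar R => 0 < x)%E) => [|x y|i _]; [exact: lte01|exact: mule_gt0|exact: Lp].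
  by rewrite gt0_muley ?lte_fin// ltNge leey.
pose A l := fine (Lip (b l) (G l)).
have AE l : Lip (b l) (G l) = (A l)%:E by rewrite fineK// gt0_fin_numE.
have A0 l : 0 < A l by rewrite -lte_fin -AE.
have PA : 0 < \prod_l A l by apply: prodr_gt0.
move: hI; under eq_bigr do rewrite AE.
rewrite -(big_morph EFin (@EFinM R) erefl) -EFinM lte_fin => hI.
exists (fun l y => (A l)^-1 * (G l y - G l x0)); split.
- move=> l; apply: Lip_onP => x y _ _; rewrite -mulrBr opprB addrA subrK normrM.
  rewrite ger0_norm ?invr_ge0 ?(ltW (A0 l))// mulrC ler_pdivrMr// mul1r mulrC.
  by apply: (@Lip_on_bound setT) => //; [exact: ltW|rewrite -AE].
- move=> l; exists ((A l)^-1 * L l) => x y; rewrite -mulrBr opprB addrA subrK normrM.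
  rewrite ger0_norm ?invr_ge0 ?(ltW (A0 l))// -mulrA ler_wpM2l ?invr_ge0 ?(ltW (A0 l))//.
  exact: GL.
- by move=> l; rewrite subrr mulr0.
have -> : \int[mu]_x (u x * detD (fun l y => (A l)^-1 * (G l y - G l x0)) x) =
    (\prod_l A l)^-1 * I.
  have ih := integrable_detD GL iu.
  rewrite /I -(RintegralZl _ measurableT ih).
  apply: eq_Rintegral => x _; rewrite detD_affine => [|l]; last by rewrite invr_eq0 gt_eqF.
  by rewrite prodfV mulrCA.
by rewrite normrM gtr0_norm ?invr_gt0// mulrC ltr_pdivlMr.
Qed.

Lemma extension_BV u (d : R) (K : set E) :
  L1c u -> n%:R < d -> d < n.+1%:R -> compact K -> ess_support u `<=` K ->
  (forall (alpha : R) (beta : 'I_n.+1 -> R),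
      0 < alpha <= 1 -> (forall i, 0 < beta i <= 1) ->
      n.+1%:R < alpha + \sum_i beta i -> d < \sum_i beta i ->
      exists T : ('I_n.+2 -> E -> R) -> R,
        [/\ functional_on K (fcons alpha beta) T,
            multilinear_on K (fcons alpha beta) T,
            continuous_on K (fcons alpha beta) T &
            forall (f : E -> R) (g : 'I_n.+1 -> E -> R),
              lipschitzR f -> (forall i, lipschitzR (g i)) ->
              T (fcons f g) = current u f g]) ->
  forall delta : R, d < delta -> delta < n.+1%:R -> BVc_alpha (delta - n%:R) u.
Proof.
move=> L1u nd dN cK uK hT delta dd ddN; split => //; have [iu _] := L1u.
pose a : R := delta - n%:R.
have a01 : 0 < a <= 1 by move: ddN; rewrite /a -natr1; lra.
pose b := fcons a (fun _ : 'I_n => 1 : R).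
have b0 : b ord0 = a by rewrite /b /fcons unlift_none.
have bS i : b (lift ord0 i) = 1 by rewrite /b /fcons liftK.
have b01 i : 0 < b i <= 1 by case: (unliftP ord0 i) => [j ->|->]; rewrite ?b0 ?bS ?ltr01//= lexx.
have Sb : \sum_i b i = delta.
  rewrite big_ord_recl b0 (eq_bigr (fun=> 1)) => [|i _]; last by rewrite bS.
  by rewrite sumr_const card_ord /a subrK.
have one01 : 0 < (1 : R) <= 1 by rewrite ltr01 lexx.
(* With alpha = 1 and the beta adding up to delta, the two conditions of the extension property read
   n < delta and d < delta. *)
have [||T [_ Tl Tc TE]] := hT 1 b one01 b01; rewrite ?Sb//.
  by rewrite -natr1; lra.
(* A base point, in K as soon as K is nonempty: vanishing there bounds the functions on K through
   its diameter. *)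
have [x0 Kx0] : exists x0, forall x, K x -> K x0.
  by have [[x Kx]|nK] := pselect (exists x, K x); [exists x|exists 0 => x Kx; case: nK; exists x].
apply: contrapT => /negP; rewrite -leNgt leye_eq => /eqP Voo.
have hk (k : nat) : exists h : 'I_n.+1 -> E -> R,
   [/\ forall i, (Lip (b i) (h i) <= 1%:E)%E,
    forall i, exists L, lip L (h i), forall i, h i x0 = 0 &
    k.+1%:R ^+ n.+1 < `|\int[mu]_x (u x * detD h x)|].
  have C0 : 0 < k.+1%:R ^+ n.+1 :> R by rewrite exprn_gt0.
  apply: contrapT => nh.
  have : (Valpha a u <= (k.+1%:R ^+ n.+1)%:E)%E.
    apply: ereal_inf_lbound; split; first by rewrite lee_fin ltW.
    move=> f g lf lg; apply: contrapT => hn; apply: nh.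
    exact: (normalized_tuple x0 iu C0 lf lg hn).
  by rewrite Voo leye_eq.
have [h hh] := choice hk.
pose g k i x := k.+1%:R^-1 * h k i x.
pose H k := fcons (fun _ : E => 1 : R) (g k).
pose H0 : 'I_n.+2 -> E -> R := fcons (fun _ : E => 1 : R) (fun _ _ => 0).
have lcst (c : R) : lipschitzR (fun _ : E => c).
  apply: (@le_lt_trans _ _ 0%:E); last exact: ltry.
  by apply: Lip_onP => x y _ _; rewrite subrr normr0 mul0r.
have k1 (k : nat) : 0 < (k.+1%:R^-1 : R) <= 1 by rewrite invr_gt0 ltr0Sn/= invf_le1// ler1n.
have Hlip k i : forall x y, `|g k i x - g k i y| <= k.+1%:R^-1 * enorm (x - y) `^ b i.
  move=> x y; have [h1 _ _ _] := hh k; have /andP[k0 _] := k1 k.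
  rewrite /g -mulrBr normrM gtr0_norm// ler_wpM2l ?(ltW k0)//.
  by rewrite (le_trans (Lip_on_bound ler01 (h1 i) _ _))// mul1r.
have HT k : `|T (H k)| > 1.
  have [h1 h2 _ h4] := hh k; have /andP[k0 _] := k1 k.
  have [L hL] := choice h2.
  have lg i : lipschitzR (g k i).
    have L0 := lip_ge0 (hL i).
    apply: (@le_lt_trans _ _ (k.+1%:R^-1 * L i)%:E); last exact: ltry.
    apply: Lip_onP => x y _ _; rewrite /g -mulrBr normrM gtr0_norm// -mulrA ler_wpM2l ?(ltW k0)//.
    by rewrite powRr1 ?sqrtr_ge0// (le_trans (hL i x y))// ler_wpM2l// enorm_ge.
  have cE : current u (fun=> 1) (g k) = (k.+1%:R ^+ n.+1)^-1 * \int[mu]_x (u x * detD (h k) x).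
    have ih := integrable_detD hL iu.
    rewrite /current -(RintegralZl _ measurableT ih).
    apply: eq_Rintegral => x _; rewrite mulr1.
    have -> : g k = (fun i y => k.+1%:R^-1 * (h k i y - 0)).
      by apply/funext => i; apply/funext => y; rewrite subr0.
    rewrite detD_affine => [|_]; last by rewrite gt_eqF.
    by rewrite prodr_const card_ord exprVn mulrCA.
  have -> : T (H k) = (k.+1%:R ^+ n.+1)^-1 * \int[mu]_x (u x * detD (h k) x).
    exact: (etrans (TE _ _ (lcst 1) lg) cE).
  by rewrite normrM gtr0_norm ?invr_gt0 ?exprn_gt0// mulrC ltr_pdivlMr ?exprn_gt0// mul1r.
have H0h : holder_on K (fcons 1 b) H0.
  move=> l; apply: (@le_lt_trans _ _ 0%:E); last exact: ltry.
  apply: Lip_onP => x y _ _; rewrite mul0r /H0 /fcons.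
  by case: (unliftP ord0 l) => [j _|_] /=; rewrite subrr normr0.
(* Linearity in a Jacobian slot, applied to 0 = 1 * 0 + 0, gives T = T + T. *)
have T0 : T H0 = 0.
  pose l1 : 'I_n.+2 := lift ord0 ord0; pose z : E -> R := fun=> 0.
  have HE : dfwith H0 l1 z = H0.
    apply/funext => l; have [->|ll] := eqVneq l l1; last by rewrite dfwithout// eq_sym.
    by rewrite dfwithin /H0 /fcons liftK.
  have := Tl H0 l1 1 z z; rewrite HE => /(_ H0h H0h).
  rewrite (_ : (fun x => _) = z); last by apply/funext => x; rewrite /z mulr0 addr0.
  by rewrite HE mul1r; lra.
have [D D0 KD] := compact_norm_le cK.
pose M : R := n.+1%:R * (D + D) + 1.
have := Tc H H0 H0h.
have cu i : {uniform K, (fun k => H k i) @ \oo --> H0 i}.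
  apply/uniform_cvgP => rho rho0; exists (Num.truncn (M / rho)).+1 => k kk x Kx.
  rewrite /H /H0 /fcons; case: (unliftP ord0 i) => [j _|_] /=; last by rewrite subrr normr0.
  rewrite subr0; have [_ _ h3 _] := hh k.
  have := Hlip k j x x0; rewrite {2}/g h3 mulr0 subr0 => /le_lt_trans; apply.
  have e1 : enorm (x - x0) `^ b j <= M.
    have en : enorm (x - x0) <= n.+1%:R * (D + D).
      rewrite (le_trans (enorm_le _))// ler_wpM2l// (le_trans (ler_normB _ _))//.
      by rewrite lerD// KD//; exact: Kx0 Kx.
    have /andP[bj0 bj1] := b01 j.
    by rewrite (le_trans (powR_le1D (sqrtr_ge0 _) _)) ?(ltW bj0)// lerD2r.
  rewrite (le_lt_trans (ler_wpM2l (ltW (andP (k1 k)).1) e1))//.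
  rewrite mulrC ltr_pdivrMr// mulrC -ltr_pdivrMr//.
  apply: (lt_le_trans (truncnS_gt _)); rewrite ler_nat.
  exact: leq_trans kk (leqnSn _).
have sup_le i : (ereal_sup (range (fun k => Lip_on K (fcons 1%R b i) (H k i))) < +oo)%E.
  apply: (@le_lt_trans _ _ 1%:E); last exact: ltry.
  apply: ge_ereal_sup => _ [k _ <-]; apply: Lip_onP => x y _ _; rewrite /H /fcons.
  case: (unliftP ord0 i) => [j _|_] /=; last by rewrite subrr normr0 mul1r powR_ge0.
  have /andP[_ k11] := k1 k.
  by rewrite (le_trans (Hlip k j x y))// ler_wpM2r ?powR_ge0.
move=> /(_ cu sup_le); rewrite T0 => cv.
have [k _ hk0] := (cvgrPdist_le _ _).1 cv _ ltr01.
have := hk0 k (leqnn _); rewrite /= sub0r normrN => /(lt_le_trans (HT k)).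
by rewrite ltxx.
Qed.
End extension_BV.

(** * Testing against partial derivatives *)

Section BV_test.
Context (R : realType) (n : nat).
Local Notation E := 'rV[R]_n.+1.
Local Notation mu := (@lebesgue_rV R n.+1).

(** The rows below v are the basis vectors other than the i-th. Cofactors along the first row do not
    see that row, so they are those of a permutation matrix, read off its adjugate. *)
Lemma det_coordinates (i : 'I_n.+1) : exists b : bool, forall v : 'rV[R]_n.+1, \det (\matrix_(l, j) fcons (v ord0 j) (fun k => (lift i k == j)%:R) l) =
    (-1) ^+ b * v ord0 i.
Proof.
pose s : 'S_n.+1 := lift_perm ord0 i 1%g; exists (odd_perm s : bool) => v.
set A := \matrix_(l, j) _.
have s0 : s ord0 = i by rewrite lift_perm_id.
have sS k : s (lift ord0 k) = lift i k by rewrite lift_perm_lift perm1.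
have sV : (s^-1)%g i = ord0 by rewrite -s0 permK.
have adjE : \adj (perm_mx s : 'M[R]_n.+1) = (-1) ^+ s *: perm_mx (s^-1)%g.
  rewrite -[LHS]mulmx1 -perm_mx1 -[1%g](mulgV s) perm_mxM mulmxA mul_adj_mx det_perm.
  by rewrite mul_scalar_mx.
have cofE j : cofactor A ord0 j = (-1) ^+ s * (j == i)%:R.
  have -> : cofactor A ord0 j = cofactor (perm_mx s : 'M[R]_n.+1) ord0 j.
    congr (_ * \det _); apply/matrixP => k l; rewrite !mxE sS.
    by rewrite /fcons liftK.
  have := congr1 (fun M : 'M[R]_n.+1 => M j ord0) adjE; rewrite /= !mxE => ->.
  by rewrite -(inj_eq (@perm_inj _ s)) permKV s0.
rewrite (expand_det_row _ ord0) (bigD1 i)//= big1 => [|j /negPf ji]; last first.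
  by rewrite cofE ji !mulr0.
by rewrite cofE eqxx mulr1 addr0 !mxE /fcons unlift_none mulrC.
Qed.

Lemma detD_coordinates (i : 'I_n.+1) (f : E -> R) : (forall x, differentiable f x) ->
  exists b : bool, forall x, detD (fcons f (fun k (y : E) => y ord0 (lift i k))) x =
    (-1) ^+ b * 'D_(delta_mx ord0 i) f x.
Proof.
move=> df; have [b hb] := det_coordinates i; exists b => x.
pose v : 'rV[R]_n.+1 := \row_j 'D_(delta_mx ord0 j) f x.
have dc (j : 'I_n.+1) : differentiable (fun y : E => y ord0 j) x.
  exact: differentiable_coord.
rewrite detDE => [|l]; last by rewrite /fcons; case: (unliftP ord0 l) => [k _|_] /=.
have := hb v; rewrite /v mxE => <-; congr (\det _); apply/matrixP => l j; rewrite !mxE.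
rewrite /fcons; case: (unliftP ord0 l) => [k _|_] //=.
pose c (m : 'I_n.+1) : R := (lift i k == m)%:R.
rewrite (_ : (fun y : E => y ord0 (lift i k)) = linform c); last first.
  apply/funext => y; rewrite /linform (bigD1 (lift i k))//= /c eqxx mul1r big1 ?addr0// => m.
  by rewrite eq_sym => /negPf ->; rewrite mul0r.
have cl := lip_continuous (linform_lip c).
rewrite deriveE; last exact: linear_differentiable.
by have := @diff_lin R E R (linform c) x cl => ->; exact: linform_delta.
Qed.

(** The variation inequality with the coordinates other than i as the functions g: their Lipschitz
    constants are at most 1, and their Jacobian with f is the partial derivative up to sign. *)
Lemma BV_test (a : R) (u : E -> R) : BVc_alpha a u ->
  exists2 c : R, 0 <= c & forall i f (L A : R), (forall x, differentiable f x) -> lip L f ->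
    0 <= A -> (forall x y, `|f x - f y| <= A * enorm (x - y) `^ a) ->
    `|\int[mu]_x (u x * 'D_(delta_mx ord0 i) f x)| <= c * A.
Proof.
move=> [[iu _] /ereal_inf_lt[C [C0 hC] Coo]].
have CE : C = (fine C)%:E by rewrite fineK// ge0_fin_numE.
exists (fine C) => [|i f L A df fL A0 fA]; first exact: fine_ge0.
pose g k (y : E) := y ord0 (lift i k).
have lg k : (Lip 1 (g k) <= 1%:E)%E.
  apply: Lip_onP => x y _ _; rewrite mul1r powRr1 ?sqrtr_ge0// (le_trans _ (enorm_ge _))//.
  by have := rV_coord_le (x - y) (lift i k); rewrite !mxE.
have lf : lipschitzR f.
  have L0 := lip_ge0 fL.
  apply: (@le_lt_trans _ _ L%:E); last exact: ltry.
  apply: Lip_onP => x y _ _; rewrite powRr1 ?sqrtr_ge0// (le_trans (fL x y))//.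
  by rewrite ler_wpM2l// enorm_ge.
have fA' : (Lip a f <= A%:E)%E by apply: Lip_onP => x y _ _; exact: fA.
have h := hC f g lf (fun k => le_lt_trans (lg k) (ltry _)).
have P1 : (\prod_(k < n) Lip 1 (g k) <= 1%:E)%E /\ (0 <= \prod_(k < n) Lip 1 (g k))%E.
  apply: (big_ind (fun x : \bar R => x <= 1%:E /\ 0 <= x)%E) => [|x y [x1 x0] [y1 y0]|k _].
  - by rewrite lexx lee01.
  - by rewrite mule_ge0// -[1%:E]mule1 lee_pmul.
  - by rewrite lg Lip_ge0.
have h2 : (`|\int[mu]_x (u x * detD (fcons f g) x)|%:E <= (fine C * A)%:E)%E.
  rewrite (le_trans h)// CE -[(fine C * A)%:E]mule1 EFinM lee_pmul ?mule_ge0 ?Lip_ge0 ?P1.2 ?P1.1//.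
  - by rewrite lee_fin fine_ge0.
  - by rewrite lee_wpmul2l// lee_fin fine_ge0.
have [b hb] := detD_coordinates i df.
have GL' l : exists L, lip L (fcons f g l).
  by rewrite /fcons; case: (unliftP ord0 l) => [k _|_] /=; [exact: lipschitzR_lip (le_lt_trans (lg k) (ltry _))|exists L].
have [L' GL] := choice GL'.
have ig := integrable_detD GL iu.
move: h2; rewrite lee_fin (_ : \int[mu]_x (u x * 'D_(delta_mx ord0 i) f x) =
   (-1) ^+ b * \int[mu]_x (u x * detD (fcons f g) x)); first by rewrite normrM normr_sign mul1r.
rewrite -(RintegralZl _ measurableT ig); apply: eq_Rintegral => x _.
by rewrite hb [RHS]mulrCA signrMK.
Qed.

(** With t = |x - y|/e in the Euclidean norm: for t <= 1 the Lipschitz bound M t is below M t^a, and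
    for t > 1 the bound 2 M is below 2 M t^a. *)
Lemma interp_holder (M e a : R) (f : E -> R) : 0 < e -> 0 <= a <= 1 -> (forall x, `|f x| <= M) ->
  lip (M / e) f -> forall x y, `|f x - f y| <= (2 * M * e^-1 `^ a) * enorm (x - y) `^ a.
Proof.
move=> e0 /andP[a0 a1] fM fl x y.
have M0 : 0 <= M by rewrite (le_trans _ (fM 0)).
have ei : 0 <= e^-1 by rewrite invr_ge0 ltW.
rewrite -mulrA -powRM ?sqrtr_ge0//; set t := e^-1 * _.
have t0 : 0 <= t by rewrite mulr_ge0 ?sqrtr_ge0.
have [t1|t1] := leP t 1; last first.
  rewrite (le_trans (y := 2 * M))//.
    rewrite (le_trans (ler_normB _ _))// mulrDl mul1r lerD//.
  rewrite ler_peMr ?mulr_ge0// -(powRr0 t) ler_powR// ltW//.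
rewrite (le_trans (fl x y))//.
have h : M / e * `|x - y| <= M * t by rewrite -mulrA ler_wpM2l// ler_wpM2l// enorm_ge.
rewrite (le_trans h)// -mulrA [leRHS]mulrDl mul1r ler_wpDr ?mulr_ge0 ?powR_ge0// ler_wpM2l//.
have [tz|tz] := eqVneq t 0; first by rewrite tz powR_ge0.
rewrite -{1}[t]powRr1// ger_powR// t1 andbT lt_neqAle eq_sym tz//.
Qed.

End BV_test.

Section decomposition.
Context (R : realType) (n : nat).
Local Notation E := 'rV[R]_n.+1.
Local Notation mu := (@lebesgue_rV R n.+1).

Lemma measurable_fine_real : measurable_fun setT (@fine R).
Proof.
move=> _ Y mY; rewrite setTI.
have mE : measurable (EFin @` Y) by exact: measurable_image_EFin.
have [Y0|nY0] := pselect (Y 0).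
  rewrite (_ : _ @^-1` Y = EFin @` Y `|` [set +oo%E] `|` [set -oo%E]).
    by apply: measurableU; [apply: measurableU => //|]; exact: emeasurable_set1.
  apply/seteqP; split => [[r||]//= Yr|_ [[[r Yr <-]//|->//]|->//]].
  - by left; left; exists r.
  - by left; right.
  - by right.
rewrite (_ : _ @^-1` Y = EFin @` Y)//.
by apply/seteqP; split => [[r||]//= Yr|_ [r Yr <-]//]; exists r.
Qed.

(** The sign of v, taken to be 1 where v vanishes, is an admissible test function. *)
Lemma L1_dual (v : E -> R) (S : R) : mu.-integrable setT (EFin \o v) ->
  (forall psi : E -> R, measurable_fun setT psi -> (forall x, `|psi x| <= 1) ->
    \int[mu]_x (v x * psi x) <= S) -> \int[mu]_x `|v x| <= S.
Proof.
move=> iv vS; have mv : measurable_fun setT v by apply/measurable_EFinP; exact: measurable_int iv.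
pose A : set E := v @^-1` `[0, +oo[%classic.
have mA : measurable A by rewrite -[A]setTI; exact: mv.
have m1 : measurable_fun setT (\1_A : E -> R) by exact: measurable_indic.
have AE x : (x \in A) = (0 <= v x).
  by apply/idP/idP; rewrite inE /A/= in_itv/= andbT.
rewrite (le_trans _ (vS (fun x => 2 * \1_A x - 1) _ _))//.
- rewrite le_eqVlt; apply/orP; left; apply/eqP; apply: eq_Rintegral => x _.
  rewrite indicE AE; have [v0|v0] := leP 0 (v x); first by rewrite ger0_norm// mulr1 -[LHS]mulr1; congr (_ * _); lra.
  by rewrite ltr0_norm// mulr0 sub0r mulrN1.
- by apply: measurable_funB => //; apply: measurable_funM.
move=> x; rewrite indicE; case: (x \in A); rewrite ?mulr1 ?mulr0 ?sub0r ?normrN ?normr1//.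
by rewrite (_ : 2 - 1 = 1) ?normr1//; lra.
Qed.

Lemma ess_support_closed (v : E -> R) : closed (ess_support v).
Proof.
rewrite -[ess_support v]setCK; apply: open_closedC; rewrite openE => x /= /existsNP[U].
move=> /not_implyP[Ux /contrapT vU].
apply: filterS (nbhs_interior Ux) => y Uy sy; exact: (sy U Uy vU).
Qed.

Lemma ess_support_out (v : E -> R) (D : R) : (forall x, D < `|x| -> v x = 0) ->
  forall x, ess_support v x -> `|x| <= D.
Proof.
move=> vD x sx; rewrite leNgt; apply/negP => Dx.
apply: (sx [set y : E | D < `|y|]); last by apply: aeW => y; exact: vD.
apply: open_nbhs_nbhs; split => //.
have -> : [set y : E | D < `|y|] = Num.Def.normr @^-1` [set t | D < t] by [].
apply: open_comp; [by move=> y _; exact: norm_continuous|exact: open_gt].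
Qed.

Lemma ess_support_compact (v : E -> R) (D : R) : (forall x, D < `|x| -> v x = 0) ->
  compact (ess_support v).
Proof.
move=> vD; apply: bounded_closed_compact; last exact: ess_support_closed.
exists D; split; first exact: num_real.
by move=> M DM x /(ess_support_out vD)/le_trans; apply; exact: ltW.
Qed.

(* The L^1 limit w of the sequence is identified with u by testing. *)
Lemma L1_cvg_test (u : E -> R) (w_ : nat -> E -> R) (g : nat -> R) :
  mu.-integrable setT (EFin \o u) ->
  (forall k, mu.-integrable setT (EFin \o w_ k)) ->
  (forall k, \int[mu]_x `|w_ k.+1 x - w_ k x| <= g k) -> (exists S : R, forall N, \sum_(0 <= k < N) g k <= S) ->
  (forall psi L, lip L psi -> (forall x, 0 <= psi x <= 1) ->
    \int[mu]_x (w_ k x * psi x) @[k --> \oo] --> \int[mu]_x (u x * psi x)) ->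
  \int[mu]_x `|u x - w_ k x| @[k --> \oo] --> 0.
Proof.
move=> iu iw wg [S gS] test.
have mw k : measurable_fun setT (w_ k) by apply/measurable_EFinP; exact: measurable_int (iw k).
pose d k x := w_ k.+1 x - w_ k x.
have id_ k : mu.-integrable setT (EFin \o d k) by exact: (integrableB measurableT (iw _) (iw _)).
have md k : measurable_fun setT (fun x => `|d k x|%:E).
  by have := measurable_int mu (integrable_norm (id_ k)).
(* The sum of the absolute increments is integrable. Where it is finite the sequence converges, and
   together with |w_0| it dominates the whole sequence. *)
pose G2 x : \bar R := (\sum_(k <oo) `|d k x|%:E)%E.
pose G x : \bar R := (`|w_ 0%N x|%:E + G2 x)%E.
have mG2 : measurable_fun setT G2.
  by apply: ge0_emeasurable_sum => // k x _ _; rewrite lee_fin.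
have G20 x : (0 <= G2 x)%E by apply: nneseries_ge0 => k _ _; rewrite lee_fin.
have mG : measurable_fun setT G.
  by apply: emeasurable_funD => //; have := measurable_int mu (integrable_norm (iw 0%N)).
have iG2 : (\int[mu]_x G2 x < +oo)%E.
  rewrite integral_nneseries//.
  apply: (@le_lt_trans _ _ S%:E); last exact: ltry.
  apply: lime_le.
    by apply: is_cvg_nneseries => k _ _; apply: integral_ge0 => x _; rewrite lee_fin.
  apply: nearW => N; rewrite (le_trans (y := (\sum_(0 <= k < N) (g k)%:E)%E))//.
    apply: lee_sum => k _; have ie := integrable_norm (id_ k).
    have := wg k; rewrite -lee_fin /Rintegral fineK//; exact: integrable_fin_num ie.
  by rewrite sumEFin lee_fin.
have iG : mu.-integrable setT G.
  apply: integrableD => //; first exact: (integrable_norm (iw 0%N)).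
  apply/integrableP; split => //.
  by under eq_integral do rewrite gee0_abs//.
have finG : {ae mu, forall x, G2 x \is a fin_num}.
  have aeF := ae_filter_ringOfSetsType mu.
  have iG2' : mu.-integrable setT G2.
    by apply/integrableP; split => //; under eq_integral do rewrite gee0_abs//.
  by have := integrable_ae measurableT iG2'; apply: filterS => x; exact.
have part x N : ((\sum_(0 <= k < N) `|d k x|)%:E <= G2 x)%E.
  rewrite -sumEFin; apply: nneseries_lim_ge => k _ _; rewrite lee_fin//.
have wE x N : w_ N x = w_ 0%N x + \sum_(0 <= k < N) d k x.
  by rewrite (telescope_sumr (fun k => w_ k x) (leq0n N)) addrC subrK.
have cvw x : G2 x \is a fin_num -> cvgn (fun k => w_ k x).
  move=> fG.
  have cs : cvgn [normed series (fun k => d k x)].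
    apply: nondecreasing_is_cvgn.
      by apply/nondecreasing_seqP => k; rewrite /= /series/= big_nat_recr//= lerDl.
    exists (fine (G2 x)) => _ [N _ <-]; rewrite -lee_fin fineK//; exact: part.
  have cd := normed_cvg cs.
  rewrite (_ : (fun k => w_ k x) = (fun k => w_ 0%N x + series (fun k => d k x) k)).
    by apply: is_cvgD => //; exact: is_cvg_cst.
  by apply/funext => N; rewrite wE.
(* The upper limit is defined everywhere and measurable, and it is the limit wherever [G2] is
   finite. *)
pose w x := fine (limn_esup (fun k => (w_ k x)%:E)).
have wl x : G2 x \is a fin_num -> w_ ^~ x @ \oo --> w x.
  move=> /cvw cw; rewrite /w.
  have cE : (w_ k x)%:E @[k --> \oo] --> (limn (w_ ^~ x))%:E by apply: cvg_EFin => //; exact: nearW.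
  rewrite is_cvg_limn_esupE; last by apply/cvg_ex; exists (limn (w_ ^~ x))%:E.
  by have := cvg_lim (@ereal_hausdorff R) cE => ->.
have mwl : measurable_fun setT w.
  apply: measurableT_comp; first exact: measurable_fine_real.
  by apply: measurable_fun_limn_esup => k; exact/measurable_EFinP.
have [iwl cv _] : [/\ mu.-integrable setT (fun x => (w x)%:E),
    [sequence (\int[mu]_x (fun k y => `|(w_ k y)%:E - (w y)%:E|) k x)%E]_k @ \oo --> 0%E
  & [sequence (\int[mu]_x (w_ k x)%:E)%E]_k @ \oo --> (\int[mu]_x (w x)%:E)%E].
  apply: (@dominated_convergence _ _ _ mu setT measurableT (fun k x => (w_ k x)%:E) _ G) => //.
  - by move=> k; exact/measurable_EFinP.
  - exact/measurable_EFinP.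
  - have aeF := ae_filter_ringOfSetsType mu.
    by apply: filterS finG => x /wl wx _; apply: cvg_EFin => //; exact: nearW.
  - apply: aeW => x k _; rewrite /G; apply: (@le_trans _ _ (`|w_ 0%N x| + \sum_(0 <= i < k) `|d i x|)%:E).
      by rewrite lee_fin wE (le_trans (ler_normD _ _))// lerD2l ler_norm_sum.
    by rewrite EFinD leeD2l.
have id2 k : mu.-integrable setT (EFin \o (fun x => w_ k x - w x)) by exact: (integrableB measurableT (iw k) iwl).
have cv2 : \int[mu]_x `|w_ k x - w x| @[k --> \oo] --> 0 by exact: (fine_cvg cv).
have ih : mu.-integrable setT (EFin \o (fun x => u x - w x)) by exact: (integrableB measurableT iu iwl).
have uw : {ae mu, forall x, u x - w x = 0}.
  apply: (ae_eq0_test ih) => psi L pl psi01.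
  have mp := lip_measurable pl.
  have p1 x : `|psi x| <= 1 by have /andP[p0 p1] := psi01 x; rewrite ger0_norm.
  have j1 := integrable_mul_bounded iu mp p1; have j2 := integrable_mul_bounded iwl mp p1.
  have j3 k := integrable_mul_bounded (iw k) mp p1.
  under eq_Rintegral do rewrite mulrBl.
  rewrite (RintegralB measurableT j1 j2); apply/eqP; rewrite subr_eq0; apply/eqP.
  apply: (cvg_unique _ (test psi L pl psi01)) => //.
  apply/cvgrPdist_le => e e0; have [N _ hN] := (cvgrPdist_le _ _).1 cv2 _ e0.
  exists N => // k Nk; have := hN k Nk; rewrite /= sub0r normrN.
  rewrite ger0_norm; last by apply: Rintegral_ge0 => x _.
  move=> he; rewrite distrC -(RintegralB measurableT (j3 k) j2).
  under eq_Rintegral do rewrite -mulrBl.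
  by have := Rintegral_mul_le (id2 k) mp p1; rewrite mulr1 => /le_trans; exact.
rewrite (_ : (fun k => _) = (fun k => \int[mu]_x `|w_ k x - w x|))//.
apply/funext => k; have aeF := ae_filter_ringOfSetsType mu.
have i1 := integrable_norm (integrableB measurableT iu (iw k)).
have i2 := integrable_norm (id2 k).
apply: eq_Rintegral_ae; [by apply/measurable_EFinP; exact: measurable_int i1|by apply/measurable_EFinP; exact: measurable_int i2|].
by apply: filterS uw => x /eqP; rewrite subr_eq0 => /eqP ->; rewrite distrC.
Qed.

Lemma conv_eq_on (r : R) (K psi psi' : E -> R) y : (forall z, r < `|z| -> K z = 0) ->
  (forall x, `|x - y| <= r -> psi x = psi' x) -> conv K psi y = conv K psi' y.
Proof.
move=> Kr pp; apply: eq_Rintegral => x _; have [xr|xr] := leP `|y - x| r; last first.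
  by rewrite Kr// !mulr0.
by rewrite pp// distrC.
Qed.

Let a0 : 'I_n.+1 -> nat := fun=> 0%N.
Local Notation K m := (moll (dyad R m) a0).

Lemma dyad_le1 m : dyad R m <= 1.
Proof. by rewrite /dyad exprn_ile1 ?invr_ge0// invf_le1// ler1n. Qed.

Lemma kernel1_dyad m : kernel1 (dyad R m) (K m) (fun j => moll (dyad R m) (incr a0 j)).
Proof. exact: (kernel1_moll (dyad_gt0 R m) (fun=> leq0n 1)). Qed.

Lemma moll_conv_id (L : R) (psi : E -> R) m y : lip L psi ->
  `|(@mass R n)^-1 * conv (K m) psi y - psi y| <= L * dyad R m.
Proof.
move=> pl; have M0 := mass_gt0 R n; have L0 := lip_ge0 pl.
have [B [kB [kl _] _ kr]] := kernel1_dyad m; have d0 := dyad_gt0 R m.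
have mpsi := lip_measurable pl; have bpsi := lip_locbd pl.
(* The increment psi x - psi y is small only near y; truncating it gives a function small
   everywhere, with the same convolution at y. *)
pose q x := Num.max (- (L * dyad R m)) (Num.min (L * dyad R m) (psi x - psi y)).
have Ld : 0 <= L * dyad R m by rewrite mulr_ge0// ltW.
have qB x : `|q x| <= L * dyad R m by exact: clip_norm.
have mp : measurable_fun setT (fun x => psi x - psi y) by apply: measurable_funB.
have mq : measurable_fun setT q by apply: measurable_maxr => //; exact: measurable_minr.
have mc : measurable_fun setT (fun _ : E => psi y : R) by exact: measurable_cst.
have i1 := integrable_kernel (ltW d0) (kernel1_dyad m) y mpsi bpsi.
have i2 := integrable_kernel (ltW d0) (kernel1_dyad m) y mc (lip_locbd (lip_cst (psi y))).
have qE : conv (K m) q y = conv (K m) psi y - psi y * (@mass R n).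
  rewrite -(@conv_eq_on (dyad R m) _ (fun x => psi x - psi y)).
  - have -> : psi y * mass R n = conv (K m) (fun=> psi y) y.
      have mc1 : measurable_fun setT (fun _ : E => 1 : R) by exact: measurable_cst.
      rewrite -(moll_mass R n m) -(conv1 (ltW d0) (kernel1_dyad m) y) /conv.
      have i3 := integrable_kernel (ltW d0) (kernel1_dyad m) y mc1 (lip_locbd (lip_cst 1)).
      rewrite -(RintegralZl _ measurableT i3); apply: eq_Rintegral => x _.
      by rewrite mul1r.
    rewrite /conv -(RintegralB measurableT i1 i2); apply: eq_Rintegral => x _.
    by rewrite mulrBl.
  - by move=> z rz; have [] := kr z rz.
  - move=> x xr; rewrite /q clip_id// (le_trans (pl _ _))// ler_wpM2l//.
have qM := conv_bound (ltW d0) (kernel1_dyad m) (fun z => moll_ge0 z d0) y mq qB.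
move: qM; rewrite qE moll_mass => qM.
have -> : (mass R n)^-1 * conv (K m) psi y - psi y =
    (mass R n)^-1 * (conv (K m) psi y - psi y * mass R n).
  by rewrite mulrBr [psi y * _]mulrC mulKf ?gt_eqF.
rewrite normrM gtr0_norm ?invr_gt0// mulrC ler_pdivrMr//.
Qed.

End decomposition.

(** * Norms of the mollified pieces *)

Section dyadic_pieces.
Context (R : realType) (n : nat).
Local Notation E := 'rV[R]_n.+1.
Local Notation mu := (@lebesgue_rV R n.+1).
Let a0 : 'I_n.+1 -> nat := fun=> 0%N.
Local Notation K m := (moll (dyad R m) a0).
Local Notation M0 := (@mass R n).

Lemma dyad_powR m (a : R) : (dyad R m)^-1 `^ a = 2 `^ (m%:R * a).
Proof. by rewrite /dyad -exprVn invrK -powR_mulrn// -powRrM. Qed.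

Lemma dyad_powR1 m (a : R) : dyad R m * (dyad R m)^-1 `^ a = 2 `^ (m%:R * (a - 1)).
Proof.
rewrite dyad_powR mulrBr pow2D mulrC mulr1 powRN powR_mulrn// /dyad exprVn.
by [].
Qed.

Lemma C1_field_coord (phi : E -> E) i : C1_field phi ->
  (forall x, differentiable (fun y => phi y ord0 i) x) /\
  continuous (fun x => 'D_(delta_mx ord0 i) (fun y => phi y ord0 i) x).
Proof.
move=> [dphi cJ]; split=> [x|].
  by apply: (differentiable_comp (g := fun N : E => N ord0 i)) => //; exact: differentiable_coord.
have -> : (fun x => 'D_(delta_mx ord0 i) (fun y => phi y ord0 i) x) = (fun x => jacobian phi x i i).
  apply/funext => x; rewrite mxE -deriveE//.
  by rewrite derive_mx ?mxE//; exact: diff_derivable.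
move=> x; apply: (@continuous_comp _ _ _ (jacobian phi) (fun M : 'M[R]_n.+1 => M i i) x (cJ x)).
exact: coord_continuous.
Qed.

Lemma integrable_locM (r : R) (v psi : E -> R) : measurable_fun setT v ->
  measurable_fun setT psi -> locbd v -> locbd psi -> (forall x, r < `|x| -> v x = 0) ->
  mu.-integrable setT (EFin \o (fun x => v x * psi x)).
Proof.
move=> mv mpsi bv bpsi vr; have [B hB] := bv r; have [P hP] := bpsi r.
have mf : measurable_fun setT (fun x => v x * psi x) by exact: measurable_funM.
apply: (integrable_bounded (a := 0) (r := `|r|) (B := `|B| * `|P|) _ mf) => // x.
  have [xr|xr] := leP `|x| r; last by rewrite vr// mul0r normr0 mulr_ge0.
  by rewrite normM_le// ?(le_trans (hB x xr))// ?(le_trans (hP x xr))// ler_norm.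
by rewrite subr0 => xr; rewrite vr ?mul0r// (le_lt_trans (ler_norm _)).
Qed.

Context (u : E -> R) (D : R).
Hypotheses (iu : mu.-integrable setT (EFin \o u))
  (uD : {ae mu, forall y, ~ (`|y| <= D) -> u y = 0}).

Definition smoothed m x := M0^-1 * corr u (K m) x.

Definition piece k x := if k is m.+1 then smoothed m.+1 x - smoothed m x else smoothed 0 x.

Lemma piece_sum N x : \sum_(0 <= k < N.+1) piece k x = smoothed N x.
Proof.
elim: N => [|N IH]; first by rewrite big_nat1.
by rewrite big_nat_recr// IH /= addrC subrK.
Qed.

Lemma smoothed_lip m : exists L, lip L (smoothed m).
Proof.
have [B [kB [kl _] _ kr]] := kernel1_dyad R n m.
exists (M0^-1 * ((\int[mu]_y `|u y|) * B)) => x y.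
rewrite /smoothed -mulrBr normrM gtr0_norm ?invr_gt0 ?mass_gt0// -mulrA ler_wpM2l ?invr_ge0 ?(ltW (mass_gt0 _ _))//.
exact: (corr_lip iu kl (fun z => (kB z).1)).
Qed.

Lemma smoothed_out m x : D + 1 < `|x| -> smoothed m x = 0.
Proof.
have [B [kB [kl _] _ kr]] := kernel1_dyad R n m => xD.
rewrite /smoothed (corr_out iu (lip_measurable kl) (fun z => (kB z).1) (fun z rz => (kr z rz).1) uD) ?mulr0//.
by rewrite (le_lt_trans _ xD)// lerD2l dyad_le1.
Qed.

Lemma smoothed_integrableM m (psi : E -> R) : measurable_fun setT psi -> locbd psi ->
  mu.-integrable setT (EFin \o (fun x => smoothed m x * psi x)).
Proof.
move=> mpsi bpsi; have [L sL] := smoothed_lip m.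
exact: (integrable_locM (lip_measurable sL) mpsi (lip_locbd sL) bpsi (@smoothed_out m)).
Qed.

Lemma smoothed_integrable m : mu.-integrable setT (EFin \o smoothed m).
Proof.
have mc : measurable_fun setT (fun _ : E => 1 : R) by exact: measurable_cst.
have := smoothed_integrableM m mc (lip_locbd (lip_cst 1)).
by apply: eq_integrable => // x _ /=; rewrite mulr1.
Qed.

Lemma piece_integrable k : mu.-integrable setT (EFin \o piece k).
Proof.
case: k => [|k]; first exact: smoothed_integrable.
exact: (integrableB measurableT (smoothed_integrable k.+1) (smoothed_integrable k)).
Qed.

Lemma piece_out k x : D + 1 < `|x| -> piece k x = 0.
Proof. by move=> xD; case: k => [|k] /=; rewrite !smoothed_out// subrr. Qed.

Lemma smoothed_dual m (psi : E -> R) : measurable_fun setT psi -> locbd psi ->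
  \int[mu]_x (smoothed m x * psi x) = M0^-1 * \int[mu]_y (u y * conv (K m) psi y).
Proof.
move=> mpsi bpsi; have [B [kB [kl _] _ kr]] := kernel1_dyad R n m.
have d0 := ltW (dyad_gt0 R m).
have mK := lip_measurable kl.
rewrite -(corr_dual_loc iu d0 kl (fun z => (kB z).1) (fun z rz => (kr z rz).1) uD mpsi bpsi).
have cl := corr_lip iu kl (fun z => (kB z).1).
have out x : D + 1 < `|x| -> corr u (K m) x = 0.
  move=> xD; apply: (corr_out iu mK (fun z => (kB z).1) (fun z rz => (kr z rz).1) uD).
  by rewrite (le_lt_trans _ xD)// lerD2l dyad_le1.
have ic := integrable_locM (lip_measurable cl) mpsi (lip_locbd cl) bpsi out.
rewrite -(RintegralZl _ measurableT ic).
by apply: eq_Rintegral => x _; rewrite mulrA.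
Qed.

Lemma smoothed_test (psi : E -> R) L : lip L psi -> (forall x, 0 <= psi x <= 1) ->
  \int[mu]_x (smoothed k x * psi x) @[k --> \oo] --> \int[mu]_x (u x * psi x).
Proof.
move=> pl psi01; have mp := lip_measurable pl; have bp := lip_locbd pl; have L0 := lip_ge0 pl.
have p1 x : `|psi x| <= 1 by have /andP[p0 p1] := psi01 x; rewrite ger0_norm.
pose U := \int[mu]_x `|u x|.
have U0 : 0 <= U by apply: Rintegral_ge0.
have key k : `|\int[mu]_x (u x * psi x) - \int[mu]_x (smoothed k x * psi x)| <= U * (L * dyad R k).
  have [B [kB [kl _] _ kr]] := kernel1_dyad R n k; have d0 := ltW (dyad_gt0 R k).
  have cc := conv_continuous d0 mp bp kl (fun z => (kB z).1) (fun z rz => (kr z rz).1).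
  have mc := continuous_measurablerV cc.
  have cB y := conv_bound d0 (kernel1_dyad R n k) (fun z => moll_ge0 z (dyad_gt0 R k)) y mp p1.
  have i1 := integrable_mul_bounded iu mp p1.
  have i2 := integrable_mul_bounded iu mc cB.
  rewrite smoothed_dual// -(RintegralZl _ measurableT i2).
  have i3 : mu.-integrable setT (EFin \o (fun y => M0^-1 * (u y * conv (K k) psi y))).
    by have := integrableZl measurableT M0^-1 i2; apply: eq_integrable.
  rewrite -(RintegralB measurableT i1 i3).
  rewrite (_ : \int[mu]_x _ = \int[mu]_x (u x * (psi x - M0^-1 * conv (K k) psi x))).
    apply: Rintegral_mul_le => //.
      by apply: measurable_funB => //; exact: measurable_funM.
    by move=> y; rewrite distrC; exact: moll_conv_id.
  by apply: eq_Rintegral => x _; rewrite mulrBr mulrCA.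
have cU : U * (L * dyad R k) @[k --> \oo] --> 0.
  rewrite -[X in _ --> X](mulr0 (U * L)).
  by under eq_fun do rewrite mulrA; apply: cvgMr; exact: dyad_cvg.
apply/cvgrPdist_le => e e0; have [N _ hN] := (cvgrPdist_le _ _).1 cU _ e0.
exists N => // k Nk; rewrite (le_trans (key k))//; have := hN k Nk; rewrite /= sub0r normrN.
by apply: le_trans; exact: ler_norm.
Qed.

Context (a c : R).
Hypotheses (a01 : 0 <= a <= 1) (c0 : 0 <= c)
  (test : forall i f (L A : R), (forall x, differentiable f x) -> lip L f ->
    0 <= A -> (forall x y, `|f x - f y| <= A * enorm (x - y) `^ a) ->
    `|\int[mu]_x (u x * 'D_(delta_mx ord0 i) f x)| <= c * A).

(** The test inequality for f = [conv k psi], whose i-th partial derivative is the convolution with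
    [dk i]. M and B bound f and its partial derivatives, and e is the scale of the interpolation. *)
Lemma conv_test (r e M B : R) (k : E -> R) dk psi i : 0 <= r -> kernel1 r k dk ->
  measurable_fun setT psi -> locbd psi -> 0 < e -> (forall y, `|conv k psi y| <= M) ->
  (forall j y, `|conv (dk j) psi y| <= B) -> n.+1%:R * B <= M / e ->
  `|\int[mu]_x (u x * conv (dk i) psi x)| <= c * (2 * M * e^-1 `^ a).
Proof.
move=> r0 kk mp bp e0 kM kB BM.
have dk' := conv_differentiable r0 mp bp kk.
have M00 : 0 <= M by rewrite (le_trans _ (kM 0)).
have fl : lip (M / e) (conv k psi).
  apply: differentiable_lip => [x|x h]; first by have [] := dk' x.
  have [_ ->] := dk' x; rewrite (le_trans (linform_le _ _))// ler_wpM2r// (le_trans _ BM)//.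
  rewrite (le_trans (ler_sum _ (fun j _ => kB j x)))// sumr_const card_ord mulr_natl//.
have := test i (fun x => (dk' x).1) fl _ (interp_holder e0 a01 kM fl).
rewrite (_ : \int[mu]_x _ = \int[mu]_x (u x * conv (dk i) psi x)).
  by apply; rewrite !mulr_ge0// powR_ge0.
apply: eq_Rintegral => x _; congr (_ * _).
by have [df dE] := dk' x; rewrite deriveE// dE; exact: linform_delta.
Qed.

(** By duality with bounded psi, the difference of mollifiers becomes a sum of derivatives of the
    kernels [telek], which are smaller by a factor e. Interpolation then yields e times e^-a. *)
Lemma piece_L1 : exists2 A : R, 0 <= A & forall m,
  \int[mu]_x `|smoothed m.+1 x - smoothed m x| <= A * 2 `^ (m.+1%:R * (a - 1)).
Proof.
have [C C0 Cb] := moll_bounds R n; have Mi : 0 <= M0^-1 by rewrite invr_ge0 (ltW (mass_gt0 _ _)).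
(* C is the kernel constant, 4^(n+1) comes from the cube of side 4 e carrying the kernels, and n + 1
   from summing partial derivatives. *)
pose M1 : R := n.+1%:R * (C * 4 ^+ n.+1).
have M10 : 0 <= M1 by rewrite !mulr_ge0// exprn_ge0.
exists (M0^-1 * (n.+1%:R * (c * (2 * M1)))) => [|m]; first by rewrite !mulr_ge0.
apply: L1_dual; first exact: (piece_integrable m.+1).
move=> psi mp p1; pose e := dyad R m.+1; have e0 : 0 < e := dyad_gt0 R m.+1.
have bp : locbd psi by move=> s; exists 1 => x _.
have e20 : 0 <= 2 * e by rewrite mulr_ge0// ltW.
have kk i := @kernel1_telek R n e i e0.
have cb (k : E -> R) (B : R) y : measurable_fun setT k -> (forall z, `|k z| <= B) ->
    (forall z, 2 * e < `|z| -> k z = 0) -> `|conv k psi y| <= B * (4 * e) ^+ n.+1.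
  move=> mk kB kr; have := conv_le (B := 1) e20 mk mp kB kr (fun x _ => p1 x).
  by rewrite mul1r mulrA (_ : 2 * 2 = 4)//; lra.
have ep : e ^+ n != 0 by rewrite expf_neq0// gt_eqF.
have en : e != 0 by rewrite gt_eqF.
have t1 i : `|\int[mu]_x (u x * conv (telek e i (incr a0 i)) psi x)| <= c * (2 * (M1 * e) * e^-1 `^ a).
  have [B [kB [kl dkl] _ kr]] := kk i.
  apply: (conv_test (B := C * 4 ^+ n.+1) i e20 (kk i) mp bp e0).
  - move=> y; have h := cb _ _ y (lip_measurable kl) (fun z => ((Cb e e0 z ord0).2 i).1) (fun z rz => (kr z rz).1).
    rewrite (le_trans h)// exprMn [e ^+ n.+1]exprS.
    rewrite (_ : C / e ^+ n * (4 ^+ n.+1 * (e * e ^+ n)) = C * 4 ^+ n.+1 * e); last first.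
      by rewrite -[in RHS](divfK ep C); move: (4 ^+ n.+1) (C / e ^+ n) (e ^+ n) => X Y Z; lra.
    by rewrite ler_wpM2r ?(ltW e0)// ler_peMl ?ler1n// mulr_ge0// exprn_ge0.
  - move=> j y; have h := cb _ _ y (lip_measurable (dkl j)) (fun z => ((Cb e e0 z j).2 i).2) (fun z rz => (kr z rz).2 j).
    rewrite (le_trans h)// exprMn.
    rewrite (_ : C / e ^+ n.+1 * (4 ^+ n.+1 * e ^+ n.+1) = C * 4 ^+ n.+1)//.
    by rewrite [4 ^+ _ * _]mulrC mulrA divfK ?expf_neq0.
  - by rewrite mulfK.
have dE : \int[mu]_x ((smoothed m.+1 x - smoothed m x) * psi x) =
    M0^-1 * \sum_i \int[mu]_x (u x * conv (telek e i (incr a0 i)) psi x).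
  have isp k := integrable_mul_bounded (smoothed_integrable k) mp p1.
  rewrite (_ : (fun x => _) = (fun x => smoothed m.+1 x * psi x - smoothed m x * psi x)); last first.
    by apply/funext => x; rewrite mulrBl.
  rewrite (RintegralB measurableT (isp _) (isp _)) !smoothed_dual// -mulrBr; congr (_ * _).
  have icK k : mu.-integrable setT (EFin \o (fun y => u y * conv (K k) psi y)).
    have [B [kB [kl _] _ kr]] := kernel1_dyad R n k; have d0 := ltW (dyad_gt0 R k).
    have cc := conv_continuous d0 mp bp kl (fun z => (kB z).1) (fun z rz => (kr z rz).1).
    have cB y := conv_bound d0 (kernel1_dyad R n k) (fun z => moll_ge0 z (dyad_gt0 R k)) y mp p1.
    exact: (integrable_mul_bounded iu (continuous_measurablerV cc) cB).
  have icT i : mu.-integrable setT (EFin \o (fun y => u y * conv (telek e i (incr a0 i)) psi y)).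
    have [B [kB [kl dkl] _ kr]] := kk i.
    have cc := conv_continuous e20 mp bp (dkl i) (fun z => (kB z).2 i) (fun z rz => (kr z rz).2 i).
    apply: (integrable_mul_bounded iu (continuous_measurablerV cc)) => y.
    exact: (cb _ _ y (lip_measurable (dkl i)) (fun z => (kB z).2 i) (fun z rz => (kr z rz).2 i)).
  rewrite -(RintegralB measurableT (icK _) (icK _)).
  have [_ <-] := Rintegral_sum (index_enum 'I_n.+1) icT.
  apply: eq_Rintegral => y _; rewrite -mulrBr -mulr_sumr; congr (_ * _).
  have ik k := integrable_kernel (ltW (dyad_gt0 R k)) (kernel1_dyad R n k) y mp bp.
  rewrite -conv_sumk => [|i]; last exact: (integrable_dkernel e20 (kk i) i y mp bp).
  rewrite /conv -(RintegralB measurableT (ik _) (ik _)); apply: eq_Rintegral => x _.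
  by rewrite -mulrBr -moll_telescope /e dyadS.
rewrite dE -[leRHS]mulrA ler_wpM2l// (le_trans (ler_norm _))// (le_trans (ler_norm_sum _ _ _))//.
rewrite (le_trans (ler_sum _ (fun i _ => t1 i)))// sumr_const card_ord -[leLHS]mulr_natl.
rewrite -[leRHS]mulrA ler_wpM2l// -[leRHS]mulrA ler_wpM2l//.
by rewrite -dyad_powR1 -/e -!mulrA.
Qed.

Lemma continuous_divergence (phi : E -> E) : C1_field phi -> continuous (divergence phi).
Proof.
move=> Cphi; have cp i := (C1_field_coord i Cphi).2.
exact: (@continuous_bsum _ _ _ _ xpredT (fun i x => 'D_(delta_mx ord0 i) (fun y => phi y ord0 i) x)).
Qed.

(** The divergence is moved onto the kernel by [conv_ibp]. Here the convolutions are of size 1 with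
    gradients of size 1/e, so interpolation yields e^-a without a further factor e. *)
Lemma smoothed_tv : exists2 A : R, 0 <= A & forall m phi, C1_field phi ->
  (forall x, enorm (phi x) <= 1) ->
  `|\int[mu]_x (smoothed m x * divergence phi x)| <= A * 2 `^ (m%:R * a).
Proof.
have [C C0 Cb] := moll_bounds R n; have M00 := ltW (mass_gt0 R n).
have Mi : 0 <= M0^-1 by rewrite invr_ge0.
(* The mass bounds the convolution and the other summand bounds e times its gradient; [conv_test]
   wants one constant for both. *)
pose M2 : R := M0 + n.+1%:R * (C * 2 ^+ n.+1).
have M20 : 0 <= M2 by rewrite addr_ge0// !mulr_ge0// exprn_ge0.
exists (M0^-1 * (n.+1%:R * (c * (2 * M2)))) => [|m phi Cphi phi1]; first by rewrite !mulr_ge0.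
pose e := dyad R m; have e0 : 0 < e := dyad_gt0 R m.
pose p i y := phi y ord0 i.
have dp i := (C1_field_coord i Cphi).1; have cp i := (C1_field_coord i Cphi).2.
have p1 i y : `|p i y| <= 1.
  by rewrite (le_trans (rV_coord_le _ _))// (le_trans (enorm_ge _)).
have mp i : measurable_fun setT (p i).
  have cpi : continuous (p i) by move=> x; exact: differentiable_continuous (dp i x).
  exact: continuous_measurablerV cpi.
have bp i : locbd (p i) by move=> s; exists 1 => x _.
have cD := continuous_divergence Cphi.
have kk := kernel1_dyad R n m; have [B [kB [kl dkl] _ kr]] := kk.
pose dk j := moll e (incr a0 j).
have en : e != 0 by rewrite gt_eqF.
have cb j i y : `|conv (dk j) (p i) y| <= C * 2 ^+ n.+1 / e.
  have := conv_le (B := 1) (ltW e0) (lip_measurable (dkl j)) (mp i) (fun z => (Cb e e0 z j).1)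
    (fun z rz => (kr z rz).2 j) (fun x _ => p1 i x).
  move/(_ y)/le_trans; apply; rewrite mul1r exprMn [e ^+ n.+2]exprS invfM.
  rewrite (_ : C * (e^-1 / e ^+ n.+1) * (2 ^+ n.+1 * e ^+ n.+1) = C * 2 ^+ n.+1 / e)//.
  by rewrite [2 ^+ _ * _]mulrC mulrA -[C * _ * _]mulrA divfK ?expf_neq0// mulrAC.
have t1 i : `|\int[mu]_x (u x * conv (dk i) (p i) x)| <= c * (2 * M2 * e^-1 `^ a).
  apply: (conv_test (B := C * 2 ^+ n.+1 / e) i (ltW e0) kk (mp i) (bp i) e0) => [y|j y|].
  - have := conv_bound (ltW e0) kk (fun z => moll_ge0 z e0) y (mp i) (p1 i).
    rewrite moll_mass mul1r => /le_trans; apply.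
    by rewrite lerDl !mulr_ge0// exprn_ge0.
  - exact: cb.
  - by rewrite mulrA ler_wpM2r ?invr_ge0 ?(ltW e0)// lerDr.
rewrite (smoothed_dual m (continuous_measurablerV cD) (continuous_locbd cD)).
have icT i : mu.-integrable setT (EFin \o (fun y => u y * conv (dk i) (p i) y)).
  have cc := conv_continuous (ltW e0) (mp i) (bp i) (dkl i) (fun z => (kB z).2 i) (fun z rz => (kr z rz).2 i).
  exact: (integrable_mul_bounded iu (continuous_measurablerV cc) (cb i i)).
have -> : \int[mu]_y (u y * conv (K m) (divergence phi) y) =
    \sum_i \int[mu]_y (u y * conv (dk i) (p i) y).
  have [_ <-] := Rintegral_sum (index_enum 'I_n.+1) icT.
  apply: eq_Rintegral => y _; rewrite -mulr_sumr; congr (_ * _).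
  have ik i := integrable_kernel (ltW e0) kk y (continuous_measurablerV (cp i)) (continuous_locbd (cp i)).
  have [_ SE] := Rintegral_sum (index_enum 'I_n.+1) ik.
  transitivity (\sum_i conv (K m) (fun x => 'D_(delta_mx ord0 i) (p i) x) y).
    rewrite -[RHS]SE; apply: eq_Rintegral => x _.
    by rewrite /divergence mulr_suml.
  by apply: eq_bigr => i _; exact: (conv_ibp y (ltW e0) kk (dp i) (cp i)).
rewrite normrM ger0_norm// -[leRHS]mulrA ler_wpM2l// (le_trans (ler_norm_sum _ _ _))//.
rewrite (le_trans (ler_sum _ (fun i _ => t1 i)))// sumr_const card_ord -[leLHS]mulr_natl.
rewrite -[leRHS]mulrA ler_wpM2l// -[leRHS]mulrA ler_wpM2l//.
by rewrite -dyad_powR -/e.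
Qed.

End dyadic_pieces.

(** * Assembling the dyadic decomposition *)

Section BV_decomposition.
Context (R : realType) (n : nat).
Local Notation E := 'rV[R]_n.+1.
Local Notation mu := (@lebesgue_rV R n.+1).

Fact piece_exponent_algebra (delta m : R) : delta - m - 1 = delta - (m + 1).
Proof. lra. Qed.

Lemma BV_decomposition (u : E -> R) (d : R) : L1c u -> n%:R < d -> d < n.+1%:R ->
  (forall delta : R, d < delta -> delta < n.+1%:R -> BVc_alpha (delta - n%:R) u) ->
  exists u_ : nat -> E -> R,
      [/\ forall k, BVc (u_ k),
          L1norm (fun x => u x - \sum_(0 <= k < N) u_ k x)
            @[N --> \oo] --> 0%E,
          bounded_set (\bigcup_k ess_support (u_ k)) &
          forall delta : R, d < delta -> delta < n.+1%:R ->
            exists2 C : R, 0 <= C & forall k : nat,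
              (L1norm (u_ k) <=
                (C * 2 `^ (k%:R * (delta - n.+1%:R)))%:E)%E /\
              (Vtotal (u_ k) <=
                (C * 2 `^ (k%:R * (delta - n%:R)))%:E)%E].
Proof.
move=> [iu cu] nd dN hBV.
have [D D0 hD] := compact_norm_le cu.
have uD : {ae mu, forall y, ~ (`|y| <= D) -> u y = 0} by apply: ess_support_ae => x /hD.
pose u_ := piece u.
have iu_ k : mu.-integrable setT (EFin \o u_ k) by exact: piece_integrable iu uD k.
have out k x : D + 1 < `|x| -> u_ k x = 0 by exact: piece_out iu uD k x.
have a01 delta : d < delta -> delta < n.+1%:R -> 0 <= delta - n%:R <= 1.
  by rewrite -natr1 => dd ddN; apply/andP; split; lra.
have est delta : d < delta -> delta < n.+1%:R ->
    exists2 C : R, 0 <= C & forall k : nat,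
      (L1norm (u_ k) <= (C * 2 `^ (k%:R * (delta - n.+1%:R)))%:E)%E /\
      (Vtotal (u_ k) <= (C * 2 `^ (k%:R * (delta - n%:R)))%:E)%E.
  move=> dd ddN; have [c c0 test] := BV_test (hBV delta dd ddN).
  have [A1 A10 L1A] := piece_L1 iu uD (a01 _ dd ddN) c0 test.
  have [A2 A20 tvA] := smoothed_tv iu uD (a01 _ dd ddN) c0 test.
  pose I0 := \int[mu]_x `|u_ 0%N x|.
  have I00 : 0 <= I0 by apply: Rintegral_ge0.
  have aE : delta - n%:R - 1 = delta - n.+1%:R by rewrite -natr1; exact: piece_exponent_algebra.
  (* The first piece is not a difference, so its L^1 norm enters separately; each later piece is a
     difference of two mollifications, whence twice [A2]. *)
  exists (I0 + A1 + (A2 + A2)); first by rewrite !addr_ge0.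
  move=> k; split.
    rewrite L1normE// lee_fin; case: k => [|k].
      by rewrite mul0r powRr0 mulr1 -addrA lerDl !addr_ge0.
    have := L1A k; rewrite aE => /le_trans; apply; rewrite ler_wpM2r ?powR_ge0//.
    by rewrite -addrA addrCA lerDl !addr_ge0.
  have AA : A2 + A2 <= I0 + A1 + (A2 + A2) by rewrite lerDr addr_ge0.
  apply: ge_ereal_sup => _ [phi [Cphi phi1] <-]; rewrite lee_fin.
  have h m := le_trans (ler_norm _) (tvA m phi Cphi phi1).
  case: k => [|k].
    by rewrite (le_trans (h 0%N))// ler_wpM2r ?powR_ge0// (le_trans _ AA)// lerDl.
  have cD := continuous_divergence Cphi.
  have ii m := smoothed_integrableM iu uD m (continuous_measurablerV cD) (continuous_locbd cD).
  rewrite (_ : (fun x => _) = (fun x => smoothed u k.+1 x * divergence phi x -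
      smoothed u k x * divergence phi x)); last by apply/funext => x; rewrite mulrBl.
  rewrite (RintegralB measurableT (ii _) (ii _)) (le_trans _ (ler_wpM2r (powR_ge0 _ _) AA))//.
  rewrite mulrDl lerD//.
  have h2 : - (\int[mu]_x (smoothed u k x * divergence phi x)) <= A2 * 2 `^ (k%:R * (delta - n%:R)).
    by rewrite (le_trans _ (tvA k phi Cphi phi1))// -normrN ler_norm.
  rewrite (le_trans h2)// ler_wpM2l// pow2_le// ler_wpM2r ?ler_nat//.
  by have /andP[] := a01 _ dd ddN.
exists u_; split => //.
- move=> k; split; first by split => //; exact: ess_support_compact (out k).
  have dd : d < (d + n.+1%:R) / 2 by lra.
  have ddN : (d + n.+1%:R) / 2 < n.+1%:R by lra.
  have [C _ hC] := est _ dd ddN; exact: le_lt_trans (hC k).2 (ltry _).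
(* A single delta, here the midpoint, makes the increments summable, as [L1_cvg_test] requires. *)
- have dd : d < (d + n.+1%:R) / 2 by lra.
  have ddN : (d + n.+1%:R) / 2 < n.+1%:R by lra.
  have [C C0 hC] := est _ dd ddN.
  set x := 2 `^ ((d + n.+1%:R) / 2 - n.+1%:R) in hC.
  have x0 : 0 <= x := powR_ge0 _ _.
  have x1 : x < 1 by rewrite pow2_lt1// subr_lt0.
  have wg k : \int[mu]_z `|smoothed u k.+1 z - smoothed u k z| <= C * x ^+ k.+1.
    by have := (hC k.+1).1; rewrite pow2M L1normE.
  have gS : exists S : R, forall N, \sum_(0 <= k < N) C * x ^+ k.+1 <= S.
    exists (C * (1 / (1 - x))) => N; rewrite -mulr_sumr ler_wpM2l//.
    rewrite (le_trans _ (geometric_tail 0 N x0 x1))// add0n; apply: ler_sum => k _.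
    by rewrite exprS ler_piMl ?exprn_ge0// ltW.
  have cv := L1_cvg_test iu (smoothed_integrable iu uD) wg gS (smoothed_test iu uD).
  (* The first N + 1 pieces add up to [smoothed u N], hence the shift by one. *)
  rewrite -cvg_shiftS (_ : [sequence _]_N = fun N => (\int[mu]_z `|u z - smoothed u N z|)%:E).
    by apply: cvg_EFin => //; exact: nearW.
  apply/funext => N /=.
  rewrite (_ : (fun z => _) = (fun z => u z - smoothed u N z)); last first.
    by apply/funext => z; rewrite piece_sum.
  by rewrite L1normE//; exact: (integrableB measurableT iu (smoothed_integrable iu uD N)).
exists (D + 1); split; first exact: num_real.
move=> M DM x [k _ /(ess_support_out (out k))] xD; exact: le_trans xD (ltW DM).
Qed.

End BV_decomposition.

(* The dimension is n.+1. *)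
Theorem theorem1p1 (R : realType) (n : nat) (u : 'rV[R]_n.+1 -> R) (d : R)
    (K : set 'rV[R]_n.+1) (L1c_u : L1c u) (d_gt : n%:R < d) (d_lt : d < n.+1%:R)
    (K_compact : compact K) (K_supp : ess_support u `<=` K) :
  [<->
    forall delta : R, d < delta -> delta < n.+1%:R ->
      BVc_alpha (delta - n%:R) u;
    exists u_ : nat -> 'rV[R]_n.+1 -> R,
      [/\ forall k, BVc (u_ k),
          L1norm (fun x => u x - \sum_(0 <= k < N) u_ k x)
            @[N --> \oo] --> 0%E,
          bounded_set (\bigcup_k ess_support (u_ k)) &
          forall delta : R, d < delta -> delta < n.+1%:R ->
            exists2 C : R, 0 <= C & forall k : nat,
              (L1norm (u_ k) <=
                (C * 2 `^ (k%:R * (delta - n.+1%:R)))%:E)%E /\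
              (Vtotal (u_ k) <=
                (C * 2 `^ (k%:R * (delta - n%:R)))%:E)%E];
    forall (alpha : R) (beta : 'I_n.+1 -> R),
      0 < alpha <= 1 -> (forall i, 0 < beta i <= 1) ->
      n.+1%:R < alpha + \sum_i beta i -> d < \sum_i beta i ->
      exists T : ('I_n.+2 -> 'rV[R]_n.+1 -> R) -> R,
        [/\ functional_on K (fcons alpha beta) T,
            multilinear_on K (fcons alpha beta) T,
            continuous_on K (fcons alpha beta) T &
            forall (f : 'rV[R]_n.+1 -> R) (g : 'I_n.+1 -> 'rV[R]_n.+1 -> R),
              lipschitzR f -> (forall i, lipschitzR (g i)) ->
              T (fcons f g) = current u f g]
  ].
Proof.
tfae.
- exact: BV_decomposition.
- move=> [u_ [hBV cv _ est]]; exact: decomposition_extension L1c_u d_gt d_lt K_compact K_supp hBV cv est.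
- exact: extension_BV.
Qed.
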